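(* Let $g$ be analytic, nonconstant and nonunivalent (i.e. non-injective) on $\mathbb{H}$ and let $D\in\mathfrak{D}$. Then there is an analytic function $f$ on $D$, extending continuously to $\overline{D}$, such that $f'(D)\subset g'(\mathbb{H})$ and $\dim(\Delta(z_0,r)\cap\mathcal{I}(f))=1$ for all $r>0$ and all $z_0\in f(\partial D)$.
   Context: $\mathbb{H}=\{z\in\mathbb{C}:\Im z>0\}$ is the upper half-plane. $\mathfrak{D}$ is the class of domains consisting of $\mathbb{H}$ together with all smoothly bounded Jordan domains, i.e. all bounded domains in $\mathbb{C}$ whose boundary is a $C^\infty$ (regularly parametrized) Jordan curve. $\Delta(a,r)=\{z\in\mathbb{C}:|z-a|<r\}$. For $X\subset\mathbb{C}$, $\dim(X)$ is the Hausdorff dimension of $X$. For an analytic function $f$ on a domain $D$, $\mathcal{I}(f)$ is the set of infinite valence values of $f$: the set of $w\in f(D)$ for which $f^{-1}(w)=\{z\in D: f(z)=w\}$ is infinite. $\partial D$ and $\overline{D}$ denote the boundary and closure of $D$ in $\mathbb{C}$ (so $\partial\mathbb{H}=\mathbb{R}$), and $f(\partial D)$ is the image of $\partial D$ under the continuous extension of $f$ to $\overline{D}$. *)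

(* Defs.v *)
From HB Require Import structures.
From mathcomp Require Import all_boot all_order all_algebra.
From mathcomp Require Import complex.
From mathcomp Require Import all_classical all_reals all_analysis.

Set Implicit Arguments.
Unset Strict Implicit.
Unset Printing Implicit Defensive.

Import Order.TTheory GRing.Theory Num.Theory.
Import numFieldNormedType.Exports.

Local Open Scope ring_scope.
Local Open Scope classical_set_scope.
Local Open Scope complex_scope.

(* The generic topology and norm of a numFieldType are only found on the alias
   R[i]^o; they are transported to R[i] itself. Thus R[i] is a normed module
   over R[i], radii of balls are complex numbers (r%:C for real r), and
   [derivable f z 1] / [f^`() z] are complex differentiability and the complex
   derivative. *)
HB.instance Definition _ (R : rcfType) := NormedModule.copy R[i] R[i]^o.

Definition upper_half_plane (R : realType) : set R[i] :=
  [set z | 0 < complex.Im z].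

Definition boundary (T : topologicalType) (A : set T) : set T :=
  closure A `\` A°.

(* To be used for open D, f being arbitrary outside D. *)
Definition analytic_on (R : realType) (D : set R[i]) (f : R[i] -> R[i]) : Prop :=
  forall z, D z -> derivable f z 1.

Definition constant_on (R : realType) (D : set R[i]) (f : R[i] -> R[i]) : Prop :=
  exists c, forall z, D z -> f z = c.

Definition smooth (R : realType) (u : R -> R) : Prop :=
  forall (n : nat) (t : R), derivable u^`(n) t 1.

(* The curve is given by its two coordinates, as 1-periodic functions on R, so
   that smoothness and regularity also hold where the curve closes up. *)
Definition smooth_jordan_curve (R : realType) (J : set R[i]) : Prop :=
  exists x y : R -> R,
    [/\ smooth x /\ smooth y,
        forall t, x (t + 1) = x t /\ y (t + 1) = y t,
        forall t, ~ (x^`() t = 0 /\ y^`() t = 0),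
        set_inj `[0, 1[ (fun t => x t +i* y t) &
        J = (fun t => x t +i* y t) @` `[0, 1[ ].

Definition domain (R : realType) (D : set R[i]) : Prop :=
  [/\ open D, connected D & D !=set0].

Definition smooth_jordan_domain (R : realType) (D : set R[i]) : Prop :=
  [/\ domain D, bounded_set D & smooth_jordan_curve (boundary D)].

Definition domain_class (R : realType) (D : set R[i]) : Prop :=
  D = @upper_half_plane R \/ smooth_jordan_domain D.

Definition infinite_valence (R : realType) (D : set R[i]) (f : R[i] -> R[i]) :
    set R[i] :=
  [set w | (f @` D) w /\ infinite_set (D `&` f @^-1` [set w])].

Section Hausdorff.
Local Open Scope ereal_scope.

(* diam set0 = -oo; this value is never used with a power below. *)
Definition diam (R : realType) (U : set R[i]) : \bar R :=
  ereal_sup [set (Normc.normc (x - y))%:E | x in U & y in U].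

(* (diam U)^s, with the usual conventions 0^0 = 1 for nonempty U, and 0 for the
   empty set even when s = 0. *)
Definition diam_pow (R : realType) (s : R) (U : set R[i]) : \bar R :=
  if U == set0 then 0 else poweR (diam U) s.

Definition hausdorff_premeasure (R : realType) (s delta : R) (X : set R[i]) :
    \bar R :=
  ereal_inf [set \sum_(0 <= i <oo) diam_pow s (U i) | U in
    [set U : nat -> set R[i] |
      X `<=` \bigcup_i U i /\ forall i, diam (U i) <= delta%:E]].

Definition hausdorff_measure (R : realType) (s : R) (X : set R[i]) : \bar R :=
  ereal_sup [set hausdorff_premeasure s delta X
            | delta in [set delta : R | (0 < delta)%R]].

Definition hausdorff_dim (R : realType) (X : set R[i]) : \bar R :=
  ereal_inf [set s%:E | s in
    [set s : R | (0 <= s)%R /\ hausdorff_measure s X = 0]].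

End Hausdorff.

(* Main.v *)
(* Choose z1 <> z2 in the half-plane with g(z1) = g(z2) and g' nonzero at both,
   and a large disc |w| < r with P + {|w| < r} in the half-plane and z1 = P + b,
   |b| close to r. The map om |-> P + b/(1 - i om) sends 0 to z1, the half-plane
   Im om > 0 into that disc, and is almost affine near 0. Hence a primitive of
   om |-> g'(P + b/(1 - i om)) is almost a rescaled copy of g, and near some om0
   in the open half-plane it takes the values which it has near 0.

   Now f' = g'(P + k), where k is the limit of k_0 = b and
   k_{n+1} = k_n (1 - T1) + b T2, with T1 and T2 sums of bumps
   1/(1 - i (z - zeta)/(nu sigma)) at equally spaced boundary points zeta with
   interior normal i nu; these bumps map D almost into |w - 1/2| < 1/2, so
   that k stays in the disc. Near each node f looks like the model, so that the
   boundary values of f on an arc of length eta sigma_n next to a node are also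
   taken inside D, near zeta + nu sigma_n om0. A boundary point lying in such an
   arc for all large n is mapped to a value of infinite valence. These points
   form a Cantor set, on which f is injective with enough control on distances;
   as sigma_n times the number of nodes is only logarithmically small in that
   number (a harmonic sum), the image has dimension 1. Conversely a value of
   infinite valence is a boundary value of f, and f is Lipschitz on the boundary,
   so the dimension is at most 1. *)

Require Import Defs.
From mathcomp Require Import all_boot all_order all_algebra.
From mathcomp Require Import complex ring lra.
From mathcomp Require Import all_classical all_reals all_analysis.

Import Order.TTheory GRing.Theory Num.Theory.
Import numFieldNormedType.Exports.

Local Open Scope ring_scope.
Local Open Scope classical_set_scope.
Local Open Scope complex_scope.

Set Implicit Arguments.
Unset Strict Implicit.
Unset Printing Implicit Defensive.

(** Only the derivative of f is constrained, so f is reached through a primitive and its values are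
    compared along short paths. This works because the coincidence of the model at om0 and 0 is
    stable: an error in f' changes the difference of the two values by at most its size times the
    distance, plus a crude bound times the height of a thin boundary layer, and since the model
    derivative is nonzero at om0 the defect is repaired by moving the interior point a little. The
    layer is unavoidable, as later stages alter f' arbitrarily close to the boundary; but stage n+1
    changes it noticeably only within theta/N_(n+1), which is small against sigma_n. A bump decays
    only like sigma/distance, so N nodes disturb each other by about sigma N log N, and sigma has to
    be of order 1/(N log N). That k stays in the disc rests on the widths in T1 and T2 being far
    apart: at each point of D either 1 - T1 or T2 is small, and |1 - T1| + |T2| barely exceeds 1. A
    primitive exists because every ingredient is built from poles that can be pushed to infinity
    outside D, and so is a limit of polynomials. *)

Notation normc := (@Normc.normc _).

(** * The real-valued modulus, and the topology of the plane expressed by it *)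

Section Modulus.
Context {R : realType}.
Implicit Types (x y z : R[i]) (r : R).

Lemma normc_normr z : `|z| = (normc z)%:C.
Proof. by case: z. Qed.

Lemma normc_ge0 z : 0 <= normc z.
Proof. by case: z => a b; exact: sqrtr_ge0. Qed.

Lemma normc0 : normc (0 : R[i]) = 0. Proof. exact: Normc.normc0. Qed.
Lemma normc1 : normc (1 : R[i]) = 1. Proof. exact: Normc.normc1. Qed.

Lemma normcM x y : normc (x * y) = normc x * normc y.
Proof. exact: Normc.normcM. Qed.

Lemma normcV x : normc x^-1 = (normc x)^-1.
Proof. exact: Normc.normcV. Qed.

Lemma normcf x y : normc (x / y) = normc x / normc y.
Proof. by rewrite normcM normcV. Qed.

Lemma normcN x : normc (- x) = normc x.
Proof. by case: x => a b /=; rewrite !sqrrN. Qed.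

Lemma normcD x y : normc (x + y) <= normc x + normc y.
Proof. exact: le_normcD. Qed.

Lemma normcB x y : normc (x - y) <= normc x + normc y.
Proof. by rewrite -(normcN y) normcD. Qed.

Lemma normcC x y : normc (x - y) = normc (y - x).
Proof. by rewrite -normcN opprB. Qed.

Lemma normc_tri y x z : normc (x - z) <= normc (x - y) + normc (y - z).
Proof. by rewrite -[x - z](_ : x - y + (y - z) = _) ?normcD //; ring. Qed.

Lemma normc_ge_sub x y : normc x - normc y <= normc (x - y).
Proof. by have := normcD (x - y) y; rewrite subrK; lra. Qed.

Lemma normc_ge_add x y : normc x - normc y <= normc (x + y).
Proof. by have := normc_ge_sub x (- y); rewrite opprK normcN. Qed.

Lemma normcX x n : normc (x ^+ n) = normc x ^+ n.
Proof.
elim: n => [|n IH]; first by rewrite !expr0 normc1.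
by rewrite !exprS normcM IH.
Qed.

Lemma normc_eq0 z : (normc z == 0) = (z == 0).
Proof. by apply/eqP/eqP => [/Normc.eq0_normc//|->]; rewrite normc0. Qed.

Lemma normc_gt0 z : (0 < normc z) = (z != 0).
Proof. by rewrite lt_def normc_ge0 andbT normc_eq0. Qed.

Lemma normc_le0 z : normc z <= 0 -> z = 0.
Proof.
by move=> h; apply: Normc.eq0_normc; apply/le_anti; rewrite h normc_ge0.
Qed.

Lemma normc_real r : normc r%:C = `|r|.
Proof. by rewrite /= expr0n /= addr0 sqrtr_sqr. Qed.

Lemma normc_nat n : normc (n%:R : R[i]) = n%:R.
Proof. by rewrite -[n%:R](rmorph_nat (real_complex R)) normc_real normr_nat. Qed.

Lemma normc_i : normc ('i : R[i]) = 1.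
Proof. by rewrite /= expr0n /= add0r expr1n sqrtr1. Qed.

Lemma normc_Re z : `|complex.Re z| <= normc z.
Proof.
case: z => a b /=; rewrite -sqrtr_sqr ler_sqrt.
  by rewrite lerDl sqr_ge0.
by rewrite addr_ge0 // sqr_ge0.
Qed.

Lemma normc_Im z : `|complex.Im z| <= normc z.
Proof.
case: z => a b /=; rewrite -sqrtr_sqr ler_sqrt.
  by rewrite lerDr sqr_ge0.
by rewrite addr_ge0 // sqr_ge0.
Qed.

Lemma normc_sqr z : normc z ^+ 2 = complex.Re z ^+ 2 + complex.Im z ^+ 2.
Proof. by case: z => a b /=; rewrite sqr_sqrtr // addr_ge0 // sqr_ge0. Qed.

Lemma normc_ReIm z : normc z <= `|complex.Re z| + `|complex.Im z|.
Proof.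
rewrite -(@ler_pXn2r _ 2) ?nnegrE ?normc_ge0 // ?addr_ge0 // normc_sqr.
rewrite sqrrD !real_normK ?num_real // -subr_ge0.
have := mulr_ge0 (normr_ge0 (complex.Re z)) (normr_ge0 (complex.Im z)); lra.
Qed.

Lemma cReD x y : complex.Re (x + y) = complex.Re x + complex.Re y.
Proof. by case: x; case: y. Qed.
Lemma cImD x y : complex.Im (x + y) = complex.Im x + complex.Im y.
Proof. by case: x; case: y. Qed.
Lemma cReN x : complex.Re (- x) = - complex.Re x. Proof. by case: x. Qed.
Lemma cImN x : complex.Im (- x) = - complex.Im x. Proof. by case: x. Qed.
Lemma cReM x y : complex.Re (x * y) =
  complex.Re x * complex.Re y - complex.Im x * complex.Im y.
Proof. by case: x; case: y. Qed.
Lemma cImM x y : complex.Im (x * y) =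
  complex.Re x * complex.Im y + complex.Im x * complex.Re y.
Proof. by case: x; case: y. Qed.
Lemma rcD r (s : R) : (r + s)%:C = r%:C + s%:C.
Proof. exact: (rmorphD (real_complex R)). Qed.
Lemma rcB r (s : R) : (r - s)%:C = r%:C - s%:C.
Proof. exact: (rmorphB (real_complex R)). Qed.
Lemma rcM r (s : R) : (r * s)%:C = r%:C * s%:C.
Proof. exact: (rmorphM (real_complex R)). Qed.
Lemma rcV r : (r^-1)%:C = (r%:C)^-1.
Proof. exact: (fmorphV (real_complex R)). Qed.
Lemma rc_eq0 r : (r%:C == 0) = (r == 0).
Proof. exact: (fmorph_eq0 (real_complex R)). Qed.

Lemma ballcE x r y : ball x r%:C y <-> normc (x - y) < r.
Proof. by rewrite -ball_normE /ball_ /= normc_normr ltcR. Qed.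

Lemma nbhscP x (A : set R[i]) : nbhs x A <->
  exists2 r, 0 < r & forall y, normc (y - x) < r -> A y.
Proof.
split.
  move=> /nbhs_ballP[e /= e0 eA]; case: e e0 eA => a b.
  (* A positive element of [R[i]] has imaginary part zero, so a complex radius is a real one. *)
  rewrite ltcE /= => /andP[/eqP -> a0] eA; exists a => // y xy.
  by apply: eA; apply/ballcE; rewrite normcC.
move=> [r r0 rA]; apply/nbhs_ballP; exists r%:C => /=; first by rewrite ltcR.
by move=> y /ballcE xy; apply: rA; rewrite normcC.
Qed.

Lemma opencP (A : set R[i]) : open A <->
  forall x, A x -> exists2 r, 0 < r & forall y, normc (y - x) < r -> A y.
Proof.
rewrite openE; split => h x Ax; first exact/nbhscP/h.
by apply/nbhscP/h.
Qed.

Lemma closurecP (A : set R[i]) x : closure A x <->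
  forall r, 0 < r -> exists2 y, A y & normc (y - x) < r.
Proof.
split.
  move=> cA r r0; have /cA : nbhs x [set y | normc (y - x) < r].
    by apply/nbhscP; exists r.
  by case=> y [Ay xy]; exists y.
move=> h B /nbhscP[r r0 rB]; have [y Ay xy] := h r r0.
by exists y; split => //; exact: rB.
Qed.

Lemma boundarycP (D : set R[i]) (oD : open D) p : boundary D p <->
  ~ D p /\ forall r, 0 < r -> exists2 y, D y & normc (y - p) < r.
Proof.
rewrite /boundary (proj1 (interior_id D) oD) /=; split.
  by move=> [/closurecP cD nD].
by move=> [nD /closurecP cD].
Qed.

End Modulus.

(** * Limits, compactness of the interval and derivatives in epsilon-delta form *)

Section Calculus.
Context {R : realType}.
Implicit Types (f g : R[i] -> R[i]) (x y z w d : R[i]) (phi : R -> R[i]).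

Definition clim (u : nat -> R[i]) (l : R[i]) :=
  forall e : R, 0 < e -> exists n0 : nat, forall n : nat, (n0 <= n)%N -> normc (u n - l) <= e.

(** The limit is the supremum of the numbers that are eventually below the sequence. *)
Lemma real_cauchy_lim (u : nat -> R) :
  (forall e : R, 0 < e -> exists n0 : nat, forall n : nat, (n0 <= n)%N -> `|u n - u n0| <= e) ->
  exists l, forall e : R, 0 < e -> exists n0 : nat, forall n : nat, (n0 <= n)%N -> `|u n - l| <= e.
Proof.
move=> cu; pose S := [set x : R | exists n0 : nat, forall n : nat, (n0 <= n)%N -> x <= u n].
have up e n0 : (forall n, (n0 <= n)%N -> `|u n - u n0| <= e) -> ubound S (u n0 + e).
  move=> h x [n1 n1x]; have := n1x (maxn n0 n1) (leq_maxr _ _).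
  by have := h (maxn n0 n1) (leq_maxl _ _); rewrite ler_norml; lra.
have lo e n0 : (forall n, (n0 <= n)%N -> `|u n - u n0| <= e) -> S (u n0 - e).
  by move=> h; exists n0 => n /h; rewrite ler_norml; lra.
have hS : has_sup S.
  by have [n0 h] := cu 1 ltr01; split; [exists (u n0 - 1); exact: lo|exists (u n0 + 1); exact: up].
exists (sup S) => e e0; have [|n0 h] := cu (e / 2); first by lra.
have h1 := ge_sup (proj1 hS) (up _ _ h).
have h2 := ub_le_sup (proj2 hS) (lo _ _ h).
by exists n0 => n /h; rewrite !ler_norml; lra.
Qed.

Lemma cauchy_clim (u : nat -> R[i]) :
  (forall e : R, 0 < e -> exists n0 : nat, forall n : nat, (n0 <= n)%N -> normc (u n - u n0) <= e) ->
  exists l, clim u l.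
Proof.
move=> cu.
have [e e0|a ha] := @real_cauchy_lim (fun n => complex.Re (u n)).
  have [n0 h] := cu e e0; exists n0 => n /h; apply: le_trans.
  by rewrite -cReN -cReD normc_Re.
have [e e0|b hb] := @real_cauchy_lim (fun n => complex.Im (u n)).
  have [n0 h] := cu e e0; exists n0 => n /h; apply: le_trans.
  by rewrite -cImN -cImD normc_Im.
exists (a +i* b) => e e0.
have [|n1 h1] := ha (e / 2); first by lra.
have [|n2 h2] := hb (e / 2); first by lra.
exists (maxn n1 n2) => n; rewrite geq_max => /andP[/h1 {}h1 /h2 {}h2].
apply: le_trans (normc_ReIm _) _; rewrite cReD cImD cReN cImN /=; lra.
Qed.

Lemma clim_le u l x (M : R) : clim u l ->
  (exists n0 : nat, forall n, (n0 <= n)%N -> normc (u n - x) <= M) -> normc (l - x) <= M.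
Proof.
move=> ul [n0 h]; apply/ler_addgt0Pr => e e0.
have [n1 h1] := ul e e0; have := h (maxn n0 n1) (leq_maxl _ _).
have := h1 (maxn n0 n1) (leq_maxr _ _).
have := normc_tri (u (maxn n0 n1)) l x; rewrite (normcC l (u _)); lra.
Qed.

Lemma clim_unique u l l' : clim u l -> clim u l' -> l = l'.
Proof.
move=> h h'; apply/eqP; rewrite -subr_eq0; apply/eqP/normc_le0.
apply/ler_addgt0Pr => e e0; rewrite add0r; apply: clim_le h _.
by have [n0 ?] := h' e e0; exists n0.
Qed.

(** Compactness of [0, 1] in the form used throughout: an additive property of intervals that holds
    for all short intervals around each point holds for the whole interval. The supremum of the
    right ends reachable from 0 cannot be smaller than 1, and is reached. *)
Lemma cousin (P : R -> R -> Prop) :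
  (forall a b c, a <= b -> b <= c -> P a b -> P b c -> P a c) ->
  (forall t, 0 <= t <= 1 -> exists2 dl, 0 < dl &
     forall a b, 0 <= a -> a <= t -> t <= b -> b <= 1 -> t - dl < a -> b < t + dl -> P a b) ->
  P 0 1.
Proof.
move=> Ptr Ploc; pose S := [set t | 0 <= t <= 1 /\ P 0 t].
have P00 : P 0 0.
  by have [|dl dl0 h] := Ploc 0; [rewrite lexx ler01|apply: h; lra].
have S0 : S 0 by split => //; rewrite lexx ler01.
have hS : has_sup S by split; [exists 0|exists 1 => t [/andP[]]].
have s0 : 0 <= sup S by apply: (ub_le_sup (proj2 hS)).
have s1 : sup S <= 1 by apply: (ge_sup (proj1 hS)) => t [/andP[]].
have [|dl dl0 h] := Ploc (sup S); first by rewrite s0 s1.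
have [t [/andP[t0 t1] Pt] st] := sup_adherent dl0 hS.
have ts : t <= sup S by apply: (ub_le_sup (proj2 hS)); split => //; rewrite t0.
have Ps b : sup S <= b -> b <= 1 -> b < sup S + dl -> P 0 b.
  by move=> sb b1 bd; apply: (Ptr 0 t b) => //; [lra|apply: h => //; lra].
have [s1'|s1'] := ltP (sup S) 1; last by apply: Ps => //; lra.
have [hb|hb] := ltP (sup S + dl / 2) 1.
  suff : S (sup S + dl / 2) by move=> /(ub_le_sup (proj2 hS)); lra.
  by split; [apply/andP; split; clear -s0 dl0 hb; lra|apply: Ps; clear -dl0 hb; lra].
by apply: Ps; clear -s1 dl0 hb; lra.
Qed.

(** The derivative is an argument and the error bounds are real, so that estimates combine directly;
    [cdiff_derivable] and [derivable_cdiff] connect this with the derivative of the theorem. *)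
Definition cdiff f z d := forall e : R, 0 < e -> exists2 dl : R, 0 < dl &
  forall w, normc (w - z) < dl -> normc (f w - f z - d * (w - z)) <= e * normc (w - z).

Definition ccont f z := forall e : R, 0 < e -> exists2 dl : R, 0 < dl &
  forall w, normc (w - z) < dl -> normc (f w - f z) <= e.

Definition rdiff phi (t : R) d := forall e : R, 0 < e -> exists2 dl : R, 0 < dl &
  forall s, `|s - t| < dl -> normc (phi s - phi t - d * (s - t)%:C) <= e * `|s - t|.

Lemma cdiff_ccont f z d : cdiff f z d -> ccont f z.
Proof.
move=> fd e e0; have [dl dl0 h] := fd 1 ltr01.
have nd := normc_ge0 d.
exists (Num.min dl (e / (normc d + 1))).
  by rewrite lt_min dl0 divr_gt0 //; lra.
move=> w; rewrite lt_min => /andP[/h {}h].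
rewrite ltr_pdivlMr; last by lra.
have := normcD (f w - f z - d * (w - z)) (d * (w - z)); rewrite subrK normcM.
lra.
Qed.

Lemma cdiff_local f g z d (r : R) : 0 < r -> (forall w, normc (w - z) < r -> f w = g w) ->
  cdiff f z d -> cdiff g z d.
Proof.
move=> r0 fg fd e e0; have [dl dl0 h] := fd e e0.
exists (Num.min dl r); first by rewrite lt_min dl0.
move=> w; rewrite lt_min => /andP[/h + wr]; rewrite !fg //.
by rewrite subrr normc0.
Qed.

Lemma cdiff_cst c z : cdiff (fun=> c) z 0.
Proof. by move=> e e0; exists 1 => // w _; rewrite mul0r !subrr normc0 mulr_ge0 ?normc_ge0 // ltW. Qed.

Lemma cdiff_id z : cdiff id z 1.
Proof. by move=> e e0; exists 1 => // w _; rewrite mul1r subrr normc0 mulr_ge0 ?normc_ge0 // ltW. Qed.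

Lemma cdiffD f g z d d' : cdiff f z d -> cdiff g z d' -> cdiff (fun w => f w + g w) z (d + d').
Proof.
move=> fd gd e e0; have [|dl dl0 h] := fd (e / 2); first by lra.
have [|dl' dl0' h'] := gd (e / 2); first by lra.
exists (Num.min dl dl'); first by rewrite lt_min dl0.
move=> w; rewrite lt_min => /andP[/h {}h /h' {}h'].
rewrite (_ : _ - _ - _ = (f w - f z - d * (w - z)) + (g w - g z - d' * (w - z))); last by ring.
by apply: le_trans (normcD _ _) _; lra.
Qed.

Lemma cdiffZ c f z d : cdiff f z d -> cdiff (fun w => c * f w) z (c * d).
Proof.
move=> fd e e0; have nc := normc_ge0 c.
have [|dl dl0 h] := fd (e / (normc c + 1)); first by rewrite divr_gt0 //; lra.
exists dl => // w /h {}h.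
rewrite (_ : _ - _ - _ = c * (f w - f z - d * (w - z))); last by ring.
rewrite normcM; apply: le_trans (ler_wpM2l nc h) _.
rewrite mulrA ler_wpM2r ?normc_ge0 // mulrCA ler_piMr //; first lra.
by rewrite ler_pdivrMr; lra.
Qed.

Lemma cdiffN f z d : cdiff f z d -> cdiff (fun w => - f w) z (- d).
Proof.
move=> /(cdiffZ (-1)); rewrite mulN1r; under [X in cdiff X]eq_fun do rewrite mulN1r.
by [].
Qed.

Lemma cdiffB f g z d d' : cdiff f z d -> cdiff g z d' -> cdiff (fun w => f w - g w) z (d - d').
Proof. by move=> fd /cdiffN; exact: cdiffD. Qed.

Lemma cdiff_comp f g z d d' : cdiff f z d -> cdiff g (f z) d' -> cdiff (fun w => g (f w)) z (d' * d).
Proof.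
move=> fd gd e e0.
have nd := normc_ge0 d; have nd' := normc_ge0 d'.
pose e2 := e / 2 / (normc d + 1).
have e20 : 0 < e2 by rewrite !divr_gt0 //; lra.
have [dl2 dl20 h2] := gd e2 e20.
pose e1 := Num.min 1 (e / 2 / (normc d' + 1)).
have e10 : 0 < e1 by rewrite lt_min ltr01 !divr_gt0 //; lra.
have [dl3 dl30 h3] := fd e1 e10.
have [|dl4 dl40 h4] := cdiff_ccont fd (_ : 0 < dl2 / 2); first by lra.
exists (Num.min dl3 dl4); first by rewrite lt_min dl30.
move=> w; rewrite lt_min => /andP[/h3 {}h3 /h4 {}h4].
have /h2 {}h2 : normc (f w - f z) < dl2 by lra.
have nw := normc_ge0 (w - z).
have e11 : e1 <= 1 by rewrite ge_min lexx.
have e12 : e1 * (normc d' + 1) <= e / 2.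
  by rewrite -ler_pdivlMr ?ge_min ?lexx ?orbT //; clear -nd'; lra.
have fw : normc (f w - f z) <= (normc d + 1) * normc (w - z).
  have := normcD (f w - f z - d * (w - z)) (d * (w - z)); rewrite subrK normcM.
  have := ler_wpM2r nw e11; clear -h3; lra.
rewrite (_ : _ - _ - _ = (g (f w) - g (f z) - d' * (f w - f z)) + d' * (f w - f z - d * (w - z))); last by ring.
apply: le_trans (normcD _ _) _; rewrite normcM.
have A : normc d' * normc (f w - f z - d * (w - z)) <= e / 2 * normc (w - z).
  apply: le_trans (ler_wpM2l nd' h3) _; rewrite mulrA ler_wpM2r //.
  by rewrite mulrC; apply: le_trans e12; rewrite ler_wpM2l //; clear -e10; lra.
have B : e2 * normc (f w - f z) <= e / 2 * normc (w - z).
  apply: le_trans (ler_wpM2l (ltW e20) fw) _; rewrite mulrA ler_wpM2r // /e2 mulfVK //; clear -nd; lra.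
(clear -h2 A B; lra).
Qed.

Lemma cdiffM f g z d d' : cdiff f z d -> cdiff g z d' ->
  cdiff (fun w => f w * g w) z (d * g z + f z * d').
Proof.
move=> fd gd.
have gc := cdiff_ccont gd.
have nd := normc_ge0 d; have nf := normc_ge0 (f z); have ng := normc_ge0 (g z).
move=> e e0.
pose e1 := Num.min 1 (e / 3 / (normc (g z) + 1)).
have e10 : 0 < e1 by rewrite lt_min ltr01 !divr_gt0 //; lra.
have e11 : e1 <= 1 by rewrite ge_min lexx.
have [dl1 dl10 h1] := fd e1 e10.
have e20 : 0 < e / 3 / (normc (f z) + 1) by rewrite !divr_gt0 //; lra.
have [dl2 dl20 h2] := gd _ e20.
have e30 : 0 < e / 3 / (normc d + 1) by rewrite !divr_gt0 //; lra.
have [dl3 dl30 h3] := gc _ e30.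
exists (Num.min dl1 (Num.min dl2 dl3)); first by rewrite !lt_min dl10 dl20.
move=> w; rewrite !lt_min => /and3P[/h1 {}h1 /h2 {}h2 /h3 {}h3].
have nw := normc_ge0 (w - z).
rewrite (_ : _ - _ - _ = (f w - f z - d * (w - z)) * g z + f z * (g w - g z - d' * (w - z))
   + (f w - f z) * (g w - g z)); last by ring.
have fw : normc (f w - f z) <= (normc d + 1) * normc (w - z).
  have := normcD (f w - f z - d * (w - z)) (d * (w - z)); rewrite subrK normcM.
  have := ler_wpM2r nw e11; clear -h1; lra.
apply: le_trans (normcD _ _) _; apply: le_trans (lerD (normcD _ _) (lexx _)) _.
rewrite !normcM.
have A : normc (f w - f z - d * (w - z)) * normc (g z) <= e / 3 * normc (w - z).
  apply: le_trans (ler_wpM2r ng h1) _; rewrite mulrAC ler_wpM2r //.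
  apply: (@le_trans _ _ (e1 * (normc (g z) + 1))); first by rewrite ler_wpM2l //; clear -e10; lra.
  by rewrite -ler_pdivlMr ?ge_min ?lexx ?orbT //; clear -ng; lra.
have B : normc (f z) * normc (g w - g z - d' * (w - z)) <= e / 3 * normc (w - z).
  apply: le_trans (ler_wpM2l nf h2) _; rewrite mulrA ler_wpM2r // mulrCA ler_piMr //; first (clear -e0; lra).
  by rewrite ler_pdivrMr; clear -nf; lra.
have C : normc (f w - f z) * normc (g w - g z) <= e / 3 * normc (w - z).
  apply: le_trans (ler_pM (normc_ge0 _) (normc_ge0 _) fw h3) _.
  by rewrite mulrAC ler_wpM2r // mulrC mulfVK //; clear -nd; lra.
(clear -A B C; lra).
Qed.

Lemma cdiff_inv z : z != 0 -> cdiff GRing.inv z (- (z ^+ 2)^-1).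
Proof.
move=> z0 e e0; have nz : 0 < normc z by rewrite normc_gt0.
pose dl := Num.min (normc z / 2) (e / 2 * normc z ^+ 3).
exists dl; first by rewrite lt_min !divr_gt0 //= mulr_gt0 ?exprn_gt0 // divr_gt0.
move=> w; rewrite lt_min => /andP[h1 h2].
have nw : normc z / 2 < normc w.
  by have := normc_ge_sub z w; rewrite normcC; lra.
have w0 : w != 0 by rewrite -normc_gt0; lra.
rewrite (_ : w^-1 - z^-1 - _ = (w - z) ^+ 2 * (w^-1 * (z ^+ 2)^-1)); last by field; rewrite z0 w0.
rewrite normcM normcX normcM !normcV normcX expr2 -mulrA mulrC ler_wpM2r ?normc_ge0 //.
apply: le_trans (ler_wpM2r _ (ltW h2)) _; first by rewrite mulr_ge0 // invr_ge0 ?exprn_ge0 ?normc_ge0.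
have -> : e / 2 * normc z ^+ 3 * ((normc w)^-1 * (normc z ^+ 2)^-1) = e * (normc z / 2 / normc w).
  by field; rewrite !gt_eqF //; lra.
by rewrite ler_piMr ?(ltW e0) // ler_pdivrMr; lra.
Qed.

Lemma cdiff_rdiff f z w d (t : R) : cdiff f (z + t%:C * (w - z)) d ->
  rdiff (fun s => f (z + s%:C * (w - z))) t (d * (w - z)).
Proof.
move=> fd e e0; have nw := normc_ge0 (w - z).
have e10 : 0 < e / (normc (w - z) + 1) by rewrite divr_gt0 //; lra.
have [dl dl0 h] := fd _ e10.
exists (dl / (normc (w - z) + 1)); first by rewrite divr_gt0 //; lra.
move=> s; rewrite ltr_pdivlMr; last by lra.
move=> hs; set u := z + s%:C * (w - z); set v := z + t%:C * (w - z).
have uv : u - v = (s - t)%:C * (w - z) by rewrite rcB /u /v; ring.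
have nuv : normc (u - v) = `|s - t| * normc (w - z) by rewrite uv normcM normc_real.
have := h u; rewrite -/v nuv uv => h'.
rewrite -mulrA [(w - z) * _]mulrC; apply: le_trans (h' _) _.
  by have := normr_ge0 (s - t); clear -hs; lra.
rewrite mulrCA [leRHS]mulrC ler_wpM2l // mulrAC ler_pdivrMr; last by lra.
by rewrite ler_wpM2l //; clear -e0; lra.
Qed.

(** Mean value inequality without an integral: the slope is at most [M + e] on short intervals
    around each point, and this bound is additive, so [cousin] extends it to [0, 1]. *)
Lemma rdiff_bound phi (M : R) : 0 <= M ->
  (forall t, 0 <= t <= 1 -> exists2 d, rdiff phi t d & normc d <= M) ->
  normc (phi 1 - phi 0) <= M.
Proof.
move=> M0 h; apply/ler_addgt0Pr => e e0.
suff : normc (phi 1 - phi 0) <= (M + e) * (1 - 0) by rewrite subr0 mulr1.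
pose P a b := normc (phi b - phi a) <= (M + e) * (b - a).
apply: (@cousin P) => [a b c ab bc|t t01]; rewrite /P.
  move=> h1 h2; have := normc_tri (phi b) (phi c) (phi a); lra.
have [d pd dM] := h t t01; have [dl dl0 hd] := pd e e0.
have key s : `|s - t| < dl -> normc (phi s - phi t) <= (M + e) * `|s - t|.
  move=> /hd; have := normcD (phi s - phi t - d * (s - t)%:C) (d * (s - t)%:C).
  rewrite subrK normcM normc_real; have := ler_wpM2r (normr_ge0 (s - t)) dM; lra.
exists dl => // a b a0 ta tb b1 da db.
have h1 : normc (phi b - phi t) <= (M + e) * (b - t).
  by have := key b; rewrite ger0_norm; [apply; clear -db; lra|clear -tb; lra].
have h2 : normc (phi a - phi t) <= (M + e) * (t - a).
  by have := key a; rewrite ler0_norm; [rewrite opprB; apply; clear -da; lra|clear -ta; lra].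
have := normc_tri (phi t) (phi b) (phi a); rewrite (normcC (phi t)); clear -h1 h2; lra.
Qed.

Lemma mean_value_bound f (f' : R[i] -> R[i]) z w (M : R) : 0 <= M ->
  (forall t : R, 0 <= t <= 1 -> cdiff f (z + t%:C * (w - z)) (f' (z + t%:C * (w - z)))
     /\ normc (f' (z + t%:C * (w - z))) <= M) ->
  normc (f w - f z) <= M * normc (w - z).
Proof.
move=> M0 h; have := @rdiff_bound (fun s => f (z + s%:C * (w - z))) (M * normc (w - z)).
rewrite mul0r addr0 mul1r [z + (w - z)]addrC subrK; apply; first by rewrite mulr_ge0 // normc_ge0.
move=> t /h[h1 h2]; exists (f' (z + t%:C * (w - z)) * (w - z)); first exact: cdiff_rdiff.
by rewrite normcM ler_wpM2r // normc_ge0.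
Qed.

(** Connectedness of a segment: membership in [A] is locally constant along it, hence passes from
    one end to the other by [cousin]. *)
Lemma clopen_segment (A : set R[i]) z w :
  (forall t : R, 0 <= t <= 1 -> exists2 dl, 0 < dl &
     (forall y, normc (y - (z + t%:C * (w - z))) < dl -> A y) \/
     (forall y, normc (y - (z + t%:C * (w - z))) < dl -> ~ A y)) ->
  A z -> A w.
Proof.
move=> h; pose P (a b : R) := A (z + a%:C * (w - z)) -> A (z + b%:C * (w - z)).
suff : P 0 1 by rewrite /P mul0r addr0 mul1r [z + (w - z)]addrC subrK.
apply: cousin => [a b c _ _ h1 h2 /h1 /h2//|t t01].
have [dl dl0 hd] := h t t01; have nw := normc_ge0 (w - z).
exists (dl / (normc (w - z) + 1)); first by rewrite divr_gt0 //; lra.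
have key s : `|s - t| < dl / (normc (w - z) + 1) ->
   normc (z + s%:C * (w - z) - (z + t%:C * (w - z))) < dl.
  rewrite ltr_pdivlMr => [st|]; last by lra.
  rewrite (_ : _ - _ = (s - t)%:C * (w - z)); last by rewrite rcB; ring.
  by rewrite normcM normc_real; have := normr_ge0 (s - t); move: st; lra.
move=> a b a0 ta tb b1 da db.
have ka : `|a - t| < dl / (normc (w - z) + 1) by rewrite ltr_norml; clear -ta da; lra.
have kb : `|b - t| < dl / (normc (w - z) + 1) by rewrite ltr_norml; clear -tb db; lra.
case: hd => hd; first by move=> _; apply/hd/key.
by move=> Aa; case: (hd _ (key _ ka)).
Qed.

Lemma cdiff_derivable f z d : cdiff f z d -> is_derive z 1 f d.
Proof.
move=> fd; suff h : (fun h : R[i] => h^-1 *: (f (h *: (1 : R[i]) + z) - f z)) @ 0^' --> d.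
  apply: DeriveDef; first by apply/cvg_ex; exists d; exact: h.
  exact: (cvg_lim (@norm_hausdorff _ _) h).
apply/cvgrPdist_le => e; rewrite ltcE /= => /andP[/eqP eIm e0].
have [dl dl0 hd] := fd _ e0.
have ee : e = (complex.Re e)%:C by case: e eIm e0 hd => a b /= -> .
apply/nbhscP; exists dl => // w; rewrite subr0 => wd /= w0.
rewrite normc_normr ee lecR.
have := hd (w + z); rewrite addrK => /(_ wd).
rewrite [w *: 1]mulr1 [_ *: _]mulrC => h'.
rewrite (_ : d - _ = - ((f (w + z) - f z - d * w) * w^-1)); last by field.
rewrite normcN normcf ler_pdivrMr // normc_gt0 //.
Qed.

Lemma derivable_cdiff f z : derivable f z 1 -> cdiff f z (f^`() z).
Proof.
rewrite /derivable => /cvg_ex[l /= hl].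
have lE : f^`() z = l.
  by rewrite derive1E /derive; apply: cvg_lim hl; exact: norm_hausdorff.
rewrite lE => e e0; move/cvgrPdist_le : hl => /(_ e%:C); rewrite ltcR => /(_ e0).
move=> /nbhscP[dl dl0 h]; exists dl => // w wz.
have [->|wz0] := eqVneq w z; first by rewrite !subrr mulr0 subrr normc0 mulr0.
have wz1 : w - z != 0 by rewrite subr_eq0.
have := h (w - z); rewrite subr0 => /(_ wz wz1).
rewrite normc_normr lecR => h'.
rewrite (_ : f w - f z - _ = - ((l - (w - z)^-1 * (f w - f z)) * (w - z))); last by field.
rewrite normcN normcM ler_wpM2r ?normc_ge0 //; move: h'.
by rewrite [(w - z)%:A]mulr1 subrK.
Qed.

Lemma cdiff_unique f z d d' : cdiff f z d -> cdiff f z d' -> d = d'.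
Proof.
by move=> /cdiff_derivable h1 /cdiff_derivable h2; rewrite -(@derive_val _ _ _ _ _ _ _ h1) -(@derive_val _ _ _ _ _ _ _ h2).
Qed.

End Calculus.

(** * Integrals along segments *)

Section Integral.
Context {R : realType}.
Implicit Types (f g : R[i] -> R[i]) (p q z w d I J : R[i]) (phi : R -> R[i]).

Lemma real_antiderivative (f : R -> R) : continuous f -> exists F : R -> R,
  forall t : R, 0 <= t <= 1 -> forall e : R, 0 < e -> exists2 dl : R, 0 < dl &
  forall s, `|s - t| < dl -> `|F s - F t - f t * (s - t)| <= e * `|s - t|.
Proof.
(* The integral starts at -1 and integrability is taken up to 2, so that every t in [0, 1] is an
   interior point for the fundamental theorem. *)
move=> fc; pose F := fun x0 : R => (\int[lebesgue_measure]_(t in [set` Interval (BLeft (-1)) (BRight x0)]) f t)%R.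
exists F => t /andP[t0 t1] e e0.
have int : lebesgue_measure.-integrable [set` Interval (BLeft (-1 : R)) (BRight 2)] (EFin \o f).
  apply: continuous_compact_integrable; first exact: segment_compact.
  exact: continuous_subspaceT.
have [] := @continuous_FTC1 R f (BLeft (-1)) t 2 _ int _ (fc t).
- by lra.
- by rewrite /= lte_fin; lra.
rewrite -/F /derivable => /cvg_ex[l /= hl] Ft.
have lE : f t = l.
  by rewrite -Ft derive1E /derive; apply: cvg_lim hl.
move/cvgrPdist_le : hl => /(_ e e0) /nbhs_ballP[dl /= dl0 h].
exists dl => // s st; have [->|s0] := eqVneq s t.
  by rewrite !subrr mulr0 subrr normr0 mulr0.
have s1 : s - t != 0 by rewrite subr_eq0.
have := h (s - t); rewrite /ball /= sub0r normrN => /(_ st s1).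
rewrite [(s - t)%:A]mulr1 subrK lE => h'.
rewrite (_ : F s - F t - _ = - ((l - (s - t)^-1 * (F s - F t)) * (s - t))); last by field.
by rewrite normrN normrM ler_wpM2r.
Qed.

Definition rcont phi (t : R) := forall e : R, 0 < e -> exists2 dl : R, 0 < dl &
  forall s, `|s - t| < dl -> normc (phi s - phi t) <= e.

Lemma antiderivative phi : (forall t, 0 <= t <= 1 -> rcont phi t) ->
  exists Phi, forall t, 0 <= t <= 1 -> rdiff Phi t (phi t).
Proof.
(* Clamping the parameter to [0, 1] extends [phi] continuously to the whole line without changing it
   on [0, 1]. *)
move=> phic; pose cl (t : R) := if t < 0 then 0 else if 1 < t then 1 else t.
have cl01 t : 0 <= cl t <= 1.
  rewrite /cl; case: (ltP t 0) => h; first by rewrite lexx ler01.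
  by case: (ltP 1 t) => h'; rewrite ?h ?h' ?lexx ?ler01.
have clE t : 0 <= t <= 1 -> cl t = t.
  by rewrite /cl => /andP[t0 t1]; rewrite ltNge t0 /= ltNge t1.
have cl_mono s t : s <= t -> 0 <= cl t - cl s <= t - s.
  rewrite /cl => st; apply/andP.
  by case: (ltP s 0) => ?; case: (ltP 1 s) => ?; case: (ltP t 0) => ?; case: (ltP 1 t) => ?; split; lra.
have cl_lip s t : `|cl s - cl t| <= `|s - t|.
  wlog st : s t / s <= t => [hw|].
    by have [/hw//|/ltW/hw] := leP s t; rewrite distrC [leRHS]distrC.
  have /andP[h1 h2] := cl_mono s t st.
  by rewrite distrC [leRHS]distrC !ger0_norm //; lra.
have cont (P : R[i] -> R) : (forall x y, `|P x - P y| <= normc (x - y)) ->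
    continuous (P \o phi \o cl).
  move=> hP t; apply/cvgrPdist_le => e e0; have [dl dl0 h] := phic _ (cl01 t) e e0.
  apply/nbhs_ballP; exists dl => //= s ts; apply: le_trans (hP _ _) _.
  rewrite normcC; apply: h; apply: le_lt_trans (cl_lip _ _) _.
  by rewrite distrC.
have [|F hF] := real_antiderivative (cont (@complex.Re R) _).
  by move=> x y; rewrite -cReN -cReD normc_Re.
have [|G hG] := real_antiderivative (cont (@complex.Im R) _).
  by move=> x y; rewrite -cImN -cImD normc_Im.
exists (fun t => F t +i* G t) => t t01 e e0.
have e20 : 0 < e / 2 by lra.
have [dl dl0 h] := hF t t01 _ e20; have [dl' dl0' h'] := hG t t01 _ e20.
exists (Num.min dl dl'); first by rewrite lt_min dl0.
move=> s; rewrite lt_min => /andP[/h {}h /h' {}h'].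
apply: le_trans (normc_ReIm _) _.
move: h h'; rewrite /= clE //; case: (phi t) => a b /=.
rewrite !mulr0 subr0 add0r; clear; lra.
Qed.

(* Integrals are increments of antiderivatives along the parameter, hence
   relations; [sint] below is 0 when there is no antiderivative. *)
Definition segint f p q I := exists Phi,
  (forall t : R, 0 <= t <= 1 -> rdiff Phi t (f (p + t%:C * (q - p)) * (q - p))) /\
  I = Phi 1 - Phi 0.

Lemma rdiffD phi psi t d d' : rdiff phi t d -> rdiff psi t d' ->
  rdiff (fun s => phi s + psi s) t (d + d').
Proof.
move=> fd gd e e0; have [|dl dl0 h] := fd (e / 2); first by lra.
have [|dl' dl0' h'] := gd (e / 2); first by lra.
exists (Num.min dl dl'); first by rewrite lt_min dl0.
move=> w; rewrite lt_min => /andP[/h {}h /h' {}h'].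
rewrite (_ : _ - _ - _ = (phi w - phi t - d * (w - t)%:C) + (psi w - psi t - d' * (w - t)%:C)); last by ring.
by apply: le_trans (normcD _ _) _; lra.
Qed.

Lemma rdiffZ c phi t d : rdiff phi t d -> rdiff (fun s => c * phi s) t (c * d).
Proof.
move=> fd e e0; have nc := normc_ge0 c.
have [|dl dl0 h] := fd (e / (normc c + 1)); first by rewrite divr_gt0 //; lra.
exists dl => // w /h {}h.
rewrite (_ : _ - _ - _ = c * (phi w - phi t - d * (w - t)%:C)); last by ring.
rewrite normcM; apply: le_trans (ler_wpM2l nc h) _.
rewrite mulrA ler_wpM2r // mulrCA ler_piMr //; first lra.
by rewrite ler_pdivrMr; lra.
Qed.

Lemma rdiff_affine (al be : R) phi t d : rdiff phi (al + be * t) d ->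
  rdiff (fun s => phi (al + be * s)) t (d * be%:C).
Proof.
move=> fd e e0; have nb := normr_ge0 be.
have [|dl dl0 h] := fd (e / (`|be| + 1)); first by rewrite divr_gt0 //; lra.
exists (dl / (`|be| + 1)); first by rewrite divr_gt0 //; lra.
move=> s; rewrite ltr_pdivlMr; last by lra.
move=> st; have E : al + be * s - (al + be * t) = be * (s - t) by ring.
have := h (al + be * s); rewrite E normrM rcM mulrA => h'.
apply: le_trans (h' _) _; first by have := normr_ge0 (s - t); clear -st; lra.
rewrite mulrA ler_wpM2r // mulrAC ler_pdivrMr; last by clear -nb; lra.
by rewrite ler_wpM2l //; clear -e0; lra.
Qed.

Lemma segint_ex f p q : (forall t : R, 0 <= t <= 1 -> ccont f (p + t%:C * (q - p))) ->
  exists I, segint f p q I.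
Proof.
move=> fc; have [t t01|Phi hPhi] := @antiderivative (fun t => f (p + t%:C * (q - p)) * (q - p)).
  have nq := normc_ge0 (q - p).
  move=> e e0; have [|dl dl0 h] := fc t t01 (e / (normc (q - p) + 1)); first by rewrite divr_gt0 //; lra.
  exists (dl / (normc (q - p) + 1)); first by rewrite divr_gt0 //; lra.
  move=> s; rewrite ltr_pdivlMr => [st|]; last by lra.
  rewrite -mulrBl normcM.
  have /h : normc (p + s%:C * (q - p) - (p + t%:C * (q - p))) < dl.
    rewrite (_ : _ - _ = (s - t)%:C * (q - p)); last by rewrite rcB; ring.
    by rewrite normcM normc_real; have := normr_ge0 (s - t); lra.
  rewrite ler_pdivlMr; last by lra.
  apply: le_trans; rewrite ler_wpM2l ?normc_ge0 //; lra.
by exists (Phi 1 - Phi 0), Phi.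
Qed.

Lemma segint_bound f p q I (M : R) : 0 <= M -> segint f p q I ->
  (forall t : R, 0 <= t <= 1 -> normc (f (p + t%:C * (q - p))) <= M) ->
  normc I <= M * normc (q - p).
Proof.
move=> M0 [Phi [hPhi ->]] h; apply: rdiff_bound; first by rewrite mulr_ge0 // normc_ge0.
move=> t t01; exists (f (p + t%:C * (q - p)) * (q - p)); first exact: hPhi.
by rewrite normcM ler_wpM2r ?normc_ge0 // h.
Qed.

Lemma segintD f g p q I J : segint f p q I -> segint g p q J ->
  segint (fun z => f z + g z) p q (I + J).
Proof.
move=> [Phi [hPhi ->]] [Psi [hPsi ->]]; exists (fun s => Phi s + Psi s); split; last by ring.
by move=> t t01; rewrite mulrDl; apply: rdiffD; [exact: hPhi|exact: hPsi].
Qed.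

Lemma segintZ c f p q I : segint f p q I -> segint (fun z => c * f z) p q (c * I).
Proof.
move=> [Phi [hPhi ->]]; exists (fun s => c * Phi s); split; last by ring.
by move=> t t01; rewrite -mulrA; apply: rdiffZ; exact: hPhi.
Qed.

Lemma segint_unique f p q I J : segint f p q I -> segint f p q J -> I = J.
Proof.
move=> hI hJ; apply/eqP; rewrite -subr_eq0; apply/eqP/normc_le0.
have := segintD hI (segintZ (-1) hJ); rewrite mulN1r => h.
rewrite -(mul0r (normc (q - p))); apply: segint_bound h _ => // t _.
by rewrite mulN1r subrr normc0.
Qed.

Lemma segint_primitive F f p q :
  (forall t : R, 0 <= t <= 1 -> cdiff F (p + t%:C * (q - p)) (f (p + t%:C * (q - p)))) ->
  segint f p q (F q - F p).
Proof.
move=> h; exists (fun t : R => F (p + t%:C * (q - p))); split; last first.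
  by rewrite mul0r addr0 mul1r [p + (q - p)]addrC subrK.
by move=> t t01; apply: cdiff_rdiff; exact: h.
Qed.

(** One antiderivative along the whole segment serves all subsegments, in both directions.
    Additivity and the change of sign under reversal are read off from it. *)
Lemma segint_sub f p q I :
  segint f p q I -> exists Phi, I = Phi 1 - Phi 0 /\
   forall al be : R, 0 <= al -> 0 <= be -> al <= 1 -> be <= 1 ->
  segint f (p + al%:C * (q - p)) (p + be%:C * (q - p)) (Phi be - Phi al).
Proof.
move=> [Phi [hPhi ->]]; exists Phi; split => // al be a0 b0 a1 b1.
exists (fun t => Phi (al + (be - al) * t)); split; last first.
  by rewrite mulr1 mulr0 addr0 [al + (be - al)]addrC subrK.
move=> t /andP[t0 t1].
have := @rdiff_affine al (be - al) Phi t (f (p + (al + (be - al) * t)%:C * (q - p)) * (q - p)).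
have -> : p + be%:C * (q - p) - (p + al%:C * (q - p)) = (be - al)%:C * (q - p).
  by rewrite rcB; ring.
have -> : p + al%:C * (q - p) + t%:C * ((be - al)%:C * (q - p)) =
          p + (al + (be - al) * t)%:C * (q - p) by rewrite [(al + _)%:C]rcD rcM; ring.
rewrite -mulrA [(q - p) * _]mulrC; apply; apply: hPhi.
have := mulr_ge0 t0 b0; have := mulr_ge0 t0 a0.
have u : 0 <= 1 - t by lra.
have := mulr_ge0 u b0; have := mulr_ge0 u a0.
have a1' : 0 <= 1 - al by lra.
have b1' : 0 <= 1 - be by lra.
have := mulr_ge0 t0 b1'; have := mulr_ge0 u a1'.
by move=> *; apply/andP; split; lra.
Qed.

End Integral.

(** * Goursat's lemma and Taylor expansions *)

Section Goursat.
Context {R : realType}.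
Implicit Types (f g : R[i] -> R[i]) (p q z w d I J a b c : R[i]).

Definition sint f p q : R[i] := xget 0 [set I | segint f p q I].
Definition tri f a b c := sint f a b + sint f b c + sint f c a.
Definition cconvex (S : set R[i]) := forall p q (t : R), S p -> S q -> 0 <= t <= 1 -> S (p + t%:C * (q - p)).
Definition cclosed (S : set R[i]) := forall u l, (forall n, S (u n)) -> clim u l -> S l.

Section OnConvex.
Variables (S : set R[i]) (f : R[i] -> R[i]).
Hypothesis (Sc : cconvex S) (fc : forall z, S z -> ccont f z).

Lemma sintP p q : S p -> S q -> segint f p q (sint f p q).
Proof.
move=> Sp Sq; have [I hI] : exists I, segint f p q I.
  by apply: segint_ex => t t01; apply: fc; exact: Sc.
by rewrite /sint; exact: (xgetI 0 hI).
Qed.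

Lemma sintE p q I : segint f p q I -> sint f p q = I.
Proof. by move=> hI; apply: (segint_unique (xgetI 0 hI : segint _ _ _ _) hI). Qed.

Lemma sint_split p q (t : R) : S p -> S q -> 0 <= t <= 1 ->
  sint f p q = sint f p (p + t%:C * (q - p)) + sint f (p + t%:C * (q - p)) q.
Proof.
move=> Sp Sq /andP[t0 t1]; have [Phi [-> h]] := segint_sub (sintP Sp Sq).
have := h 0 t (lexx _) t0 ler01 t1; rewrite mul0r addr0 => /sintE ->.
have := h t 1 t0 ler01 t1 (lexx _); rewrite mul1r [p + (q - p)]addrC subrK => /sintE ->.
by ring.
Qed.

Lemma sint_rev p q : S p -> S q -> sint f q p = - sint f p q.
Proof.
move=> Sp Sq; have [Phi [-> h]] := segint_sub (sintP Sp Sq).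
have := h 1 0 ler01 (lexx _) (lexx _) ler01.
by rewrite mul0r addr0 mul1r [p + (q - p)]addrC subrK opprB => /sintE ->.
Qed.

Lemma sint_bound p q (M : R) : 0 <= M -> S p -> S q -> (forall z, S z -> normc (f z) <= M) ->
  normc (sint f p q) <= M * normc (q - p).
Proof.
move=> M0 Sp Sq h; apply: (segint_bound M0 (sintP Sp Sq)) => t t01.
by apply: h; exact: Sc.
Qed.

Definition mid a b : R[i] := a + (2^-1 : R)%:C * (b - a).

Lemma S_mid a b : S a -> S b -> S (mid a b).
Proof. by move=> Sa Sb; apply: Sc => //; apply/andP; split; lra. Qed.

Lemma sint_mid p q : S p -> S q -> sint f p q = sint f p (mid p q) + sint f (mid p q) q.
Proof. by move=> Sp Sq; apply: sint_split => //; apply/andP; split; lra. Qed.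

Lemma tri_split4 a b c : S a -> S b -> S c ->
  tri f a b c = tri f a (mid a b) (mid c a) + tri f (mid a b) b (mid b c) +
    tri f (mid c a) (mid b c) c + tri f (mid b c) (mid c a) (mid a b).
Proof.
move=> Sa Sb Sc'; have Sab := S_mid Sa Sb; have Sbc := S_mid Sb Sc'; have Sca := S_mid Sc' Sa.
rewrite /tri (sint_mid Sa Sb) (sint_mid Sb Sc') (sint_mid Sc' Sa).
rewrite (sint_rev Sab Sca) (sint_rev Sab Sbc) (sint_rev Sbc Sca).
by ring.
Qed.

End OnConvex.

(** One bisection step: keeps one of the four triangles of half the size whose integral is at least
    a quarter of the given one. The middle triangle is the default, since it must qualify when the
    other three do not. *)
Definition trisub f (t : R[i] * R[i] * R[i]) : R[i] * R[i] * R[i] :=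
  let: (a, b, c) := t in let T := normc (tri f a b c) in
  if T <= 4 * normc (tri f a (mid a b) (mid c a)) then (a, mid a b, mid c a) else
  if T <= 4 * normc (tri f (mid a b) b (mid b c)) then (mid a b, b, mid b c) else
  if T <= 4 * normc (tri f (mid c a) (mid b c) c) then (mid c a, mid b c, c) else
  (mid b c, mid c a, mid a b).

Definition ntri f (t : R[i] * R[i] * R[i]) := normc (tri f t.1.1 t.1.2 t.2).
Definition perim (t : R[i] * R[i] * R[i]) : R :=
  normc (t.1.1 - t.1.2) + normc (t.1.2 - t.2) + normc (t.2 - t.1.1).
Definition Stri (S : set R[i]) (t : R[i] * R[i] * R[i]) := [/\ S t.1.1, S t.1.2 & S t.2].

Lemma half_normc z w u v : z - w = (2^-1 : R)%:C * (u - v) -> normc (z - w) = normc (u - v) / 2.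
Proof. by move=> ->; rewrite normcM normc_real ger0_norm ?invr_ge0 // mulrC. Qed.

Lemma half2 : (2^-1 : R)%:C = (2 : R[i])^-1.
Proof. by rewrite rcV (_ : (2 : R)%:C = 2) // (rmorph_nat (real_complex R)). Qed.

Lemma trisub_perim f t : perim (trisub f t) = perim t / 2.
Proof.
case: t => [[a b] c]; rewrite /trisub.
have h1 x y : normc (x - mid x y) = normc (x - y) / 2.
  by apply: half_normc; rewrite /mid half2; field.
have h2 x y : normc (mid x y - y) = normc (x - y) / 2.
  by apply: half_normc; rewrite /mid half2; field.
have h3 x y v : normc (mid x y - mid v x) = normc (y - v) / 2.
  by apply: half_normc; rewrite /mid half2; field.
have h4 x y v : normc (mid x y - mid y v) = normc (v - x) / 2.
  by rewrite (normcC v); apply: half_normc; rewrite /mid half2; field.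
do 3?case: ifP => _; rewrite /perim /= ?h1 ?h2 ?h3 ?h4; first by field.
- by field.
- by field.
- by field.
Qed.

Lemma trisub_move f t : normc ((trisub f t).1.1 - t.1.1) <= perim t.
Proof.
case: t => [[a b] c]; rewrite /trisub; do 3?case: ifP => _; rewrite /perim /=;
have := normc_ge0 (a - b); have := normc_ge0 (b - c); have := normc_ge0 (c - a).
- by rewrite subrr normc0; lra.
- by rewrite (@half_normc (mid a b) a b a) ?(normcC b a); [lra|rewrite /mid half2; field].
- by rewrite (@half_normc (mid c a) a c a); [lra|rewrite /mid half2; field].
- have : normc (mid b c - a) <= normc (a - b) + normc (b - c).
    rewrite (_ : mid b c - a = (b - a) + (2^-1 : R)%:C * (c - b)); last by rewrite /mid; ring.
    apply: le_trans (normcD _ _) _; rewrite normcM normc_real ger0_norm ?invr_ge0 //.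
    by rewrite (normcC b a) (normcC c b); have := normc_ge0 (b - c); lra.
  lra.
Qed.

Lemma trisub_spec S f t : cconvex S -> (forall z, S z -> ccont f z) -> Stri S t ->
  Stri S (trisub f t) /\ ntri f t <= 4 * ntri f (trisub f t).
Proof.
case: t => [[a b] c] Sc fc [/= Sa Sb Sc'].
have Sab := S_mid Sc Sa Sb; have Sbc := S_mid Sc Sb Sc'; have Sca := S_mid Sc Sc' Sa.
rewrite /trisub; case: ifP => [h|/negbT]; first by split.
rewrite -ltNge => h1; case: ifP => [h|/negbT]; first by split.
rewrite -ltNge => h2; case: ifP => [h|/negbT]; first by split.
rewrite -ltNge => h3; split=> //; rewrite /ntri /=.
have := tri_split4 Sc fc Sa Sb Sc' => E.
have := normcD (tri f a (mid a b) (mid c a) + tri f (mid a b) b (mid b c) +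
    tri f (mid c a) (mid b c) c) (tri f (mid b c) (mid c a) (mid a b)).
have := normcD (tri f a (mid a b) (mid c a) + tri f (mid a b) b (mid b c))
    (tri f (mid c a) (mid b c) c).
have := normcD (tri f a (mid a b) (mid c a)) (tri f (mid a b) b (mid b c)).
rewrite -E; clear -h1 h2 h3; lra.
Qed.

Lemma sint_affine A B p q : sint (fun z => A + B * z) p q =
  (A * q + B * (q * q) * 2^-1) - (A * p + B * (p * p) * 2^-1).
Proof.
apply: sintE; apply: (@segint_primitive _ (fun z => A * z + B * (z * z) * 2^-1)) => t _.
set z := p + _.
have h := cdiffD (cdiffZ A (cdiff_id z)) (cdiffZ (2^-1 * B) (cdiffM (cdiff_id z) (cdiff_id z))).
have -> : A + B * z = A * 1 + 2^-1 * B * (1 * id z + id z * 1) by rewrite /=; field.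
by apply: cdiff_local h; [exact: ltr01|move=> w _ /=; ring].
Qed.

(** The bisected triangles shrink to a point [l] of [S]. There f differs from an affine function by
    o(perimeter), and affine functions have primitives, so the integral over the n-th triangle is
    o(4^-n), while it is at least 4^-n times the original one. *)
Lemma goursat S f a b c : cconvex S -> cclosed S ->
  (forall z, S z -> exists d, cdiff f z d) -> S a -> S b -> S c -> tri f a b c = 0.
Proof.
move=> Sc Scl fd Sa Sb Sc'.
have fc z : S z -> ccont f z by move=> /fd[d /cdiff_ccont].
pose u n := iter n (trisub f) (a, b, c).
have Su n : Stri S (u n).
  by elim: n => [|n IH]; [split|rewrite /u iterS; apply: (trisub_spec Sc fc IH).1].
have pu n : perim (u n) = perim (a, b, c) / 2 ^+ n.
  elim: n => [|n IH]; first by rewrite expr0 divr1.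
  rewrite /u iterS trisub_perim -/(u n) IH exprS; field.
  by rewrite expf_neq0.
have nu n : ntri f (a, b, c) <= 4 ^+ n * ntri f (u n).
  elim: n => [|n IH]; first by rewrite expr0 mul1r.
  apply: le_trans IH _; rewrite exprSr -mulrA ler_wpM2l ?exprn_ge0 //.
  by rewrite /u iterS; apply: (trisub_spec Sc fc (Su n)).2.
have p0 n : 0 <= perim (u n) by rewrite /perim !addr_ge0 // normc_ge0.
have mv n m : normc ((u (n + m)%N).1.1 - (u n).1.1) <= 2 * perim (u n) - 2 * perim (u (n + m)%N).
  elim: m => [|m IH]; first by rewrite addn0 !subrr normc0.
  rewrite addnS; have := normc_tri (u (n + m)%N).1.1 (u (n + m).+1).1.1 (u n).1.1.
  have := trisub_move f (u (n + m)%N); have := trisub_perim f (u (n + m)%N).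
  rewrite -[trisub f (u _)]/(u (n + m).+1); lra.
have mv' n m : (n <= m)%N -> normc ((u m).1.1 - (u n).1.1) <= 2 * perim (u n).
  by move=> /subnKC <-; have := mv n (m - n)%N; have := p0 (n + (m - n))%N; lra.
set P := perim (a, b, c); have P0 : 0 <= P by exact: (p0 0%N).
have small e : 0 < e -> exists n, 2 * perim (u n) <= e.
  move=> e0; exists (Num.truncn (2 * P / e)).+1.
  rewrite pu -/P mulrA ler_pdivrMr ?exprn_gt0 //.
  have := Num.Theory.truncnS_gt (2 * P / e); set k := (Num.truncn _).+1 => h.
  have : (k%:R : R) <= 2 ^+ k by rewrite -natrX ler_nat ltnW // ltn_expl.
  move=> /(lt_le_trans h).
  by rewrite ltr_pdivrMr // => /ltW; rewrite [2 ^+ _ * e]mulrC.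
have [e e0|l hl] := @cauchy_clim R (fun n => (u n).1.1).
  by have [n hn] := small e e0; exists n => m /mv'; lra.
have Sl : S l by apply: Scl hl => n; case: (Su n).
have [d fl] := fd l Sl.
suff : ntri f (a, b, c) <= 0 by rewrite /ntri /= => /normc_le0.
apply/ler_addgt0Pr => e e0; rewrite add0r.
(* The final bound is 4^n times 3 e1 (P / 2^n)^2, that is 3 e1 P^2; the added 1 covers a degenerate
   triangle. *)
pose e1 := e / (3 * (P * P + 1)).
have PP : 0 <= P * P by rewrite mulr_ge0.
have e10 : 0 < e1 by rewrite divr_gt0 //; lra.
have [dl dl0 h] := fl e1 e10.
have [|n hn] := small (dl / 3); first by lra.
apply: le_trans (nu n) _.
have ul : normc (l - (u n).1.1) <= 2 * perim (u n).
  by apply: clim_le hl _; exists n => m; exact: mv'.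
(* The first vertex is within two perimeters of [l], so three perimeters contain the triangle. *)
pose B := [set z | normc (z - l) <= 3 * perim (u n)].
have Bc : cconvex (S `&` B).
  move=> p q t [Sp Bp] [Sq Bq] t01; split; first exact: Sc.
  have /andP[t0 t1] := t01.
  rewrite /B /= (_ : _ - l = (1 - t)%:C * (p - l) + t%:C * (q - l)); last by rewrite rcB; ring.
  apply: le_trans (normcD _ _) _; rewrite !normcM !normc_real !ger0_norm //; last by clear -t01; lra.
  have t1' : 0 <= 1 - t by clear -t01; lra.
  have := ler_wpM2l t0 Bq; have := ler_wpM2l t1' Bp; clear; lra.
set A := f l - d * l.
have dc z : S z -> ccont (fun z => f z - (A + d * z)) z.
  move=> Sz; have [d' fz] := fd z Sz; apply: cdiff_ccont (cdiffB fz (cdiffD (cdiff_cst A z) (cdiffZ d (cdiff_id z)))).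
have fbound z : (S `&` B) z -> normc (f z - (A + d * z)) <= e1 * (3 * perim (u n)).
  move=> [Sz Bz]; rewrite (_ : _ - _ = f z - f l - d * (z - l)); last by rewrite /A; ring.
  apply: le_trans (h z _) _; last by rewrite ler_wpM2l // ltW.
  by apply: le_lt_trans Bz _; have := p0 n; lra.
have key p q : (S `&` B) p -> (S `&` B) q ->
  normc (sint f p q - sint (fun z => A + d * z) p q) <= e1 * (3 * perim (u n)) * normc (q - p).
  move=> hp hq; rewrite -[sint f p q - _](_ : sint (fun z => f z - (A + d * z)) p q = _).
    apply: (sint_bound Bc) => //; last by rewrite mulr_ge0 ?(ltW e10) // mulr_ge0.
    by move=> z [/dc].
  apply: sintE; rewrite -mulN1r.
  have h1 : segint f p q (sint f p q) by apply: (sintP Sc fc); [case: hp|case: hq].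
  have h2 : segint (fun z => A + d * z) p q (sint (fun z => A + d * z) p q).
    apply: (@sintP setT); [by []| |by []|by []].
    by move=> z _; apply: cdiff_ccont (cdiffD (cdiff_cst A z) (cdiffZ d (cdiff_id z))).
  have := segintD h1 (segintZ (-1) h2); congr (segint _ _ _ _).
  by apply/funext => z; rewrite mulN1r.
have Bu : [/\ (S `&` B) (u n).1.1, (S `&` B) (u n).1.2 & (S `&` B) (u n).2].
  have [S1 S2 S3] := Su n; move: ul; rewrite /B /perim.
  have := normc_tri (u n).1.1 (u n).1.2 l; have := normc_tri (u n).1.1 (u n).2 l.
  have := normc_ge0 ((u n).1.1 - (u n).1.2).
  have := normc_ge0 ((u n).1.2 - (u n).2).
  have := normc_ge0 ((u n).2 - (u n).1.1).
  rewrite (normcC (u n).1.2 (u n).1.1) (normcC l).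
  by move=> *; split; split => //=; lra.
have [B1 B2 B3] := Bu.
have h1 := key _ _ B1 B2; have h2 := key _ _ B2 B3; have h3 := key _ _ B3 B1.
have T0 : tri (fun z => A + d * z) (u n).1.1 (u n).1.2 (u n).2 = 0.
  by rewrite /tri !sint_affine; ring.
have : ntri f (u n) <= e1 * (3 * perim (u n)) * perim (u n).
  rewrite /ntri -[tri _ _ _ _]subr0 -T0.
  rewrite (_ : _ - _ = (sint f (u n).1.1 (u n).1.2 - sint (fun z => A + d * z) (u n).1.1 (u n).1.2)
    + (sint f (u n).1.2 (u n).2 - sint (fun z => A + d * z) (u n).1.2 (u n).2)
    + (sint f (u n).2 (u n).1.1 - sint (fun z => A + d * z) (u n).2 (u n).1.1)); last by rewrite /tri; ring.
  apply: le_trans (normcD _ _) _; apply: le_trans (lerD (normcD _ _) (lexx _)) _.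
  rewrite {2}/perim (normcC (u n).1.1) (normcC (u n).1.2 (u n).2) (normcC (u n).2 (u n).1.1).
  by move: h1 h2 h3; clear; lra.
rewrite pu -/P => h4; apply: le_trans (ler_wpM2l (exprn_ge0 n _) h4) _ => //.
have -> : 4 ^+ n * (e1 * (3 * (P / 2 ^+ n)) * (P / 2 ^+ n)) = e * (P * P / (P * P + 1)).
  have -> : (4 : R) ^+ n = 2 ^+ n * 2 ^+ n by rewrite -exprMn; congr (_ ^+ _); ring.
  by rewrite /e1; field; rewrite expf_neq0 //= gt_eqF //; clear -PP; lra.
by rewrite ler_piMr ?(ltW e0) // ler_pdivrMr; clear -PP; lra.
Qed.

End Goursat.

Section Taylor.
Context {R : realType}.
Implicit Types (f g : R[i] -> R[i]) (p q z w d I J a b c : R[i]) (phi psi : R -> R[i]).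

Lemma rdiff_rcont phi t d : rdiff phi t d -> rcont phi t.
Proof.
move=> fd e e0; have [dl dl0 h] := fd 1 ltr01.
have nd := normc_ge0 d.
exists (Num.min dl (e / (normc d + 1))); first by rewrite lt_min dl0 divr_gt0 //; lra.
move=> s; rewrite lt_min => /andP[/h {}h].
rewrite ltr_pdivlMr; last by lra.
have := normcD (phi s - phi t - d * (s - t)%:C) (d * (s - t)%:C); rewrite subrK normcM normc_real.
lra.
Qed.

Lemma ccont_rcont f phi t : ccont f (phi t) -> rcont phi t -> rcont (fun s => f (phi s)) t.
Proof.
move=> fc pc e e0; have [dl dl0 h] := fc e e0.
have [|dl' dl0' h'] := pc (dl / 2); first by lra.
by exists dl' => // s /h' ?; apply: h; lra.
Qed.

Lemma cdiff_rdiff_comp f phi t d d' : cdiff f (phi t) d -> rdiff phi t d' ->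
  rdiff (fun s => f (phi s)) t (d * d').
Proof.
move=> fd pd e e0; have nd := normc_ge0 d; have nd' := normc_ge0 d'.
have e10 : 0 < e / 2 / (normc d' + 1) by rewrite !divr_gt0 //; lra.
have [dl1 dl10 h1] := fd _ e10.
have [dl2 dl20 h2] := rdiff_rcont pd (divr_gt0 dl10 (ltr0Sn _ 1)).
pose e3 := Num.min 1 (e / 2 / (normc d + 1)).
have e30 : 0 < e3 by rewrite lt_min ltr01 !divr_gt0 //; lra.
have [dl3 dl30 h3] := pd e3 e30.
exists (Num.min dl2 dl3); first by rewrite lt_min dl20.
move=> s; rewrite lt_min => /andP[/h2 {}h2 /h3 {}h3].
have ns := normr_ge0 (s - t).
have /h1 {}h1 : normc (phi s - phi t) < dl1 by clear -dl10 h2; lra.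
have e31 : e3 <= 1 by rewrite ge_min lexx.
have e32 : e3 * (normc d + 1) <= e / 2.
  by rewrite -ler_pdivlMr ?ge_min ?lexx ?orbT //; clear -nd; lra.
have h4 : normc (phi s - phi t) <= (normc d' + 1) * `|s - t|.
  have := normcD (phi s - phi t - d' * (s - t)%:C) (d' * (s - t)%:C).
  rewrite subrK normcM normc_real; have := ler_wpM2r ns e31; clear -h3; lra.
rewrite (_ : _ - _ - _ = (f (phi s) - f (phi t) - d * (phi s - phi t)) + d * (phi s - phi t - d' * (s - t)%:C)); last by ring.
apply: le_trans (normcD _ _) _; rewrite normcM.
have A : normc (f (phi s) - f (phi t) - d * (phi s - phi t)) <= e / 2 * `|s - t|.
  apply: le_trans h1 _; apply: le_trans (ler_wpM2l (ltW e10) h4) _.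
  by rewrite mulrA mulfVK //; clear -nd'; lra.
have B : normc d * normc (phi s - phi t - d' * (s - t)%:C) <= e / 2 * `|s - t|.
  apply: le_trans (ler_wpM2l nd h3) _; rewrite mulrA ler_wpM2r // mulrC.
  by apply: le_trans e32; rewrite ler_wpM2l //; clear -e30; lra.
(clear -A B; lra).
Qed.

Lemma cdiffX f z d n : cdiff f z d -> cdiff (fun w => f w ^+ n) z (n%:R * f z ^+ n.-1 * d).
Proof.
move=> fd; elim: n => [|n IH].
  by rewrite mul0r mul0r; apply: cdiff_local (cdiff_cst 1 z); [exact: ltr01|move=> w _; rewrite expr0].
have := cdiffM IH fd; rewrite /=; have -> : n%:R * f z ^+ n.-1 * d * f z + f z ^+ n * d = n.+1%:R * f z ^+ n * d.
  by case: n {IH} => [|n] /=; rewrite ?expr0 ?exprS -?natr1 //; ring.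
by apply: cdiff_local; [exact: ltr01|move=> w _; rewrite exprSr].
Qed.

Definition cis (t : R) : R[i] := cos (2 * pi * t) +i* sin (2 * pi * t).

Lemma cis_norm t : normc (cis t) = 1.
Proof. by rewrite /cis /= cos2Dsin2 sqrtr1. Qed.

Lemma cis0 : cis 0 = 1.
Proof. by rewrite /cis mulr0 cos0 sin0. Qed.

Lemma cis1 : cis 1 = 1.
Proof. by rewrite /cis mulr1 mulr_natl -[pi *+ 2]add0r cosD2pi sinD2pi cos0 sin0. Qed.

Lemma real_deriv (F : R -> R) (t l : R) : is_derive t (1 : R) F l -> forall e : R, 0 < e -> exists2 dl : R, 0 < dl &
  forall s, `|s - t| < dl -> `|F s - F t - l * (s - t)| <= e * `|s - t|.
Proof.
move=> [Fd Fl] e e0; move: Fd; rewrite /derivable => /cvg_ex[l' /= hl].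
have lE : l = l' by rewrite -Fl /derive; apply: cvg_lim hl.
move/cvgrPdist_le : hl => /(_ e e0) /nbhs_ballP[dl /= dl0 h].
exists dl => // s st; have [->|s0] := eqVneq s t.
  by rewrite !subrr mulr0 subrr normr0 mulr0.
have s1 : s - t != 0 by rewrite subr_eq0.
have := h (s - t); rewrite /ball /= sub0r normrN => /(_ st s1).
rewrite [(s - t)%:A]mulr1 subrK -lE => h'.
rewrite (_ : F s - F t - _ = - ((l - (s - t)^-1 * (F s - F t)) * (s - t))); last by field.
by rewrite normrN normrM ler_wpM2r.
Qed.

Lemma cis_rdiff t : rdiff cis t ('i * (2 * pi)%:C * cis t).
Proof.
have h : rdiff (fun s => cos s +i* sin s) (0 + 2 * pi * t) ('i * (cos (2 * pi * t) +i* sin (2 * pi * t))).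
  rewrite add0r; set x := 2 * pi * t => e e0.
  have e20 : 0 < e / 2 by lra.
  have [dl dl0 h] := real_deriv (is_derive_cos x) e20.
  have [dl' dl0' h'] := real_deriv (is_derive_sin x) e20.
  exists (Num.min dl dl'); first by rewrite lt_min dl0.
  move=> s; rewrite lt_min => /andP[/h {}h /h' {}h'].
  apply: le_trans (normc_ReIm _) _; rewrite /=.
  rewrite !(mul0r, mul1r, mulr0, add0r, sub0r, subr0, addr0); lra.
have := @rdiff_affine _ 0 (2 * pi) _ t _ h.
move=> {}h e e0; have [dl dl0 hd] := h e e0; exists dl => // s /hd.
by rewrite !add0r -/(cis s) -/(cis t) ['i * cis t * _]mulrAC.
Qed.

Definition rint psi I := exists Phi, (forall t, 0 <= t <= 1 -> rdiff Phi t (psi t)) /\ I = Phi 1 - Phi 0.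

Lemma rint_ex psi : (forall t, 0 <= t <= 1 -> rcont psi t) -> exists I, rint psi I.
Proof. by move=> /antiderivative[Phi hPhi]; exists (Phi 1 - Phi 0), Phi. Qed.

Lemma rint_bound psi I (M : R) : 0 <= M -> rint psi I ->
  (forall t, 0 <= t <= 1 -> normc (psi t) <= M) -> normc I <= M.
Proof.
by move=> M0 [Phi [hPhi ->]] h; apply: rdiff_bound => // t t01; exists (psi t); [exact: hPhi|exact: h].
Qed.

Lemma rintD phi psi I J : rint phi I -> rint psi J -> rint (fun t => phi t + psi t) (I + J).
Proof.
move=> [F [hF ->]] [G [hG ->]]; exists (fun t => F t + G t); split; last by ring.
by move=> t t01; apply: rdiffD; [exact: hF|exact: hG].
Qed.

Lemma rintZ c phi I : rint phi I -> rint (fun t => c * phi t) (c * I).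
Proof.
move=> [F [hF ->]]; exists (fun t => c * F t); split; last by ring.
by move=> t t01; apply: rdiffZ; exact: hF.
Qed.

Lemma rint_sum n (F : nat -> R -> R[i]) (G : nat -> R[i]) : (forall k, rint (F k) (G k)) ->
  rint (fun t => \sum_(k < n) F k t) (\sum_(k < n) G k).
Proof.
move=> h; elim: n => [|n IH].
  exists (fun=> 0); split; last by rewrite big_ord0 subrr.
  by move=> t _ e e0; exists 1 => // s _; rewrite big_ord0 mul0r !subrr normc0 mulr_ge0 // ltW.
rewrite big_ord_recr /=; have [F0 [h0 E0]] := rintD IH (h n).
by exists F0; split=> // t /h0; rewrite big_ord_recr.
Qed.

Lemma rcont_bounded psi : (forall t, 0 <= t <= 1 -> rcont psi t) ->
  exists2 M, 0 <= M & forall t, 0 <= t <= 1 -> normc (psi t) <= M.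
Proof.
move=> pc; pose P (a b : R) := exists2 M, 0 <= M & forall t, a <= t <= b -> normc (psi t) <= M.
suff [M M0 h] : P 0 1 by exists M.
apply: cousin => [a b c _ _ [M M0 h] [M' M0' h']|t t01].
  exists (M + M'); first by lra.
  move=> s /andP[s1 s2]; have [sb|sb] := leP s b.
    by have := h s; rewrite s1 sb => /(_ isT); lra.
  by have := h' s; rewrite s2 ltW // => /(_ isT); lra.
have [dl dl0 h] := pc t t01 1 ltr01.
exists dl => // a b a0 ta tb b1 da db; exists (normc (psi t) + 1).
  by have := normc_ge0 (psi t); lra.
move=> s /andP[s1 s2]; have /h : `|s - t| < dl by rewrite ltr_norml; apply/andP; split; clear -da s1 db s2; lra.
by have := normc_ge_sub (psi s) (psi t); lra.
Qed.

Definition cball P (r : R) : set R[i] := [set z | normc (z - P) <= r].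

Lemma cball_convex P r : cconvex (cball P r).
Proof.
move=> p q t hp hq /andP[t0 t1]; rewrite /cball /=.
rewrite (_ : _ - P = (1 - t)%:C * (p - P) + t%:C * (q - P)); last by rewrite rcB; ring.
apply: le_trans (normcD _ _) _; rewrite !normcM !normc_real !ger0_norm //; last by lra.
have t1' : 0 <= 1 - t by lra.
have := ler_wpM2l t0 hq; have := ler_wpM2l t1' hp; lra.
Qed.

Lemma cball_closed P r : cclosed (cball P r).
Proof.
by move=> u l h ul; apply: (clim_le ul); exists 0%N => n _; exact: h.
Qed.

Lemma cReZ (t : R) z : complex.Re (t%:C * z) = t * complex.Re z.
Proof. by rewrite cReM /= mul0r subr0. Qed.
Lemma cImZ (t : R) z : complex.Im (t%:C * z) = t * complex.Im z.
Proof. by rewrite cImM /= mul0r addr0. Qed.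

Lemma cball_half_convex P r d w (k : R) :
  cconvex (cball P r `&` [set z | k <= complex.Re (d * (z - w))]).
Proof.
move=> p q t [hp hp'] [hq hq'] t01; split; first exact: cball_convex.
have /andP[t0 t1] := t01; rewrite /=.
rewrite (_ : d * _ = (1 - t)%:C * (d * (p - w)) + t%:C * (d * (q - w))); last by rewrite rcB; ring.
rewrite cReD !cReZ.
have t1' : 0 <= 1 - t by lra.
move: hp' hq'; rewrite /=.
by move=> /(ler_wpM2l t1') + /(ler_wpM2l t0); lra.
Qed.

Lemma cball_half_closed P r d w (k : R) :
  cclosed (cball P r `&` [set z | k <= complex.Re (d * (z - w))]).
Proof.
move=> u l h ul; split; first by apply: cball_closed ul => n; case: (h n).
rewrite /=; apply/ler_addgt0Pr => e e0.
have nd := normc_ge0 d.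
have [|n hn] := ul (e / (normc d + 1)); first by rewrite divr_gt0 //; lra.
have [_ /= h2] := h n; have := hn n (leqnn n).
rewrite ler_pdivlMr => [h3|]; last by lra.
rewrite (_ : d * (l - w) = d * (u n - w) - d * (u n - l)); last by ring.
rewrite cReD cReN; have := normc_Re (d * (u n - l)); rewrite normcM.
have := ler_norm (complex.Re (d * (u n - l))).
have := normc_ge0 (u n - l); lra.
Qed.

Lemma sintpp f p : sint f p p = 0.
Proof.
apply: sintE; exists (fun=> 0); split; last by rewrite subrr.
by move=> t _ e' e0'; exists 1 => // s _; rewrite !subrr !mulr0 mul0r subrr normc0 mulr_ge0 // ltW.
Qed.

Section Kernel.
Variables (r : R) (w : R[i]) (phi : R[i] -> R[i]).
Hypotheses (wr : normc w <= r) (phic : forall z, normc z <= r -> ccont phi z)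
  (phid : forall z, normc z <= r -> z != w -> exists d, cdiff phi z d).

Let S := cball 0 r.
Let SE z : S z <-> normc z <= r. Proof. by rewrite /S /cball /= subr0. Qed.
Let Sw : S w. Proof. exact/SE. Qed.
Let Sc : cconvex S. Proof. exact: cball_convex. Qed.
Let Scc z : S z -> ccont phi z. Proof. by move/SE; exact: phic. Qed.

(* The singular point [w] is a vertex of the triangle: cut off a small triangle
   at [w]; the rest lies in a half-plane missing [w]. *)
Lemma tri_vertex z z' : S z -> S z' -> normc (z' - z) <= normc (z - w) / 2 -> tri phi w z z' = 0.
Proof.
move=> Sz Sz' zz'.
have [zw|zw] := eqVneq z w.
  have /normc_le0 : normc (z' - z) <= 0 by rewrite (le_trans zz') // zw subrr normc0 mul0r.
  move=> /eqP; rewrite subr_eq0 => /eqP ->; rewrite zw /tri.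
  by rewrite sintpp; ring.
have nzw : 0 < normc (z - w) by rewrite normc_gt0 subr_eq0.
apply: normc_le0; apply/ler_addgt0Pr => e e0; rewrite add0r.
have [dl dl0 hdl] := phic wr ltr01.
pose M := normc (phi w) + 1.
have M0 : 0 < M by rewrite /M; have := normc_ge0 (phi w); lra.
pose L := normc (z - w) + normc (z' - w) + normc (z' - z).
have L0 : 0 < L by rewrite /L; have := normc_ge0 (z' - w); have := normc_ge0 (z' - z); lra.
pose t := Num.min 1 (Num.min (dl / (2 * L)) (e / (M * L))).
have t0 : 0 < t by rewrite !lt_min ltr01 !divr_gt0 // mulr_gt0.
have t1 : t <= 1 by rewrite ge_min lexx.
have tL : t * L <= dl / 2.
  by rewrite -ler_pdivlMr // -mulrA -invfM [2 * L]mulrC mulrC !(ge_min, lexx, orbT) // mulrC [L * 2]mulrC !(ge_min, lexx, orbT).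
have tML : M * (t * L) <= e.
  by rewrite mulrCA -ler_pdivlMr ?mulr_gt0 // !(ge_min, lexx, orbT).
have t01 : 0 <= t <= 1 by rewrite (ltW t0) t1.
set u := w + t%:C * (z - w); set u' := w + t%:C * (z' - w).
have Su : S u by exact: Sc.
have Su' : S u' by exact: Sc.
have E1 := sint_split Sc Scc Sw Sz t01; have E2 := sint_split Sc Scc Sw Sz' t01.
rewrite -/u -/u' in E1 E2.
(* The real part of [d * (x - w)] measures the progress of [x] from [w] in the direction of [z]. The
   hypothesis that [z'] is close to [z] leaves [z'] at least half of the progress of [z], and
   scaling by t shows that all of u, u', z, z' have progress at least k. *)
pose d := (z - w)^*; pose k := t * normc (z - w) ^+ 2 / 2.
have k0 : 0 < k by rewrite /k divr_gt0 // mulr_gt0 // exprn_gt0.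
pose S' := cball 0 r `&` [set x | k <= complex.Re (d * (x - w))].
have S'd x : S' x -> exists d, cdiff phi x d.
  move=> [/SE Sx /= hx]; apply: phid => //; apply/eqP => xw.
  by move: hx; rewrite xw subrr mulr0 /=; clear -k0; lra.
have dz : complex.Re (d * (z - w)) = normc (z - w) ^+ 2.
  rewrite normc_sqr /d; case: (z - w) => x y /=; ring.
have dz' : normc (z - w) ^+ 2 / 2 <= complex.Re (d * (z' - w)).
  rewrite (_ : d * (z' - w) = d * (z - w) + d * (z' - z)); last by ring.
  rewrite cReD dz; have := normc_Re (d * (z' - z)); rewrite ler_norml => /andP[+ _].
  have -> : normc (d * (z' - z)) = normc (z - w) * normc (z' - z).
    by rewrite normcM /d; congr (_ * _); case: (z - w) => x y /=; rewrite sqrrN.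
  have := ler_wpM2l (ltW nzw) zz'; rewrite expr2; clear -r w phi S SE Sw Sc Scc; lra.
have nn : 0 <= normc (z - w) ^+ 2 by rewrite exprn_ge0 // ltW.
have tn : t * (normc (z - w) ^+ 2) <= normc (z - w) ^+ 2 by rewrite ler_piMl.
have S'z : S' z by split => //=; rewrite dz /k; clear -nn tn; lra.
have S'z' : S' z' by split => //=; rewrite /k; clear -dz' tn; lra.
have hu x : complex.Re (d * (w + t%:C * (x - w) - w)) = t * complex.Re (d * (x - w)).
  by rewrite [w + _]addrC addrK mulrCA cReZ.
have S'u : S' u by split => //=; rewrite hu dz /k; have := mulr_ge0 (ltW t0) nn; clear -r w phi S SE Sw Sc Scc; lra.
have S'u' : S' u'.
  by split => //=; rewrite hu /k; have := ler_wpM2l (ltW t0) dz'; clear; lra.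
have G1 := goursat (@cball_half_convex 0 r d w k) (@cball_half_closed 0 r d w k) S'd S'u S'z S'z'.
have G2 := goursat (@cball_half_convex 0 r d w k) (@cball_half_closed 0 r d w k) S'd S'u S'z' S'u'.
have Tsum : tri phi w z z' = tri phi w u u' + tri phi u z z' + tri phi u z' u'.
  rewrite /tri E1 (sint_rev Sc Scc Sw Sz') E2 (sint_rev Sc Scc Sw Su').
  rewrite (sint_rev Sc Scc Su Su') (sint_rev Sc Scc Su' Sz') (sint_rev Sc Scc Su Sz').
  by ring.
rewrite Tsum G1 G2 !addr0 /tri.
pose S2 := S `&` cball w (dl / 2).
have S2c : cconvex S2.
  by move=> p q s [? ?] [? ?] s01; split; [exact: Sc|exact: cball_convex].
have S2cc x : S2 x -> ccont phi x by case=> /Scc.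
have S2M x : S2 x -> normc (phi x) <= M.
  move=> [_ xw]; have /hdl : normc (x - w) < dl by apply: le_lt_trans xw _; clear -dl0 r w phi S SE Sw Sc Scc; lra.
  by have := normc_ge_sub (phi x) (phi w); rewrite /M; lra.
have nu x : normc (w + t%:C * (x - w) - w) = t * normc (x - w).
  by rewrite [w + _]addrC addrK normcM normc_real gtr0_norm.
have L1 : normc (z - w) <= L by rewrite /L; have := normc_ge0 (z' - w); have := normc_ge0 (z' - z); clear -r w phi S SE Sw Sc Scc; lra.
have L2 : normc (z' - w) <= L by rewrite /L; have := normc_ge0 (z' - z); clear -zz' r w phi S SE Sw Sc Scc; lra.
have S2w : S2 w by split => //; rewrite /cball /= subrr normc0; clear -dl0 r w phi S SE Sw Sc Scc; lra.
have S2u : S2 u by split => //; rewrite /cball /= nu; have := ler_wpM2l (ltW t0) L1; clear -tL; lra.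
have S2u' : S2 u' by split => //; rewrite /cball /= nu; have := ler_wpM2l (ltW t0) L2; clear -tL; lra.
have b1 := sint_bound S2c S2cc (ltW M0) S2w S2u S2M.
have b2 := sint_bound S2c S2cc (ltW M0) S2u S2u' S2M.
have b3 := sint_bound S2c S2cc (ltW M0) S2u' S2w S2M.
have uu' : normc (u' - u) = t * normc (z' - z).
  rewrite (_ : u' - u = t%:C * (z' - z)); last by rewrite /u /u'; ring.
  by rewrite normcM normc_real gtr0_norm.
rewrite (normcC w u') nu in b3; rewrite nu in b1; rewrite uu' in b2.
apply: le_trans (normcD _ _) _; apply: le_trans (lerD (normcD _ _) (lexx _)) _.
by apply: le_trans tML; rewrite /L; move: b1 b2 b3; clear; lra.
Qed.

(** Integrating from the exceptional point [w] itself means that only triangles with vertex [w] have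
    to be closed, which is [tri_vertex]; at [z = w] no triangle is involved. *)
Lemma kernel_primitive z : normc z < r -> cdiff (fun z => sint phi w z) z (phi z).
Proof.
move=> zr e e0; have [dl dl0 h] := phic (ltW zr) e0.
have Sz : S z by apply/SE/ltW.
pose d1 := Num.min dl (r - normc z).
have d10 : 0 < d1 by rewrite lt_min dl0; lra.
have [rho rho0 [rd rT]] : exists2 rho, 0 < rho & rho <= d1 /\
   forall z', S z' -> normc (z' - z) < rho -> sint phi w z' - sint phi w z = sint phi z z'.
  have [->|zw] := eqVneq z w.
    exists d1 => //; split => // z' Sz' _.
    by rewrite sintpp subr0.
  have nzw : 0 < normc (z - w) by rewrite normc_gt0 subr_eq0.
  exists (Num.min d1 (normc (z - w) / 2)); first by rewrite lt_min d10; lra.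
  split; first by rewrite ge_min lexx.
  move=> z' Sz'; rewrite lt_min => /andP[_ /ltW h2].
  have := tri_vertex Sz Sz' h2; rewrite /tri (sint_rev Sc Scc Sw Sz') => /eqP.
  by rewrite subr_eq0 => /eqP <-; ring.
exists rho => // z' z'z.
have : normc (z' - z) < d1 by lra.
rewrite lt_min => /andP[z1 z2].
have Sz' : S z' by apply/SE; have := normc_ge_sub z' z; lra.
rewrite rT //.
have -> : sint phi z z' - phi z * (z' - z) = sint (fun x => phi x - phi z) z z'.
  apply/esym/sintE; have h1 := sintP Sc Scc Sz Sz'.
  have h2 : segint (fun=> - phi z) z z' (- phi z * z' - - phi z * z).
    by apply: segint_primitive => t _; have := cdiffZ (- phi z) (cdiff_id (z + t%:C * (z' - z))); rewrite mulr1.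
  have := segintD h1 h2; congr (segint _ _ _ _); ring.
apply: (segint_bound (ltW e0)).
  apply: (@sintP R (cball z (normc (z' - z)) `&` S)).
  - by move=> p q s [? ?] [? ?] s01; split; [exact: cball_convex|exact: Sc].
  - move=> x [_ Sx] e' e0'; have [dl' dl0' h'] := Scc Sx e0'; exists dl' => // y /h'.
    by rewrite (_ : phi y - phi x = phi y - phi z - (phi x - phi z)) //; ring.
  - by split => //; rewrite /cball /= subrr normc0 normc_ge0.
  - by split => //; rewrite /cball /=.
move=> t /andP[t0 t1]; apply: h.
rewrite [z + _]addrC addrK normcM normc_real ger0_norm //.
by apply: le_lt_trans z1; rewrite ler_piMl // normc_ge0.
Qed.

End Kernel.
End Taylor.

Section PowerSeries.
Context {R : realType}.
Implicit Types (f g : R[i] -> R[i]) (p q z w d I J a b : R[i]) (phi psi : R -> R[i]) (c : nat -> R[i]).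

Lemma rdiff_eqd phi t d d' : d = d' -> rdiff phi t d -> rdiff phi t d'.
Proof. by move=> ->. Qed.

Lemma cdiff_eqd f z d d' : d = d' -> cdiff f z d -> cdiff f z d'.
Proof. by move=> ->. Qed.

Lemma geom_small (q C e : R) : 0 <= q < 1 -> 0 < e -> exists n0, forall n, (n0 <= n)%N -> C * q ^+ n <= e.
Proof.
move=> /andP[q0 q1] e0; have : (GRing.exp q : nat -> R) @ \oo --> (0 : R).
  by apply: cvg_expr; rewrite ger0_norm.
have C0 := normr_ge0 C.
move=> /cvgrPdist_le /(_ (e / (`|C| + 1))) h.
have [|n0 _ hn] := h; first by rewrite divr_gt0 //; lra.
exists n0 => n /hn /=; rewrite sub0r normrN ger0_norm ?exprn_ge0 // ler_pdivlMr; last by lra.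
have := ler_wpM2r (exprn_ge0 n q0) (ler_norm C); have := exprn_ge0 n q0; lra.
Qed.

Lemma geom_remainder z w n : z != 0 -> z != w ->
  z / (z - w) - \sum_(k < n) w ^+ k * z^-1 ^+ k = (w / z) ^+ n * (z / (z - w)).
Proof.
move=> z0 zw; have zw0 : z - w != 0 by rewrite subr_eq0.
elim: n => [|n IH]; first by rewrite big_ord0 subr0 expr0 mul1r.
rewrite big_ord_recr /= opprD addrA IH exprS -exprMn; set q := (w / z) ^+ n.
by field; rewrite z0 zw0.
Qed.

(** For k > 0 a negative power of the circle parametrization is the derivative of a multiple of
    itself, which is periodic; hence its mean vanishes. *)
Lemma rint_circle (r : R) k : 0 < r ->
  rint (fun t => (r%:C * cis t)^-1 ^+ k) ((k == 0%N)%:R : R[i]).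
Proof.
move=> r0; have r1 : (r%:C : R[i]) != 0 by rewrite rc_eq0 gt_eqF.
have c0 t : (cis t : R[i]) != 0.
  by rewrite -normc_gt0 cis_norm.
have z0 t : r%:C * cis t != 0 by rewrite mulf_neq0.
have pi0 : (2 * pi)%:C != 0 :> R[i] by rewrite rc_eq0 mulf_neq0 // gt_eqF // pi_gt0.
have i0 : ('i : R[i]) != 0 by rewrite -normc_gt0 normc_i.
case: k => [|k].
  exists (fun t : R => t%:C); split; last by rewrite subr0.
  move=> t _ e e0; exists 1 => // s _; rewrite expr0 mul1r rcB subrr normc0.
  by rewrite mulr_ge0 // ltW.
exists (fun t => (- (k.+1%:R * ('i * (2 * pi)%:C))^-1) * (r%:C * cis t)^-1 ^+ k.+1).
split; last by rewrite cis0 cis1 subrr.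
move=> t _.
have h1 := rdiffZ r%:C (@cis_rdiff R t).
have h2 := cdiff_rdiff_comp (cdiffX k.+1 (cdiff_inv (z0 t))) h1.
apply: rdiff_eqd (rdiffZ (- (k.+1%:R * ('i * (2 * pi)%:C))^-1) h2).
have k0 : (k.+1%:R : R[i]) != 0 by rewrite pnatr_eq0.
set z := r%:C * cis t; rewrite [k.+1.-1]/= [in RHS]exprS.
have -> : r%:C * ('i * (2 * pi)%:C * cis t) = z * ('i * (2 * pi)%:C) by rewrite /z; ring.
have aux (m x v u y : R[i]) : m != 0 -> x != 0 -> v != 0 -> u != 0 ->
    - (m * (x * v))^-1 * (m * y * - (u ^+ 2)^-1 * (u * (x * v))) = u^-1 * y.
  by move=> m0 x0 v0 u0; field; rewrite u0 m0 x0 v0.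
exact: aux (z0 t).
Qed.

(** Cauchy's estimate for the coefficients is part of the notion, because all tails are bounded
    through it, uniformly on smaller discs. *)
Definition is_taylor f P (r : R) c (M : R) := [/\ 0 <= M, forall k, normc (c k) <= M / r ^+ k &
  forall w, normc w < r -> clim (fun n => \sum_(k < n) c k * w ^+ k) (f (P + w))].

(** Cauchy's formula in disguise: the difference quotient of g at [w] is continuous, and
    differentiable off [w], so it has a primitive and its integral over the circle vanishes. The
    coefficients are the means of g(Z) Z^-k, and a geometric series gives the expansion. *)
Lemma taylor f P (r0 r : R) : (forall z, normc (z - P) < r0 -> exists d, cdiff f z d) ->
  0 < r -> r < r0 -> exists c M, is_taylor f P r c M.
Proof.
move=> fd rp rr0; pose g z := f (P + z).
have gd z : normc z < r0 -> exists d, cdiff g z d.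
  move=> zr; have [|d hd] := fd (P + z); first by rewrite [P + z]addrC addrK.
  have := cdiff_comp (cdiffD (cdiff_cst P z) (cdiff_id z)) hd.
  by rewrite add0r mulr1; exists d.
pose Z t : R[i] := r%:C * cis t.
have nZ t : normc (Z t) = r by rewrite normcM normc_real cis_norm mulr1 gtr0_norm.
have Z0 t : Z t != 0 by rewrite -normc_gt0 nZ.
have Zc t : rcont Z t by exact: rdiff_rcont (rdiffZ _ (cis_rdiff t)).
have gZc t : rcont (fun t => g (Z t)) t.
  apply: ccont_rcont (Zc t); have [|d hd] := gd (Z t); first by rewrite nZ.
  exact: cdiff_ccont hd.
have [M M0 gM] := rcont_bounded (fun t _ => gZc t).
have cex k : exists I, rint (fun t => g (Z t) * (Z t)^-1 ^+ k) I.
  apply: rint_ex => t _.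
  have [|d hd] := gd (Z t); first by rewrite nZ.
  apply: (@ccont_rcont _ (fun z => g z * z^-1 ^+ k)) (Zc t).
  exact: cdiff_ccont (cdiffM hd (cdiffX k (cdiff_inv (Z0 t)))).
have [c hc] := choice cex.
exists c, M; split => // [k|w wr].
  apply: rint_bound (hc k) _ => [|t t01]; first by rewrite divr_ge0 // exprn_ge0 // ltW.
  by rewrite normcM normcX normcV nZ exprVn ler_wpM2r ?gM // invr_ge0 exprn_ge0 // ltW.
have [|g' hg'] := gd w; first by lra.
pose phi z := if z == w then g' else (g z - g w) / (z - w).
have phiE z : z != w -> phi z = (g z - g w) / (z - w) by rewrite /phi => /negbTE ->.
pose r1 := (r + r0) / 2.
have phid z : normc z <= r1 -> z != w -> exists d, cdiff phi z d.
  move=> zr zw; have [|d hd] := gd z; first by move: zr; rewrite /r1; lra.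
  have zw0 : z - w != 0 by rewrite subr_eq0.
  have h1 := cdiffB hd (cdiff_cst (g w) z).
  have h2 := cdiff_comp (cdiffB (cdiff_id z) (cdiff_cst w z)) (cdiff_inv zw0).
  have h := cdiffM h1 h2; eexists.
  have nz : 0 < normc (z - w) by rewrite normc_gt0.
  apply: (cdiff_local nz _ h) => x hx; rewrite phiE //.
  by apply/eqP => xw; move: hx; rewrite xw normcC ltxx.
have phic z : normc z <= r1 -> ccont phi z.
  move=> zr; have [->|zw] := eqVneq z w; last by have [d /cdiff_ccont] := phid z zr zw.
  move=> e e0; have [dl dl0 h] := hg' e e0; exists dl => // x xw.
  rewrite {2}/phi eqxx; have [->|xw0] := eqVneq x w; first by rewrite /phi eqxx subrr normc0 ltW.
  have xw1 : x - w != 0 by rewrite subr_eq0.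
  rewrite phiE // (_ : _ - _ = (g x - g w - g' * (x - w)) / (x - w)); last by field.
  by rewrite normcf ler_pdivrMr ?normc_gt0 //; exact: h.
have wr1 : normc w <= r1 by rewrite /r1; lra.
have i0 : ('i * (2 * pi)%:C : R[i]) != 0.
  apply: mulf_neq0; first by rewrite -normc_gt0 normc_i.
  by rewrite rc_eq0 mulf_neq0 // gt_eqF // pi_gt0.
have hphi : rint (fun t => phi (Z t) * Z t) 0.
  exists (fun t => ('i * (2 * pi)%:C)^-1 * sint phi w (Z t)); split; last by rewrite /Z cis0 cis1 subrr.
  move=> t _; have h1 := kernel_primitive wr1 phic phid (_ : normc (Z t) < r1).
  have h2 := cdiff_rdiff_comp (h1 ltac:(by rewrite nZ /r1; lra)) (rdiffZ r%:C (cis_rdiff t)).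
  apply: rdiff_eqd (rdiffZ ('i * (2 * pi)%:C)^-1 h2); set x := phi _.
  by rewrite /Z; move: i0; set y := 'i * _ => y0; field.
have Zw t : Z t != w by apply/eqP => h; move: (nZ t); rewrite h; lra.
pose Cc := (M + normc (g w)) * (r / (r - normc w)).
(* For n > 0 the sum includes k = 0, the only index at which the mean over the circle of a negative
   power is not zero. *)
have bound n : (0 < n)%N -> normc (\sum_(k < n) c k * w ^+ k - g w) <= Cc * (normc w / r) ^+ n.
  move=> n0.
  have h1 := rint_sum n (fun k => rintZ (w ^+ k) (hc k)).
  have h2 := rint_sum n (fun k => rintZ (w ^+ k) (rint_circle k rp)).
  have h3 : \sum_(k < n) w ^+ k * (k == 0%N :> nat)%:R = 1 :> R[i].
    case: n n0 {h1 h2} => // n _; rewrite big_ord_recl /= mulr1 expr0 big1 ?addr0 //.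
    by move=> i _; rewrite /= mulr0.
  rewrite h3 in h2.
  have := rintD (rintD h1 (rintZ (- g w) h2)) (rintZ (-1) hphi).
  rewrite mulr0 addr0 mulr1 => h4.
  rewrite (_ : _ - g w = \sum_(k < n) w ^+ k * c k - g w); last first.
    by congr (_ - _); apply: eq_bigr => k _; rewrite mulrC.
  apply: rint_bound h4 _ => [|t t01].
    apply: mulr_ge0; last by rewrite exprn_ge0 // divr_ge0 ?normc_ge0 ?(ltW rp).
    apply: mulr_ge0; first by rewrite addr_ge0 // normc_ge0.
    by apply: divr_ge0; clear -rp wr; lra.
  (* The sum of the coefficients, the constant g(w) and the vanishing mean of phi(Z) Z combine into
     g(Z) - g(w) times the remainder of the geometric series. *)
  rewrite (_ : _ + _ = - ((g (Z t) - g w) * (Z t / (Z t - w) - \sum_(k < n) w ^+ k * (Z t)^-1 ^+ k))); last first.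
    rewrite (eq_bigr (fun k : 'I_n => g (Z t) * (w ^+ k * (Z t)^-1 ^+ k))) => [|k _]; last by ring.
    rewrite -mulr_sumr -/(Z t) phiE //; ring.
  rewrite geom_remainder // normcN normcM normcM normcX !normcf nZ.
  rewrite mulrA mulrAC /Cc; apply: ler_wpM2r; first by rewrite exprn_ge0 // divr_ge0 ?normc_ge0 ?(ltW rp).
  apply: ler_pM; first exact: normc_ge0.
    - by rewrite divr_ge0 ?normc_ge0 // ltW.
    - by apply: le_trans (normcB _ _) _; rewrite lerD2r; exact: gM.
  rewrite ler_wpM2l ?(ltW rp) // lef_pV2 ?posrE; first by have := normc_ge_sub (Z t) w; rewrite nZ.
    by rewrite normc_gt0 subr_eq0.
  lra.
move=> e e0; have q01 : 0 <= normc w / r < 1.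
  by rewrite divr_ge0 ?normc_ge0 ?(ltW rp) //= ltr_pdivrMr // mul1r.
have [n0 h] := geom_small Cc q01 e0.
exists n0.+1 => n hn; apply: le_trans (bound n _) _; first exact: leq_ltn_trans hn.
by apply: h; exact: ltnW.
Qed.

End PowerSeries.

Section Analytic.
Context {R : realType}.
Implicit Types (f g : R[i] -> R[i]) (p q z w d I J a b P : R[i]) (c : nat -> R[i]).

(** The function [Q n x - h z * x] has small derivative near z, uniformly for large n, so the mean
    value inequality survives the limit in n. *)
Lemma cdiff_limit (q Q : nat -> R[i] -> R[i]) (h H : R[i] -> R[i]) z (r : R) : 0 < r ->
  (forall n w, normc (w - z) < r -> cdiff (Q n) w (q n w)) ->
  (forall w, normc (w - z) < r -> clim (fun n => Q n w) (H w)) ->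
  (forall e : R, 0 < e -> exists n0, forall n w, (n0 <= n)%N -> normc (w - z) < r -> normc (q n w - h w) <= e) ->
  ccont h z -> cdiff H z (h z).
Proof.
move=> r0 Qq QH qh hc e e0; have e20 : 0 < e / 2 by lra.
have [dl dl0 hdl] := hc _ e20; have [n0 hn0] := qh _ e20.
exists (Num.min dl r); first by rewrite lt_min dl0.
move=> w; rewrite lt_min => /andP[w1 w2].
apply/ler_addgt0Pr => e' e'0.
have z0 : normc (z - z) < r by rewrite subrr normc0.
have e'20 : 0 < e' / 2 by lra.
have [n1 h1] := QH w w2 _ e'20; have [n2 h2] := QH z z0 _ e'20.
pose n := maxn n0 (maxn n1 n2).
have nn0 : (n0 <= n)%N by rewrite leq_maxl.
have {}h1 : normc (Q n w - H w) <= e' / 2 by apply: h1; rewrite /n !leq_max leqnn orbT.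
have {}h2 : normc (Q n z - H z) <= e' / 2 by apply: h2; rewrite /n !leq_max leqnn !orbT.
have key : normc (Q n w - h z * w - (Q n z - h z * z)) <= e * normc (w - z).
  apply: (@mean_value_bound R (fun x => Q n x - h z * x) (fun x => q n x - h z)); first exact: ltW.
  move=> t /andP[t0 t1]; set x := z + _.
  have xz : normc (x - z) <= normc (w - z).
    by rewrite /x [z + _]addrC addrK normcM normc_real ger0_norm // ler_piMl // normc_ge0.
  split.
    have := cdiffB (Qq n x _) (cdiffZ (h z) (cdiff_id x)); rewrite mulr1; apply.
    exact: le_lt_trans w2.
  have := hn0 n x nn0 (le_lt_trans xz w2); have := hdl x (le_lt_trans xz w1).
  have := normc_tri (h x) (q n x) (h z); clear; lra.
rewrite (_ : _ - _ - _ = (Q n w - h z * w - (Q n z - h z * z)) + ((Q n z - H z) - (Q n w - H w))); last by ring.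
apply: le_trans (normcD _ _) _; have := normcB (Q n z - H z) (Q n w - H w); clear -h1 h2 key; lra.
Qed.

Definition cpoly c n z := \sum_(k < n) c k * z ^+ k.

Lemma cdiff_cpoly c n z : cdiff (cpoly c n.+1) z (cpoly (fun k => k.+1%:R * c k.+1) n z).
Proof.
elim: n => [|n IH].
  rewrite /cpoly big_ord0; apply: cdiff_local (cdiff_cst (c 0%N) z); first exact: ltr01.
  by move=> w _; rewrite big_ord1 expr0 mulr1.
have := cdiffD IH (cdiffZ (c n.+1) (cdiffX n.+1 (cdiff_id z))).
rewrite [n.+1.-1]/= /= mulr1 => h.
have -> : cpoly (fun k => k.+1%:R * c k.+1) n.+1 z = cpoly (fun k => k.+1%:R * c k.+1) n z + c n.+1 * (n.+1%:R * z ^+ n).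
  by rewrite /cpoly big_ord_recr /=; ring.
apply: cdiff_local h; first exact: ltr01.
by move=> w _; rewrite /cpoly [in RHS]big_ord_recr.
Qed.

Lemma ccont_cpoly c n z : ccont (cpoly c n) z.
Proof.
case: n => [|n]; last exact: cdiff_ccont (cdiff_cpoly c n z).
apply: cdiff_ccont (cdiff_local _ _ (cdiff_cst 0 z)); first exact: ltr01.
by move=> w _; rewrite /cpoly big_ord0.
Qed.

Lemma geom_sum_bound (q : R) n m : 0 <= q < 1 -> \sum_(n <= k < m) q ^+ k <= q ^+ n / (1 - q).
Proof.
move=> /andP[q0 q1]; have q1' : 0 < 1 - q by lra.
have [nm|mn] := leqP n m; last by rewrite big_geq ?(ltnW mn) // divr_ge0 ?exprn_ge0 // ltW.
rewrite ler_pdivlMr // -subr_ge0.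
suff -> : q ^+ n - (\sum_(n <= k < m) q ^+ k) * (1 - q) = q ^+ m by rewrite exprn_ge0.
elim: m nm => [|m IH]; first by rewrite leqn0 => /eqP ->; rewrite big_geq // mul0r subr0.
rewrite leq_eqVlt => /orP[/eqP ->|]; first by rewrite big_geq // mul0r subr0.
rewrite ltnS => nm; rewrite big_nat_recr //= mulrDl opprD addrA IH // exprS; ring.
Qed.

Lemma cpoly_cauchy c (r M : R) w n m : 0 < r -> 0 <= M -> (forall k, normc (c k) <= M / r ^+ k) ->
  normc w < r -> (n <= m)%N ->
  normc (cpoly c m w - cpoly c n w) <= M * (normc w / r) ^+ n / (1 - normc w / r).
Proof.
move=> r0 M0 hc wr nm.
have q01 : 0 <= normc w / r < 1.
  by rewrite divr_ge0 ?normc_ge0 ?(ltW r0) //= ltr_pdivrMr // mul1r.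
have -> : cpoly c m w - cpoly c n w = \sum_(n <= k < m) c k * w ^+ k.
  rewrite /cpoly -!(big_mkord xpredT (fun k => c k * w ^+ k)).
  by rewrite (big_cat_nat (leq0n n) nm) /= [X in X - _]addrC addrK.
apply: (@le_trans _ _ (\sum_(n <= k < m) normc (c k * w ^+ k))).
  elim: m nm => [|m IH]; first by rewrite leqn0 => /eqP ->; rewrite !big_geq // normc0.
  rewrite leq_eqVlt => /orP[/eqP ->|]; first by rewrite !big_geq // normc0.
  rewrite ltnS => nm; rewrite !big_nat_recr //=.
  by apply: le_trans (normcD _ _) _; rewrite lerD2r IH.
apply: (@le_trans _ _ (\sum_(n <= k < m) M * (normc w / r) ^+ k)).
  apply: ler_sum => k _; rewrite normcM normcX expr_div_n.
  have := ler_wpM2r (exprn_ge0 k (normc_ge0 w)) (hc k); rewrite mulrAC mulrA //.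
rewrite -mulr_sumr -mulrA ler_wpM2l //; exact: geom_sum_bound.
Qed.

Lemma taylor_tail f P (r : R) c (M : R) w n : is_taylor f P r c M -> normc w < r ->
  normc (f (P + w) - cpoly c n w) <= M * (normc w / r) ^+ n / (1 - normc w / r).
Proof.
move=> [M0 hc hf] wr; apply: clim_le (hf w wr) _.
exists n => m nm; apply: cpoly_cauchy => //.
exact: le_lt_trans (normc_ge0 w) wr.
Qed.

Lemma taylor_tail_le f P (r : R) c (M : R) w n (s : R) : is_taylor f P r c M -> normc w <= s -> s < r ->
  normc (f (P + w) - cpoly c n w) <= M / (1 - s / r) * (s / r) ^+ n.
Proof.
move=> ft ws sr; have w0 := normc_ge0 w; have r0 : 0 < r by lra.
apply: le_trans (taylor_tail n ft (le_lt_trans ws sr)) _; case: ft => M0 _ _.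
have h1 : normc w / r <= s / r by rewrite ler_pM2r ?invr_gt0.
have h2 : s / r < 1 by rewrite ltr_pdivrMr // mul1r.
have h3 : 0 <= normc w / r by rewrite divr_ge0 // ltW.
rewrite mulrAC; apply: ler_pM.
- by rewrite divr_ge0 //; lra.
- by rewrite exprn_ge0.
- by rewrite ler_wpM2l // lef_pV2 ?posrE; clear -h1 h2; lra.
- by rewrite lerXn2r // ?nnegrE //; lra.
Qed.

Lemma taylor_ccont f P (r : R) c (M : R) w : is_taylor f P r c M -> normc w < r -> ccont f (P + w).
Proof.
move=> ft wr e e0; have w0 := normc_ge0 w.
pose s := (normc w + r) / 2.
have q01 : 0 <= s / r < 1.
  by rewrite divr_ge0 ?(@ltW _ _ _ r) /s //= ?ltr_pdivrMr; lra.
have [|n hn] := geom_small (M / (1 - s / r)) q01 (_ : 0 < e / 3); first by lra.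
have [|dl dl0 h] := ccont_cpoly c n w (_ : 0 < e / 3); first by lra.
have sr : s < r by rewrite /s; lra.
exists (Num.min dl (s - normc w)); first by rewrite lt_min dl0 /s; lra.
move=> x; rewrite lt_min => /andP[x1 x2].
have E : x = P + (x - P) by ring.
have E2 : x - (P + w) = x - P - w by ring.
rewrite E2 in x1 x2; rewrite E; move: (x - P) x1 x2 => y y1 y2.
have ys : normc y <= s by have := normc_ge_sub y w; lra.
have ws : normc w <= s by rewrite /s; lra.
have := taylor_tail_le n ft ys sr; have := taylor_tail_le n ft ws sr.
have := hn n (leqnn n); have := h y y1.
rewrite (_ : f (P + y) - _ = (f (P + y) - cpoly c n y) + (cpoly c n y - cpoly c n w) - (f (P + w) - cpoly c n w)); last by ring.
have := normcB ((f (P + y) - cpoly c n y) + (cpoly c n y - cpoly c n w)) (f (P + w) - cpoly c n w).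
have := normcD (f (P + y) - cpoly c n y) (cpoly c n y - cpoly c n w); clear; lra.
Qed.

Lemma taylor_ex P c (r M : R) : 0 < r -> 0 <= M -> (forall k, normc (c k) <= M / r ^+ k) ->
  exists f, is_taylor f P r c M.
Proof.
move=> r0 M0 hc.
have ex w : exists l, normc w < r -> clim (fun n => cpoly c n w) l.
  have [wr|wr] := boolP (normc w < r); last by exists 0.
  have q01 : 0 <= normc w / r < 1.
    by rewrite divr_ge0 ?normc_ge0 ?(ltW r0) //= ltr_pdivrMr // mul1r.
  have [e e0|l hl] := @cauchy_clim R (fun n => cpoly c n w); last by exists l.
  have [n0 h] := geom_small (M / (1 - normc w / r)) q01 e0.
  exists n0 => n n0n; apply: le_trans (cpoly_cauchy r0 M0 hc wr n0n) _.
  by rewrite mulrAC; exact: h.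
have [l hl] := choice ex.
exists (fun z => l (z - P)); split => // w wr.
by rewrite [P + w]addrC addrK; exact: hl.
Qed.

(** Termwise differentiation: the factor k+1 is at most 2^k, which is absorbed by halving the
    radius; another halving makes the convergence uniform. *)
Lemma taylor_deriv f P (r : R) c (M : R) : 0 < r -> is_taylor f P r c M ->
  exists f', is_taylor f' P (r / 2) (fun k => k.+1%:R * c k.+1) (M / r) /\
    forall u, normc u < r / 4 -> cdiff f (P + u) (f' (P + u)).
Proof.
move=> r0 ft; have [M0 hc hf] := ft.
have Mr : 0 <= M / r by rewrite divr_ge0 // ltW.
have r20 : 0 < r / 2 by lra.
have hd k : normc (k.+1%:R * c k.+1) <= M / r / (r / 2) ^+ k.
  rewrite normcM normc_nat; apply: (@le_trans _ _ (2 ^+ k * (M / r ^+ k.+1))).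
    apply: ler_pM => //; [exact: normc_ge0|].
    by rewrite -natrX ler_nat ltn_expl.
  rewrite exprS expr_div_n le_eqVlt; apply/orP; left; apply/eqP.
  by field; rewrite ?expf_neq0 // gt_eqF.
have [f' f't] := @taylor_ex P _ _ _ r20 Mr hd.
exists f'; split => // u ur; have u0 := normc_ge0 u.
pose Q n z := cpoly c n.+1 (z - P).
pose q n z := cpoly (fun k => k.+1%:R * c k.+1) n (z - P).
have shift w : P + (w - P) = w by ring.
have r4 : 0 < r / 4 - normc u by lra.
have near_u w : normc (w - (P + u)) < r / 4 - normc u -> normc (w - P) <= r / 4.
  by rewrite (_ : w - (P + u) = (w - P) - u); [have := normc_ge_sub (w - P) u; lra|ring].
apply: (@cdiff_limit q Q f' f (P + u) (r / 4 - normc u) r4).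
- move=> n w _; have := cdiff_comp (cdiffB (cdiff_id w) (cdiff_cst P w)) (cdiff_cpoly c n (w - P)).
  by rewrite subr0 mulr1.
- move=> w /near_u wr e e0.
  have [|n0 h] := hf (w - P) _ e e0; first by lra.
  by rewrite shift in h; exists n0 => n hn; exact: h n.+1 (leqW hn).
- move=> e e0.
  have q01 : 0 <= (r / 4) / (r / 2) < 1.
    by rewrite divr_ge0 ?ltr_pdivrMr //=; clear -r0; lra.
  have [n0 h] := geom_small (M / r / (1 - r / 4 / (r / 2))) q01 e0.
  exists n0 => n w hn /near_u wr; rewrite normcC -{1}(shift w).
  apply: le_trans (taylor_tail_le n f't wr _) (h n hn); clear -r0; lra.
- apply: taylor_ccont f't _; lra.
Qed.

Lemma taylor0 f P (r : R) c (M : R) : 0 < r -> is_taylor f P r c M -> f P = c 0%N.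
Proof.
move=> r0 [M0 hc hf]; have := hf 0; rewrite normc0 addr0 => /(_ r0) h.
apply: clim_unique h _ => e e0; exists 1%N => -[//|n] _.
by rewrite big_ord_recl big1 ?expr0 ?mulr1 ?addr0 ?subrr ?normc0 ?(ltW e0) // => i _; rewrite exprS mul0r mulr0.
Qed.

Lemma cdiff_cdiff f f1 P (r : R) : 0 < r -> (forall z, normc (z - P) < r -> cdiff f z (f1 z)) ->
  exists d, cdiff f1 P d.
Proof.
move=> r0 hf.
have [|||c [M ft]] := @taylor R f P r (r / 2); try lra.
  by move=> z /hf; exists (f1 z).
have r20 : 0 < r / 2 by lra.
have [f' [f't hf']] := taylor_deriv r20 ft.
have [|f'' [_ hf'']] := taylor_deriv _ f't; first by lra.
have := hf'' 0; rewrite normc0 addr0 => h; exists (f'' P).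
have r8 : 0 < r / 2 / 4 by lra.
apply: (cdiff_local r8 _ (h _)) => [w wP|]; last by lra.
have := hf' (w - P) wP; rewrite (_ : P + (w - P) = w); last by ring.
by move=> /cdiff_unique; apply; apply: hf; lra.
Qed.

Definition order_expansion f f1 P (m : nat) a (C r : R) := forall u, normc u < r ->
  normc (f (P + u) - f P - a * u ^+ m.+1) <= C * normc u ^+ m.+2 /\
  normc (f1 (P + u) - m.+1%:R * a * u ^+ m) <= C * normc u ^+ m.+1.

(** Either all coefficients after the first vanish, or the first nonzero one governs f and its
    derivative near [P]. This one local statement yields the identity theorem, the behaviour at
    critical points and the discreteness of level sets. *)
Lemma order_dichotomy f f1 P (r : R) : 0 < r -> (forall z, normc (z - P) < r -> cdiff f z (f1 z)) ->
  (forall z, normc (z - P) < r / 2 -> f z = f P) \/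
  exists m a (C r' : R), [/\ a != 0, 0 <= C, 0 < r', r' < r & order_expansion f f1 P m a C r'].
Proof.
move=> r0 hf.
have [|||c [M ft]] := @taylor R f P r (r / 2); try lra.
  by move=> z /hf; exists (f1 z).
have r20 : 0 < r / 2 by lra.
have [M0 hc hft] := ft.
have c0 := taylor0 r20 ft.
have [f' [f't hf']] := taylor_deriv r20 ft.
have [h|/existsNP] := pselect (forall k, c k.+1 = 0).
  left => z zP; have := hft _ zP; rewrite (_ : P + (z - P) = z); last by ring.
  move=> h1; apply: clim_unique h1 _ => e e0; exists 1%N => -[//|n] _.
  rewrite big_ord_recl /= expr0 mulr1 big1 ?addr0 -?c0 ?subrr ?normc0 ?(ltW e0) // => i _.
  by rewrite h mul0r.
move=> [k0 ck0]; right.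
have exm : exists k, c k.+1 != 0 by exists k0; apply/eqP.
pose m := ex_minn exm.
have [cm cmin] : c m.+1 != 0 /\ forall k, (k < m)%N -> c k.+1 = 0.
  rewrite /m; case: ex_minnP => m' cm' hmin; split => // k km; apply/eqP/negbNE/negP => /hmin.
  by rewrite leqNgt km.
have P2 u : cpoly c m.+2 u = f P + c m.+1 * u ^+ m.+1.
  rewrite /cpoly big_ord_recr big_ord_recl /= expr0 mulr1 big1 ?addr0 -?c0 // => i _.
  by rewrite /= cmin ?mul0r.
have P1 u : cpoly (fun k => k.+1%:R * c k.+1) m.+1 u = m.+1%:R * c m.+1 * u ^+ m.
  rewrite /cpoly big_ord_recr /= big1 ?add0r // => i _.
  by rewrite cmin ?mulr0 ?mul0r.
pose rr := r / 2 / 4.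
have rr0 : 0 < rr by rewrite /rr; lra.
pose C1 := M * (r / 2)^-1 ^+ m.+2 * 2; pose C2 := M / (r / 2) * (r / 2 / 2)^-1 ^+ m.+1 * 2.
have ri : 0 <= (r / 2)^-1 by rewrite invr_ge0 ltW.
have ri2 : 0 <= (r / 2 / 2)^-1 by rewrite invr_ge0; lra.
have C10 : 0 <= C1 by apply: mulr_ge0 => //; apply: mulr_ge0 => //; exact: exprn_ge0.
have C20 : 0 <= C2.
  apply: mulr_ge0 => //; apply: mulr_ge0; first exact: mulr_ge0.
  exact: exprn_ge0.
exists m, (c m.+1), (C1 + C2), rr; split => //; [clear -exm C10 C20; lra|by rewrite /rr; clear -r0 exm; lra|].
move=> u ur; have u0 := normc_ge0 u; split.
  have u1 : normc u < r / 2 by move: ur; rewrite /rr; lra.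
  have := taylor_tail m.+2 ft u1; rewrite P2.
  rewrite opprD addrA => /le_trans; apply.
  apply: (@le_trans _ _ (C1 * normc u ^+ m.+2)); last by rewrite ler_wpM2r ?exprn_ge0 //; clear -exm C20; lra.
  have q : normc u / (r / 2) <= 2^-1 by rewrite ler_pdivrMr //; move: ur; rewrite /rr; clear -r0 exm; lra.
  have q' : (1 - normc u / (r / 2))^-1 <= 2.
    by rewrite -[leRHS]invrK lef_pV2 ?posrE //; clear -exm q; lra.
  have hu : 0 <= M * (normc u / (r / 2)) ^+ m.+2.
    by apply: mulr_ge0 => //; apply: exprn_ge0; exact: mulr_ge0.
  have := ler_wpM2l hu q'; rewrite /C1 exprMn; clear -exm; lra.
have u1 : normc u < r / 2 / 2 by move: ur; rewrite /rr; clear -r0 exm; lra.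
have := taylor_tail m.+1 f't u1; rewrite P1.
have -> : f' (P + u) = f1 (P + u).
  have := hf' u ur => /cdiff_unique; apply; apply: hf.
  by rewrite [P + u]addrC addrK; move: ur; rewrite /rr; clear -r0 exm; lra.
move=> /le_trans; apply.
apply: (@le_trans _ _ (C2 * normc u ^+ m.+1)); last by rewrite ler_wpM2r ?exprn_ge0 //; clear -exm C10; lra.
have q : normc u / (r / 2 / 2) <= 2^-1 by rewrite ler_pdivrMr; move: ur; rewrite /rr; clear -exm r0; lra.
have q' : (1 - normc u / (r / 2 / 2))^-1 <= 2.
  by rewrite -[leRHS]invrK lef_pV2 ?posrE //; clear -exm q; lra.
have hu : 0 <= M / (r / 2) * (normc u / (r / 2 / 2)) ^+ m.+1.
  by apply: mulr_ge0; [exact: mulr_ge0|apply: exprn_ge0; exact: mulr_ge0].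
have := ler_wpM2l hu q'; rewrite /C2 exprMn; clear -exm; lra.
Qed.

(* Connectedness as: a predicate locally constant on D is constant on D. *)
Definition clopen_conn (D : set R[i]) := forall A : set R[i],
  (forall z, D z -> exists2 dl : R, 0 < dl &
     (forall y, normc (y - z) < dl -> A y) \/ (forall y, normc (y - z) < dl -> ~ A y)) ->
  forall z w, D z -> D w -> A z -> A w.

Lemma convex_clopen_conn (D : set R[i]) : cconvex D -> clopen_conn D.
Proof.
move=> Dc A h z w Dz Dw; apply: clopen_segment => t t01; apply: h; exact: Dc.
Qed.

End Analytic.

(** * Local models *)

Section Model.
Context {R : realType}.
Implicit Types (f g : R[i] -> R[i]) (p q z w d I J a b c P : R[i]).

Lemma connected_clopen_conn (D : set R[i]) : connected D -> clopen_conn D.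
Proof.
move=> cD A h z w Dz Dw Az.
have E1 : D `&` A = D `&` A°.
  apply/seteqP; split => y [Dy Ay]; split => //; last exact: interior_subset.
  have [dl dl0 [hA|hA]] := h y Dy; first by apply/nbhscP; exists dl.
  by case: (hA y _ Ay); rewrite subrr normc0.
have E2 : D `&` A = D `&` closure A.
  apply/seteqP; split => y [Dy Ay]; split => //; first exact: subset_closure.
  have [dl dl0 [hA|hA]] := h y Dy; first by apply: hA; rewrite subrr normc0.
  by have /closurecP /(_ dl dl0) [x Ax /hA] := Ay.
have : (D `&` A) w; last by case.
suff -> : D `&` A = D by [].
apply: cD; first by exists z.
- by exists A° => //; exact: open_interior.
- by exists (closure A) => //; exact: closed_closure.
Qed.

(** The property of vanishing on a neighbourhood is locally constant on [D]: by [order_dichotomy]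
    the derivative either vanishes near a point or has no other zero near it. *)
Lemma identity_deriv (D : set R[i]) f f1 : open D -> clopen_conn D ->
  (forall z, D z -> cdiff f z (f1 z)) ->
  (exists2 z0, D z0 & exists2 r : R, 0 < r & forall y, normc (y - z0) < r -> f1 y = 0) ->
  forall z, D z -> f1 z = 0.
Proof.
move=> /opencP oD cD fd [z0 Dz0 hz0] z Dz.
pose A := [set x | exists2 r : R, 0 < r & forall y, normc (y - x) < r -> f1 y = 0].
suff [r r0 hr] : A z by apply: hr; rewrite subrr normc0.
apply: (cD A _ z0) => // {hz0 Dz} {}z Dz.
have [r r0 rD] := oD z Dz.
have [|h|[m [a [C [r' [a0 C0 r'0 r'r h]]]]]] := @order_dichotomy R f f1 z r r0.
- by move=> y /rD /fd.
- have f10 y : normc (y - z) < r / 2 -> f1 y = 0.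
    move=> yz; have h1 : 0 < r / 2 - normc (y - z) by lra.
    have fy : cdiff f y (f1 y) by apply: fd; apply: rD; lra.
    apply: cdiff_unique fy _; apply: (cdiff_local h1 _ (cdiff_cst (f z) y)) => w hw.
    by rewrite h //; have := normc_tri y w z; lra.
  exists (r / 4); first by lra.
  left => y yz; exists (r / 4); first by lra.
  by move=> x xy; apply: f10; have := normc_tri y x z; lra.
have na : 0 < normc a by rewrite normc_gt0.
pose rho := Num.min r' (normc a / (C + 1)).
have rho0 : 0 < rho by rewrite lt_min r'0 divr_gt0 //; lra.
have nz u : u != 0 -> normc u < rho -> f1 (z + u) <> 0.
  move=> u0; rewrite lt_min => /andP[ur]; rewrite ltr_pdivlMr; last by lra.
  move=> uC fu; have [_] := h u ur; rewrite fu sub0r normcN !normcM normc_nat normcX.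
  have nu : 0 < normc u by rewrite normc_gt0.
  rewrite exprS mulrA ler_pM2r ?exprn_gt0 // => hle.
  have : normc a <= m.+1%:R * normc a by rewrite ler_peMl ?ler1n // ltW.
  have := mulr_ge0 (ltW nu) C0; have := normc_ge0 u; clear -uC hle; lra.
exists rho => //; right => y yz [r1 r10 hr1].
have [u [u0 u1 u2]] : exists u, [/\ u != 0, normc u < rho & normc (z + u - y) < r1].
  have [yz0|yz0] := eqVneq y z; last first.
    by exists (y - z); rewrite subr_eq0 yz0 yz (_ : z + (y - z) - y = 0) ?normc0 //; ring.
  pose s := Num.min rho r1 / 2.
  have m0 : 0 < Num.min rho r1 by rewrite lt_min rho0.
  have s0 : 0 < s by rewrite /s; lra.
  have ss : s < Num.min rho r1 by rewrite /s; clear -m0; lra.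
  move: ss; rewrite lt_min => /andP[s1 s2].
  exists s%:C; rewrite rc_eq0 gt_eqF // yz0 [z + _]addrC addrK normc_real gtr0_norm //.
by apply: (nz u u0 u1); apply: hr1.
Qed.

Definition uhp : set R[i] := @upper_half_plane R.

Lemma uhp_open : open uhp.
Proof.
apply/opencP => z hz; exists (complex.Im z) => // y yz.
have := normc_Im (y - z); rewrite cImD cImN ler_norml => /andP[h _].
by rewrite /uhp /upper_half_plane /=; lra.
Qed.

Lemma uhp_convex : cconvex uhp.
Proof.
move=> p q t; rewrite /uhp /upper_half_plane /= => hp hq /andP[t0 t1].
rewrite cImD cImZ cImD cImN.
have t1' : 0 <= 1 - t by lra.
have := mulr_ge0 t0 (ltW hq); have := mulr_ge0 t1' (ltW hp) => h1 h2.
have [h3|h3] := ltP t (1 / 2).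
  have : 1/2 * complex.Im p <= (1 - t) * complex.Im p by apply: ler_wpM2r; lra.
  lra.
have : 1/2 * complex.Im q <= t * complex.Im q by apply: ler_wpM2r; lra.
lra.
Qed.

(** Newton's iteration with the fixed slope [c] contracts by 1/2, and its first step has length at
    most r/2, so it stays in the disc and converges to a solution. *)
Lemma local_solve f f1 z0 (r : R) c w : 0 < r -> c != 0 ->
  (forall z, normc (z - z0) <= r -> cdiff f z (f1 z) /\ normc (f1 z - c) <= normc c / 2) ->
  normc (w - f z0) <= normc c * r / 2 -> exists2 z, normc (z - z0) <= r & f z = w.
Proof.
move=> r0 c0 h hw; have nc : 0 < normc c by rewrite normc_gt0.
pose T z := z - (f z - w) / c.
have Tc z z' : cball z0 r z -> cball z0 r z' -> normc (T z' - T z) <= normc (z' - z) / 2.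
  move=> hz hz'.
  have := @mean_value_bound R (fun x => f x - c * x) (fun x => f1 x - c) z z' (normc c / 2).
  have c20 : 0 <= normc c / 2 by lra.
  move=> /(_ c20) H.
  have : normc (f z' - c * z' - (f z - c * z)) <= normc c / 2 * normc (z' - z).
    apply: H => t t01; have /h[h1 h2] := cball_convex hz hz' t01; split => //.
    by have := cdiffB h1 (cdiffZ c (cdiff_id (z + t%:C * (z' - z)))); rewrite mulr1.
  rewrite (_ : T z' - T z = - ((f z' - c * z' - (f z - c * z)) / c)); last by rewrite /T; field.
  by rewrite normcN normcf ler_pdivrMr // => ?; lra.
have Tz0 : normc (T z0 - z0) <= r / 2.
  rewrite (_ : T z0 - z0 = (w - f z0) / c); last by rewrite /T; field.
  by rewrite normcf ler_pdivrMr //; lra.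
have z0B : cball z0 r z0 by rewrite /cball /= subrr normc0 ltW.
have TB z : cball z0 r z -> cball z0 r (T z).
  move=> hz; have := Tc z0 z z0B hz; rewrite /cball /= in hz *.
  have := normc_tri (T z0) (T z) z0; lra.
pose u n := iter n T z0.
have uB n : cball z0 r (u n) by elim: n => [//|n IH]; rewrite /u iterS; exact: TB.
have ud n : normc (u n.+1 - u n) <= r * (2^-1) ^+ n.+1.
  elim: n => [|n IH]; first by rewrite expr1; move: Tz0; rewrite /u /=; lra.
  have := Tc (u n) (u n.+1) (uB n) (uB n.+1); rewrite -[T (u n)]/(u n.+1) -[T (u n.+1)]/(u n.+2).
  by rewrite [2^-1 ^+ n.+2]exprS; lra.
have ud2 n m : normc (u (n + m)%N - u n) <= r * 2^-1 ^+ n - r * 2^-1 ^+ (n + m).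
  elim: m => [|m IH]; first by rewrite addn0 !subrr normc0.
  rewrite addnS; have := ud (n + m)%N; have := normc_tri (u (n + m)%N) (u (n + m).+1) (u n).
  by rewrite exprS; lra.
have [e e0|l hl] := @cauchy_clim R u.
  have [||n0 hn] := @geom_small R 2^-1 r e; [by apply/andP; split; lra|by []|].
  exists n0 => n n0n; have := hn n0 (leqnn _); have := ud2 n0 (n - n0)%N; rewrite subnKC //.
  have : 0 <= r * 2^-1 ^+ n by rewrite mulr_ge0 // ?exprn_ge0 // ltW.
  lra.
have lB : cball z0 r l := cball_closed uB hl.
exists l => //; apply/eqP; rewrite -subr_eq0; apply/eqP/normc_le0.
have [/cdiff_ccont fc _] := h l lB.
apply/ler_addgt0Pr => e e0; rewrite add0r.
have [|dl dl0 hd] := fc (e / 2); first by lra.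
have [|n1 h1] := hl (dl / 2); first by lra.
have [||n2 h2] := @geom_small R 2^-1 (r * normc c) (e / 2); [by apply/andP; split; clear; lra|by clear -e0; lra|].
pose n := maxn n1 n2.
have h3 := h1 n (leq_maxl _ _).
have h4 : normc (f (u n) - f l) <= e / 2 by apply: hd; lra.
have h5 := h2 n (leq_maxr _ _).
have h6 : normc (f (u n) - w) <= normc c * normc (u n.+1 - u n).
  rewrite -normcM (_ : c * (u n.+1 - u n) = - (f (u n) - w)) ?normcN //.
  by rewrite -[u n.+1]/(T (u n)) /T; field.
have h7 := ler_wpM2l (ltW nc) (ud n); rewrite exprS in h7.
have h8 : 0 <= 2^-1 ^+ n :> R by rewrite exprn_ge0.
have h9 : 0 <= normc c * r * 2^-1 ^+ n by rewrite !mulr_ge0 // ltW.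
have := normc_tri (f (u n)) (f l) w; rewrite (normcC (f l) (f (u n))); clear -e0 h4 h5 h6 h7; lra.
Qed.

(** A zero of 1 + X + ... + X^m; it is not 1, where this polynomial takes the value m+1. *)
Lemma root_of_unity m : (0 < m)%N -> exists2 xi : R[i], xi ^+ m.+1 = 1 & xi != 1.
Proof.
move=> m0; have [xi hxi] := @solve_monicpoly R[i] m (fun=> -1) m0.
have hs : \sum_(i < m.+1) xi ^+ i = 0.
  rewrite big_ord_recr /= hxi.
  by rewrite -big_split /= big1 // => i _; rewrite mulN1r subrr.
exists xi; first by apply/eqP; rewrite -subr_eq0 subrX1 hs mulr0.
apply/eqP => x1; move: hs; rewrite x1.
under eq_bigr do rewrite expr1n.
by rewrite sumr_const card_ord => /eqP; rewrite pnatr_eq0.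
Qed.

Section Pair.
Variables (g g1 : R[i] -> R[i]).
Hypothesis gd : forall z, uhp z -> cdiff g z (g1 z).

Lemma uhp_not_locally_constant : ~ constant_on uhp g -> forall z (r : R), uhp z -> 0 < r ->
  (forall y, normc (y - z) < r -> uhp y) -> ~ (forall y, normc (y - z) < r -> g y = g z).
Proof.
move=> nc z r hz r0 rH h; apply: nc; exists (g z) => w hw.
have f10 : forall x, uhp x -> g1 x = 0.
  apply: (identity_deriv uhp_open (convex_clopen_conn uhp_convex) gd).
  exists z => //; exists r => // y yz.
  have h1 : 0 < r - normc (y - z) by lra.
  apply: cdiff_unique (gd (rH y yz)) _.
  apply: (cdiff_local h1 _ (cdiff_cst (g z) y)) => x xy.
  by rewrite h //; have := normc_tri y x z; lra.
apply/eqP; rewrite -subr_eq0; apply/eqP/normc_le0; rewrite -(mul0r (normc (w - z))).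
apply: (mean_value_bound (f' := g1)) => // t t01.
have hx := uhp_convex hz hw t01; split; first exact: gd.
by rewrite f10 // normc0.
Qed.

(** At a critical point g is close to a u^(m+1) with m > 0, so it nearly takes the same value at P +
    s and P + xi s for a root of unity xi. [local_solve] near the second point makes the values
    equal, and for small s both derivatives are close to nonzero multiples of s^m. *)
Lemma critical_pair P : ~ constant_on uhp g -> uhp P -> g1 P = 0 ->
  exists z1 z2, [/\ uhp z1, uhp z2, z1 != z2, g z1 = g z2 & g1 z1 != 0 /\ g1 z2 != 0].
Proof.
move=> nc HP gP; have /opencP /(_ P HP) [r r0 rH] := uhp_open.
have [|h|[m [a [C [r' [a0 C0 r'0 r'r h]]]]]] := @order_dichotomy R g g1 P r r0.
- by move=> z /rH /gd.
- have r20 : 0 < r / 2 by lra.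
  by case: (uhp_not_locally_constant nc HP r20 _ h) => y yP; apply: rH; lra.
have na : 0 < normc a by rewrite normc_gt0.
have m0 : (0 < m)%N.
  case: m h => // h; have [] := h 0; rewrite ?normc0 // => _.
  rewrite addr0 gP expr0 mulr1 mul1r sub0r normcN expr1 mulr0.
  by move=> /normc_le0 /eqP; rewrite (negbTE a0).
have [xi xi1 xin1] := root_of_unity m0.
have nxi : normc xi = 1.
  have : normc xi ^+ m.+1 = 1 by rewrite -normcX xi1 normc1.
  by move=> /eqP; rewrite pexpr_eq1 ?normc_ge0 // => /eqP.
have [|k0 k00 hk0] := cdiff_ccont (cdiffX m (cdiff_id xi)) (_ : 0 < 1 / 8); first by lra.
have nx1 : 0 < normc (xi - 1) by rewrite normc_gt0 subr_eq0.
(* In the disc of radius k s around P + xi s the m-th power varies by a small fraction, and this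
   disc does not contain P + s. *)
pose k := Num.min 1 (Num.min (k0 / 2) (normc (xi - 1) / 2)).
have kp : 0 < k by rewrite !lt_min ltr01 /=; apply/andP; split; clear -k00 nx1; lra.
have k1 : k <= 1 by rewrite ge_min lexx.
have k2 : k <= k0 / 2 by rewrite !(ge_min, lexx, orbT).
have k3 : k <= normc (xi - 1) / 2 by rewrite !(ge_min, lexx, orbT).
pose m1 : R := m.+1%:R.
have m10 : 1 <= m1 by rewrite /m1 ler1n.
pose B := C * 2 ^+ m.+1 + 1.
have e2 : (1 : R) <= 2 ^+ m.+1 by rewrite -natrX ler1n expn_gt0.
have B0 : 0 < B by rewrite /B; have := mulr_ge0 C0 (le_trans ler01 e2); clear; lra.
(* In turn: the expansion is valid up to 2s, its remainder is within the tolerance of [local_solve],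
   and the remainder of the derivative is small against its leading term. *)
pose s := Num.min (r' / 4) (Num.min (normc a * k / (4 * B)) (normc a / (8 * B))).
have s0 : 0 < s by rewrite !lt_min !divr_gt0 ?mulr_gt0 //.
have s1 : s <= r' / 4 by rewrite !(ge_min, lexx, orbT).
have s2 : 4 * B * s <= normc a * k by rewrite mulrC -ler_pdivlMr ?mulr_gt0 // !(ge_min, lexx, orbT).
have s3 : 8 * B * s <= normc a by rewrite mulrC -ler_pdivlMr ?mulr_gt0 // !(ge_min, lexx, orbT).
have CB : C <= B.
  by rewrite /B; have := ler_wpM2l C0 e2; clear; lra.
have sm : 0 < s ^+ m by rewrite exprn_gt0.
pose c := m1%:C * a * (xi * s%:C) ^+ m.
have m1E : m.+1%:R = m1%:C :> R[i] by rewrite /m1 (rmorph_nat (real_complex R)).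
have nm1 : normc (m1%:C : R[i]) = m1 by rewrite normc_real ger0_norm //; lra.
have ns : normc (s%:C : R[i]) = s by rewrite normc_real gtr0_norm.
have ncE : normc c = m1 * normc a * s ^+ m.
  by rewrite /c !normcM normcX normcM nxi mul1r !normc_real !ger0_norm ?(ltW s0) //; lra.
have ma : normc a <= m1 * normc a by rewrite ler_peMl // ltW.
have nc0 : 0 < normc c by rewrite ncE !mulr_gt0 //; lra.
have c0 : c != 0 by rewrite -normc_gt0.
have cbig : normc a * s ^+ m <= normc c by rewrite ncE ler_wpM2r // ltW.
pose z0 := P + xi * s%:C.
have ks : 0 < k * s by rewrite mulr_gt0.
have hz v : normc (v - z0) <= k * s -> normc (v - P) <= 2 * s.
  have := normc_tri z0 v P; rewrite (_ : z0 - P = xi * s%:C); last by rewrite /z0; ring.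
  rewrite normcM nxi mul1r normc_real gtr0_norm //.
  have := ler_wpM2r (ltW s0) k1; clear; lra.
have hw : normc (g (P + s%:C) - g z0) <= normc c * (k * s) / 2.
  have [|h1 _] := h (xi * s%:C).
    by rewrite normcM nxi mul1r normc_real gtr0_norm //; clear -r'0 s1; lra.
  have [|h2 _] := h s%:C; first by rewrite normc_real gtr0_norm //; clear -r'0 s1; lra.
  move: h1 h2; rewrite exprMn xi1 mul1r normcM nxi mul1r !normc_real !(gtr0_norm s0) => h1 h2.
  rewrite (_ : _ - _ = (g (P + s%:C) - g P - a * s%:C ^+ m.+1) - (g (P + xi * s%:C) - g P - a * s%:C ^+ m.+1)); last by rewrite /z0; ring.
  apply: le_trans (normcB _ _) _; apply: (@le_trans _ _ (2 * (C * s ^+ m.+2))); first by clear -h1 h2; lra.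
  have h3 : C * s <= normc a * k / 4 by have := ler_wpM2r (ltW s0) CB; clear -s2; lra.
  have h4 := ler_wpM2r (mulr_ge0 (ltW ks) ler01) cbig.
  have h5 : C * s * (s ^+ m * s) <= normc a * k / 4 * (s ^+ m * s).
    by rewrite ler_wpM2r // mulr_ge0 // ltW.
  rewrite !exprS; clear -h4 h5; lra.
have g1c v : normc (v - z0) <= k * s -> normc (g1 v - c) <= normc c / 2.
  move=> hv; have vP := hz v hv.
  have [|_ h1] := h (v - P); first by clear -r'0 s1 vP; lra.
  rewrite (_ : P + (v - P) = v) in h1; last by ring.
  rewrite m1E in h1.
  pose y := (v - P) * (s^-1)%:C.
  have sC : (s%:C : R[i]) != 0 by rewrite rc_eq0 gt_eqF.
  have vy : v - P = y * s%:C by rewrite /y rcV; field.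
  have yx : normc (y - xi) < k0.
    rewrite (_ : y - xi = (v - z0) * (s^-1)%:C); last by rewrite /y /z0 rcV; field.
    rewrite normcM normc_real ger0_norm ?invr_ge0 ?(ltW s0) // ltr_pdivrMr //.
    by apply: le_lt_trans hv _; rewrite ltr_pM2r //; clear -k00 k2; lra.
  have h2 := hk0 y yx; rewrite /= in h2.
  have h3 : normc (m1%:C * a * (v - P) ^+ m - c) <= normc c / 8.
    have aux (A S X Y : R[i]) : A * (Y * S) - A * (X * S) = A * S * (Y - X) by ring.
    rewrite {1}/c vy [(xi * _) ^+ m]exprMn (exprMn m y) aux.
    rewrite normcM normcM normcM normcX nm1 ns.
    rewrite ncE; have n0 := ltW nc0; rewrite ncE in n0; have := ler_wpM2l n0 h2; clear; lra.
  have h4 : C * normc (v - P) ^+ m.+1 <= normc c / 8.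
    have h5 : normc (v - P) ^+ m.+1 <= (2 * s) ^+ m.+1 by rewrite lerXn2r // ?nnegrE ?normc_ge0 //; clear -s0; lra.
    apply: le_trans (ler_wpM2l C0 h5) _; rewrite exprMn [s ^+ m.+1]exprS.
    have h6 : C * 2 ^+ m.+1 * s <= normc a / 8 by have := s3; rewrite /B; clear -s0; lra.
    have := ler_wpM2r (ltW sm) h6; clear -cbig; lra.
  have := normcD (g1 v - m1%:C * a * (v - P) ^+ m) (m1%:C * a * (v - P) ^+ m - c).
  rewrite (_ : _ + _ = g1 v - c); last by ring.
  lra.
have [z2 hz2 gz2] : exists2 z2, normc (z2 - z0) <= k * s & g z2 = g (P + s%:C).
  apply: (local_solve (f1 := g1) ks c0) hw => v hv; split; last exact: g1c.
  by apply: gd; apply: rH; have := hz v hv; lra.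
exists (P + s%:C), z2; split => //.
- by apply: rH; rewrite [P + _]addrC addrK normc_real gtr0_norm //; lra.
- by apply: rH; have := hz z2 hz2; lra.
- apply/eqP => E; move: hz2; rewrite -E (_ : _ - _ = - ((xi - 1) * s%:C)); last by rewrite /z0; ring.
  rewrite normcN normcM normc_real gtr0_norm //.
  have := ler_wpM2r (ltW s0) k3; have := mulr_gt0 nx1 s0; lra.
split; apply/eqP => g0; last by have := g1c z2 hz2; rewrite g0 sub0r normcN; lra.
have [|_] := h s%:C; first by rewrite normc_real gtr0_norm //; lra.
rewrite g0 sub0r normcN m1E normcM normcM normcX nm1 ns.
have h6 : C * s <= normc a / 8 by have := ler_wpM2r (ltW s0) CB; lra.
have := ler_wpM2r (ltW sm) h6; rewrite exprS; have := ler_wpM2r (ltW sm) ma.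
have := mulr_gt0 na sm; lra.
Qed.

(** If g' has no zero, any two points with a common value will do; otherwise a zero of g' has such a
    pair next to it. *)
Lemma noncritical_pair : ~ constant_on uhp g -> ~ set_inj uhp g ->
  exists z1 z2, [/\ uhp z1, uhp z2, z1 != z2, g z1 = g z2 & g1 z1 != 0 /\ g1 z2 != 0].
Proof.
move=> nc ninj; have [[P HP gP]|h] := pselect (exists2 P, uhp P & g1 P = 0).
  exact: critical_pair HP gP.
have nz z : uhp z -> g1 z != 0 by move=> hz; apply/eqP => gz; apply: h; exists z.
apply: contrapT => h2; apply: ninj => z1 z2 /set_mem h1 /set_mem h3 E.
by apply/eqP/negbNE/negP => z12; apply: h2; exists z1, z2; split => //; split; exact: nz.
Qed.

End Pair.
End Model.

Section LocalModel.
Context {R : realType}.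
Implicit Types (f g : R[i] -> R[i]) (p q z w d I J a b c P : R[i]).

(** The second derivative exists and is bounded on the smaller disc by its own Taylor series
    there. *)
Lemma deriv_lipschitz f f1 P (r s : R) : 0 <= s -> s < r ->
  (forall z, normc (z - P) < r -> cdiff f z (f1 z)) ->
  exists2 L, 0 < L & forall z z', normc (z - P) <= s -> normc (z' - P) <= s ->
    normc (f1 z' - f1 z) <= L * normc (z' - z).
Proof.
move=> s0 sr fd.
have ex z : exists d, normc (z - P) < r -> cdiff f1 z d.
  have [zr|zr] := boolP (normc (z - P) < r); last by exists 0.
  have r0 : 0 < r - normc (z - P) by lra.
  have [|d hd] := @cdiff_cdiff R f f1 z _ r0; last by exists d.
  by move=> y yz; apply: fd; have := normc_tri z y P; lra.
have [f2 hf2] := choice ex.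
pose r1 := (r + s) / 2.
have [|||c [M ft]] := @taylor R f2 P r r1; try (rewrite /r1; lra).
  move=> z zr; have r0 : 0 < r - normc (z - P) by lra.
  apply: (@cdiff_cdiff R f1 f2 z _ r0) => y yz; apply: hf2.
  by have := normc_tri z y P; lra.
have sr1 : s < r1 by rewrite /r1; lra.
have [M0 _ _] := ft.
have q1 : s / r1 < 1 by rewrite ltr_pdivrMr ?mul1r; lra.
have Mq : 0 <= M / (1 - s / r1) by rewrite divr_ge0 //; lra.
have bd z : normc (z - P) <= s -> normc (f2 z) <= M / (1 - s / r1).
  move=> zs; have := taylor_tail_le 0 ft zs sr1.
  by rewrite /cpoly big_ord0 subr0 expr0 mulr1 (_ : P + (z - P) = z) //; ring.
exists (M / (1 - s / r1) + 1) => [|z z' hz hz']; first by lra.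
have : normc (f1 z' - f1 z) <= M / (1 - s / r1) * normc (z' - z).
  apply: (mean_value_bound (f' := f2)) => // t t01.
  have ht := cball_convex hz hz' t01; split; last exact: bd.
  apply: hf2; exact: le_lt_trans ht sr.
by have := normc_ge0 (z' - z); lra.
Qed.

(* At a boundary node f' is modelled by [om |-> F (b / (1 - 'i om))]; G is a
   rescaled copy of g whose derivative differs from the model by at most
   [lm_e], and [lm_m] is the derivative of G at the interior point [lm_om]. *)
Record local_model (F : R[i] -> R[i]) (r : R) b := LocalModel {
  lm_G : R[i] -> R[i]; lm_G1 : R[i] -> R[i]; lm_om : R[i]; lm_m : R[i];
  lm_k : R; lm_k1 : R; lm_e : R;
  lm_b0 : b != 0; lm_br : normc b < r; lm_Fb : F b != 0; lm_m0 : lm_m != 0;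
  lm_k0 : 0 < lm_k; lm_k10 : 0 < lm_k1; lm_e0 : 0 <= lm_e;
  lm_Im : 2 * lm_k <= complex.Im lm_om;
  lm_per : lm_G lm_om = lm_G 0;
  lm_diff : forall om, normc om <= 10 * normc lm_om -> - lm_k1 <= complex.Im om ->
    cdiff lm_G om (lm_G1 om) /\ normc (lm_G1 om - F (b / (1 - 'i * om))) <= lm_e;
  lm_near : forall om, normc (om - lm_om) <= lm_k -> normc (lm_G1 om - lm_m) <= normc lm_m / 4;
  lm_small : lm_e <= normc lm_m / 8;
  lm_err : 100 * lm_e * normc lm_om <= normc lm_m * lm_k }.

(** A very large disc contains a bounded piece of a half-plane, so that one Lipschitz constant from
    a single disc serves the whole piece. *)
Lemma halfplane_ball z (y1 S T : R) : 0 < y1 -> 0 < S -> 16 * S ^+ 2 <= T * y1 -> 0 < T ->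
  normc z <= 2 * S -> - (y1 / 2) <= complex.Im z -> normc (z - 'i * T%:C) <= T + 5 / 8 * y1.
Proof.
move=> y0 S0 hT T0 zS zI; have nz := normc_ge0 z.
rewrite -(@ler_pXn2r _ 2) ?nnegrE ?normc_ge0 //; last by lra.
have -> : normc (z - 'i * T%:C) ^+ 2 = normc z ^+ 2 - 2 * T * complex.Im z + T ^+ 2.
  rewrite !normc_sqr; case: z {zS zI nz} => x y /=; ring.
have h1 : normc z ^+ 2 <= (2 * S) ^+ 2 by rewrite ler_pXn2r // nnegrE //; lra.
have h2 := ler_wpM2l (ltW T0) zI.
have h3 : 0 <= y1 ^+ 2 by rewrite exprn_ge0 // ltW.
have -> : (T + 5 / 8 * y1) ^+ 2 = T ^+ 2 + 5 / 4 * (T * y1) + 25 / 64 * y1 ^+ 2 by field.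
rewrite exprMn in h1; move: h1 hT h2 h3; lra.
Qed.

(** The difficulty is a horizontal z2 - z1: then om would be real. The direction d is therefore
    tilted by an angle of order p, which gives om an imaginary part at least p A / rho. The tilted
    disc of radius rho still fits in the half-plane if rho is of order 1/p^2; the deviation of b/(1
    - i om) from an affine map is then of order 1/rho, that is p^2, and for small p it is negligible
    against the gain of order p. *)
Lemma model_ex g (g1 : R[i] -> R[i]) : (forall z, uhp z -> cdiff g z (g1 z)) ->
  (exists z1 z2, [/\ uhp z1, uhp z2, z1 != z2, g z1 = g z2 & g1 z1 != 0 /\ g1 z2 != 0]) ->
  exists P (r : R) b, (forall w, normc w < r -> uhp (P + w)) /\
    inhabited (local_model (fun w => g1 (P + w)) r b).
Proof.
move=> gd [z1 [z2 [H1 H2 z12 gz [g11 g12]]]].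
wlog yy : z1 z2 H1 H2 z12 gz g11 g12 / complex.Im z1 <= complex.Im z2.
  move=> hw; have [|/ltW h] := leP (complex.Im z1) (complex.Im z2); first exact: hw.
  by apply: hw h => //; rewrite eq_sym.
pose y1 := complex.Im z1; have y10 : 0 < y1 by exact: H1.
pose a := z2 - z1; pose A := normc a.
have A0 : 0 < A by rewrite /A normc_gt0 subr_eq0 eq_sym.
pose S := 10 * A; have S0 : 0 < S by rewrite /S; lra.
have S20 : 0 < S ^+ 2 by rewrite exprn_gt0.
pose T := 16 * S ^+ 2 / y1; have T0 : 0 < T by rewrite divr_gt0 //; lra.
have hT : 16 * S ^+ 2 <= T * y1 by rewrite /T mulfVK // gt_eqF.
pose Z := z1 + 'i * T%:C.
have [|||L L0 hL] := @deriv_lipschitz g g1 Z (T + 3/4 * y1) (T + 5 / 8 * y1).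
- by lra.
- by lra.
- move=> z zZ; apply: gd; rewrite /uhp /upper_half_plane /=.
  have := normc_Im (z - Z); rewrite ler_norml => /andP[h _]; move: h.
  by rewrite cImD cImN /Z cImD cImM /= !mul0r mul1r add0r -/y1; lra.
have inQ s : normc s <= 2 * S -> - (y1 / 2) <= complex.Im s -> normc (z1 + s - Z) <= T + 5 / 8 * y1.
  by rewrite (_ : z1 + s - Z = s - 'i * T%:C); [exact: halfplane_ball|rewrite /Z; ring].
have lipQ s s' : normc s <= 2 * S -> - (y1 / 2) <= complex.Im s -> normc s' <= 2 * S ->
    - (y1 / 2) <= complex.Im s' -> normc (g1 (z1 + s') - g1 (z1 + s)) <= L * normc (s' - s).
  move=> h1 h2 h3 h4; have := hL _ _ (inQ s h1 h2) (inQ s' h3 h4).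
  by rewrite (_ : z1 + s' - (z1 + s) = s' - s) //; ring.
(* The condition [lm_err] amounts to 1600 p L S^2 <= |m| y1, in view of e y1 = 8 L S^2 p^2 and k = p
   A / (2 rho). *)
have [K K0 KE] : exists2 K : R, 0 < K & K = 40 ^+ 2 by exists (40 ^+ 2) => //; rewrite exprn_gt0 // ltr0n.
pose m := g1 z2; have m0 : 0 < normc m by rewrite normc_gt0.
pose p := Num.min (4^-1) (Num.min (y1 / (16 * S)) (Num.min (y1 ^+ 2 / (32 * S ^+ 2))
  (Num.min (normc m / (4 * L * A)) (normc m * y1 / (K * L * S ^+ 2))))).
have LA : 0 < L * A by rewrite mulr_gt0.
have LS : 0 < L * S ^+ 2 by rewrite mulr_gt0.
have y2 : 0 < y1 ^+ 2 by rewrite exprn_gt0.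
have my : 0 < normc m * y1 by rewrite mulr_gt0.
have p0 : 0 < p.
  have h1 : 0 < y1 / (16 * S) by apply: divr_gt0 => //; lra.
  have h2 : 0 < y1 ^+ 2 / (32 * S ^+ 2) by apply: divr_gt0 => //; lra.
  have h3 : 0 < normc m / (4 * L * A) by apply: divr_gt0 => //; lra.
  have h4 : 0 < normc m * y1 / (K * L * S ^+ 2) by apply: divr_gt0 => //; rewrite -mulrA mulr_gt0.
  by rewrite !lt_min h1 h2 h3 h4 !andbT; lra.
have p1 : p <= 4^-1 by rewrite ge_min lexx.
have p2 : p * (16 * S) <= y1 by rewrite -ler_pdivlMr; [rewrite !(ge_min, lexx, orbT)|lra].
have p3 : p * (32 * S ^+ 2) <= y1 ^+ 2 by rewrite -ler_pdivlMr; [rewrite !(ge_min, lexx, orbT)|lra].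
have p4 : p * (4 * L * A) <= normc m.
  by rewrite -ler_pdivlMr; [rewrite !(ge_min, lexx, orbT)|rewrite -mulrA mulr_gt0].
have p5 : p * (K * L * S ^+ 2) <= normc m * y1.
  by rewrite -ler_pdivlMr; [rewrite !(ge_min, lexx, orbT)|rewrite -mulrA mulr_gt0].
(* The lowest point of the disc of radius rho around P lies below z1 by rho (1 - dp) <= 2 rho p^2 =
   y1 / 2, so it stays above the real axis. *)
pose rho := y1 / (4 * p ^+ 2).
have pp : 0 < p ^+ 2 by rewrite exprn_gt0.
have pple : p ^+ 2 <= p / 4 by rewrite expr2; have := ler_wpM2l (ltW p0) p1; lra.
have rho0 : 0 < rho by rewrite divr_gt0 // mulr_gt0.
have rhop : rho * p ^+ 2 = y1 / 4 by rewrite /rho; field; rewrite gt_eqF.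
have irho : rho^-1 = 4 * p ^+ 2 / y1 by rewrite /rho; field; rewrite !gt_eqF.
clearbody rho p.
have q0 : 0 < 1 + p ^+ 2 by lra.
(* The rational point of the unit circle with parameter p; [v] is between p and 2p. *)
pose dp := (1 - p ^+ 2) / (1 + p ^+ 2); pose v := 2 * p / (1 + p ^+ 2).
have dv : dp ^+ 2 + v ^+ 2 = 1 by rewrite /dp /v; field; rewrite gt_eqF.
have v0 : 0 < v by rewrite divr_gt0 //; lra.
have vp : p <= v by rewrite ler_pdivlMr //; have := ler_wpM2l (ltW p0) pple; have := ler_wpM2l (ltW p0) p1; lra.
have v2p : v <= 2 * p by rewrite ler_pdivrMr //; have := mulr_ge0 (ltW p0) (ltW pp); lra.
have dvle : v <= dp by rewrite ler_pM2r ?invr_gt0 //; lra.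
have dp1 : 1 - 2 * p ^+ 2 <= dp.
  rewrite ler_pdivlMr //; have := mulr_ge0 (ltW pp) (ltW pp); lra.
have dple1 : dp <= 1 by rewrite ler_pdivrMr //; lra.
clearbody dp v.
(* The tilt is towards the side that raises the imaginary part of a/d. *)
pose sg : R := if 0 <= complex.Re a then 1 else -1.
have sgE : sg * complex.Re a = `|complex.Re a|.
  by rewrite /sg; case: leP => h; [rewrite mul1r ger0_norm|rewrite mulN1r ltr0_norm].
have sg1 : `|sg| = 1 by rewrite /sg; case: ifP => _; rewrite ?normrN normr1.
have sg2 : sg ^+ 2 = 1 by rewrite -[sg ^+ 2]ger0_norm ?sqr_ge0 // normrX sg1 expr1n.
clearbody sg.
pose d : R[i] := dp +i* (- (sg * v)).
have nd : normc d = 1 by rewrite /= sqrrN exprMn sg2 mul1r dv sqrtr1.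
have d0 : d != 0 by rewrite -normc_gt0 nd.
have dinv : d^-1 = dp +i* (sg * v).
  apply: (mulfI d0); rewrite divff //; apply/eqP; rewrite eq_complex /= /d; apply/andP; split; apply/eqP; last by ring.
  by transitivity (dp ^+ 2 + sg ^+ 2 * v ^+ 2); [rewrite sg2 mul1r dv|ring].
have rC : (rho%:C : R[i]) != 0 by rewrite rc_eq0 gt_eqF.
have ii : ('i : R[i]) * 'i = -1 by rewrite -expr2 sqr_i.
pose b : R[i] := - 'i * rho%:C * d.
have nb : normc b = rho by rewrite !normcM normcN normc_i nd normc_real gtr0_norm // mul1r mulr1.
have ib : 'i * b = rho%:C * d by rewrite /b mulrA mulrA mulrN ii opprK mul1r.
pose om := a / (rho%:C * d).
have nom : normc om = A / rho by rewrite normcf normcM nd normc_real gtr0_norm // mulr1.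
have omI : p * A / rho <= complex.Im om.
  have -> : om = (rho^-1)%:C * (a * d^-1) by rewrite /om rcV invfM; ring.
  rewrite cImZ [p * A / rho]mulrC; apply: ler_wpM2l; first by rewrite invr_ge0 ltW.
  rewrite dinv cImM /=.
  have aI : 0 <= complex.Im a by rewrite /a cImD cImN; clear -yy; lra.
  have h1 : p * A <= v * A by rewrite ler_wpM2r // ltW.
  have h2 : v * A <= v * (`|complex.Re a| + `|complex.Im a|) by rewrite ler_wpM2l ?(ltW v0) // normc_ReIm.
  have h3 := ler_wpM2r aI dvle.
  move: h2; rewrite (ger0_norm aI) -sgE; clear -h1 h3; lra.
pose P := z1 - b; pose r := complex.Im P.
have rE : r = y1 + rho * dp.
  by rewrite /r /P cImD cImN /b /= !(mulr0, mul0r, oppr0, add0r, addr0, subr0, sub0r, mulN1r, mul1r, mulNr, opprK); rewrite -/y1; ring.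
have br : rho < r.
  rewrite rE; have := ler_wpM2l (ltW rho0) dp1; rewrite mulrBr mulrCA rhop; clear -y10; lra.
exists P, r, b; split.
  move=> w wr; rewrite /uhp /upper_half_plane /= cImD -/r.
  by have := normc_Im w; rewrite ler_norml => /andP[h _]; lra.
pose e := L * (2 * S ^+ 2 / rho).
have e0 : 0 <= e by rewrite mulr_ge0 ?(ltW L0) // divr_ge0 ?(ltW rho0) // mulr_ge0 // ltW.
have eE : e * y1 = 8 * L * S ^+ 2 * p ^+ 2 by rewrite /e irho; field; rewrite gt_eqF.
pose k := p * A / (2 * rho).
have k0 : 0 < k by rewrite divr_gt0 ?mulr_gt0.
pose k1 := y1 / (8 * rho).
have k10 : 0 < k1 by rewrite divr_gt0 ?mulr_gt0.
have SA : A * 10 = S by rewrite /S mulrC.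
have sd x : normc (rho%:C * d * x) = rho * normc x.
  by rewrite normcM normcM nd mulr1 normc_real gtr0_norm.
(* The exact deviation of the model map from z1 + rho d x. The pole of the map is excluded
   afterwards by |x| <= 1/2. *)
have sub_s x : P + b / (1 - 'i * x) = z1 + rho%:C * d * x + rho%:C * d * x * ('i * x) / (1 - 'i * x) \/ 1 - 'i * x = 0.
  have [->|h] := eqVneq (1 - 'i * x) 0; [by right|left].
  by rewrite -ib /P; field.
have hregion x : normc x <= 10 * normc om -> - k1 <= complex.Im x ->
   [/\ normc (rho%:C * d * x) <= S, - (y1 / 4) <= complex.Im (rho%:C * d * x) & normc x <= 2^-1].
  rewrite nom => h1 h2.
  have h3 : rho * normc x <= S.
    by rewrite mulrC -ler_pdivlMr // /S -mulrA.
  have nx := normc_ge0 x.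
  split; first by rewrite sd.
    rewrite -mulrA cImZ cImM [complex.Re d]/= [complex.Im d]/=.
    have h4 : - (y1 / 8) <= rho * dp * complex.Im x.
      have [h|h] := leP 0 (complex.Im x).
        by apply: (@le_trans _ _ 0); [clear -y10; lra|rewrite !mulr_ge0 ?(ltW rho0) //; clear -v0 dvle; lra].
      have : rho * k1 = y1 / 8 by rewrite /k1; field; rewrite gt_eqF.
      have := ler_wpM2l (ltW rho0) h2.
      have : rho * complex.Im x <= rho * dp * complex.Im x.
        rewrite -mulrA ler_wpM2l ?(ltW rho0) //; have := ler_wnM2r (ltW h) dple1; clear; lra.
      clear; lra.
    have h5 : `|rho * (sg * v) * complex.Re x| <= y1 / 8.
      rewrite normrM normrM normrM sg1 mul1r (gtr0_norm rho0) (gtr0_norm v0).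
      have := normc_Re x => h6.
      have h7 : rho * v * `|complex.Re x| <= v * (rho * normc x).
        by rewrite [rho * v]mulrC -mulrA; apply: ler_wpM2l; [exact: ltW|apply: ler_wpM2l => //; exact: ltW].
      have h8 : v * (rho * normc x) <= 2 * p * S.
        by apply: ler_pM => //; [exact: ltW|rewrite mulr_ge0 // ltW].
      clear -h7 h8 p2; lra.
    move: h5; rewrite ler_norml => /andP[h5 h5']; clear -h4 h5 h5'; lra.
  have : S / rho <= 2^-1.
    rewrite irho; rewrite mulrA ler_pdivrMr //.
    have := ler_wpM2l (ltW S0) pple; clear -p2 y10; lra.
  have : normc x <= S / rho by rewrite ler_pdivlMr // mulrC.
  clear; lra.
constructor; apply: (@LocalModel (fun w => g1 (P + w)) r b
  (fun x => g (z1 + rho%:C * d * x) / (rho%:C * d)) (fun x => g1 (z1 + rho%:C * d * x)) om m k k1 e) => //.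
- by rewrite -normc_gt0 nb.
- by rewrite nb.
- by rewrite /P subrK.
- have -> : 2 * k = p * A / rho by rewrite /k; field; rewrite gt_eqF.
  exact: omI.
- rewrite mulr0 addr0 gz /om; congr (g _ / _); rewrite mulrC mulfVK ?mulf_neq0 //.
  by rewrite /a; ring.
- move=> x hx1 hx2; have [h1 h2 h3] := hregion x hx1 hx2.
  have rd : rho%:C * d != 0 by rewrite mulf_neq0.
  split.
    have hin : uhp (z1 + rho%:C * d * x).
      by rewrite /uhp /upper_half_plane /= cImD -/y1; clear -y10 h2; lra.
    have := cdiff_comp (cdiffD (cdiff_cst z1 x) (cdiffZ (rho%:C * d) (cdiff_id x))) (gd _ hin).
    rewrite add0r mulr1 => /(cdiffZ (rho%:C * d)^-1); rewrite mulrCA mulVf // mulr1.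
    by apply: (cdiff_local (r := 1)) => // y _; rewrite mulrC.
  have n1 : 2^-1 <= normc (1 - 'i * x).
    by have := normc_ge_sub 1 ('i * x); rewrite normc1 normcM normc_i mul1r; clear -h3; lra.
  have [->|h4] := sub_s x; last by move: n1; rewrite h4 normc0; clear; lra.
  rewrite -addrA; set s := rho%:C * d * x; set t := _ * _ / _.
  have n10 : 0 < normc (1 - 'i * x) by clear -n1; lra.
  have tE : normc t = normc s * normc x / normc (1 - 'i * x).
    by rewrite /t normcf (normcM s) (normcM 'i) normc_i mul1r.
  have nt : normc t <= 2 * S ^+ 2 / rho.
    rewrite tE ler_pdivrMr //.
    have h5 : normc x = normc s / rho by rewrite /s sd; field; rewrite gt_eqF.
    have h6 : normc s * normc s <= S * S by apply: ler_pM; rewrite ?normc_ge0.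
    rewrite h5 mulrA; apply: (@le_trans _ _ (S ^+ 2 / rho)).
      by rewrite ler_pM2r ?invr_gt0 // expr2.
    have h7 : 0 <= S ^+ 2 / rho by rewrite divr_ge0 // ltW.
    have := ler_wpM2l h7 n1; clear; lra.
  have nt2 : normc t <= y1 / 4.
    apply: le_trans nt _; rewrite irho; rewrite -mulrA.
    have -> : 2 * (S ^+ 2 * (4 * p ^+ 2 / y1)) = 8 * S ^+ 2 * p ^+ 2 / y1 by field; rewrite gt_eqF.
    rewrite ler_pdivrMr //; have := ler_wpM2l (ltW S20) pple; clear -p3 y2; lra.
  have nt3 : normc t <= S.
    apply: le_trans h1; rewrite -/s tE ler_pdivrMr //.
    by rewrite ler_wpM2l ?normc_ge0 //; clear -h3 n1; lra.
  rewrite normcC; have := normc_Im t; rewrite ler_norml => /andP[tI _].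
  apply: le_trans (lipQ s (s + t) _ _ _ _) _.
  - by clear -h1 S0; lra.
  - by clear -h2 y10; lra.
  - by have := normcD s t; clear -h1 nt3; lra.
  - by rewrite cImD; clear -tI nt2 h2; lra.
  - by rewrite [s + t]addrC addrK ler_wpM2l // ltW.
- move=> x hx.
  have zE : rho%:C * d * x = a + rho%:C * d * (x - om).
    rewrite mulrBr /om [_ * (a / _)]mulrC mulfVK ?mulf_neq0 //; ring.
  have kr : rho * k = p * A / 2 by rewrite /k; field; rewrite gt_eqF.
  have h1 : normc (rho%:C * d * (x - om)) <= p * A / 2.
    by rewrite sd -kr ler_wpM2l // ltW.
  have aI : 0 <= complex.Im a by rewrite /a cImD cImN; clear -yy; lra.
  have pA : p * A <= A / 4 by have := ler_wpM2r (ltW A0) p1; clear; lra.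
  have pS : p * S <= y1 / 8 by clear -p2 y10; lra.
  have nI := normc_Im (rho%:C * d * (x - om)); rewrite ler_norml in nI; case/andP: nI => nI _.
  rewrite /m (_ : z2 = z1 + a); last by rewrite /a; ring.
  rewrite zE; apply: le_trans (lipQ a _ _ _ _ _) _.
  - by rewrite -/A /S; clear -A0; lra.
  - by clear -aI y10; lra.
  - by have := normcD a (rho%:C * d * (x - om)); rewrite -/A /S; clear -h1 pA A0; lra.
  - by rewrite cImD; move: pS; rewrite /S; clear -aI nI h1 y10 A0 p0; have := mulr_gt0 p0 A0; lra.
  - rewrite [a + _]addrC addrK; have := ler_wpM2l (ltW L0) h1; move: p4; rewrite -/m (_ : z1 + a = z2); last by rewrite /a; ring.
    by rewrite -/m; clear -m0; lra.
- rewrite -(ler_pM2r y10) eE; have := ler_wpM2l (ltW LS) pple.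
  by have := mulr_gt0 LS p0; move: p5; rewrite KE; clear -my; lra.
- rewrite nom; have -> : 100 * e * (A / rho) = (e * y1) * (100 * A / rho / y1) by field; rewrite !gt_eqF.
  rewrite eE; have -> : normc m * k = (normc m * y1) * (p * A / 2 / rho / y1) by rewrite /k; field; rewrite !gt_eqF.
  have -> : 8 * L * S ^+ 2 * p ^+ 2 * (100 * A / rho / y1) = (p * (K * L * S ^+ 2)) * (p * A / 2 / rho / y1) by rewrite KE; field; rewrite !gt_eqF.
  by rewrite ler_wpM2r // !divr_ge0 ?mulr_ge0 // ?(ltW p0) ?(ltW A0) ?(ltW rho0) // ltW.
Qed.

End LocalModel.

(** * Polynomial approximation *)

Section PolyApprox.
Context {R : realType}.
Implicit Types (f g h : R[i] -> R[i]) (p q z w c : R[i]) (S D : set R[i]).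

Definition poly_approx S f := forall e : R, 0 < e ->
  exists p : {poly R[i]}, forall z, S z -> normc (f z - p.[z]) <= e.

Definition core D (B y : R) : set R[i] :=
  [set z | normc z <= B /\ forall w, normc (w - z) < y -> D w].

(* A substitute for simple connectivity: polynomials have primitives, so
   functions that are locally limits of polynomials have them too. *)
Definition locally_approx D f := forall B y : R, 0 < y -> poly_approx (core D B y) f.

Lemma poly_approx_horner S (p : {poly R[i]}) : poly_approx S (fun z => p.[z]).
Proof. by move=> e e0; exists p => z _; rewrite subrr normc0 ltW. Qed.

Lemma poly_approx_cst S c : poly_approx S (fun=> c).
Proof. by move=> e e0; exists c%:P => z _; rewrite hornerC subrr normc0 ltW. Qed.

Lemma poly_approxD S f g : poly_approx S f -> poly_approx S g ->
  poly_approx S (fun z => f z + g z).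
Proof.
move=> hf hg e e0; have [|p hp] := hf (e / 2); first by lra.
have [|q hq] := hg (e / 2); first by lra.
exists (p + q) => z Sz; rewrite hornerD opprD addrACA.
by apply: le_trans (normcD _ _) _; have := hp z Sz; have := hq z Sz; lra.
Qed.

Lemma poly_approx_lim S f : (forall e : R, 0 < e -> exists2 g, poly_approx S g &
  forall z, S z -> normc (f z - g z) <= e) -> poly_approx S f.
Proof.
move=> h e e0; have [|g hg fg] := h (e / 2); first by lra.
have [|p hp] := hg (e / 2); first by lra.
exists p => z Sz; have := normc_tri (g z) (f z) p.[z].
by have := hp z Sz; have := fg z Sz; lra.
Qed.

Lemma poly_approx_ext S f g : (forall z, S z -> f z = g z) -> poly_approx S f -> poly_approx S g.
Proof. by move=> fg hf e /hf[p hp]; exists p => z Sz; rewrite -fg //; exact: hp. Qed.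

Section Bounded.
Variables (S : set R[i]) (B : R).
Hypothesis SB : forall z, S z -> normc z <= B.

Lemma horner_bounded (p : {poly R[i]}) : exists2 M, 0 <= M & forall z, S z -> normc p.[z] <= M.
Proof.
elim/poly_ind: p => [|p c [M M0 h]]; first by exists 0 => // z _; rewrite horner0 normc0.
have nc := normc_ge0 c; have B0 := normr_ge0 B.
exists (M * `|B| + normc c); first by rewrite addr_ge0 // mulr_ge0.
move=> z Sz; rewrite hornerMXaddC; apply: le_trans (normcD _ _) _; rewrite lerD2r normcM.
by apply: ler_pM; rewrite ?normc_ge0 ?h //; exact: le_trans (SB Sz) (ler_norm _).
Qed.

Lemma poly_approx_bounded f : poly_approx S f -> exists2 M, 0 <= M & forall z, S z -> normc (f z) <= M.
Proof.
move=> /(_ 1 ltr01)[p hp]; have [M M0 h] := horner_bounded p.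
exists (M + 1) => [|z Sz]; first by lra.
by have := normc_ge_sub (f z) p.[z]; have := hp z Sz; have := h z Sz; lra.
Qed.

Lemma poly_approxM f g : poly_approx S f -> poly_approx S g ->
  poly_approx S (fun z => f z * g z).
Proof.
move=> hf hg e e0; have [M M0 hM] := poly_approx_bounded hg.
have [|p hp] := hf (e / (2 * (M + 1))); first by rewrite divr_gt0 //; lra.
have [N N0 hN] := horner_bounded p.
have [|q hq] := hg (e / (2 * (N + 1))); first by rewrite divr_gt0 //; lra.
exists (p * q) => z Sz; rewrite hornerM.
have -> : f z * g z - p.[z] * q.[z] = (f z - p.[z]) * g z + p.[z] * (g z - q.[z]) by ring.
apply: le_trans (normcD _ _) _; rewrite !normcM.
have h1 : normc (f z - p.[z]) * normc (g z) <= e / 2.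
  apply: (@le_trans _ _ (e / (2 * (M + 1)) * (M + 1))).
    by apply: ler_pM; rewrite ?normc_ge0 ?hp //; have := hM z Sz; lra.
  by rewrite le_eqVlt; apply/orP; left; apply/eqP; field; lra.
have h2 : normc p.[z] * normc (g z - q.[z]) <= e / 2.
  apply: (@le_trans _ _ ((N + 1) * (e / (2 * (N + 1))))).
    by apply: ler_pM; rewrite ?normc_ge0 ?hq //; have := hN z Sz; lra.
  by rewrite le_eqVlt; apply/orP; left; apply/eqP; field; lra.
lra.
Qed.

Lemma poly_approxX f n : poly_approx S f -> poly_approx S (fun z => f z ^+ n).
Proof.
move=> hf; elim: n => [|n IH]; first by under [X in poly_approx _ X]eq_fun do rewrite expr0; exact: poly_approx_cst.
by under [X in poly_approx _ X]eq_fun do rewrite exprS; exact: poly_approxM.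
Qed.

Lemma poly_approx_sum (I : Type) (s : seq I) (F : I -> R[i] -> R[i]) : (forall i, poly_approx S (F i)) ->
  poly_approx S (fun z => \sum_(i <- s) F i z).
Proof.
move=> hF; elim: s => [|a s IH].
  by under [X in poly_approx _ X]eq_fun do rewrite big_nil; exact: poly_approx_cst.
by under [X in poly_approx _ X]eq_fun do rewrite big_cons; exact: poly_approxD.
Qed.

Lemma poly_approx_cpoly (c : nat -> R[i]) n f : poly_approx S f -> poly_approx S (fun z => cpoly c n (f z)).
Proof.
move=> hf; apply: poly_approx_sum => i.
by apply: poly_approxM; [exact: poly_approx_cst|exact: poly_approxX].
Qed.

Lemma poly_approx_taylor F (P : R[i]) (r s : R) (c : nat -> R[i]) (M : R) f : is_taylor F P r c M -> 0 < s -> s < r ->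
  (forall z, S z -> normc (f z) <= s) -> poly_approx S f -> poly_approx S (fun z => F (P + f z)).
Proof.
move=> tF s0 sr fs hf; apply: poly_approx_lim => e e0.
have r0 : 0 < r := lt_trans s0 sr.
have [|n hn] := @geom_small R (s / r) (M / (1 - s / r)) e _ e0.
  by rewrite divr_ge0 ?ltW // ltr_pdivrMr // mul1r.
exists (fun z => cpoly c n (f z)); first exact: poly_approx_cpoly.
move=> z Sz; apply: le_trans (taylor_tail_le n tF (fs z Sz) sr) _; exact: hn.
Qed.

Lemma poly_approx_geom f : (forall z, S z -> normc (f z) <= 2^-1) -> poly_approx S f ->
  poly_approx S (fun z => (1 - f z)^-1).
Proof.
move=> fs hf; apply: poly_approx_lim => e e0.
have [|n hn] := @geom_small R 2^-1 2 e _ e0; first by lra.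
exists (fun z => cpoly (fun=> 1) n (f z)); first exact: poly_approx_cpoly.
move=> z Sz; have fz := fs z Sz.
have n1 : 2^-1 <= normc (1 - f z) by have := normc_ge_sub 1 (f z); rewrite normc1; lra.
have n0 : 1 - f z != 0 by rewrite -normc_gt0; lra.
have -> : (1 - f z)^-1 - cpoly (fun=> 1) n (f z) = f z ^+ n / (1 - f z).
  apply: (mulIf n0); rewrite mulrBl mulVf // divfK // /cpoly.
  under eq_bigr do rewrite mul1r.
  by rewrite -[RHS](subrK 1) subrX1; ring.
apply: le_trans (hn n (leqnn n)); rewrite normcf normcX ler_pdivrMr; last by lra.
have h1 : normc (f z) ^+ n <= 2^-1 ^+ n by rewrite lerXn2r ?nnegrE ?normc_ge0 //; lra.
have h2 : 0 <= (2^-1 : R) ^+ n by rewrite exprn_ge0 //; lra.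
have := ler_wpM2l h2 n1; lra.
Qed.

(* Pole pushing: [1/(z-p') = u/(1-(p'-p)u)] with [u = 1/(z-p)]. *)
Lemma poly_approx_push p p' (y : R) : 0 < y -> (forall z, S z -> y <= normc (z - p)) ->
  normc (p' - p) <= y / 2 -> poly_approx S (fun z => (z - p)^-1) -> poly_approx S (fun z => (z - p')^-1).
Proof.
move=> y0 Sp pp hu.
have h1 : poly_approx S (fun z => (p' - p) * (z - p)^-1) by apply: poly_approxM => //; exact: poly_approx_cst.
have h2 z : S z -> normc ((p' - p) * (z - p)^-1) <= 2^-1.
  move=> Sz; rewrite normcf ler_pdivrMr; first by have := Sp z Sz; lra.
  by have := Sp z Sz; lra.
apply: poly_approx_ext (poly_approxM hu (poly_approx_geom h2 h1)) => z Sz.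
have n0 : z - p != 0 by rewrite -normc_gt0; have := Sp z Sz; lra.
rewrite -invfM mulrBr mulr1 mulrCA divff // mulr1; congr (_^-1); ring.
Qed.

(** Geometric series in z/p. This is the starting point from which poles are pushed inwards. *)
Lemma poly_approx_far p : 0 < B -> 2 * B <= normc p -> poly_approx S (fun z => (z - p)^-1).
Proof.
move=> B0 pB; have p0 : p != 0 by rewrite -normc_gt0; lra.
have h1 : poly_approx S (fun z => p^-1 * z).
  apply: poly_approxM; first exact: poly_approx_cst.
  by have := poly_approx_horner S 'X; under [X in poly_approx _ X]eq_fun do rewrite hornerX.
have h2 z : S z -> normc (p^-1 * z) <= 2^-1.
  by move=> Sz; rewrite mulrC normcf ler_pdivrMr; have := SB Sz; lra.
apply: poly_approx_ext (poly_approxM (@poly_approx_cst S (- p^-1)) (poly_approx_geom h2 h1)) => z Sz.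
rewrite -invrN -invfM; congr (_^-1); rewrite mulrBr mulr1 mulrA mulNr divff //; ring.
Qed.

End Bounded.

Lemma core_bounded D (B y : R) z : core D B y z -> normc z <= B.
Proof. by case. Qed.

Lemma core_away D (B y : R) p z : ~ D p -> core D B y z -> y <= normc (z - p).
Proof. by move=> Dp [_ h]; rewrite leNgt; apply/negP => zp; apply/Dp/h; rewrite normcC. Qed.

Lemma locally_approxD D f g : locally_approx D f -> locally_approx D g -> locally_approx D (fun z => f z + g z).
Proof. by move=> hf hg B y y0; apply: poly_approxD; [exact: hf|exact: hg]. Qed.

Lemma locally_approxM D f g : locally_approx D f -> locally_approx D g -> locally_approx D (fun z => f z * g z).
Proof. by move=> hf hg B y y0; apply: (poly_approxM (@core_bounded D B y)); [exact: hf|exact: hg]. Qed.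

Lemma locally_approx_cst D c : locally_approx D (fun=> c).
Proof. by move=> B y _; exact: poly_approx_cst. Qed.

Lemma locally_approx_sum D (I : Type) (s : seq I) (F : I -> R[i] -> R[i]) : (forall i, locally_approx D (F i)) ->
  locally_approx D (fun z => \sum_(i <- s) F i z).
Proof. by move=> h B y y0; apply: poly_approx_sum => i; exact: h. Qed.

Lemma antiderivative_poly (p : {poly R[i]}) : exists Q : R[i] -> R[i], forall z, cdiff Q z p.[z].
Proof.
pose c k : R[i] := if k is k'.+1 then p`_k' / k'.+1%:R else 0.
exists (cpoly c (size p).+1) => z; apply: cdiff_eqd (cdiff_cpoly c (size p) z).
rewrite /cpoly horner_coef; apply: eq_bigr => i _.
by rewrite /c mulrCA divff ?mulr1 // pnatr_eq0.
Qed.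

Lemma poly_ccont (p : {poly R[i]}) z : ccont (fun z => p.[z]) z.
Proof.
move=> e e0; have [dl dl0 h] := ccont_cpoly (fun k => p`_k) (size p) z e0.
by exists dl => // w /h; rewrite /cpoly !horner_coef.
Qed.

Lemma natr_inv_small (e : R) : 0 < e -> exists n0 : nat, forall n : nat, (n0 <= n)%N -> n.+1%:R^-1 <= e.
Proof.
move=> e0; exists (Num.trunc e^-1).+1 => n hn.
rewrite invf_ple ?posrE // ?ltr0n //.
have h := truncnS_gt e^-1; apply: le_trans (ltW h) _.
by rewrite ler_nat; exact: leq_trans hn (leqnSn n).
Qed.

Lemma natr_large (x : R) : exists n0 : nat, forall n : nat, (n0 <= n)%N -> x <= n%:R.
Proof.
exists (Num.trunc x).+1 => n hn; have h := truncnS_gt x; apply: le_trans (ltW h) _.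
by rewrite ler_nat.
Qed.

Lemma core_exhaust D z (r : R) : 0 < r -> (forall w, normc (w - z) < 2 * r -> D w) ->
  exists n0 : nat, forall n : nat, (n0 <= n)%N -> forall w, normc (w - z) < r -> core D n%:R n.+1%:R^-1 w.
Proof.
move=> r0 rD; have [n1 h1] := natr_inv_small r0; have [n2 h2] := natr_large (normc z + r).
exists (maxn n1 n2) => n; rewrite geq_max => /andP[/h1 {}h1 /h2 {}h2] w wz; split.
  by have := normcD (w - z) z; rewrite subrK; lra.
by move=> v vw; apply: rD; have := normc_tri w v z; have := lt_le_trans vw h1; lra.
Qed.

(** Polynomials p_n approximate h within 1/(n+1) on the n-th member of an exhaustion. Their
    primitives, normalized at [z0], converge at every point of [D], and the limit is differentiated
    by [cdiff_limit]. *)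
Lemma locally_approx_primitive D h z0 : open D -> clopen_conn D -> D z0 -> locally_approx D h ->
  exists f, forall z, D z -> cdiff f z (h z).
Proof.
move=> /opencP oD cD Dz0 hh.
have /choice[p hp] (n : nat) : exists p : {poly R[i]}, forall z, core D n%:R n.+1%:R^-1 z ->
    normc (h z - p.[z]) <= n.+1%:R^-1 by apply: hh; rewrite ?invr_gt0 ltr0n.
have /choice[Q0 hQ0] (n : nat) := antiderivative_poly (p n).
pose Q n z := Q0 n z - Q0 n z0.
have hQ n z : cdiff (Q n) z (p n).[z].
  by apply: cdiff_eqd (cdiffB (hQ0 n z) (cdiff_cst (Q0 n z0) z)); rewrite subr0.
have unif z : D z -> exists2 r, 0 < r & (forall w, normc (w - z) < 2 * r -> D w) /\
    forall e : R, 0 < e -> exists n0 : nat, forall (n : nat) w, (n0 <= n)%N -> normc (w - z) < r ->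
    normc ((p n).[w] - h w) <= e.
  move=> /oD[r r0 rD]; exists (r / 2); first by lra.
  split; first by move=> w wz; apply: rD; lra.
  move=> e e0; have [n1 h1] := natr_inv_small e0.
  have [||n2 h2] := @core_exhaust D z (r / 2); first by lra.
    by move=> w wz; apply: rD; lra.
  exists (maxn n1 n2) => n w; rewrite geq_max => /andP[/h1 {}h1 /h2 {}h2] wz.
  by rewrite normcC; apply: le_trans h1; apply: hp; exact: h2.
have diffQ z : D z -> exists2 r, 0 < r & forall w, normc (w - z) < r ->
    forall e : R, 0 < e -> exists n0 : nat, forall n m : nat, (n0 <= n)%N -> (n0 <= m)%N ->
    normc (Q n w - Q n z - (Q m w - Q m z)) <= e.
  move=> /unif[r r0 [_ hr]]; exists r => // w wz e e0.
  have [|n0 hn0] := hr (e / (2 * r)); first by rewrite divr_gt0 //; lra.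
  exists n0 => n m nn nm.
  have := @mean_value_bound _ (fun x => Q n x - Q m x) (fun x => (p n).[x] - (p m).[x]) z w (e / r).
  have er : 0 <= e / r by rewrite divr_ge0 // ltW.
  move=> /(_ er) H.
  have -> : Q n w - Q n z - (Q m w - Q m z) = Q n w - Q m w - (Q n z - Q m z) by ring.
  apply: le_trans (H _) _.
    move=> t /andP[t0 t1]; split; first by apply: cdiffB; exact: hQ.
    have wr : normc (z + t%:C * (w - z) - z) < r.
      rewrite addrC addKr normcM normc_real ger0_norm //.
      by have := ler_wpM2r (normc_ge0 (w - z)) t1; clear -wz; lra.
    have a1 := hn0 n _ nn wr; have a2 := hn0 m _ nm wr.
    apply: le_trans (normc_tri (h (z + t%:C * (w - z))) _ _) _.
    rewrite (normcC (h _)); apply: le_trans (lerD a1 a2) _.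
    by rewrite le_eqVlt; apply/orP; left; apply/eqP; field; rewrite gt_eqF.
  by rewrite -[leRHS](@divfK _ r) ?gt_eqF // ler_wpM2l // ltW.
(* Differences of [Q n] over a small disc converge uniformly, so convergence at one point of the
   disc is equivalent to convergence at any other; it holds at [z0], where [Q n] is 0, and spreads
   by connectedness. *)
pose cauchy z := forall e : R, 0 < e -> exists n0 : nat, forall n m : nat, (n0 <= n)%N -> (n0 <= m)%N ->
    normc (Q n z - Q m z) <= e.
have cauchy_move z w : (forall e : R, 0 < e -> exists n0 : nat, forall n m : nat, (n0 <= n)%N -> (n0 <= m)%N ->
    normc (Q n w - Q n z - (Q m w - Q m z)) <= e) -> cauchy z -> cauchy w.
  move=> h1 h2 e e0; have [|n1 {}h1] := h1 (e / 2); first by lra.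
  have [|n2 {}h2] := h2 (e / 2); first by lra.
  exists (maxn n1 n2) => n m; rewrite !geq_max => /andP[a1 a2] /andP[b1 b2].
  have -> : Q n w - Q m w = (Q n w - Q n z - (Q m w - Q m z)) + (Q n z - Q m z) by ring.
  by apply: le_trans (normcD _ _) _; have := h1 n m a1 b1; have := h2 n m a2 b2; lra.
have cauchyD z : D z -> cauchy z.
  move=> Dz; apply: (cD cauchy) Dz0 Dz _ => [y /diffQ[r r0 hr]|e e0].
    exists r => //; have [cy|ncy] := pselect (cauchy y); [left|right] => w wy.
      exact: cauchy_move (hr w wy) cy.
    move=> cw; apply: ncy; apply: cauchy_move cw => e e0.
    have [n0 hn] := hr w wy e e0; exists n0 => n m nn nm; have := hn n m nn nm.
    by rewrite -normcN; congr (normc _ <= _); ring.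
  by exists 0%N => n m _ _; rewrite /Q !subrr normc0 ltW.
pose f z := xget 0 [set l | clim (fun n => Q n z) l].
have hf z : D z -> clim (fun n => Q n z) (f z).
  move=> /cauchyD cz; apply: (@xgetPex _ _ [set l | clim (fun n => Q n z) l]).
  by apply: cauchy_clim => e /cz[n0 hn]; exists n0 => n nn; apply: hn.
exists f => z Dz; have [r r0 [rD hr]] := unif z Dz.
apply: (@cdiff_limit _ (fun n w => (p n).[w]) Q h f z r) => //.
  by move=> w wz; apply/hf/rD; lra.
move=> e e0; have [|n0 hn] := hr (e / 3); first by lra.
have [|dl dl0 hd] := poly_ccont (p n0) z (_ : 0 < e / 3); first by lra.
exists (Num.min dl r); first by rewrite lt_min dl0.
move=> w; rewrite lt_min => /andP[/hd {}hd wr].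
have a1 := hn n0 w (leqnn _) wr; have a2 := hn n0 z (leqnn _); rewrite subrr normc0 in a2.
have {}a2 := a2 r0.
have := normc_tri (p n0).[w] (h w) (h z); have := normc_tri (p n0).[z] (p n0).[w] (h z).
by rewrite (normcC (h w) (p n0).[w]); clear -hd a1 a2; lra.
Qed.

End PolyApprox.

(** * Boundary charts and boundary values *)

Section Charts.
Context {R : realType}.
Implicit Types (f g h : R[i] -> R[i]) (p q z w u v : R[i]) (D : set R[i]).

(** In the coordinate (z - p)/nu the domain is the part above a graph through 0; the quadratic bound
    makes [nu] tangent to the boundary, so ['i * nu] is the interior normal. The slope 1/2 makes
    vertical cones lie in [D]. Later [r0] and [C] are the same for all boundary points. *)
Definition graph_chart D p nu (r0 C : R) := exists phi : R -> R,
  [/\ forall x, `|x| < r0 -> `|phi x| <= C * x ^+ 2,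
      forall x y, `|x| < r0 -> `|y| < r0 -> `|phi x - phi y| <= `|x - y| / 2 &
      forall u, `|complex.Re u| < r0 -> `|complex.Im u| < r0 ->
        (D (p + nu * u) <-> phi (complex.Re u) < complex.Im u)].

Section LocalPath.
Variables (D : set R[i]) (p nu : R[i]) (r0 C : R).
Hypotheses (nu1 : normc nu = 1) (r00 : 0 < r0) (ch : graph_chart D p nu r0 C).

Let nu0 : nu != 0. Proof. by rewrite -normc_gt0 nu1. Qed.

Lemma chart_dist u v : normc (p + nu * u - (p + nu * v)) = normc (u - v).
Proof. by rewrite -[RHS]mul1r -nu1 -normcM; congr (normc _); ring. Qed.

Lemma chart_dist0 u : normc (p + nu * u - p) = normc u.
Proof. by rewrite addrC addKr normcM nu1 mul1r. Qed.

Lemma chart_coord z : exists2 u, z = p + nu * u & normc u = normc (z - p).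
Proof.
exists ((z - p) / nu); first by rewrite mulrC divfK //; ring.
by rewrite normcf nu1 divr1.
Qed.

Lemma chart_above u (x : R) : normc u + x < r0 -> 0 <= x -> D (p + nu * u) ->
  D (p + nu * (u + 'i * x%:C)).
Proof.
case: ch => phi [_ _ h] ux x0.
have h1 := normc_Re u; have h2 := normc_Im u.
have eR : complex.Re (u + 'i * x%:C) = complex.Re u by rewrite cReD cReM /=; ring.
have eI : complex.Im (u + 'i * x%:C) = complex.Im u + x by rewrite cImD cImM /=; ring.
have h3 : `|complex.Im u + x| < r0 by apply: le_lt_trans (ler_normD _ _) _; rewrite (ger0_norm x0); lra.
have rR : `|complex.Re u| < r0 by lra.
have rI : `|complex.Im u| < r0 by lra.
move=> /(h u rR rI) h4; apply/h; rewrite ?eR ?eI //; lra.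
Qed.

(** The cone of slope 1/2 above a point of [D] lies in [D]. Within radius y the height drops by at
    most y and the cone rises by at most y/2, so clearing it by 2y is enough. *)
Lemma chart_deep u (y : R) : 0 <= y -> normc u + y <= r0 ->
  (exists2 v, D (p + nu * v) & normc v < r0 /\ `|complex.Re u - complex.Re v| / 2 + complex.Im v + 2 * y <= complex.Im u) ->
  forall w, normc (w - (p + nu * u)) < y -> D w.
Proof.
case: ch => phi [_ lip h] y0 uy [v Dv [vr uv]] w wy.
have [u' wE _] := chart_coord w; rewrite wE chart_dist in wy *.
have h1 := normc_Re u; have h2 := normc_Im u; have h3 := normc_Re v; have h4 := normc_Im v.
have h5 := normc_Re (u' - u); have h6 := normc_Im (u' - u); rewrite !(cReD, cReN, cImD, cImN) in h5 h6.
have nu' := normcD (u' - u) u; rewrite subrK in nu'.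
have h7 := normc_Re u'; have h8 := normc_Im u'.
have rR : `|complex.Re v| < r0 by lra.
have rI : `|complex.Im v| < r0 by lra.
have rR' : `|complex.Re u'| < r0 by lra.
have rI' : `|complex.Im u'| < r0 by lra.
have a1 := (h v rR rI).1 Dv.
apply/h => //; have := lip _ _ rR' rR; rewrite ler_norml => /andP[_].
have := ler_normD (complex.Re u' - complex.Re u) (complex.Re u - complex.Re v); rewrite subrKA.
move: h6; rewrite ler_norml => /andP[h6 _]; lra.
Qed.

Lemma chart_segment h h1 (M : R) u v : 0 <= M ->
  (forall t : R, 0 <= t <= 1 -> cdiff h (p + nu * (u + t%:C * (v - u))) (h1 (p + nu * (u + t%:C * (v - u)))) /\
     normc (h1 (p + nu * (u + t%:C * (v - u)))) <= M) ->
  normc (h (p + nu * v) - h (p + nu * u)) <= M * normc (v - u).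
Proof.
move=> M0 H; rewrite -(chart_dist v u); apply: (@mean_value_bound _ h h1) => // t /H.
by rewrite (_ : p + nu * u + _ = p + nu * (u + t%:C * (v - u))) //; ring.
Qed.

Variables (h h1 : R[i] -> R[i]) (S y e M : R).
Hypotheses (y0 : 0 <= y) (yS : 8 * y <= S) (S0 : 0 < S) (Sr : S <= r0 / 2) (M0 : 0 <= M) (e0 : 0 <= e).
Hypothesis hd : forall z, D z -> normc (z - p) < S -> [/\ cdiff h z (h1 z), normc (h1 z) <= M &
  (forall w, normc (w - z) < y -> D w) -> normc (h1 z) <= e].

Let small (x t : R) : `|x| <= S / 8 -> `|t| <= S / 2 -> normc (x +i* t) < S.
Proof.
move: (S0) => S0'.
by move=> hx ht; apply: le_lt_trans (normc_ReIm _) _; apply: le_lt_trans (lerD hx ht) _; lra.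
Qed.

Let vert (x t0 t1 : R) (N : R) : 0 <= N -> t0 <= t1 -> - (S / 8) <= t0 -> t1 <= S / 2 -> `|x| <= S / 8 -> D (p + nu * (x +i* t0)) ->
    (forall t, t0 <= t <= t1 -> normc (h1 (p + nu * (x +i* t))) <= N) ->
    normc (h (p + nu * (x +i* t1)) - h (p + nu * (x +i* t0))) <= N * (t1 - t0).
Proof.
move: (S0) (Sr) (r00) => S0' Sr' r00'.
move=> N0 t01 b0 b1 xS Dx hN.
have eN : normc ((x +i* t1) - (x +i* t0)) = t1 - t0.
  rewrite (_ : _ - _ = 'i * (t1 - t0)%:C); first by rewrite normcM normc_i normc_real mul1r ger0_norm //; lra.
  by apply/eqP; rewrite eq_complex /=; apply/andP; split; apply/eqP; ring.
rewrite -eN; apply: (@chart_segment h h1) => // t /andP[k0 k1].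
have d0 : 0 <= t1 - t0 by lra.
have k2 := mulr_ge0 k0 d0; have k3 := ler_wpM2r d0 k1.
have -> : (x +i* t0) + t%:C * ((x +i* t1) - (x +i* t0)) = x +i* (t0 + t * (t1 - t0)).
  by apply/eqP; rewrite eq_complex /=; apply/andP; split; apply/eqP; ring.
have Dt : D (p + nu * (x +i* (t0 + t * (t1 - t0)))).
  have := @chart_above (x +i* t0) (t * (t1 - t0)) _ k2 Dx.
  rewrite (_ : (x +i* t0) + _ = x +i* (t0 + t * (t1 - t0))); last first.
    by apply/eqP; rewrite eq_complex /=; apply/andP; split; apply/eqP; ring.
  apply; have k4 : t * (t1 - t0) <= S / 2 + S / 8 by lra.
  have k5 : normc (x +i* t0) <= S / 8 + S / 2.
    apply: le_trans (normc_ReIm _) _; apply: (lerD xS); rewrite ler_norml /=; lra.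
  lra.
have [|c1 _ _] := hd Dt _; last by split => //; apply: hN; lra.
by rewrite chart_dist0; apply: small => //; rewrite ler_norml; lra.
Qed.

Let deepv (b s0 x t : R) : D (p + nu * (b +i* s0)) -> normc (b +i* s0) <= S / 8 ->
   `|x| <= S / 8 -> `|t| <= S / 2 -> `|x - b| / 2 + s0 + 2 * y <= t ->
   D (p + nu * (x +i* t)) /\ normc (h1 (p + nu * (x +i* t))) <= e.
Proof.
move: (y0) (yS) (S0) (Sr) (r00) => y0' yS' S0' Sr' r00'.
move=> Db nb xS tS xt; have sm := small xS tS.
have dp : forall w, normc (w - (p + nu * (x +i* t))) < y -> D w.
  apply: chart_deep => //; first by lra.
  by exists (b +i* s0) => //; split; [lra|exact: xt].
have Dt : D (p + nu * (x +i* t)).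
  (* For y = 0 the ball is empty and says nothing, so membership comes from the graph itself; this
     case gives the plain Lipschitz estimate of f. *)
  have [y00|y00] := ltP 0 y; first by apply: dp; rewrite subrr normc0.
  have yz : y = 0 by lra.
  have := @chart_deep (x +i* t) 0 (lexx _).
  case: ch => phi [_ lip hh].
  have q1 : `|b| <= normc (b +i* s0) := normc_Re (b +i* s0).
  have q2 : `|s0| <= normc (b +i* s0) := normc_Im (b +i* s0).
  have rb : `|b| < r0 by lra.
  have rs0 : `|s0| < r0 by lra.
  have rx : `|x| < r0 by lra.
  have rt : `|t| < r0 by lra.
  have q3 : phi b < s0 := (hh (b +i* s0) rb rs0).1 Db.
  move=> _.
  by apply/hh => //=; have := lip x b rx rb; rewrite ler_norml => /andP[_]; lra.
split => //; have [|_ _] := hd Dt _; last by apply.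
by rewrite chart_dist0.
Qed.

Let up (L b s0 : R) : `|L| <= S / 2 -> D (p + nu * (b +i* s0)) -> normc (b +i* s0) <= S / 8 -> `|b| <= S / 8 -> - (S / 8) <= s0 -> s0 + 2 * y <= L ->
    normc (h (p + nu * (b +i* L)) - h (p + nu * (b +i* s0))) <= M * (2 * y) + e * (L - s0 - 2 * y).
Proof.
move: (y0) (yS) (S0) (Sr) (M0) (e0) => y0' yS' S0' Sr' M0' e0'.
move=> Sb Db nb bS s0S sL; have L2 : L <= S / 2 := le_trans (ler_norm L) Sb.
have q1 : normc (h (p + nu * (b +i* (s0 + 2 * y))) - h (p + nu * (b +i* s0))) <= M * (s0 + 2 * y - s0).
  apply: vert => //; [lra|lra|move=> t /andP[k0 k1]].
  have Dt : D (p + nu * (b +i* t)).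
    have := @chart_above (b +i* s0) (t - s0) _ _ Db.
    rewrite (_ : (b +i* s0) + _ = b +i* t); last first.
      by apply/eqP; rewrite eq_complex /=; apply/andP; split; apply/eqP; ring.
    by apply; lra.
  have [|_ + _] := hd Dt _; last by [].
  by rewrite chart_dist0; apply: small => //; rewrite ler_norml; lra.
have Dv2 : D (p + nu * (b +i* (s0 + 2 * y))).
  have := @chart_above (b +i* s0) (2 * y) _ _ Db.
  rewrite (_ : (b +i* s0) + _ = b +i* (s0 + 2 * y)); last first.
    by apply/eqP; rewrite eq_complex /=; apply/andP; split; apply/eqP; ring.
  by apply; lra.
have q2 : normc (h (p + nu * (b +i* L)) - h (p + nu * (b +i* (s0 + 2 * y)))) <= e * (L - (s0 + 2 * y)).
  apply: vert => //; [lra|move=> t /andP[k0 k1]].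
  apply: (proj2 (@deepv b s0 b t Db nb bS _ _)); first by rewrite ler_norml; lra.
  by rewrite subrr normr0; lra.
have := normc_tri (h (p + nu * (b +i* (s0 + 2 * y)))) (h (p + nu * (b +i* L))) (h (p + nu * (b +i* s0))).
lra.
Qed.

(* The path goes up from [u], across, and down to [v]; only the two parts of
   height [2 y] next to the boundary see the bound [M]. *)
Lemma local_path u v : D (p + nu * u) -> D (p + nu * v) -> normc u <= S / 8 -> normc v <= S / 8 ->
  normc (h (p + nu * v) - h (p + nu * u)) <= 3 * e * normc (v - u) + 4 * M * y.
Proof.
move: (y0) (yS) (S0) (Sr) (M0) (e0) (r00) => y0' yS' S0' Sr' M0' e0' r00'.
case: u => a s; case: v => a' s' Du Dv nu_ nv.
have ra : `|a| <= normc (a +i* s) := normc_Re (a +i* s).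
have rs : `|s| <= normc (a +i* s) := normc_Im (a +i* s).
have ra' : `|a'| <= normc (a' +i* s') := normc_Re (a' +i* s').
have rs' : `|s'| <= normc (a' +i* s') := normc_Im (a' +i* s').
have nd1 : `|a' - a| <= normc ((a' +i* s') - (a +i* s)) := normc_Re ((a' +i* s') - (a +i* s)).
have nd2 : `|s' - s| <= normc ((a' +i* s') - (a +i* s)) := normc_Im ((a' +i* s') - (a +i* s)).
(* The height of the crossing: it clears by 2y the cones above both ends over the whole horizontal
   distance. *)
pose L := Num.max s s' + `|a' - a| / 2 + 2 * y.
have Ls : s + `|a' - a| / 2 + 2 * y <= L by rewrite !lerD // le_max lexx.
have Ls' : s' + `|a' - a| / 2 + 2 * y <= L by rewrite !lerD // le_max lexx orbT.
(* Apart from the two lowest pieces the vertical parts have total length |s' - s| + |a' - a|. With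
   the crossing this is at most three times the distance of the ends. *)
have Lsum : (L - s - 2 * y) + (L - s' - 2 * y) = `|s' - s| + `|a' - a|.
  rewrite /L; case: leP => ss; first by rewrite (ger0_norm (_ : 0 <= s' - s)); lra.
  by rewrite (ltr0_norm (_ : s' - s < 0)); lra.
have nn := normr_ge0 (a' - a).
have Lle : L <= S / 8 + S / 8 + 2 * y.
  clear Ls Ls' Lsum nd1 nd2 M0' e0' Sr' r00'.
  move: ra ra' rs rs'; rewrite !ler_norml /L => /andP[p1 p2] /andP[p3 p4] /andP[p5 p6] /andP[p7 p8].
  have p9 : `|a' - a| <= S / 4 by rewrite ler_norml; lra.
  by case: (leP s s') => ss; lra.
clearbody L.
have Sb : `|L| <= S / 2 by rewrite ler_norml; move: rs; rewrite ler_norml => /andP[]; lra.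
have rs1 := rs; have rs1' := rs'; rewrite ler_norml in rs1; rewrite ler_norml in rs1'.
have ram : `|a| <= S / 8 by exact: le_trans ra nu_.
have ram' : `|a'| <= S / 8 by exact: le_trans ra' nv.
have u1 : normc (h (p + nu * (a +i* L)) - h (p + nu * (a +i* s))) <= M * (2 * y) + e * (L - s - 2 * y).
  clear Lsum Lle Ls' nd1 nd2 ra ra' rs rs' rs1' ram' e0' M0' r00' Sr'.
  by apply: up => //; lra.
have u2 : normc (h (p + nu * (a' +i* L)) - h (p + nu * (a' +i* s'))) <= M * (2 * y) + e * (L - s' - 2 * y).
  clear Lsum Lle Ls nd1 nd2 ra ra' rs rs' rs1 ram e0' M0' r00' Sr' u1.
  by apply: up => //; lra.
have u3 : normc (h (p + nu * (a' +i* L)) - h (p + nu * (a +i* L))) <= e * `|a' - a|.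
  clear Lsum Lle Ls' nd1 nd2 ra ra' rs rs' rs1 rs1' M0' r00' Sr' u1 u2 nv y0' yS' S0'.
  have -> : `|a' - a| = normc ((a' +i* L) - (a +i* L)).
    rewrite -normc_real; congr (normc _).
    by apply/eqP; rewrite eq_complex /=; apply/andP; split; apply/eqP; ring.
  apply: (@chart_segment h h1) => // t /andP[t0 t1].
  have -> : (a +i* L) + t%:C * ((a' +i* L) - (a +i* L)) = (a + t * (a' - a)) +i* L.
    by apply/eqP; rewrite eq_complex /=; apply/andP; split; apply/eqP; ring.
  have hx : `|a + t * (a' - a)| <= S / 8.
    rewrite (_ : a + _ = (1 - t) * a + t * a'); last by ring.
    apply: le_trans (ler_normD _ _) _; rewrite !normrM (ger0_norm t0) ger0_norm; last by lra.
    have z1 : 0 <= 1 - t by lra.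
    have := ler_wpM2l z1 ram; have := ler_wpM2l t0 ram'; lra.
  have hxa : `|a + t * (a' - a) - a| <= `|a' - a|.
    rewrite addrC addKr normrM (ger0_norm t0); have := ler_wpM2r nn t1; lra.
  have [|Dt et] := @deepv a s _ L Du nu_ hx Sb (_ : _ <= L); first by lra.
  have [|c _ _] := hd Dt _; last by [].
  by rewrite chart_dist0; exact: small.
have := normc_tri (h (p + nu * (a' +i* L))) (h (p + nu * (a' +i* s'))) (h (p + nu * (a +i* s))).
have := normc_tri (h (p + nu * (a +i* L))) (h (p + nu * (a' +i* L))) (h (p + nu * (a +i* s))).
rewrite (normcC (h (p + nu * (a' +i* s'))) (h (p + nu * (a' +i* L)))) => q1 q2.
have q3 : e * (L - s - 2 * y) + e * (L - s' - 2 * y) + e * `|a' - a| <= 3 * e * normc ((a' +i* s') - (a +i* s)).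
  rewrite -!mulrDr Lsum (mulrC 3) -mulrA ler_wpM2l //.
  clear u1 u2 u3 q1 q2 Lle Ls Ls' ra ra' rs rs' rs1 rs1' ram ram' r00' Sr' S0' yS' nu_ nv Sb.
  by lra.
clear Lsum Lle Ls Ls' nd1 nd2 ra ra' rs rs' rs1 rs1' ram ram' r00' Sr' S0' yS' nu_ nv Sb; lra.
Qed.

End LocalPath.
End Charts.

Section BoundaryValues.
Context {R : realType}.
Implicit Types (f g h : R[i] -> R[i]) (p q z w u v l : R[i]) (D : set R[i]).

Definition bd_lim D f p l := forall e : R, 0 < e -> exists2 dl : R, 0 < dl &
  forall z, D z -> normc (z - p) < dl -> normc (f z - l) <= e.

(* Takes the value 0 where the limit does not exist. *)
Definition bd_ext D f p : R[i] := xget 0 [set l | bd_lim D f p l].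

Lemma bd_lim_unique D f p l l' : closure D p -> bd_lim D f p l -> bd_lim D f p l' -> l = l'.
Proof.
move=> /closurecP cp h h'; apply/eqP; rewrite -subr_eq0; apply/eqP/normc_le0.
apply/ler_addgt0Pr => e e0; rewrite add0r.
have [|d1 d10 h1] := h (e / 2); first by lra.
have [|d2 d20 h2] := h' (e / 2); first by lra.
have [|z Dz] := cp (Num.min d1 d2); first by rewrite lt_min d10.
rewrite lt_min => /andP[/(h1 z Dz) a1 /(h2 z Dz) a2].
by have := normc_tri (f z) l l'; rewrite (normcC l (f z)); lra.
Qed.

Lemma bd_extP D f p : (exists l, bd_lim D f p l) -> bd_lim D f p (bd_ext D f p).
Proof. by move=> h; exact: (@xgetPex _ _ [set l | bd_lim D f p l]). Qed.

Lemma ccont_bd_lim D f p : ccont f p -> bd_lim D f p (f p).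
Proof. by move=> h e /h[dl dl0 H]; exists dl => // z _; exact: H. Qed.

Lemma bd_ext_in D f p : D p -> ccont f p -> bd_ext D f p = f p.
Proof.
move=> Dp cf; apply: bd_lim_unique (subset_closure Dp) _ (ccont_bd_lim D cf).
by apply: bd_extP; exists (f p); exact: ccont_bd_lim.
Qed.

Lemma bd_limB D f g p l m : bd_lim D f p l -> bd_lim D g p m -> bd_lim D (fun z => f z - g z) p (l - m).
Proof.
move=> hf hg e e0; have [|d1 d10 h1] := hf (e / 2); first by lra.
have [|d2 d20 h2] := hg (e / 2); first by lra.
exists (Num.min d1 d2); first by rewrite lt_min d10.
move=> z Dz; rewrite lt_min => /andP[/(h1 z Dz) a1 /(h2 z Dz) a2].
rewrite (_ : _ - _ = (f z - l) - (g z - m)); last by ring.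
by apply: le_trans (normcB _ _) _; lra.
Qed.

(** Carries the estimates of [local_path] over to boundary values; the constant term [B] is the
    contribution of the boundary layer. *)
Lemma bd_lim_le D h p q l m (A B : R) (r : R) : 0 < r -> 0 <= A -> closure D p -> closure D q -> bd_lim D h p l -> bd_lim D h q m ->
  (forall z w, D z -> D w -> normc (z - p) < r -> normc (w - q) < r -> normc (h w - h z) <= A * normc (w - z) + B) ->
  normc (m - l) <= A * normc (q - p) + B.
Proof.
move=> r0 A0 /closurecP cp /closurecP cq hl hm H; apply/ler_addgt0Pr => e e0.
have [|d1 d10 h1] := hl (e / 4); first by lra.
have [|d2 d20 h2] := hm (e / 4); first by lra.
pose s := Num.min r (e / (4 * (A + 1))).
have s0 : 0 < s by rewrite lt_min r0 divr_gt0 //; lra.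
have sr : s <= r by rewrite ge_min lexx.
have sA : s * (4 * (A + 1)) <= e by rewrite -ler_pdivlMr ?ge_min ?lexx ?orbT //; lra.
clearbody s.
have [|z Dz] := cp (Num.min d1 s); first by rewrite lt_min d10.
rewrite lt_min => /andP[/(h1 z Dz) a1 zp].
have [|w Dw] := cq (Num.min d2 s); first by rewrite lt_min d20.
rewrite lt_min => /andP[/(h2 w Dw) a2 wq].
have a3 := H z w Dz Dw (lt_le_trans zp sr) (lt_le_trans wq sr).
have a4 : normc (w - z) <= normc (q - p) + s + s.
  have := normc_tri q w z; have := normc_tri p q z; rewrite (normcC p z); clear -zp wq; lra.
have a5 := ler_wpM2l A0 a4.
have := normc_tri (h w) m l; have := normc_tri (h z) (h w) l; rewrite (normcC m (h w)).
(clear -s0 sA a1 a2 a3 a5; lra).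
Qed.

Lemma bd_lim_ex D f p (r K : R) : 0 < r -> 0 <= K -> closure D p ->
  (forall z w, D z -> D w -> normc (z - p) < r -> normc (w - p) < r -> normc (f w - f z) <= K * normc (w - z)) ->
  exists l, bd_lim D f p l.
Proof.
move=> r0 K0 /closurecP cp H.
have /choice[u hu] (n : nat) : exists z, D z /\ normc (z - p) < n.+1%:R^-1.
  by have [|z] := cp n.+1%:R^-1; [rewrite invr_gt0 ltr0n|exists z].
have key (e : R) : 0 < e -> exists n0 : nat, forall n : nat, (n0 <= n)%N -> normc (u n - p) < r /\ K * normc (u n - p) <= e.
  move=> e0; have [|n0 h0] := @natr_inv_small R (Num.min (r / 2) (e / (K + 1))).
    by rewrite lt_min !divr_gt0 //; lra.
  exists n0 => n /h0; rewrite le_min => /andP[a1 a2]; have [_ a3] := hu n.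
  have {}a1 := lt_le_trans a3 a1; have {}a2 := lt_le_trans a3 a2.
  split; first by lra.
  move: a2; rewrite ltr_pdivlMr; last by lra.
  by have := normc_ge0 (u n - p); lra.
have [|l ul] := @cauchy_clim R (fun n => f (u n)).
  move=> e e0; have [|n0 h0] := key (e / 2); first by lra.
  exists n0 => n nn; have [a1 a2] := h0 n nn; have [b1 b2] := h0 n0 (leqnn _).
  have [Du _] := hu n; have [Dv _] := hu n0.
  apply: le_trans (H _ _ Dv Du b1 a1) _.
  have := ler_wpM2l K0 (normc_tri p (u n) (u n0)); rewrite (normcC p (u n0)); lra.
exists l => e e0; exists (Num.min r (e / (2 * (K + 1)))).
  by rewrite lt_min r0 divr_gt0 //; lra.
move=> z Dz; rewrite lt_min => /andP[zr]; rewrite ltr_pdivlMr; last by lra.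
move=> ze; rewrite normcC; apply: clim_le ul _.
have [|n0 h0] := key (e / 2); first by lra.
exists n0 => n /h0[a1 a2]; have [Du _] := hu n.
apply: le_trans (H _ _ Dz Du zr a1) _.
have := ler_wpM2l K0 (normc_tri p (u n) z); rewrite (normcC p z).
by have := normc_ge0 (z - p); lra.
Qed.

(** Two points of the closure are compared through a point of [D] close to one of them, since the
    limits are taken from inside only. *)
Lemma bd_lim_continuous D fb : (forall p, closure D p -> bd_lim D fb p (fb p)) ->
  {within closure D, continuous fb}.
Proof.
move=> H; apply/subspace_continuousP => p cp B /nbhscP[e e0 eB].
have [|dl dl0 hd] := H p cp (e / 3); first by lra.
apply/nbhscP; exists (dl / 2); first by lra.
move=> z zp cz; apply: eB.
have [|d1 d10 h1] := H z cz (e / 3); first by lra.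
have [|w Dw] := (closurecP D z).1 cz (Num.min d1 (dl / 2)); first by rewrite lt_min d10; lra.
rewrite lt_min => /andP[/(h1 w Dw) a1 wz].
have := hd w Dw; have := normc_tri z w p; have := normc_tri (fb w) (fb z) (fb p).
rewrite (normcC (fb z) (fb w)) => q1 q2 q3.
have : normc (w - p) < dl by lra.
by move=> /q3; lra.
Qed.

End BoundaryValues.

(** * Construction of the derivative *)

Section Stage.
Context {R : realType}.
Implicit Types (f g h : R[i] -> R[i]) (p q z w u v b : R[i]) (D : set R[i]).

(* [i nu sigma / (z - p)] with its pole [p = zeta - i nu sigma] just outside the
   domain: a bump equal to 1 at the boundary point [zeta], of width [sigma]. *)
Definition pole_bump (zeta nu : R[i]) (sigma : R) z := (1 - 'i * ((z - zeta) / (nu * sigma%:C)))^-1.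

Lemma bump_pole zeta nu sigma z : nu != 0 -> sigma != 0 ->
  pole_bump zeta nu sigma z = ('i * (nu * sigma%:C)) * (z - (zeta - 'i * nu * sigma%:C))^-1.
Proof.
move=> nu0 s0; have sC : sigma%:C != 0 :> R[i] by rewrite rc_eq0.
have ii : ('i : R[i]) * 'i = -1 by rewrite -expr2 sqr_i.
have i0 : ('i : R[i]) != 0 by rewrite -normc_gt0 normc_i.
have ni : 'i * (nu * sigma%:C) != 0 by rewrite !mulf_neq0.
rewrite -[X in X * _]invrK -invfM; congr (_^-1).
apply: (mulfI ni); rewrite [RHS]mulrA divff // mul1r mulrBr mulr1 [_ * ('i * _)]mulrA.
have -> : 'i * (nu * sigma%:C) * 'i = - (nu * sigma%:C) by rewrite mulrAC ii mulN1r.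
by rewrite mulNr opprK [_ * (_ / _)]mulrC divfK ?mulf_neq0 //; ring.
Qed.

Lemma normc_addi z : normc (z + 'i) ^+ 2 = normc z ^+ 2 + 2 * complex.Im z + 1.
Proof. by rewrite !normc_sqr; case: z => x y /=; ring. Qed.

(** In the chart Im om >= - C sigma |om|^2, and therefore |om + i|^2 = |om|^2 + 2 Im om + 1 is at
    least 1 + (1 - e) |om|^2. Outside the chart |om| >= 1/e, and the triangle inequality
    suffices. *)
Lemma bump_denom D zeta nu (r0 C e sigma : R) z : normc nu = 1 -> 0 < r0 -> 0 <= C ->
  graph_chart D zeta nu r0 C -> 0 < e -> e <= 2^-1 -> 0 < sigma -> 2 * C * sigma <= e -> sigma <= e * r0 ->
  D z -> let om := (z - zeta) / (nu * sigma%:C) in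
  1 - e <= normc (om + 'i) /\ (1 - e) * normc om <= normc (om + 'i).
Proof.
move=> nu1 r00 C0 [phi [hphi _ hD]] e0 e1 s0 Cs sr Dz om.
have nu0 : nu != 0 by rewrite -normc_gt0 nu1.
have sC : sigma%:C != 0 :> R[i] by rewrite rc_eq0 gt_eqF.
have zE : z = zeta + nu * (sigma%:C * om).
  by rewrite /om [nu * _]mulrA [nu * _ * _]mulrC divfK ?mulf_neq0 //; ring.
have nzE : normc (z - zeta) = sigma * normc om.
  by rewrite {1}zE addrC addKr !normcM nu1 mul1r normc_real gtr0_norm.
clearbody om; have no := normc_ge0 om.
have [zr|zr] := ltP (normc (z - zeta)) r0; last first.
  have h1 : r0 <= sigma * normc om by rewrite -nzE.
  have h2 : 1 <= e * normc om.
    have : sigma * 1 <= sigma * (e * normc om) by have := ler_wpM2l (ltW e0) h1; clear -sr; lra.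
    by rewrite ler_pM2l.
  have := normc_ge_add om 'i; rewrite normc_i.
  by have := ler_wpM2r no e1; split; clear -e0 h2 H H0; lra.
have hI : - (C * sigma * normc om ^+ 2) <= complex.Im om.
  have h1 := normc_Re (sigma%:C * om); have h2 := normc_Im (sigma%:C * om).
  have h3 : normc (sigma%:C * om) = sigma * normc om by rewrite normcM normc_real gtr0_norm.
  have a1 : `|complex.Re (sigma%:C * om)| < r0 by apply: le_lt_trans h1 _; rewrite h3 -nzE.
  have a2 : `|complex.Im (sigma%:C * om)| < r0 by apply: le_lt_trans h2 _; rewrite h3 -nzE.
  have := hphi _ a1; rewrite ler_norml => /andP[b1 _].
  move: Dz; rewrite zE => /(hD _ a1 a2); rewrite cImZ => b2.
  have b3 : complex.Re (sigma%:C * om) ^+ 2 <= (sigma * normc om) ^+ 2.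
    by rewrite -[leLHS]real_normK ?num_real //; apply: lerXn2r; rewrite ?nnegrE ?normr_ge0 ?mulr_ge0 ?(ltW s0) // -h3.
  have b4 := ler_wpM2l C0 b3.
  by rewrite -(ler_pM2l s0); move: b1 b2 b4; rewrite exprMn expr2; clear; lra.
have hs : 1 + (1 - e) * normc om ^+ 2 <= normc (om + 'i) ^+ 2.
  rewrite normc_addi; have := ler_wpM2r (sqr_ge0 (normc om)) Cs; clear -hI; lra.
have n0 := normc_ge0 (om + 'i).
have s2 := sqr_ge0 (normc om).
split.
  rewrite -(@ler_pXn2r _ 2) ?nnegrE //; last by clear -e1; lra.
  apply: le_trans hs; have : 0 <= (1 - e) * normc om ^+ 2 by rewrite mulr_ge0 //; clear -e1; lra.
  by rewrite expr2; nra.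
rewrite -(@ler_pXn2r _ 2) ?nnegrE //; last by rewrite mulr_ge0 //; clear -e1; lra.
apply: le_trans hs; rewrite exprMn.
have h1 : (1 - e) ^+ 2 <= 1 - e by rewrite expr2; nra.
have := ler_wpM2r s2 h1; clear; lra.
Qed.

(** With |1 - i om| = |om + i|, the bump has modulus 1/|om + i| and its difference from 1 has
    modulus |om|/|om + i|. Up to the factor 1 + 2e both are as in a half-plane: bounded by 1, the
    first decaying like sigma/|z - zeta|, the second growing from 0 like |z - zeta|/sigma. *)
Lemma bump_bounds D zeta nu (r0 C e sigma : R) z : normc nu = 1 -> 0 < r0 -> 0 <= C ->
  graph_chart D zeta nu r0 C -> 0 < e -> e <= 2^-1 -> 0 < sigma -> 2 * C * sigma <= e -> sigma <= e * r0 ->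
  D z -> [/\ normc (pole_bump zeta nu sigma z) <= 1 + 2 * e,
    normc (pole_bump zeta nu sigma z) * normc (z - zeta) <= (1 + 2 * e) * sigma,
    normc (1 - pole_bump zeta nu sigma z) <= 1 + 2 * e &
    normc (1 - pole_bump zeta nu sigma z) * sigma <= (1 + 2 * e) * normc (z - zeta)].
Proof.
move=> nu1 r00 C0 ch e0 e1 s0 Cs sr Dz.
have [] := bump_denom nu1 r00 C0 ch e0 e1 s0 Cs sr Dz.
rewrite /pole_bump; set om := (z - zeta) / _ => h1 h2.
have sC : sigma%:C != 0 :> R[i] by rewrite rc_eq0 gt_eqF.
have nu0 : nu != 0 by rewrite -normc_gt0 nu1.
have nzE : normc (z - zeta) = sigma * normc om.
  by rewrite /om normcf normcM nu1 mul1r normc_real gtr0_norm // mulrC divfK // gt_eqF.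
clearbody om; rewrite nzE.
have n0 : 0 < normc (om + 'i) by lra.
have o0 : om + 'i != 0 by rewrite -normc_gt0.
have ii : ('i : R[i]) * 'i = -1 by rewrite -expr2 sqr_i.
have dE : 1 - 'i * om = - 'i * (om + 'i) by rewrite mulrDr mulNr mulNr ii; ring.
have tE : normc (1 - 'i * om)^-1 = (normc (om + 'i))^-1 by rewrite dE normcV normcM normcN normc_i mul1r.
have d0 : 1 - 'i * om != 0 by rewrite dE mulf_neq0 // oppr_eq0 -normc_gt0 normc_i.
have t'E : normc (1 - (1 - 'i * om)^-1) = normc om / normc (om + 'i).
  have -> : 1 - (1 - 'i * om)^-1 = - ('i * om) / (1 - 'i * om).
    by apply: (mulIf d0); rewrite divfK // mulrBl mulVf //; ring.
  by rewrite normcM tE normcN normcM normc_i mul1r.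
have k0 : 0 <= 1 + 2 * e by clear -e0; lra.
(* This is where e <= 1/2 enters: 1 + 2e dominates 1/(1 - e). *)
have k1 : 1 <= (1 + 2 * e) * (1 - e) by nra.
have k2 := ler_wpM2l k0 h1; have k3 := ler_wpM2l k0 h2; rewrite mulrA in k3.
have no := normc_ge0 om; have k4 := ler_wpM2r no k1.
have q1 : (normc (om + 'i))^-1 <= 1 + 2 * e by rewrite -[leLHS]mul1r ler_pdivrMr //; clear -k1 k2; lra.
have q2 : normc om / normc (om + 'i) <= 1 + 2 * e by rewrite ler_pdivrMr //; clear -k3 k4; lra.
rewrite tE t'E; split => //.
  by rewrite mulrCA [X in _ <= X]mulrC ler_pM2l // mulrC.
rewrite -[_ / _ * sigma]mulrA [X in _ <= X]mulrA [X in _ <= X]mulrC ler_wpM2l //.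
by rewrite [X in X <= _]mulrC [X in _ <= X]mulrC ler_pM2l.
Qed.

Definition harmonic_sum (n : nat) : R := \sum_(i < n) i.+1%:R^-1.

Lemma harmonic_sum_ge1 n : (0 < n)%N -> 1 <= harmonic_sum n.
Proof.
case: n => // n _; by rewrite /harmonic_sum big_ord_recl invr1 lerDl sumr_ge0.
Qed.

Lemma harmonic_sum_le m n : (m <= n)%N -> harmonic_sum m <= harmonic_sum n.
Proof.
move=> mn; rewrite /harmonic_sum -!(big_mkord xpredT (fun i => i.+1%:R^-1)).
by rewrite (@big_cat_nat _ _ _ m 0 n) //= lerDl sumr_ge0.
Qed.

(* Distance in Z/M, for i, j < M. *)
Definition cycdist (M i j : nat) : nat := minn (i - j + (j - i)) (M - (i - j + (j - i))).

Lemma cycdist_gt0 M i j : (i < M)%N -> (j < M)%N -> i != j -> (0 < cycdist M i j)%N.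
Proof.
move=> iM jM ij; rewrite /cycdist leq_min; move/eqP: ij => ij; apply/andP; split.
  by case: (ltngtP i j) ij => // h _; [rewrite addnC|]; rewrite ltn_addr // subn_gt0.
rewrite subn_gt0; case: (leqP i j) => h.
  by rewrite (eqP h) add0n; exact: leq_ltn_trans (leq_subr _ _) jM.
by rewrite (eqP (ltnW h)) addn0; exact: leq_ltn_trans (leq_subr _ _) iM.
Qed.

(** In natural numbers [i - j + (j - i)] is |i - j|, and each value occurs at most once on either
    side of j. The test on the right removes the value M, which is never attained. *)
Lemma sum_offset (F : nat -> R) M j : (forall k, 0 <= F k) -> (j < M)%N ->
  \sum_(i < M | nat_of_ord i != j) F (i - j + (j - i))%N <= 2 * \sum_(k < M) (if k.+1 == M then 0 else F k.+1).
Proof.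
move=> F0 jM; pose G k : R := if k.+1 == M then 0 else F k.+1.
have G0 k : 0 <= G k by rewrite /G; case: ifP.
have -> : \sum_(i < M | nat_of_ord i != j) F (i - j + (j - i))%N = \sum_(0 <= i < M | i != j) F (i - j + (j - i))%N.
  by rewrite big_mkord.
rewrite (@big_cat_nat _ _ _ j 0 M) //=; last exact: ltnW.
rewrite [X in _ + X]big_ltn_cond // eqxx /= (_ : 2 * _ = \sum_(0 <= k < M) G k + \sum_(0 <= k < M) G k); last first.
  by rewrite !big_mkord; rewrite mulr_natl mulr2n.
have le n : (n <= M)%N -> \sum_(0 <= k < n) G k <= \sum_(0 <= k < M) G k.
  by move=> nM; rewrite [leRHS](@big_cat_nat _ _ _ n 0 M) //= lerDl sumr_ge0.
apply: lerD.
  apply: le_trans (le j (ltnW jM)).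
  rewrite [leRHS]big_nat_rev /= add0n big_nat_cond [leRHS]big_nat_cond.
  rewrite le_eqVlt; apply/orP; left; apply/eqP; apply: eq_big => i.
    by rewrite andbT; case: (ltnP i j) => h //=; rewrite ltn_eqF // andbF.
  move=> /andP[/andP[_ ij] _]; rewrite /G -subSn // subSS.
  by rewrite (eqP (ltnW ij)) add0n ltn_eqF //; exact: leq_ltn_trans (leq_subr _ _) jM.
apply: le_trans (le (M - j.+1)%N (leq_subr _ _)).
rewrite -{1}[j.+1]add0n big_addn big_nat_cond [leRHS]big_nat_cond.
rewrite le_eqVlt; apply/orP; left; apply/eqP; apply: eq_big => i.
  by rewrite andbT; case: (ltnP i (M - j.+1)) => h //=; rewrite gtn_eqF //= addnS ltnS leq_addl.
move=> /andP[/andP[_ ij] _]; rewrite /G addnS subSn ?leq_addl // addnK.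
have -> : (j - (i + j).+1 = 0)%N by apply/eqP; rewrite subn_eq0 (leq_trans (leq_addl i j)).
by rewrite addn0 ltn_eqF //; move: ij; rewrite ltn_subRL; apply: leq_ltn_trans; rewrite addSn ltnS leq_addl.
Qed.

(** The reciprocal of min(k, M - k) is at most 1/k + 1/(M - k), and each of the two families sums to
    a harmonic sum. *)
Lemma sum_cycdist M j : (j < M)%N ->
  \sum_(i < M | nat_of_ord i != j) (cycdist M i j)%:R^-1 <= 4 * harmonic_sum M.
Proof.
case: M => // M jM; pose F k : R := k%:R^-1 + (M.+1 - k)%:R^-1.
have F0 k : 0 <= F k by rewrite addr_ge0 // invr_ge0 ler0n.
apply: (@le_trans _ _ (\sum_(i < M.+1 | nat_of_ord i != j) F (i - j + (j - i))%N)).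
  apply: ler_sum => i ij; rewrite /F /cycdist /minn.
  by case: ifP => _; [rewrite lerDl|rewrite lerDr]; rewrite invr_ge0 ler0n.
apply: le_trans (sum_offset F0 jM) _.
rewrite big_ord_recr /= eqxx addr0.
have -> : \sum_(k < M) (if k.+1 == M.+1 then 0 else F k.+1) = \sum_(k < M) k.+1%:R^-1 + \sum_(k < M) (M - k)%:R^-1.
  by rewrite -big_split; apply: eq_bigr => k _; rewrite eqSS ltn_eqF // /F subSS.
have -> : \sum_(k < M) (M - k)%:R^-1 = harmonic_sum M.
  rewrite /harmonic_sum (reindex_inj rev_ord_inj); apply: eq_bigr => k _ /=.
  by rewrite subKn.
have := harmonic_sum_le (leqnSn M); rewrite -/(harmonic_sum M); lra.
Qed.

End Stage.

Section StageLemma.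
Context {R : realType}.
Implicit Types (f g h k : R[i] -> R[i]) (p q z w u v b : R[i]) (D : set R[i]).

Lemma normc_sum (I : Type) (s : seq I) (P : pred I) (F : I -> R[i]) :
  normc (\sum_(i <- s | P i) F i) <= \sum_(i <- s | P i) normc (F i).
Proof.
elim/big_ind2: _ => [|x a y d xa yd|//]; first by rewrite normc0.
exact: le_trans (normcD _ _) (lerD xa yd).
Qed.

Lemma exists_nearest (zeta : nat -> R[i]) M z : (0 < M)%N ->
  exists2 j, (j < M)%N & forall i, (i < M)%N -> normc (z - zeta j) <= normc (z - zeta i).
Proof.
elim: M => // -[_ _|M IH _]; first by exists 0%N => // i; rewrite ltnS leqn0 => /eqP ->.
have [//|j jM hj] := IH; have [h|h] := leP (normc (z - zeta j)) (normc (z - zeta M.+1)).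
  by exists j => [|i]; [exact: ltnW|rewrite ltnS leq_eqVlt => /orP[/eqP ->//|]; exact: hj].
exists M.+1 => // i; rewrite ltnS leq_eqVlt => /orP[/eqP ->//|/hj]; lra.
Qed.

Section Nodes.
Variables (D : set R[i]) (zeta nu : nat -> R[i]) (M N : nat) (c r0 C : R).
Hypotheses (r00 : 0 < r0) (C0 : 0 <= C) (c0 : 0 < c) (M0 : (0 < M)%N) (N0 : (0 < N)%N).
Hypothesis ch : forall i, (i < M)%N -> normc (nu i) = 1 /\ graph_chart D (zeta i) (nu i) r0 C.
Hypothesis chord : forall i j, (i < M)%N -> (j < M)%N -> i != j ->
  c / N%:R * (cycdist M i j)%:R <= normc (zeta i - zeta j).

Definition bump_sum sigma z := \sum_(i < M) pole_bump (zeta i) (nu i) sigma z.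

Section Scale.
Variables (e sigma : R).
Hypotheses (e0 : 0 < e) (e1 : e <= 2^-1) (s0 : 0 < sigma) (Cs : 2 * C * sigma <= e) (sr : sigma <= e * r0).

(** A point nearest to node j has distance at least half of |zeta_i - zeta_j|, hence of order
    cycdist/N, from every other node. The slow decay of the bumps then produces the harmonic sum. *)
Lemma bump_sum_near z j : D z -> (j < M)%N ->
  (forall i, (i < M)%N -> i != j -> normc (zeta i - zeta j) <= 2 * normc (z - zeta i)) ->
  normc (bump_sum sigma z - pole_bump (zeta j) (nu j) sigma z) <= 16 * sigma * N%:R * harmonic_sum M / c.
Proof.
move: (s0) (c0) (e0) (e1) => s0' c0' e0' e1' Dz jM hj.
rewrite /bump_sum (bigD1 (Ordinal jM)) //= addrAC subrr add0r.
have Nr : 0 < N%:R :> R by rewrite ltr0n.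
apply: le_trans (normc_sum _ _ _) _.
apply: (@le_trans _ _ (\sum_(i < M | nat_of_ord i != j) 4 * sigma * N%:R / c * (cycdist M i j)%:R^-1)).
  apply: ler_sum => i ij; have ij' : nat_of_ord i != j by [].
  have [nui chi] := ch (ltn_ord i).
  have [_ h1 _ _] := bump_bounds nui r00 C0 chi e0 e1 s0 Cs sr Dz.
  have h2 := chord (ltn_ord i) jM ij'; have h3 := hj _ (ltn_ord i) ij'.
  have d0 : 0 < (cycdist M i j)%:R :> R by rewrite ltr0n cycdist_gt0.
  have cN : 0 < c / N%:R * (cycdist M i j)%:R by rewrite mulr_gt0 // divr_gt0.
  set d := (cycdist M i j)%:R in d0 cN h2 *; set nz := normc (z - zeta i) in h1 h3 *.
  have n0 : 0 < nz by lra.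
  have -> : 4 * sigma * N%:R / c * d^-1 = 4 * sigma / (c / N%:R * d) by field; rewrite !gt_eqF.
  rewrite ler_pdivlMr //; apply: (@le_trans _ _ (normc (pole_bump (zeta i) (nu i) sigma z) * (2 * nz))).
    by rewrite ler_wpM2l ?normc_ge0 //; lra.
  have : (1 + 2 * e) * sigma <= 2 * sigma by rewrite ler_pM2r //; lra.
  lra.
rewrite -mulr_sumr; apply: le_trans (ler_wpM2l _ (sum_cycdist jM)) _.
  by rewrite divr_ge0 ?mulr_ge0 ?ler0n ?ltW // ltW.
by rewrite le_eqVlt; apply/orP; left; apply/eqP; field; rewrite gt_eqF.
Qed.

Lemma bump_sum_nearest z : D z -> exists2 j, (j < M)%N & forall i, (i < M)%N -> i != j ->
  normc (zeta i - zeta j) <= 2 * normc (z - zeta i).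
Proof.
move=> Dz; have [j jM hj] := exists_nearest zeta z M0; exists j => // i iM _.
have := hj i iM; have := normc_tri z (zeta i) (zeta j); rewrite (normcC (zeta i) z); lra.
Qed.

End Scale.

Lemma bump_locally_approx i (sigma : R) : (i < M)%N -> 0 < sigma ->
  locally_approx D (fun z => (z - (zeta i - 'i * nu i * sigma%:C))^-1) ->
  locally_approx D (pole_bump (zeta i) (nu i) sigma).
Proof.
move=> iM s0 hp; have [nui _] := ch iM.
have nu0 : nu i != 0 by rewrite -normc_gt0 nui.
have := locally_approxM (@locally_approx_cst _ D ('i * (nu i * sigma%:C))) hp.
congr (locally_approx D _); apply/funext => z; rewrite bump_pole // gt_eqF //.
Qed.

End Nodes.

(* [k' = k (1 - T1) + b T2], where T1 and T2 are the sums of the bumps of widths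
   sigma1 and s^2 sigma1 at the nodes: the first erases k near the nodes and
   the second puts b times a bump there. *)
Lemma stage D b (rho c r0 C e theta A : R) : 0 < r0 -> 0 <= C -> 0 < c -> 0 < e -> 0 < theta -> 0 < A ->
  normc b <= rho -> exists2 B : R, 0 < B & 2 * C * B <= 1 /\ B <= r0 / 2 /\
  forall (zeta nu : nat -> R[i]) (M N : nat), (0 < M)%N -> (0 < N)%N ->
  (forall i, (i < M)%N -> [/\ normc (nu i) = 1, graph_chart D (zeta i) (nu i) r0 C &
     forall s, 0 < s -> s < r0 -> locally_approx D (fun z => (z - (zeta i - 'i * nu i * s%:C))^-1)]) ->
  (forall i j, (i < M)%N -> (j < M)%N -> i != j -> c / N%:R * (cycdist M i j)%:R <= normc (zeta i - zeta j)) ->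
  (forall i, (i < M)%N -> ~ D (zeta i)) ->
  let sigma := B / (N%:R * harmonic_sum M) in
  forall k, (forall z, D z -> normc (k z) <= rho) -> locally_approx D k ->
  exists k', [/\ forall z, D z -> normc (k' z) <= rho + e, locally_approx D k',
    forall z, (forall w, normc (w - z) < theta / N%:R -> D w) -> normc (k' z - k z) <= e &
    forall j z, (j < M)%N -> D z -> normc (z - zeta j) <= A * sigma ->
      normc (k' z - b * pole_bump (zeta j) (nu j) sigma z) <= e].
Proof.
move=> r00 C0 c0 e0 th0 A0 brho.
have rho0 : 0 <= rho := le_trans (normc_ge0 b) brho.
(* The budget of one stage, all errors being at most rho s (5 + 2A); its square is also the ratio of
   the two widths. *)
pose s := Num.min 2^-1 (e / ((rho + 1) * (5 + 2 * A))).
have X0 : 0 < (rho + 1) * (5 + 2 * A) by rewrite mulr_gt0 //; lra.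
have s0 : 0 < s by rewrite lt_min divr_gt0 // andbT; lra.
have s1 : s <= 2^-1 by rewrite ge_min lexx.
have s2 : s * ((rho + 1) * (5 + 2 * A)) <= e by rewrite -ler_pdivlMr // ge_min lexx orbT.
(* The wider bumps have width q/(N H). In turn: the other nodes contribute at most s/2, a bump is at
   most s/2 at distance theta/N, discs of radius A sigma keep their own node as the relevant one,
   and the two conditions of [bump_bounds] hold. *)
pose q := Num.min (s * c / 32) (Num.min (s * theta / 4) (Num.min (c / (2 * A)) (Num.min (s / (2 * C + 1)) (s * r0 / 2)))).
have q0 : 0 < q.
  have h1 : 0 < s * c / 32 by rewrite divr_gt0 ?mulr_gt0.
  have h2 : 0 < s * theta / 4 by rewrite divr_gt0 ?mulr_gt0.
  have h3 : 0 < c / (2 * A) by rewrite divr_gt0 ?mulr_gt0.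
  have h4 : 0 < s / (2 * C + 1) by rewrite divr_gt0 //; lra.
  have h5 : 0 < s * r0 / 2 by rewrite divr_gt0 ?mulr_gt0.
  by rewrite !lt_min h1 h2 h3 h4 h5.
have q1 : q <= s * c / 32 by rewrite ge_min lexx.
have q2 : q <= s * theta / 4 by rewrite !(ge_min, lexx, orbT).
have q3 : q * (2 * A) <= c by rewrite -ler_pdivlMr ?mulr_gt0 // !(ge_min, lexx, orbT).
have q4 : q * (2 * C + 1) <= s by rewrite -ler_pdivlMr; [rewrite !(ge_min, lexx, orbT)|lra].
have q5 : q <= s * r0 / 2 by rewrite !(ge_min, lexx, orbT).
clearbody q s.
have ss : s ^+ 2 <= s / 2 by rewrite expr2; have := ler_wpM2l (ltW s0) s1; lra.
have ss1 : s ^+ 2 <= 1 by lra.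
have ss0 : 0 < s ^+ 2 by rewrite exprn_gt0.
have qs : q * s ^+ 2 <= q by rewrite ler_piMr // ltW.
have sr0 : s * r0 <= r0 / 2 by have := ler_wpM2r (ltW r00) s1; lra.
exists (q * s ^+ 2); first by rewrite mulr_gt0.
split; first by have := ler_wpM2l C0 qs; lra.
split; first by lra.
move=> zeta nu M N M0 N0 hnode chord nD sigma k krho ka.
have Nr : 1 <= N%:R :> R by rewrite ler1n.
have H1 := @harmonic_sum_ge1 R M M0; set H := harmonic_sum M in H1 sigma *.
have NH1 : 1 <= N%:R * H by have := ler_wpM2l (le_trans ler01 Nr) H1; clear -Nr; lra.
have NH : 0 < N%:R * H by clear -NH1; lra.
have N00 : 0 < N%:R :> R by clear -Nr; lra.
pose sg1 := q / (N%:R * H).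
have sg10 : 0 < sg1 by rewrite divr_gt0.
have sg1N : sg1 * (N%:R * H) = q by rewrite /sg1 divfK // gt_eqF.
have sE : sigma = sg1 * s ^+ 2 by rewrite /sigma /sg1 mulrAC.
have sg1N' : sg1 * N%:R <= q.
  by have := ler_wpM2l (mulr_ge0 (ltW sg10) (ltW N00)) H1; clear -sg1N; lra.
have sg1q : sg1 <= q by have := ler_wpM2l (ltW sg10) Nr; clear -sg1N'; lra.
have sg20 : 0 < sigma by rewrite sE mulr_gt0.
have sg21 : sigma <= sg1 by rewrite sE ler_piMr // ltW.
have cC : 2 * C * sg1 <= s by have := ler_wpM2l C0 sg1q; clear -q0 q4; lra.
have cC2 : 2 * C * sigma <= s by have := ler_wpM2l C0 sg21; clear -cC; lra.
have sgr : sg1 <= s * r0 by have := mulr_ge0 (ltW s0) (ltW r00); clear -q5 sg1q; lra.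
have sgr2 : sigma <= s * r0 by clear -q0 q5 sg1q sg21; lra.
have ch i : (i < M)%N -> normc (nu i) = 1 /\ graph_chart D (zeta i) (nu i) r0 C by move=> /hnode[].
clearbody sigma sg1.
pose dl := s / 2.
have near sg z j : 0 < sg -> sg <= sg1 -> D z -> (j < M)%N ->
  (forall i, (i < M)%N -> i != j -> normc (zeta i - zeta j) <= 2 * normc (z - zeta i)) ->
  normc (bump_sum zeta nu M sg z - pole_bump (zeta j) (nu j) sg z) <= dl.
  move=> sg0 sgle Dz jM hj.
  have a1 : 2 * C * sg <= s by have := ler_wpM2l C0 sgle; clear -cC; lra.
  have a2 : sg <= s * r0 by clear -q0 q5 sg1q sgle; lra.
  apply: le_trans (bump_sum_near r00 C0 c0 N0 ch chord s0 s1 sg0 a1 a2 Dz jM hj) _.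
  rewrite ler_pdivrMr // -/H; have := ler_wpM2r (ltW NH) sgle; rewrite /dl; clear -q1 sg1N; lra.
pose k' z := k z * (1 + (- 1) * bump_sum zeta nu M sg1 z) + b * bump_sum zeta nu M sigma z.
have bsa sg : 0 < sg -> sg < r0 -> locally_approx D (bump_sum zeta nu M sg).
  move=> sg0 sgl; apply: locally_approx_sum => i.
  by apply: (bump_locally_approx ch) => //; have [_ _] := hnode _ (ltn_ord i); apply.
have kE z t1 t2 : k' z = k z * (1 - t1) + b * t2 +
    (- k z * (bump_sum zeta nu M sg1 z - t1) + b * (bump_sum zeta nu M sigma z - t2)) by rewrite /k'; ring.
have perr z (x y : R[i]) : D z -> normc x <= dl -> normc y <= dl -> normc (- k z * x + b * y) <= rho * s.
  move=> Dz xd yd; apply: le_trans (normcD _ _) _; rewrite !normcM normcN.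
  have h1 : normc (k z) * normc x <= rho * dl by apply: ler_pM; rewrite ?normc_ge0 ?krho.
  have h2 : normc b * normc y <= rho * dl by apply: ler_pM; rewrite ?normc_ge0.
  by move: h1 h2; rewrite /dl; clear; lra.
have rs : rho * s * (5 + 2 * A) <= e.
  by have : 0 <= s * (5 + 2 * A) by [rewrite mulr_ge0 ?ltW //; clear -A0; lra]; clear -s2; lra.
have rs0 : 0 <= rho * s by rewrite mulr_ge0 // ltW.
have rsA : 0 <= rho * s * A by rewrite mulr_ge0 // ltW.
exists k'; split.
- move=> z Dz; have [j jM hj] := bump_sum_nearest zeta M0 Dz.
  have [nuj chj] := ch j jM.
  rewrite (kE z (pole_bump (zeta j) (nu j) sg1 z) (pole_bump (zeta j) (nu j) sigma z)).
  have [_ _ b3 b4] := bump_bounds nuj r00 C0 chj s0 s1 sg10 cC sgr Dz.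
  have [c1 c2 _ _] := bump_bounds nuj r00 C0 chj s0 s1 sg20 cC2 sgr2 Dz.
  have E1 := near sg1 z j sg10 (lexx _) Dz jM hj.
  have E2 := near sigma z j sg20 sg21 Dz jM hj.
  apply: le_trans (normcD _ _) _; apply: le_trans (lerD (normcD _ _) (perr z _ _ Dz E1 E2)) _.
  rewrite !normcM.
  set t1 := normc (1 - _) in b3 b4 *; set t2 := normc (pole_bump _ _ _ _) in c1 c2 *.
  have t10 : 0 <= t1 := normc_ge0 _.
  have t20 : 0 <= t2 := normc_ge0 _.
  (* At distance at least s sg1 from the node the narrow bump is at most 2s; closer than that the
     wide bump is within 2s of 1. This separation of scales keeps k' bounded by almost the same
     constant as k and b. *)
  have key : t1 + t2 <= 1 + 4 * s.
    set d := normc (z - _) in b4 c2.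
    have zn : d != 0.
      rewrite normc_eq0 subr_eq0; apply/eqP => zz; apply: (nD j jM); by rewrite -zz.
    have d0 : 0 < d by rewrite lt_def zn normc_ge0.
    have k2 : (1 + 2 * s) * s <= 2 * s by rewrite ler_pM2r //; clear -s1; lra.
    have [h|h] := leP (s * sg1) d.
      suff : t2 <= 2 * s by clear -b3; lra.
      rewrite -(ler_pM2r d0); apply: le_trans c2 _; rewrite sE.
      have := ler_wpM2l (ltW s0) h; have := ler_wpM2r (mulr_ge0 (ltW s0) (ltW sg10)) k2.
      by rewrite expr2; clear; lra.
    suff : t1 <= 2 * s by clear -c1; lra.
    rewrite -(ler_pM2r sg10); apply: le_trans b4 _.
    have k3 : 0 <= 1 + 2 * s by clear -s0; lra.
    have := ler_wpM2l k3 (ltW h); have := ler_wpM2r (ltW sg10) k2; clear; lra.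
  have h1 : normc (k z) * t1 <= rho * t1 by rewrite ler_wpM2r // krho.
  have h2 : normc b * t2 <= rho * t2 by rewrite ler_wpM2r.
  have := ler_wpM2l rho0 key; clear -rs rsA h1 h2; lra.
- apply: locally_approxD; first apply: locally_approxM => //.
    apply: locally_approxD; first exact: locally_approx_cst.
    by apply: locally_approxM; [exact: locally_approx_cst|apply: bsa => //; clear -r00 q5 sr0 sg1q; lra].
  by apply: locally_approxM; [exact: locally_approx_cst|apply: bsa => //; clear -r00 q5 sr0 sg1q sg21; lra].
- move=> z zD; have Dz : D z by apply: zD; rewrite subrr normc0 divr_gt0.
  have [j jM hj] := bump_sum_nearest zeta M0 Dz; have [nuj chj] := ch j jM.
  have E1 := near sg1 z j sg10 (lexx _) Dz jM hj.
  have E2 := near sigma z j sg20 sg21 Dz jM hj.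
  have [_ b2 _ _] := bump_bounds nuj r00 C0 chj s0 s1 sg10 cC sgr Dz.
  have [_ c2 _ _] := bump_bounds nuj r00 C0 chj s0 s1 sg20 cC2 sgr2 Dz.
  have zj : theta / N%:R <= normc (z - zeta j).
    by rewrite leNgt; apply/negP => zz; apply: (nD j jM); apply: zD; rewrite normcC.
  have tN : 0 < theta / N%:R by rewrite divr_gt0.
  have tb sg t : 0 < sg -> sg <= sg1 -> 0 <= t -> t * normc (z - zeta j) <= (1 + 2 * s) * sg -> t <= s / 2.
    move=> sg0 sgle t0 ht; rewrite -(ler_pM2r tN); apply: le_trans (ler_wpM2l t0 zj) _.
    apply: le_trans ht _; rewrite mulrA ler_pdivlMr //.
    have k1 : (1 + 2 * s) * (sg * N%:R) <= 2 * (sg * N%:R) by rewrite ler_pM2r ?mulr_gt0 //; clear -s1; lra.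
    have := ler_wpM2r (ltW N00) sgle; clear -k1 q2 sg1N'; lra.
  have g1 := tb _ _ sg10 (lexx _) (normc_ge0 _) b2.
  have g2 := tb _ _ sg20 sg21 (normc_ge0 _) c2.
  have -> : k' z - k z = (- k z * (pole_bump (zeta j) (nu j) sg1 z) + b * pole_bump (zeta j) (nu j) sigma z) +
    (- k z * (bump_sum zeta nu M sg1 z - pole_bump (zeta j) (nu j) sg1 z) + b * (bump_sum zeta nu M sigma z - pole_bump (zeta j) (nu j) sigma z)).
    by rewrite /k'; ring.
  apply: le_trans (normcD _ _) _; apply: le_trans (lerD (perr z _ _ Dz g1 g2) (perr z _ _ Dz E1 E2)) _.
  (clear -rs rs0 rsA; lra).
- move=> j z jM Dz zA; have [nuj chj] := ch j jM.
  have hj i : (i < M)%N -> i != j -> normc (zeta i - zeta j) <= 2 * normc (z - zeta i).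
    move=> iM ij; have h1 := chord i j iM jM ij.
    have d1 : 1 <= (cycdist M i j)%:R :> R by rewrite ler1n cycdist_gt0.
    have h2 : 2 * A * sigma <= c / N%:R.
      rewrite ler_pdivlMr //; have := ler_wpM2l (ltW A0) sg1N'; have := ler_wpM2l (ltW A0) (ler_wpM2r (ltW N00) sg21); clear -q3; lra.
    have cN : 0 <= c / N%:R by rewrite divr_ge0 // ltW.
    have h3 := ler_wpM2l cN d1.
    by have := normc_tri z (zeta i) (zeta j); rewrite (normcC (zeta i) z); clear -h1 h2 h3 zA; lra.
  rewrite (kE z (pole_bump (zeta j) (nu j) sg1 z) (pole_bump (zeta j) (nu j) sigma z)).
  have [_ _ _ b4] := bump_bounds nuj r00 C0 chj s0 s1 sg10 cC sgr Dz.
  have E1 := near sg1 z j sg10 (lexx _) Dz jM hj.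
  have E2 := near sigma z j sg20 sg21 Dz jM hj.
  rewrite [X in normc X](_ : _ = k z * (1 - pole_bump (zeta j) (nu j) sg1 z) +
    (- k z * (bump_sum zeta nu M sg1 z - pole_bump (zeta j) (nu j) sg1 z) + b * (bump_sum zeta nu M sigma z - pole_bump (zeta j) (nu j) sigma z))); last by ring.
  apply: le_trans (normcD _ _) _; apply: le_trans (lerD (lexx _) (perr z _ _ Dz E1 E2)) _.
  rewrite normcM; set t1 := normc (1 - _) in b4 *.
  have t1s : t1 <= 2 * A * s.
    rewrite -(ler_pM2r sg10); apply: le_trans b4 _.
    have k3 : 0 <= 1 + 2 * s by clear -s0; lra.
    apply: le_trans (ler_wpM2l k3 zA) _; rewrite sE.
    have a1 : (1 + 2 * s) * (A * sg1 * s ^+ 2) <= 2 * (A * sg1 * s ^+ 2).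
      by rewrite ler_pM2r ?mulr_gt0 //; clear -s1; lra.
    by have := ler_wpM2l (mulr_ge0 (ltW A0) (ltW sg10)) ss; have := mulr_gt0 (mulr_gt0 A0 sg10) s0; clear -a1; lra.
  have h1 : normc (k z) * t1 <= rho * (2 * A * s) by apply: ler_pM; rewrite ?normc_ge0 ?krho.
  (clear -h1 rs rs0 rsA; lra).
Qed.

End StageLemma.

Section Construction.
Context {R : realType}.
Implicit Types (f g h : R[i] -> R[i]) (p q z w u v b : R[i]) (D : set R[i]).

(* The boundary is covered by windows [o_n, o_n + L_n) of the parameter; in the
   chord-arc condition the two ends of a window are regarded as close. *)
Record boundary_geometry D (gam : R -> R[i]) := BoundaryGeometry {
  bg_nu : R -> R[i]; bg_c : R; bg_K : R; bg_r0 : R; bg_C : R; bg_o : nat -> R; bg_L : nat -> nat;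
  bg_open : open D; bg_conn : clopen_conn D;
  bg_c0 : 0 < bg_c; bg_K0 : 1 <= bg_K; bg_r00 : 0 < bg_r0; bg_C0 : 0 <= bg_C;
  bg_L0 : forall n, (0 < bg_L n)%N;
  bg_lip : forall t t', normc (gam t - gam t') <= bg_K * `|t - t'|;
  bg_nu1 : forall t, normc (bg_nu t) = 1;
  bg_chart : forall t, graph_chart D (gam t) (bg_nu t) bg_r0 bg_C;
  bg_pole : forall t s, 0 < s -> s < bg_r0 ->
    locally_approx D (fun z => (z - (gam t - 'i * bg_nu t * s%:C))^-1);
  bg_chord : forall n t t', bg_o n <= t < bg_o n + (bg_L n)%:R -> bg_o n <= t' < bg_o n + (bg_L n)%:R ->
    bg_c * Num.min `|t - t'| ((bg_L n)%:R - `|t - t'|) <= normc (gam t - gam t');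
  bg_mono : forall n, bg_o n.+1 <= bg_o n /\ bg_o n + (bg_L n)%:R <= bg_o n.+1 + (bg_L n.+1)%:R;
  bg_surj : forall p, boundary D p -> exists n t, bg_o n <= t < bg_o n + (bg_L n)%:R /\ p = gam t }.

(** Each dyadic block contributes at most 1. *)
Lemma harmonic_sum_exp2 j : harmonic_sum (2 ^ j) <= j.+1%:R :> R.
Proof.
elim: j => [|j IH]; first by rewrite /harmonic_sum big_ord_recl big_ord0 invr1 addr0.
have -> : harmonic_sum (2 ^ j.+1) = harmonic_sum (2 ^ j) + \sum_(2 ^ j <= i < 2 ^ j.+1) i.+1%:R^-1 :> R.
  rewrite /harmonic_sum -!(big_mkord xpredT (fun i => i.+1%:R^-1)) -big_cat_nat //=.
  by rewrite leq_exp2l.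
rewrite -[j.+2]addn1 natrD lerD //.
apply: (@le_trans _ _ (\sum_(2 ^ j <= i < 2 ^ j.+1) (2 ^ j)%:R^-1)).
  rewrite big_seq_cond [leRHS]big_seq_cond; apply: ler_sum => i; rewrite andbT mem_index_iota => /andP[ij _].
  by rewrite lef_pV2 ?posrE ?ltr0n ?expn_gt0 // ler_nat ltnW.
rewrite big_const_nat iter_addr addr0 expnS mul2n -addnn addnK.
by rewrite -[_ *+ _]mulr_natr mulVf // pnatr_eq0 -lt0n expn_gt0.
Qed.

(** With i the logarithm of m to the base 2^n, the harmonic sum is at most n(i+1) + 1 <= n 2^(i+1),
    whose n-th power is (2n)^n (2^n)^i, and (2^n)^i <= m. *)
Lemma harmonic_sum_pow n m : (0 < n)%N -> (0 < m)%N -> harmonic_sum m ^+ n <= ((2 * n) ^ n)%:R * m%:R :> R.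
Proof.
move=> n0 m0; pose p := (2 ^ n)%N.
have p1 : (1 < p)%N by rewrite -(exp1n n) ltn_exp2r.
pose i := trunc_log p m.
have pi : (p ^ i <= m)%N by exact: trunc_logP.
have mi : (m < p ^ i.+1)%N by exact: trunc_log_ltn.
apply: (@le_trans _ _ ((n * i.+1).+1%:R ^+ n)).
  rewrite lerXn2r ?nnegrE ?ler0n //; first by rewrite sumr_ge0.
  by apply: le_trans (harmonic_sum_le (ltnW mi)) _; rewrite -expnM harmonic_sum_exp2.
rewrite -natrM -natrX ler_nat; apply: leq_trans (_ : (n * 2 ^ i.+1) ^ n <= _)%N.
  rewrite leq_exp2r //; apply: leq_trans (_ : n * i.+2 <= _)%N; first by rewrite [in leqRHS]mulnS addnC -addn1 leq_add2l.
  by rewrite leq_mul2l ltn_expl ?orbT.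
rewrite expnS mulnA -(mulnC 2) expnMn leq_mul2l; apply/orP; right.
by rewrite -expnM mulnC expnM.
Qed.

Lemma harmonic_growth n L (X : R) : 0 <= X -> exists N0, forall N, (N0 <= N)%N ->
  (X * harmonic_sum (L * N)) ^+ n <= N%:R.
Proof.
move=> X0; have [->|L0] := posnP L.
  exists 1%N => N N0; rewrite mul0n /harmonic_sum big_ord0 mulr0 expr0n.
  by case: eqP; rewrite ?ler1n ?ler0n.
case: n => [|n]; first by exists 1%N => N; rewrite expr0 ler1n.
(* The exponent is doubled so that the bound, linear in N with a large constant, can be compared
   with N^2. *)
pose m := (n.+1 * 2)%N; have [N0 hN] := natr_large (X ^+ m * ((2 * m) ^ m)%:R * L%:R).
exists (maxn N0 1) => N; rewrite geq_max => /andP[/hN {}hN N1].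
have H0 : 0 <= harmonic_sum (L * N) :> R by rewrite sumr_ge0.
rewrite -(@ler_pXn2r _ 2) ?nnegrE ?ler0n ?exprn_ge0 ?mulr_ge0 //.
rewrite -exprM exprMn; apply: le_trans (ler_wpM2l _ (harmonic_sum_pow _ _)) _ => //.
- by rewrite exprn_ge0.
- by rewrite muln_gt0 L0.
- by rewrite -/m natrM !mulrA expr2 ler_wpM2r ?ler0n.
Qed.

End Construction.

Section ScaleData.
Context {R : realType}.
Implicit Types (f g h : R[i] -> R[i]) (p q z w u v b : R[i]).
Variables (D : set R[i]) (gam : R -> R[i]) (bg : boundary_geometry D gam).

Lemma bg_notin t : ~ D (gam t).
Proof.
have [phi [h1 _ h2]] := bg_chart bg t; have r0 := bg_r00 bg.
have p0 : phi 0 = 0.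
  apply/eqP; rewrite -normr_eq0 eq_le normr_ge0 andbT.
  by have := h1 0; rewrite normr0 expr0n /= mulr0; apply.
have := h2 0; rewrite mulr0 addr0 p0 /= normr0 ltxx => /(_ r0 r0)[h _] /h.
by [].
Qed.

Lemma natr_dist (i j : nat) : `|i%:R - j%:R| = (i - j + (j - i))%:R :> R.
Proof.
case: (leqP i j) => h.
  by rewrite (eqP h) add0n distrC -natrB // normr_nat.
by rewrite (eqP (ltnW h)) addn0 -natrB ?normr_nat // ltnW.
Qed.

Definition node (N : nat -> nat) n (j : nat) : R := bg_o bg n + j%:R / (N n)%:R.

(* [sd_k] is the limit of the functions produced by the stages, with nodes 1/N_n
   apart and bumps of width s_n at stage n. By [sd_grow] the product of the
   ratios 1/(s_i N_i) is smaller than any power of N_n; this gives dimension 1. *)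
Record scale_data b (rho eps theta A kap kap' : R) := ScaleData {
  sd_N : nat -> nat; sd_s : nat -> R; sd_k : R[i] -> R[i];
  sd_N0 : forall n, (n < sd_N n)%N;
  sd_s0 : forall n, 0 < sd_s n;
  sd_sN : forall n, sd_s n * (sd_N n)%:R <= bg_r0 bg / 2;
  sd_sC : forall n, 2 * bg_C bg * (sd_s n * (sd_N n)%:R) <= 1;
  sd_Nk : forall n, 1 <= kap * (sd_N n)%:R;
  sd_mono : forall n, (sd_N n <= sd_N n.+1)%N;
  sd_step : forall n, 1 <= kap * sd_s n * (sd_N n.+1)%:R;
  sd_grow : forall n, (\prod_(i < n.+1) (kap' / (sd_s i * (sd_N i)%:R))) ^+ n <= (sd_N n)%:R;
  sd_bound : forall z, D z -> normc (sd_k z) <= rho;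
  sd_approx : locally_approx D sd_k;
  sd_node : forall n j z, (j < bg_L bg n * sd_N n)%N -> D z ->
    normc (z - gam (node sd_N n j)) <= A * sd_s n ->
    (forall w, normc (w - z) < theta / (sd_N n.+1)%:R -> D w) ->
    normc (sd_k z - b * pole_bump (gam (node sd_N n j)) (bg_nu bg (node sd_N n j)) (sd_s n) z) <= eps;
  sd_far : forall z, (forall w, normc (w - z) < 1 -> D w) -> normc (sd_k z - b) <= eps }.

(** A window of length L consists of L N grid steps, so the wrap-around distance in [bg_chord] is
    [cycdist] divided by N. *)
Lemma node_chord (N : nat -> nat) n i j : (0 < N n)%N -> (i < bg_L bg n * N n)%N -> (j < bg_L bg n * N n)%N -> i != j ->
  bg_c bg / (N n)%:R * (cycdist (bg_L bg n * N n) i j)%:R <= normc (gam (node N n i) - gam (node N n j)).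
Proof.
move=> N0 iM jM ij; have Nr : 0 < (N n)%:R :> R by rewrite ltr0n.
have rng i' : (i' < bg_L bg n * N n)%N -> bg_o bg n <= node N n i' < bg_o bg n + (bg_L bg n)%:R.
  move=> h; rewrite /node lerDl divr_ge0 ?ler0n //= ltrD2l ltr_pdivrMr //.
  by rewrite -natrM ltr_nat.
apply: le_trans (bg_chord (rng i iM) (rng j jM)).
rewrite -mulrA ler_pM2l ?bg_c0 //.
have -> : `|node N n i - node N n j| = (i - j + (j - i))%:R / (N n)%:R.
  by rewrite /node opprD addrACA subrr add0r -mulrBl normrM natr_dist ger0_norm.
rewrite mulrC ler_pdivrMr // /cycdist; set d := (i - j + (j - i))%N.
have dM : (d <= bg_L bg n * N n)%N.
  rewrite /d; case: (leqP i j) => h.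
    by rewrite (eqP h) add0n (leq_trans (leq_subr _ _)) // ltnW.
  by rewrite (eqP (ltnW h)) addn0 (leq_trans (leq_subr _ _)) // ltnW.
have e2 : ((bg_L bg n)%:R - d%:R / (N n)%:R) * (N n)%:R = (bg_L bg n * N n - d)%:R :> R.
  by rewrite mulrBl divfK ?gt_eqF // natrB // natrM.
have [_|_] := leP (d%:R / (N n)%:R) ((bg_L bg n)%:R - d%:R / (N n)%:R).
  by rewrite divfK ?gt_eqF // ler_nat geq_minl.
by rewrite e2 ler_nat geq_minr.
Qed.

(** Since s_n N_n is B_n divided by a harmonic sum, the new factor of the product is only
    logarithmic in N_n. With the earlier factors fixed, a sufficiently large N_n beats any power of
    the product. The recursion carries N, s and the product so far. *)
Lemma lacunary_sequence (B : nat -> R) (kap kap' : R) : (forall n, 0 < B n) -> 0 < kap -> 0 < kap' ->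
  exists N : nat -> nat, let s n := B n / ((N n)%:R * harmonic_sum (bg_L bg n * N n)) in
  forall n, [/\ (n < N n)%N, 1 <= kap * (N n)%:R, (N n <= N n.+1)%N, 1 <= kap * s n * (N n.+1)%:R &
    (\prod_(i < n.+1) (kap' / (s i * (N i)%:R))) ^+ n <= (N n)%:R].
Proof.
move=> B0 k0 k0'; pose H n N : R := harmonic_sum (bg_L bg n * N).
have step (n : nat) (st : nat * R * R) : exists st' : nat * R * R, 0 < st.1.2 -> 0 < st.2 ->
    [/\ (n < st'.1.1)%N /\ (st.1.1 <= st'.1.1)%N, 1 <= kap * st'.1.1%:R, 1 <= kap * st.1.2 * st'.1.1%:R,
     st'.1.2 = B n / (st'.1.1%:R * H n st'.1.1) &
     st'.2 = st.2 * (kap' / (st'.1.2 * st'.1.1%:R)) /\ st'.2 ^+ n <= st'.1.1%:R].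
  have [s0|s0] := ltP 0 st.1.2; last by exists st.
  have [q0|q0] := ltP 0 st.2; last by exists st.
  have X0 : 0 <= st.2 * kap' / B n by rewrite !mulr_ge0 ?invr_ge0 // ltW.
  have [n1 h1] := harmonic_growth n (bg_L bg n) X0.
  have [n2 h2] := natr_large kap^-1.
  have [n3 h3] := natr_large (kap * st.1.2)^-1.
  pose N := maxn n.+1 (maxn st.1.1 (maxn n1 (maxn n2 n3))).
  have : (N <= N)%N by []; rewrite {1}/N !geq_max => /and5P[a1 a2 a3 a4 a5].
  exists (N, B n / (N%:R * H n N), st.2 * (kap' / (B n / (N%:R * H n N) * N%:R))) => _ _ /=; split => //.
  - by have := h2 N a4; rewrite -[_^-1]mulr1 mulrC ler_pdivrMr // mulrC.
  - by have := h3 N a5; rewrite -[_^-1]mulr1 mulrC ler_pdivrMr ?mulr_gt0 // mulrC.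
  - split => //; apply: le_trans (h1 N a3).
    have N0 : 0 < N%:R :> R by rewrite ltr0n (leq_trans _ a1).
    have H0 : 0 < H n N by apply: lt_le_trans ltr01 (harmonic_sum_ge1 _); rewrite muln_gt0 bg_L0 (leq_trans _ a1).
    rewrite le_eqVlt; apply/orP; left; apply/eqP; congr (_ ^+ _); rewrite -/(H n N).
    by field; rewrite !gt_eqF // B0.
have /choice[F hF] (x : nat * (nat * R * R)) : exists st' : nat * R * R, 0 < x.2.1.2 -> 0 < x.2.2 ->
    [/\ (x.1 < st'.1.1)%N /\ (x.2.1.1 <= st'.1.1)%N, 1 <= kap * st'.1.1%:R, 1 <= kap * x.2.1.2 * st'.1.1%:R,
     st'.1.2 = B x.1 / (st'.1.1%:R * H x.1 st'.1.1) &
     st'.2 = x.2.2 * (kap' / (st'.1.2 * st'.1.1%:R)) /\ st'.2 ^+ x.1 <= st'.1.1%:R].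
  by exact: step.
(* The initial state is a dummy with product 1; stage n is the state with index n+1. *)
pose S := fix S n : nat * R * R := if n is n'.+1 then F (n', S n') else (1%N, 1, 1).
have Spos n : 0 < (S n).1.2 /\ 0 < (S n).2.
  elim: n => [|n [p1 p2]]; first by rewrite ltr01.
  have [[c1 _] _ _ c4 [c5 _]] := hF (n, S n) p1 p2; rewrite /= -/(S n) in c1 c4 c5 *.
  have N0 : 0 < (F (n, S n)).1.1%:R :> R by rewrite ltr0n (leq_trans _ c1).
  have H0 : 0 < H n (F (n, S n)).1.1.
    by apply: lt_le_trans ltr01 (harmonic_sum_ge1 _); rewrite muln_gt0 bg_L0 (leq_trans _ c1).
  have s0 : 0 < (F (n, S n)).1.2 by rewrite c4 divr_gt0 // mulr_gt0.
  by split => //; rewrite c5 mulr_gt0 // divr_gt0 // mulr_gt0.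
pose N n := (S n.+1).1.1; exists N => s.
have sE n : s n = (S n.+1).1.2.
  by have [p1 p2] := Spos n; have [_ _ _ -> _] := hF (n, S n) p1 p2.
have PE n : \prod_(i < n) (kap' / (s i * (N i)%:R)) = (S n).2.
  elim: n => [|n IH]; first by rewrite big_ord0.
  rewrite big_ord_recr /= IH; have [p1 p2] := Spos n; have [_ _ _ _ [c5 _]] := hF (n, S n) p1 p2.
  by rewrite sE [RHS]c5.
move=> n; have [p1 p2] := Spos n; have [[c1 c2] c3 _ _ [_ c6]] := hF (n, S n) p1 p2.
have [p3 p4] := Spos n.+1; have [[_ d2] _ d3 _ _] := hF (n.+1, S n.+1) p3 p4.
by split => //; [rewrite sE|rewrite PE].
Qed.

(** Stage n may err by eps / 2^(n+1), so the bounds rn n rise from |b| to at most |b| + eps and the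
    corrections are summable. At a point of D they are small only once theta/N_n is below its
    distance from the complement, so the limit exists on D and is uniform on each [core]. *)
Lemma scale_data_ex b (rho eps theta A kap kap' : R) : 0 < eps -> 0 < theta -> theta <= 1 -> 0 < A ->
  0 < kap -> 0 < kap' -> normc b + eps <= rho -> inhabited (scale_data b rho eps theta A kap kap').
Proof.
move=> e0 th0 th1 A0 k0 k0' brho.
pose en n : R := eps / 2 ^+ n.+1; pose rn n : R := normc b + eps - eps / 2 ^+ n.
have e2 n : 0 < (2 : R) ^+ n by rewrite exprn_gt0.
have en0 n : 0 < en n by rewrite divr_gt0.
have enE n : en n + en n = eps / 2 ^+ n by rewrite /en exprS; field; rewrite gt_eqF.
have rnS n : rn n.+1 = rn n + en n by have := enE n; rewrite /rn /en; lra.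
have ee n : eps / 2 ^+ n <= eps.
  rewrite ler_pdivrMr //; apply: ler_peMr; first exact: ltW.
  by rewrite exprn_ege1 // ler1n.
have brn n : normc b <= rn n by rewrite /rn; have := ee n; lra.
have rnle n : rn n <= rho by rewrite /rn; have := divr_gt0 e0 (e2 n); lra.
have /choice[B hB] (n : nat) : exists B : R, 0 < B /\ (2 * bg_C bg * B <= 1 /\ B <= bg_r0 bg / 2 /\
  forall (zeta nu : nat -> R[i]) (M N : nat), (0 < M)%N -> (0 < N)%N ->
  (forall i, (i < M)%N -> [/\ normc (nu i) = 1, graph_chart D (zeta i) (nu i) (bg_r0 bg) (bg_C bg) &
     forall s, 0 < s -> s < bg_r0 bg -> locally_approx D (fun z => (z - (zeta i - 'i * nu i * s%:C))^-1)]) ->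
  (forall i j, (i < M)%N -> (j < M)%N -> i != j -> bg_c bg / N%:R * (cycdist M i j)%:R <= normc (zeta i - zeta j)) ->
  (forall i, (i < M)%N -> ~ D (zeta i)) ->
  let sigma := B / (N%:R * harmonic_sum M) in
  forall k, (forall z, D z -> normc (k z) <= rn n) -> locally_approx D k ->
  exists k', [/\ forall z, D z -> normc (k' z) <= rn n + en n, locally_approx D k',
    forall z, (forall w, normc (w - z) < theta / N%:R -> D w) -> normc (k' z - k z) <= en n &
    forall j z, (j < M)%N -> D z -> normc (z - zeta j) <= A * sigma ->
      normc (k' z - b * pole_bump (zeta j) (nu j) sigma z) <= en n]).
  have [B B0 hB] := stage D (bg_r00 bg) (bg_C0 bg) (bg_c0 bg) (en0 n) th0 A0 (brn n).
  by exists B.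
have B0 n : 0 < B n by have [] := hB n.
have [N hN0] := lacunary_sequence B0 k0 k0'.
pose s n := B n / ((N n)%:R * harmonic_sum (bg_L bg n * N n)).
have hN n : [/\ (n < N n)%N, 1 <= kap * (N n)%:R, (N n <= N n.+1)%N, 1 <= kap * s n * (N n.+1)%:R &
    (\prod_(i < n.+1) (kap' / (s i * (N i)%:R))) ^+ n <= (N n)%:R] := hN0 n.
have N0 n : (0 < N n)%N by have [h _ _ _ _] := hN n; apply: leq_trans h.
have Nr n : 0 < (N n)%:R :> R by rewrite ltr0n.
(* The requirements on the previous function are premises, so that [choice] gives one total
   operation to be iterated. *)
have /choice[F hF] (x : nat * (R[i] -> R[i])) : exists k' : R[i] -> R[i],
   (forall z, D z -> normc (x.2 z) <= rn x.1) -> locally_approx D x.2 ->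
   [/\ forall z, D z -> normc (k' z) <= rn x.1.+1, locally_approx D k',
    forall z, (forall w, normc (w - z) < theta / (N x.1)%:R -> D w) -> normc (k' z - x.2 z) <= en x.1 &
    forall j z, (j < bg_L bg x.1 * N x.1)%N -> D z -> normc (z - gam (node N x.1 j)) <= A * s x.1 ->
      normc (k' z - b * pole_bump (gam (node N x.1 j)) (bg_nu bg (node N x.1 j)) (s x.1) z) <= en x.1].
  case: x => n k /=; have [_ [_ [_ hn]]] := hB n.
  have [hk|nk] := pselect ((forall z, D z -> normc (k z) <= rn n) /\ locally_approx D k); last first.
    by exists k => h1 h2; case: nk.
  have [hk1 hk2] := hk.
  have [||||k' hk'] := hn (fun j => gam (node N n j)) (fun j => bg_nu bg (node N n j)) (bg_L bg n * N n)%N (N n) _ (N0 n) _ _ _ k hk1 hk2.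
  - by rewrite muln_gt0 bg_L0 N0.
  - by move=> i _; split; [exact: bg_nu1|exact: bg_chart|exact: bg_pole].
  - by move=> i j; exact: node_chord.
  - by move=> i _; exact: bg_notin.
  by exists k' => _ _; rewrite rnS.
pose k := fix k n : R[i] -> R[i] := if n is n'.+1 then F (n', k n') else fun=> b.
have kP n : (forall z, D z -> normc (k n z) <= rn n) /\ locally_approx D (k n).
  elim: n => [|n [h1 h2]]; first by split => [z _|]; [exact: brn|exact: locally_approx_cst].
  by have [] := hF (n, k n) h1 h2.
have kS n : forall z, (forall w, normc (w - z) < theta / (N n)%:R -> D w) -> normc (k n.+1 z - k n z) <= en n.
  by have [h1 h2] := kP n; have [_ _ h _] := hF (n, k n) h1 h2.
have Nmono n m : (n <= m)%N -> (N n <= N m)%N.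
  elim: m => [|m IH]; first by rewrite leqn0 => /eqP ->.
  rewrite leq_eqVlt => /orP[/eqP ->//|/IH h]; apply: leq_trans h _.
  by have [_ _ ] := hN m.
have tN n m : (n <= m)%N -> theta / (N m)%:R <= theta / (N n)%:R.
  by move=> nm; rewrite ler_pM2l // lef_pV2 ?posrE // ler_nat Nmono.
have kd n m z : (n <= m)%N -> (forall w, normc (w - z) < theta / (N n)%:R -> D w) ->
    normc (k m z - k n z) <= eps / 2 ^+ n - eps / 2 ^+ m.
  move=> nm zD; elim: m nm => [|m IH]; first by rewrite leqn0 => /eqP ->; rewrite !subrr normc0.
  rewrite leq_eqVlt => /orP[/eqP ->|]; first by rewrite !subrr normc0.
  rewrite ltnS => nm; have h1 := IH nm.
  have h2 : normc (k m.+1 z - k m z) <= en m.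
    by apply: kS => w wz; apply: zD; apply: lt_le_trans wz (tN _ _ nm).
  have := normc_tri (k m z) (k m.+1 z) (k n z); have := enE m; rewrite /en in h2 *; clear -h1 h2; lra.
have small (e : R) : 0 < e -> exists n0 : nat, forall n : nat, (n0 <= n)%N -> eps / 2 ^+ n <= e.
  move=> e00; have [|n0 h] := @geom_small R 2^-1 eps e _ e00; first by clear -D gam bg; lra.
  by exists n0 => n /h; rewrite exprVn.
have Nsmall (y : R) : 0 < y -> exists n0 : nat, forall n : nat, (n0 <= n)%N -> theta / (N n)%:R <= y.
  move=> y0; have [n0 h] := natr_inv_small y0; exists n0 => n /h; apply: le_trans.
  apply: (@le_trans _ _ (1 / (N n)%:R)); first by rewrite ler_pM2r ?invr_gt0.
  by rewrite mul1r lef_pV2 ?posrE ?ltr0n // ler_nat; have [h' _ _ _ _] := hN n.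
pose kk z := xget 0 [set l | clim (fun n => k n z) l].
have kkP n z : (forall w, normc (w - z) < theta / (N n)%:R -> D w) -> normc (kk z - k n z) <= eps / 2 ^+ n.
  move=> zD; have hc : clim (fun n => k n z) (kk z).
    apply: (@xgetPex _ _ [set l | clim (fun n => k n z) l]).
    apply: cauchy_clim => e e00; have [n0 h0] := small e e00.
    exists (maxn n n0) => m hm; apply: le_trans (kd _ _ _ hm _) _.
      by move=> w wz; apply: zD; apply: lt_le_trans wz (tN _ _ (leq_maxl _ _)).
    by have := h0 _ (leq_maxr n n0); have := divr_gt0 e0 (e2 m); clear; lra.
  apply: clim_le hc _; exists n => m nm; apply: le_trans (kd _ _ _ nm zD) _.
  by have := divr_gt0 e0 (e2 m); clear; lra.
have Din z : D z -> exists2 y : R, 0 < y & forall w, normc (w - z) < y -> D w.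
  by move=> Dz; have /opencP := bg_open bg; apply.
have hB' n : s n * (N n)%:R <= B n /\ 0 < s n.
  have H1 : 1 <= harmonic_sum (bg_L bg n * N n) :> R by apply: harmonic_sum_ge1; rewrite muln_gt0 bg_L0 N0.
  have H0 : 0 < harmonic_sum (bg_L bg n * N n) :> R by clear -H1; lra.
  split; last by rewrite divr_gt0 // mulr_gt0.
  have -> : s n * (N n)%:R = B n / harmonic_sum (bg_L bg n * N n).
    by rewrite /s; field; rewrite !gt_eqF.
  by rewrite ler_pdivrMr //; apply: ler_peMr => //; exact: ltW.
constructor; apply: (@ScaleData b rho eps theta A kap kap' N s kk).
- by move=> n; have [] := hN n.
- by move=> n; have [] := hB' n.
- by move=> n; have [h1 _] := hB' n; have [_ [_ [h2 _]]] := hB n; clear -h1 h2; lra.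
- move=> n; have [h1 _] := hB' n; have [_ [h2 _]] := hB n.
  by have := ler_wpM2l (bg_C0 bg) h1; clear -h2; lra.
- by move=> n; have [] := hN n.
- by move=> n; have [] := hN n.
- by move=> n; have [] := hN n.
- by move=> n; have [] := hN n.
- move=> z Dz; have [y y0 zD] := Din z Dz; have [n0 h0] := Nsmall y y0.
  have := kkP n0 z (fun w wz => zD w (lt_le_trans wz (h0 _ (leqnn _)))).
  have [h1 _] := kP n0; have := h1 z Dz; have := normc_ge_sub (kk z) (k n0 z); rewrite /rn; clear -brho; lra.
- move=> S y y0; apply: poly_approx_lim => e e00.
  have [n0 h0] := small e e00; have [n1 h1] := Nsmall y y0; pose n := maxn n0 n1.
  exists (k n); first by have [_] := kP n; apply.
  move=> z [_ zD]; apply: le_trans (kkP n z _) (h0 _ (leq_maxl _ _)) => w wz.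
  by apply: zD; apply: lt_le_trans wz (h1 _ (leq_maxr _ _)).
(* Half of eps at most comes from the stage itself and half from all later ones; [zD] keeps z out of
   reach of these. *)
- move=> n j z jM Dz zA zD; have [h1 h2] := kP n; have [_ _ _ h3] := hF (n, k n) h1 h2.
  have := h3 j z jM Dz zA; have := kkP n.+1 z zD; rewrite -/(k n.+1) => a1 a2.
  have := normc_tri (k n.+1 z) (kk z) (b * pole_bump (gam (node N n j)) (bg_nu bg (node N n j)) (s n) z).
  have : en n + en n <= eps by rewrite enE.
  by move: a1 a2; rewrite /= -/(k n.+1) -/(en n); clear; lra.
(* As theta <= 1 <= N_0, a point at distance 1 from the complement is out of reach of every stage,
   and the limit is compared with the initial constant b. *)
- move=> z zD; have := kkP 0%N z; rewrite expr0 divr1; apply => w wz; apply: zD.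
  apply: lt_le_trans wz _; rewrite ler_pdivrMr // mul1r; apply: le_trans th1 _.
  by rewrite ler1n.
Qed.

End ScaleData.

(** * Cantor sets and Hausdorff dimension *)

Section Cantor.
Context {R : realType}.
Variables (o : nat -> R) (L N : nat -> nat) (l : nat -> R).
Hypotheses (N0 : forall n, (0 < N n)%N) (l0 : forall n, 0 < l n) (lN : forall n, l n * (N n)%:R <= 4^-1)
  (lNS : forall n, 8 <= l n * (N n.+1)%:R)
  (omono : forall n, o n.+1 <= o n /\ o n + (L n)%:R <= o n.+1 + (L n.+1)%:R)
  (grow : forall n, (\prod_(i < n.+1) (4 / (l i * (N i)%:R))) ^+ n <= (N n)%:R).

Definition grid n (j : nat) : R := o n + j%:R / (N n)%:R.
(* The Cantor set of the parameters lying, for all [n >= n0], within [l n] to the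
   right of a node of generation n; [children n] is the number of descendants
   kept at each node. The state of [descend] is a node of generation n with a
   number in [0, 1) whose next digit in base [children n] selects the child. *)
Definition children n : nat := Num.trunc (l n * (N n.+1)%:R / 2).
Definition first_child n j : nat := (Num.trunc ((grid n j - o n.+1) * (N n.+1)%:R)).+1.
Definition digit n (x : R) : nat := Num.trunc ((children n)%:R * x).
Definition descend n (st : nat * R) : nat * R :=
  ((first_child n st.1 + digit n st.2)%N, (children n)%:R * st.2 - (digit n st.2)%:R).

Let Nr n : 0 < (N n)%:R :> R. Proof. by rewrite ltr0n. Qed.

Lemma children_bounds n : l n * (N n.+1)%:R / 4 <= (children n)%:R /\ (children n)%:R + 2 <= l n * (N n.+1)%:R.
Proof.
have h := lNS n; have h1 := truncnS_gt (l n * (N n.+1)%:R / 2).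
have h2 : 0 <= l n * (N n.+1)%:R / 2 by lra.
have /andP[h3 _] := truncn_itv h2; rewrite -/(children n) in h1 h3.
by move: h1; rewrite -[(children n).+1%:R]natr1 => h1; split; lra.
Qed.

Lemma digit_bounds n (x : R) : 0 <= x < 1 -> [/\ (digit n x < children n)%N, (digit n x)%:R <= (children n)%:R * x &
  0 <= (children n)%:R * x - (digit n x)%:R < 1].
Proof.
move=> /andP[x0 x1]; have [h1 _] := children_bounds n; have h := lNS n.
have M0 : 0 < (children n)%:R :> R by lra.
have h2 : 0 <= (children n)%:R * x by rewrite mulr_ge0 ?ler0n.
have /andP[h3 h4] := truncn_itv h2; rewrite -/(digit n x) in h3 h4.
split => //; last by move: h4; rewrite -[(digit n x).+1%:R]natr1; lra.
by rewrite -(ltr_nat R); apply: le_lt_trans h3 _; have := mulr_gt0 M0 (_ : 0 < 1 - x); rewrite subr_gt0 mulrBr => /(_ x1); lra.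
Qed.

Lemma grid_top n j : (j < L n * N n)%N -> grid n j + l n < o n + (L n)%:R.
Proof.
move=> jM; have h1 : j.+1%:R <= (L n)%:R * (N n)%:R :> R by rewrite -natrM ler_nat.
have h := lN n; rewrite /grid -addrA ltrD2l -(ltr_pM2r (Nr n)) mulrDl divfK ?gt_eqF //.
by apply: lt_le_trans h1; rewrite -[j.+1%:R]natr1 ltrD2l; lra.
Qed.

(** Rounding up puts the child to the right of its parent, by at most d + 1 <= [children n] grid
    steps; the two spare steps in [children_bounds] leave room for its own interval. *)
Lemma child_bounds n j (d : nat) : (j < L n * N n)%N -> (d < children n)%N ->
  [/\ grid n j <= grid n.+1 (first_child n j + d), grid n.+1 (first_child n j + d) + l n.+1 <= grid n j + l n &
      (first_child n j + d < L n.+1 * N n.+1)%N].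
Proof.
move=> jM dM; have [le1 le2] := omono n.
have h1 : d%:R + 1 <= (children n)%:R :> R by rewrite natr1 ler_nat.
have [_ h2] := children_bounds n; have h3 := lN n.+1.
pose x := (grid n j - o n.+1) * (N n.+1)%:R.
have x0 : 0 <= x.
  rewrite mulr_ge0 ?ler0n // subr_ge0; apply: le_trans le1 _.
  by rewrite /grid lerDl divr_ge0 ?ler0n.
have /andP[t1 t2] := truncn_itv x0.
have fE : (first_child n j)%:R = (Num.trunc x)%:R + 1 :> R by rewrite natr1.
have gE : (grid n.+1 (first_child n j + d) - o n.+1) * (N n.+1)%:R = (Num.trunc x)%:R + 1 + d%:R.
  by rewrite /grid addrC addKr divfK ?gt_eqF // natrD fE.
have b1 : grid n j <= grid n.+1 (first_child n j + d).
  rewrite -(lerD2r (- o n.+1)) -(ler_pM2r (Nr n.+1)) gE -/x.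
  by move: t2; rewrite -[(Num.trunc x).+1%:R]natr1; have := ler0n R d; lra.
have b2 : grid n.+1 (first_child n j + d) + l n.+1 <= grid n j + l n.
  rewrite -(lerD2r (- o n.+1)) [X in X <= _]addrAC [X in _ <= X]addrAC -(ler_pM2r (Nr n.+1)).
  by rewrite mulrDl [X in _ <= X]mulrDl gE -/x; lra.
split => //; have h5 := grid_top jM; have h6 := l0 n.+1.
have h7 : grid n.+1 (first_child n j + d) < o n.+1 + (L n.+1)%:R by lra.
move: h7; rewrite /grid ltrD2l ltr_pdivrMr // -natrM ltr_nat.
by [].
Qed.

Section Base.
Variables (n0 j0 : nat).
Hypothesis (n00 : (0 < n0)%N) (j0M : (j0 < L n0 * N n0)%N).

Fixpoint address (x : R) i : nat * R :=
  if i is i'.+1 then descend (n0 + i') (address x i') else (j0, x).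

Let J x i := (address x i).1.
Let X x i := (address x i).2.
Let T x i := grid (n0 + i) (J x i).

Lemma address_bounds x i : 0 <= x < 1 -> (J x i < L (n0 + i) * N (n0 + i))%N /\ 0 <= X x i < 1.
Proof.
move=> x01; elim: i => [|i [IH1 IH2]]; first by rewrite addn0.
have [d1 d2 d3] := digit_bounds (n0 + i) IH2.
have [_ _ c3] := child_bounds IH1 d1.
by rewrite /J /X /= addnS.
Qed.

Lemma address_nested x i : 0 <= x < 1 -> T x i <= T x i.+1 /\ T x i.+1 + l (n0 + i.+1) <= T x i + l (n0 + i).
Proof.
move=> x01; have [IH1 IH2] := address_bounds i x01.
have [d1 d2 d3] := digit_bounds (n0 + i) IH2.
by have [c1 c2 _] := child_bounds IH1 d1; rewrite /T /J /= !addnS.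
Qed.

Lemma address_mono x i i' : 0 <= x < 1 -> (i <= i')%N -> T x i <= T x i' /\ T x i' + l (n0 + i') <= T x i + l (n0 + i).
Proof.
move=> x01; elim: i' => [|i' IH]; first by rewrite leqn0 => /eqP ->.
rewrite leq_eqVlt => /orP[/eqP ->//|/IH[h1 h2]].
by have [h3 h4] := address_nested i' x01; split; lra.
Qed.

Definition cantor_point x : R := sup [set T x i | i in setT].

Lemma cantor_point_in x i : 0 <= x < 1 -> T x i <= cantor_point x <= T x i + l (n0 + i).
Proof.
move=> x01.
have ub i' : ubound [set T x i | i in setT] (T x i' + l (n0 + i')).
  move=> _ [i'' _ <-]; have [h|h] := leqP i' i''.
    by have [_ h2] := address_mono x01 h; have := l0 (n0 + i''); lra.
  by have [h2 _] := address_mono x01 (ltnW h); have := l0 (n0 + i'); lra.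
have hs : has_sup [set T x i | i in setT] by split; [exists (T x 0), 0%N|exists (T x 0 + l (n0 + 0)); exact: ub].
apply/andP; split; first by apply: (ub_le_sup (proj2 hs)); exists i.
by apply: (ge_sup (proj1 hs)); exact: ub.
Qed.

Let P i : R := \prod_(a < i) (children (n0 + a))%:R.

(** Each descent multiplies the remaining fraction by the number of children and subtracts the
    digit, so equal digits stretch the difference by the product of these numbers. *)
Lemma same_address x y i : (forall a, (a < i)%N -> digit (n0 + a) (X x a) = digit (n0 + a) (X y a)) ->
  J x i = J y i /\ X x i - X y i = P i * (x - y).
Proof.
elim: i => [|i IH] h; first by rewrite /P big_ord0 mul1r.
have [|IH1 IH2] := IH; first by move=> a ai; apply: h; exact: ltnW.
have hi := h i (leqnn _); rewrite /J /X /= in IH1 IH2 hi *.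
rewrite /P big_ord_recr /= -/(P i) [_ * (children _)%:R]mulrC -mulrA -IH2 IH1 hi; split => //; ring.
Qed.

Let children2 n : 2 <= (children n)%:R :> R.
Proof. by have [h _] := children_bounds n; have := lNS n; lra. Qed.

Let P0 i : 2 ^+ i <= P i.
Proof.
elim: i => [|i IH]; first by rewrite /P big_ord0 expr0.
rewrite /P big_ord_recr /= -/(P i) exprSr ler_pM //.
Qed.

Lemma first_difference x y : 0 <= x < 1 -> 0 <= y < 1 -> x != y ->
  exists i, (forall a, (a < i)%N -> digit (n0 + a) (X x a) = digit (n0 + a) (X y a)) /\
    digit (n0 + i) (X x i) != digit (n0 + i) (X y i).
Proof.
move=> x01 y01 xy.
have [h|h] := pselect (exists i, digit (n0 + i) (X x i) != digit (n0 + i) (X y i)).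
  exists (ex_minn h); case: ex_minnP => i hi hmin; split => // a ai; apply/eqP.
  by apply: contraTT ai => /hmin; rewrite -leqNgt.
have all a : digit (n0 + a) (X x a) = digit (n0 + a) (X y a).
  by apply/eqP; apply: contra_notT h => ?; exists a.
have d0 : 0 < `|x - y| by rewrite normr_gt0 subr_eq0.
have [||i hi] := @geom_small R 2^-1 1 (`|x - y| / 2) _ _; [by lra|by lra|].
have {}hi := hi i (leqnn _); rewrite mul1r exprVn in hi.
have [_ h1] := @same_address x y i (fun a _ => all a).
have [_ /andP[a1 a2]] := address_bounds i x01; have [_ /andP[b1 b2]] := address_bounds i y01.
have h2 : P i * `|x - y| < 1.
  have Pi : 0 < P i by apply: lt_le_trans (P0 i); rewrite exprn_gt0.
  by rewrite -(gtr0_norm Pi) -normrM -h1 ltr_norml; apply/andP; split; lra.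
have h3 : 2 ^+ i * `|x - y| < 1 by apply: le_lt_trans h2; rewrite ler_wpM2r.
have h4 : 0 < (2 : R) ^+ i by rewrite exprn_gt0.
by have := ler_wpM2l (ltW h4) hi; rewrite divff ?gt_eqF //; lra.
Qed.

Lemma prod_ge1 (G : nat -> R) n : (forall i, 1 <= G i) -> 1 <= \prod_(i < n) G i.
Proof.
move=> h; elim: n => [|n IH]; first by rewrite big_ord0.
by rewrite big_ord_recr /= -[leLHS]mulr1 ler_pM.
Qed.

Let q n : R := 4 / (l n * (N n)%:R).
Let Q n := \prod_(i < n.+1) q i.

Let q1 n : 1 <= q n.
Proof.
have p : 0 < l n * (N n)%:R by rewrite mulr_gt0.
by rewrite /q ler_pdivlMr //; have := lN n; lra.
Qed.

(** Passing to the next generation multiplies the left side by l_n / (l_(n+1) children_n), and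
    children_n >= l_n N_(n+1) / 4 bounds this by the new factor of [Q]. The product in the growth
    condition thus measures the loss of length in the Cantor construction. *)
Let children_prod i : 16 / (l (n0 + i) * P i) <= 16 / l n0 * Q (n0 + i).
Proof.
have Qs n : Q n.+1 = Q n * q n.+1 by rewrite /Q big_ord_recr.
have Pp k : 0 < P k by apply: lt_le_trans (P0 k); rewrite exprn_gt0.
elim: i => [|i IH].
  rewrite addn0 /P big_ord0 mulr1 ler_peMr ?divr_ge0 ?(ltW (l0 n0)) //.
  exact: prod_ge1.
rewrite addnS Qs mulrA.
have q0 : 0 <= q (n0 + i).+1 by apply: le_trans (q1 _).
apply: le_trans (ler_wpM2r q0 IH).
rewrite {1}/P big_ord_recr /= -/(P i) /q.
have [cb _] := children_bounds (n0 + i).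
have [li ls] := (l0 (n0 + i), l0 (n0 + i).+1); have Ns := Nr (n0 + i).+1; have Pi := Pp i.
have c0 : 0 < (children (n0 + i))%:R :> R by have := children2 (n0 + i); lra.
set ch := (children _)%:R in cb c0 *.
have -> : 16 / (l (n0 + i) * P i) * (4 / (l (n0 + i).+1 * (N (n0 + i).+1)%:R)) =
  16 / (l (n0 + i).+1 * P i) * (l (n0 + i) * (N (n0 + i).+1)%:R / 4)^-1.
  by field; rewrite !gt_eqF.
have -> : 16 / (l (n0 + i).+1 * (P i * ch)) = 16 / (l (n0 + i).+1 * P i) * ch^-1.
  by field; rewrite !gt_eqF.
apply: ler_wpM2l; first by apply/ltW; rewrite divr_gt0 // mulr_gt0.
by rewrite lef_pV2 ?posrE // divr_gt0 // mulr_gt0.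
Qed.

(** At the first differing digit, in generation n, the two points are separated by a definite part
    of the digit difference over N_(n+1), while |x - y| is at most twice that difference over the
    number of intervals. This gives |x - y| <= C Q_n del, where del is the distance of the points
    and del <= l_n <= 1/N_n. By the growth condition Q_n^n0 <= N_n, so one factor del out of n0
    absorbs Q_n^n0. *)
Lemma cantor_separation : exists2 C : R, 0 < C & forall x y, 0 <= x < 1 -> 0 <= y < 1 -> x != y ->
  exists n j, [/\ (n0 <= n)%N /\ (j < L n * N n)%N, grid n j <= cantor_point x <= grid n j + l n,
    grid n j <= cantor_point y <= grid n j + l n, 1 <= 2 * (N n.+1)%:R * `|cantor_point x - cantor_point y| &
    `|x - y| ^+ n0 <= C * `|cantor_point x - cantor_point y| ^+ n0.-1].
Proof.
pose C0 := 16 / l n0; have C00 : 0 < C0 by rewrite divr_gt0.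
exists (C0 ^+ n0); first by rewrite exprn_gt0.
move=> x y x01 y01 xy; have [i [same diff]] := first_difference x01 y01 xy.
have [eqJ eqX] := same_address same; pose n := (n0 + i)%N.
have px := cantor_point_in i x01; have py := cantor_point_in i y01.
have [jx Xx] := address_bounds i x01; have [jy Xy] := address_bounds i y01.
have px1 := cantor_point_in i.+1 x01; have py1 := cantor_point_in i.+1 y01.
rewrite /T -eqJ in px py px1 py1.
set dx := digit _ _ in diff; set dy := digit _ _ in diff.
have TE z d : J z i = J x i -> digit (n0 + i) (X z i) = d -> (grid (n0 + i.+1) (J z i.+1)) * (N n.+1)%:R = (o n.+1 * (N n.+1)%:R + (first_child n (J x i))%:R) + d%:R.
  move=> h1 h2; rewrite /J /= -/(J z i) -/(X z i) h1 h2 addnS /grid mulrDl divfK ?gt_eqF // natrD addrA.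
  by [].
have Tx := TE x dx erefl erefl; have Ty := TE y dy (esym eqJ) erefl.
have Nn := Nr n.+1.
pose dd := `|dx%:R - dy%:R : R|.
have dd1 : 1 <= dd by rewrite /dd natr_dist ler1n lt0n addn_eq0 !subn_eq0 -eqn_leq.
pose del := `|cantor_point x - cantor_point y|.
have hdel : dd <= 2 * (N n.+1)%:R * del.
  have a1 : `|(cantor_point x - cantor_point y) * (N n.+1)%:R - (dx%:R - dy%:R)| <= 4^-1.
    move: px1 py1; rewrite !addnS -/n => /andP[p1 p2] /andP[p3 p4].
    have := ler_wpM2r (ltW Nn) p1; have := ler_wpM2r (ltW Nn) p2; have := ler_wpM2r (ltW Nn) p3; have := ler_wpM2r (ltW Nn) p4.
    have := lN n.+1; rewrite !addnS -/n in Tx Ty; rewrite ler_norml; lra.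
  have a2 : dd <= `|(cantor_point x - cantor_point y) * (N n.+1)%:R| + 4^-1.
    rewrite /dd; set u := _ * _ in a1 *; rewrite (_ : dx%:R - dy%:R = u - (u - (dx%:R - dy%:R))); last by ring.
    by apply: le_trans (ler_normB _ _) (lerD (lexx _) a1).
  by move: a2; rewrite normrM (gtr0_norm Nn) -/del; lra.
have del_l : del <= l n by move: px py; rewrite -/n => /andP[a1 a2] /andP[a3 a4]; rewrite /del ler_norml; lra.
have N1 : 1 <= (N n)%:R :> R by rewrite ler1n.
have ln := l0 n; have lNn := lN n.
have Ndel : (N n)%:R * del <= 1 by have := ler_wpM2r (ltW (Nr n)) del_l; lra.
have [cb _] := children_bounds n; have c2 := children2 n.
have Pi : 0 < P i by apply: lt_le_trans (P0 i); rewrite exprn_gt0.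
have del0 : 0 <= del := normr_ge0 _.
have hX : (children n)%:R * (P i * `|x - y|) <= 2 * dd.
  rewrite -{1}(gtr0_norm Pi) -normrM -eqX.
  have ch0 : 0 <= (children n)%:R :> R by lra.
  rewrite -{1}(ger0_norm ch0) -normrM.
  have [_ _ d1] := digit_bounds n Xx; have [_ _ d2] := digit_bounds n Xy.
  have : `|(children n)%:R * (X x i - X y i)| <= 1 + dd.
    rewrite (_ : _ * _ = ((children n)%:R * X x i - dx%:R - ((children n)%:R * X y i - dy%:R)) + (dx%:R - dy%:R)); last by ring.
    apply: le_trans (ler_normD _ _) _; rewrite lerD2r ler_norml.
    by move: d1 d2; rewrite -/dx -/dy => /andP[a1 a2] /andP[a3 a4]; lra.
  by move/le_trans; apply; lra.
have key : `|x - y| <= 16 / l n0 * Q n * del.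
  apply: le_trans (ler_wpM2r del0 (children_prod i)); rewrite -/n.
  have lP : 0 < l n * P i by rewrite mulr_gt0.
  rewrite mulrAC ler_pdivlMr //.
  have h1 : l n * (N n.+1)%:R / 4 * (P i * `|x - y|) <= (children n)%:R * (P i * `|x - y|).
    by rewrite ler_wpM2r // mulr_ge0 // ltW.
  have Nn' : 0 < (N n.+1)%:R :> R := Nn.
  rewrite -(ler_pM2r Nn'); lra.
have Q1 : 1 <= Q n by exact: prod_ge1.
exists n, (J x i); split => //.
- by split; rewrite ?leq_addr.
- by apply: le_trans dd1 _; rewrite -mulrA in hdel *.
have C1 : 0 <= C0 := ltW C00.
have Q0 : 0 <= Q n by lra.
apply: (@le_trans _ _ ((C0 * Q n * del) ^+ n0)); first by apply: lerXn2r; rewrite ?nnegrE ?(mulr_ge0 (mulr_ge0 C1 Q0) del0) //; exact: key.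
rewrite exprMn [(C0 * Q n) ^+ n0]exprMn -mulrA; apply: ler_wpM2l; first exact: exprn_ge0.
have q2 : Q n ^+ n0 <= (N n)%:R.
  by apply: le_trans (grow n); rewrite -/(Q n); apply: ler_weXn2l => //; rewrite leq_addr.
have -> : del ^+ n0 = del * del ^+ n0.-1 by rewrite -exprS prednK.
rewrite mulrA -[leRHS]mul1r ler_wpM2r ?exprn_ge0 //.
by apply: le_trans (ler_wpM2r del0 q2) _.
Qed.

End Base.
End Cantor.

(** * Bounds for the Hausdorff dimension *)

Section HausdorffDim.
Context {R : realType}.
Implicit Types (X U : set R[i]) (s : R).

Lemma diam_ge U (x y : R[i]) : U x -> U y -> ((normc (x - y))%:E <= diam U)%E.
Proof. by move=> Ux Uy; apply: ereal_sup_ubound; exists x => //; exists y. Qed.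

Lemma diam_le U (d : R) : (forall x y, U x -> U y -> normc (x - y) <= d) -> (diam U <= d%:E)%E.
Proof. by move=> h; apply: ge_ereal_sup => _ [x Ux [y Uy <-]]; rewrite lee_fin; exact: h. Qed.

Lemma diam_pow_ge0 s U : (0 <= diam_pow s U)%E.
Proof. by rewrite /diam_pow; case: ifP => // _; exact: poweR_ge0. Qed.

Lemma diam_fin U (x : R[i]) (d : R) : U x -> (diam U <= d%:E)%E ->
  exists2 e, diam U = e%:E & 0 <= e <= d.
Proof.
move=> Ux; have := diam_ge Ux Ux; rewrite subrr normc0.
by case: (diam U) => [e| |] //; rewrite !lee_fin => e0 ed; exists e => //; rewrite e0.
Qed.

Lemma hausdorff_premeasure_ge0 s (delta : R) X : (0 <= hausdorff_premeasure s delta X)%E.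
Proof.
apply: le_ereal_inf_tmp => _ [U _ <-]; apply: nneseries_ge0 => n _ _; exact: diam_pow_ge0.
Qed.

(** Taking the m-th root gives the exponent (m - 1)/m = 1 - 1/m, which may be lowered to s because d
    <= 1. The case d = 0 is separate, as 0 to the power s need not be 0. *)
Lemma holder_powR (a d C : R) s (m : nat) : (1 < m)%N -> 0 <= a -> 0 <= d <= 1 -> 0 < C -> 0 <= s ->
  s <= 1 - m%:R^-1 -> a ^+ m <= C * d ^+ m.-1 -> a <= C `^ m%:R^-1 * d `^ s.
Proof.
move=> m1 a0 /andP[d0 d1] C0 s0 sm h.
have m0 : 0 < m%:R :> R by rewrite ltr0n ltnW.
have mi : 0 <= m%:R^-1 :> R by rewrite invr_ge0 ltW.
have aE : a = (a ^+ m) `^ m%:R^-1.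
  by rewrite -powR_mulrn // -powRrM divff ?gt_eqF // powRr1.
have h1 : a <= (C * d ^+ m.-1) `^ m%:R^-1.
  by rewrite {1}aE; apply: ge0_ler_powR => //; rewrite nnegrE ?exprn_ge0 // mulr_ge0 ?exprn_ge0 // ltW.
apply: le_trans h1 _; rewrite powRM ?exprn_ge0 ?(ltW C0) //.
apply: ler_wpM2l; first exact: powR_ge0.
rewrite -powR_mulrn // -powRrM.
have pE : m.-1%:R * m%:R^-1 = 1 - m%:R^-1 :> R.
  by rewrite -subn1 natrB 1?ltnW // mulrBl mul1r divff ?gt_eqF.
rewrite pE; have [d00|d00] := eqVneq d 0.
  rewrite d00 powR0 ?powR_ge0 //; apply/eqP => h2.
  have : m%:R^-1 < 1 :> R by rewrite invf_lt1 // ltr1n.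
  lra.
by apply: ger_powR => //; rewrite d1 andbT lt_def d00.
Qed.

(** The inverse of h is Hoelder continuous with exponent at least s on sets of diameter at most 1,
    so a cover of X with small s-sum pulls back to a cover of [0, 1) by intervals of small total
    length. *)
Lemma hausdorff_measure_pos X (h : R -> R[i]) (m : nat) (C : R) s : (1 < m)%N -> 0 < C -> 0 <= s -> s <= 1 - m%:R^-1 ->
  (forall x, 0 <= x < 1 -> X (h x)) ->
  (forall x y, 0 <= x < 1 -> 0 <= y < 1 -> `|x - y| ^+ m <= C * normc (h x - h y) ^+ m.-1) ->
  hausdorff_measure s X != 0%E.
Proof.
move=> m1 C0 s0 sm hX hh; apply/eqP => H0.
pose C1 := C `^ m%:R^-1; have C10 : 0 < C1 by exact: powR_gt0.
(* The intervals below have total length at most 2 C1 times the sum, that is 1/2. *)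
have hp : (hausdorff_premeasure s 1 X < ((4 * C1)^-1)%:E)%E.
  apply: (@le_lt_trans _ _ 0%E); last by rewrite lte_fin invr_gt0 mulr_gt0.
  by rewrite -H0; apply: ereal_sup_ubound; exists 1 => //=; exact: ltr01.
have [_ [U [Ucov Ud] <-] Usum] := ereal_inf_lt hp.
(* Centre and half-length of an interval containing all parameters that h sends into [U i]; the
   half-length is 0 if there are none. *)
have /choice[aw haw] (i : nat) : exists aw : R * R, [/\ 0 <= aw.2, (aw.2%:E <= C1%:E * diam_pow s (U i))%E &
    forall x, 0 <= x < 1 -> U i (h x) -> `|x - aw.1| <= aw.2].
  have [[a [a01 Ua]]|none] := pselect (exists a, 0 <= a < 1 /\ U i (h a)); last first.
    exists (0, 0); split => //=; first by rewrite mule_ge0 ?diam_pow_ge0 // lee_fin ltW.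
    by move=> x x01 Ux; case: none; exists x.
  have [d dE d01] := diam_fin Ua (Ud i).
  exists (a, C1 * d `^ s); split => /=; first by rewrite mulr_ge0 ?powR_ge0 // ltW.
    rewrite /diam_pow ifF ?dE ?poweR_EFin //.
    by apply/negP => /eqP U0; rewrite U0 in Ua.
  move=> x x01 Ux; apply: (holder_powR m1) => //.
  apply: le_trans (hh x a x01 a01) _; rewrite ler_pM2l //.
  apply: lerXn2r; rewrite ?nnegrE ?normc_ge0 //; first by case/andP: d01.
  by have := diam_ge Ux Ua; rewrite dE lee_fin.
pose I i : set R := `[(aw i).1 - (aw i).2, (aw i).1 + (aw i).2]%classic.
have cover : `[0, 1[%classic `<=` \bigcup_i I i.
  move=> x /=; rewrite in_itv /= => x01; have [i _ Ux] := Ucov _ (hX x x01).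
  exists i => //; rewrite /I /= in_itv /=; have [_ _ /(_ x x01 Ux)] := haw i.
  by rewrite ler_norml => /andP[h1 h2]; apply/andP; split; lra.
have mI i : measurable (I i) by exact: measurable_itv.
have mU : measurable (`[0, 1[%classic : set R) by exact: measurable_itv.
have /= := measure_sigma_subadditive (@lebesgue_measure R) mI mU cover.
apply/negP; rewrite -ltNge lebesgue_measure_itv /= lte_fin ltr01 oppr0 adde0.
apply: (@le_lt_trans _ _ (\sum_(0 <= i <oo) ((2 * C1)%:E * diam_pow s (U i)))%E).
  apply: lee_nneseries => i _; first by move=> _; exact: measure_ge0.
  have [w0 wle _] := haw i; rewrite lebesgue_measure_itv /=.
  case: ifP => _; last by rewrite mule_ge0 ?diam_pow_ge0 // lee_fin mulr_ge0 // ltW.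
  rewrite -EFinB (_ : _ - _ = 2 * (aw i).2); last by ring.
  by rewrite !EFinM -muleA lee_pmul2l // lte_fin.
rewrite nneseriesZl; last by move=> i _; exact: diam_pow_ge0.
apply: (@lt_trans _ _ ((2 * C1)%:E * ((4 * C1)^-1)%:E)%E).
  by rewrite lte_pmul2l // lte_fin mulr_gt0.
rewrite -EFinM lte_fin (_ : _ * _ = 2^-1); first by lra.
by field; rewrite gt_eqF.
Qed.

Lemma hausdorff_dim_ge1 X : (forall m : nat, exists m' C (h : R -> R[i]), [/\ (m <= m')%N, 0 < C,
  forall x, 0 <= x < 1 -> X (h x) &
  forall x y, 0 <= x < 1 -> 0 <= y < 1 -> `|x - y| ^+ m' <= C * normc (h x - h y) ^+ m'.-1]) ->
  (1 <= hausdorff_dim X)%E.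
Proof.
move=> H; apply: le_ereal_inf_tmp => _ [s [s0 Hs] <-]; rewrite lee_fin leNgt; apply/negP => s1.
have [m hm] := natr_large (1 - s)^-1.
have [m' [C [h [mm C0 hX hh]]]] := H (maxn m 2).
move: mm; rewrite geq_max => /andP[mm m2].
suff sm : s <= 1 - m'%:R^-1 by have := hausdorff_measure_pos m2 C0 s0 sm hX hh; rewrite Hs eqxx.
have s1' : 0 < 1 - s by lra.
have : m'%:R^-1 <= 1 - s.
  by rewrite invf_ple ?posrE // ?ltr0n ?(leq_trans _ m2) //; exact: hm.
lra.
Qed.

(** For every e > 0 the (1 + e)-dimensional measure vanishes: n equal arcs of diameter at most T/n
    contribute n (T/n)^(1+e) = T (T/n)^e. *)
Lemma hausdorff_dim_le1 X (phi : R -> R[i]) (B K dl : R) : 0 < B -> 0 < K -> 0 < dl ->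
  (forall z, X z -> exists2 t, - B <= t <= B & z = phi t) ->
  (forall t t', - B <= t <= B -> - B <= t' <= B -> `|t - t'| < dl -> normc (phi t - phi t') <= K * `|t - t'|) ->
  (hausdorff_dim X <= 1)%E.
Proof.
move=> B0 K0 dl0 Xphi lip; apply/lee_addgt0Pr => e e0; apply: ereal_inf_lbound.
exists (1 + e) => //; split; first by lra.
apply/eqP; rewrite eq_le; apply/andP; split; last first.
  by apply: le_ereal_sup_tmp; exists (hausdorff_premeasure (1 + e) 1 X); [exists 1 => //=; exact: ltr01|exact: hausdorff_premeasure_ge0].
apply: ge_ereal_sup => _ [delta /= delta0 <-]; apply/lee_addgt0Pr => eta eta0; rewrite add0e.
pose c := 2 * B; have cE : c = 2 * B by []. clearbody c.
have c0 : 0 < c by rewrite cE mulr_gt0.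
pose T := K * c; have T0 : 0 < T by rewrite mulr_gt0.
(* The diameter at which T times its e-th power equals eta. *)
pose xi := (eta / T) `^ e^-1; have xi0 : 0 < xi by rewrite powR_gt0 // divr_gt0.
have [n1 h1] := natr_large (T / xi); have [n2 h2] := natr_large (T / delta); have [n3 h3] := natr_large (2 * c / dl).
pose n := (maxn (maxn n1 n2) n3).+1.
have nle k : (k <= maxn (maxn n1 n2) n3)%N -> (k <= n)%N by move=> /leq_trans; apply; exact: leqnSn.
have {}h1 := h1 n (nle _ (leq_trans (leq_maxl n1 n2) (leq_maxl _ n3))).
have {}h2 := h2 n (nle _ (leq_trans (leq_maxr n1 n2) (leq_maxl _ n3))).
have {}h3 := h3 n (nle _ (leq_maxr _ n3)).
have nr : 0 < n%:R :> R by rewrite ltr0n.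
clearbody n.
have Txi : T / n%:R <= xi by rewrite ler_pdivrMr // mulrC -ler_pdivrMr.
have Tde : T / n%:R <= delta by rewrite ler_pdivrMr // mulrC -ler_pdivrMr.
have cdl : c / n%:R < dl.
  have : 2 * c / n%:R <= dl by rewrite ler_pdivrMr // [leRHS]mulrC -ler_pdivrMr.
  by have : 0 < c / n%:R by [rewrite divr_gt0]; lra.
have Tn0 : 0 < T / n%:R by rewrite divr_gt0.
(* From index n on the sets are empty and weigh 0, so the series is a finite sum. *)
pose V (i : nat) : set R[i] := [set z | (i < n)%N /\ exists2 t, - B + c * i%:R / n%:R <= t <= - B + c * i.+1%:R / n%:R & z = phi t].
have Vd i x y : V i x -> V i y -> normc (x - y) <= T / n%:R.
  move=> [iN [t /andP[t1 t2] ->]] [_ [t' /andP[t1' t2'] ->]].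
  have e1 : c * i.+1%:R / n%:R = c * i%:R / n%:R + c / n%:R by rewrite -natr1; ring.
  have i0 : 0 <= c * i%:R / n%:R by rewrite divr_ge0 ?mulr_ge0 ?ler0n // ltW.
  have i1 : c * i.+1%:R / n%:R <= c by rewrite ler_pdivrMr // ler_wpM2l ?(ltW c0) // ler_nat.
  have tt : `|t - t'| <= c / n%:R by rewrite ler_norml; lra.
  have := lip t t' _ _ (le_lt_trans tt cdl).
  have -> : T / n%:R = K * (c / n%:R) by rewrite /T mulrA.
  move=> L; apply: le_trans (L _ _) _; last by rewrite ler_wpM2l // ltW.
  - by apply/andP; split; lra.
  - by apply/andP; split; lra.
pose v := (T / n%:R) `^ (1 + e).
have Vp i : (diam_pow (1 + e) (V i) <= v%:E)%E.
  rewrite /diam_pow; case: ifPn => [_|V0]; first by rewrite lee_fin powR_ge0.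
  have /set0P[x Vx] := V0; have [d dE /andP[d0 d1]] := diam_fin Vx (diam_le (Vd i)).
  rewrite dE poweR_EFin lee_fin; apply: ge0_ler_powR; rewrite ?nnegrE //; lra.
have sumle p : (\sum_(0 <= i < p) diam_pow (1 + e) (V i) <= ((minn p n)%:R * v)%:E)%E.
  elim: p => [|p IH]; first by rewrite big_geq // min0n mul0r.
  rewrite big_nat_recr //=; have [pn|pn] := ltnP p n.
    rewrite (minn_idPl pn) -natr1 mulrDl mul1r EFinD; apply: leeD; last exact: Vp.
    by move: IH; rewrite (minn_idPl (ltnW pn)).
  rewrite (_ : diam_pow _ _ = 0%E) ?adde0.
    by move: IH; rewrite (minn_idPr pn) (minn_idPr (leq_trans pn (leqnSn _))).
  rewrite /diam_pow ifT //; apply/eqP/seteqP; split => // z [pn' _].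
  by move: pn; rewrite leqNgt pn'.
have nv : n%:R * v <= eta.
  rewrite /v powRD; last by apply/implyP => _; rewrite gt_eqF.
  rewrite powRr1 ?(ltW Tn0) // mulrA [n%:R * _]mulrC divfK ?gt_eqF //.
  have : (T / n%:R) `^ e <= xi `^ e.
    by apply: ge0_ler_powR; rewrite ?nnegrE ?(ltW xi0) ?(ltW Tn0) // ltW.
  rewrite /xi -powRrM mulVf ?gt_eqF // powRr1; last by rewrite divr_ge0 // ltW.
  by move/(ler_wpM2l (ltW T0)); rewrite mulrCA divff ?gt_eqF // mulr1.
apply: (@le_trans _ _ (\sum_(0 <= i <oo) diam_pow (1 + e) (V i))%E).
  apply: ereal_inf_lbound; exists V => //; split; last first.
    by move=> i; apply: diam_le => x y Vx Vy; apply: le_trans (Vd i x y Vx Vy) Tde.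
  move=> z /Xphi[t /andP[t1 t2] zE].
  pose i := Num.trunc ((t + B) / c * n%:R).
  have x0 : 0 <= (t + B) / c * n%:R by rewrite mulr_ge0 ?ler0n // divr_ge0 ?(ltW c0) //; lra.
  have /andP[i1 i2] := truncn_itv x0; rewrite -/i in i1 i2.
  have back (y : R) : c * y / n%:R = y * (c / n%:R) by ring.
  have cn : 0 < c / n%:R by rewrite divr_gt0.
  have xE : (t + B) / c * n%:R * (c / n%:R) = t + B by field; rewrite !gt_eqF.
  have [iN|iN] := ltnP i n.
    exists i => //; split => //; exists t => //; rewrite !back.
    have := ler_wpM2r (ltW cn) i1; have := ler_wpM2r (ltW cn) (ltW i2); rewrite xE => ? ?.
    by apply/andP; split; lra.
  (* The right end of the parameter interval is put into the last arc. *)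
  have tB : t = B.
    have : n%:R <= (t + B) / c * n%:R by apply: le_trans i1; rewrite ler_nat.
    move/(ler_wpM2r (ltW cn)); rewrite xE [n%:R * _]mulrC divfK ?gt_eqF //; lra.
  exists n.-1 => //; split; first by rewrite prednK // -(ltr0n R).
  exists t => //; rewrite !back prednK -?(ltr0n R) // [n%:R * _]mulrC divfK ?gt_eqF // tB.
  have : n.-1%:R * (c / n%:R) <= c.
    rewrite mulrA ler_pdivrMr // mulrC ler_wpM2l ?(ltW c0) // ler_nat leq_pred //.
  by move=> ?; apply/andP; split; lra.
apply: lime_le; first by apply: is_cvg_nneseries => k _ _; exact: diam_pow_ge0.
apply: nearW => p; apply: le_trans (sumle p) _; rewrite lee_fin; apply: le_trans nv.
by rewrite ler_wpM2r ?powR_ge0 // ler_nat geq_minr.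
Qed.

End HausdorffDim.

(** * Discrete sets and level sets of analytic functions *)

Section Discrete.
Context {R : realType}.
Implicit Types (A : set R[i]) (q z : R[i]).

(** Compactness of a square by [cousin], applied twice: along a horizontal line it yields a thin
    strip containing finitely many points, and then finitely many strips fill the square. *)
Lemma bounded_discrete_finite A (B : R) : (forall z, A z -> normc z <= B) ->
  (forall q, exists2 e : R, 0 < e & forall z, A z -> normc (z - q) < e -> z = q) -> finite_set A.
Proof.
move=> AB0 disc; pose S := `|B| + 1; have S0 : 0 < S by rewrite ltr_wpDl.
have AB z : A z -> `|complex.Re z| <= S /\ `|complex.Im z| <= S.
  move=> /AB0 h; have h1 := normc_Re z; have h2 := normc_Im z; have h3 := ler_norm B.
  by rewrite /S; split; lra.
pose X t := 2 * S * t - S.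
have Xloc t s d : 0 < d -> t - d / (2 * S) < s -> s < t + d / (2 * S) -> `|X s - X t| < d.
  move=> d0; have S2 : 0 < 2 * S by rewrite mulr_gt0.
  rewrite ltrBlDr -!ltrBlDl => h1 h2.
  have h3 : 2 * S * (t - s) < d by rewrite mulrC -ltr_pdivlMr //; lra.
  have h4 : 2 * S * (s - t) < d by rewrite mulrC -ltr_pdivlMr //; lra.
  by rewrite /X ltr_norml; apply/andP; split; clear -h3 h4; lra.
have row y : exists2 d : R, 0 < d & finite_set [set z | A z /\ `|complex.Im z - y| < d].
  have [||d d0 fin] := @cousin R (fun a b => exists2 d : R, 0 < d & finite_set [set z | A z /\ X a <= complex.Re z <= X b /\ `|complex.Im z - y| < d]).
  - move=> a b c _ _ [d1 d10 f1] [d2 d20 f2]; exists (Num.min d1 d2); first by rewrite lt_min d10.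
    apply: sub_finite_set (_ : finite_set ([set z | A z /\ X a <= complex.Re z <= X b /\ `|complex.Im z - y| < d1] `|` [set z | A z /\ X b <= complex.Re z <= X c /\ `|complex.Im z - y| < d2])).
      move=> z /= [Az [/andP[z1 z2]]]; rewrite lt_min => /andP[y1 y2].
      by have [h|h] := leP (complex.Re z) (X b); [left|right]; split => //; rewrite ?z1 ?z2 ?h ?(ltW h).
    by rewrite finite_setU.
  - move=> t _; have [e e0 he] := disc (X t +i* y); have e20 : 0 < e / 2 by lra.
    exists (e / 2 / (2 * S)); first by rewrite divr_gt0 // mulr_gt0.
    move=> a b _ at_ tb _ h1 h2; exists (e / 2) => //.
    apply: (@sub_finite_set _ _ [set X t +i* y]); last exact: finite_set1.
    move=> z /= [Az [/andP[z1 z2] zy]]; apply: he => //.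
    have d0 : 0 < e / 2 / (2 * S) by rewrite divr_gt0 // mulr_gt0.
    have a1 : `|X a - X t| < e / 2 by apply: Xloc => //; clear -at_ h1; lra.
    have a2 : `|X b - X t| < e / 2 by apply: Xloc => //; clear -at_ tb h1; lra.
    apply: le_lt_trans (normc_ReIm _) _; rewrite cReD cReN cImD cImN /=.
    have : `|complex.Re z - X t| < e / 2.
      by move: a1 a2; rewrite !ltr_norml => /andP[? ?] /andP[? ?]; apply/andP; split; lra.
    (clear -zy; lra).
  exists d => //; apply: sub_finite_set fin => z /= [Az zy]; split => //; split => //.
  have [h _] := AB z Az; move: h; rewrite ler_norml /X => /andP[? ?]; apply/andP; split; lra.
have fin : finite_set [set z | A z /\ X 0 <= complex.Im z <= X 1].
  apply: (@cousin R (fun a b => finite_set [set z | A z /\ X a <= complex.Im z <= X b])).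
  - move=> a b c _ _ f1 f2.
    apply: sub_finite_set (_ : finite_set ([set z | A z /\ X a <= complex.Im z <= X b] `|` [set z | A z /\ X b <= complex.Im z <= X c])).
      move=> z /= [Az /andP[z1 z2]].
      by have [h|h] := leP (complex.Im z) (X b); [left|right]; split => //; rewrite ?z1 ?z2 ?h ?(ltW h).
    by rewrite finite_setU.
  - move=> t _; have [d d0 fin] := row (X t).
    exists (d / (2 * S)); first by rewrite divr_gt0 // mulr_gt0.
    move=> a b _ at_ tb _ h1 h2; apply: sub_finite_set fin => z /= [Az /andP[z1 z2]]; split => //.
    have d0' : 0 < d / (2 * S) by rewrite divr_gt0 // mulr_gt0.
    have a1 : `|X a - X t| < d by apply: Xloc => //; lra.
    have a2 : `|X b - X t| < d by apply: Xloc => //; clear -at_ tb h1; lra.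
    by move: a1 a2; rewrite !ltr_norml => /andP[? ?] /andP[? ?]; apply/andP; split; lra.
apply: sub_finite_set fin => z Az; split => //.
have [_ h] := AB z Az; move: h; rewrite ler_norml /X => /andP[? ?]; apply/andP; split; lra.
Qed.

Lemma infinite_accumulation A q : ~ A q -> (forall e : R, 0 < e -> exists2 z, A z & normc (z - q) < e) -> infinite_set A.
Proof.
move=> nA acc /finite_seqP[s sE].
have [e e0 he] : exists2 e : R, 0 < e & forall z, z \in s -> z != q -> e <= normc (z - q).
  elim: (s) => [|a l [e e0 he]]; first by exists 1.
  have [->|aq] := eqVneq a q.
    by exists e => // z; rewrite inE => /orP[/eqP ->|/he //]; rewrite eqxx.
  exists (Num.min e (normc (a - q))); first by rewrite lt_min e0 normc_gt0 subr_eq0.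
  move=> z; rewrite inE => /orP[/eqP ->|/he h] zq; first by rewrite ge_min lexx orbT.
  by rewrite ge_min h.
have [z Az zq] := acc e e0.
have zs : z \in s by move: Az; rewrite sE.
have zq' : z != q by apply/eqP => zz; apply: nA; rewrite -zz.
by have := he z zs zq'; lra.
Qed.

(** If f(q) = w, the leading term of the expansion at q exceeds the remainder near q; a vanishing
    expansion would make f constant by the identity theorem. *)
Lemma level_set_discrete (D : set R[i]) f f1 w q : open D -> clopen_conn D -> (forall z, D z -> cdiff f z (f1 z)) ->
  (exists2 z, D z & f1 z != 0) -> D q ->
  exists2 e : R, 0 < e & forall z, f z = w -> normc (z - q) < e -> z = q.
Proof.
move=> oD cD fd [z1 Dz1 f1z] Dq; have /opencP/(_ q Dq)[r r0 rD] := oD.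
have [cst|[m [a [C [r' [a0 C0 r'0 r'r ord]]]]]] := order_dichotomy r0 (fun z zq => fd z (rD z zq)).
  have := identity_deriv oD cD fd _ Dz1 => /(_ _)/eqP; rewrite (negPf f1z) => h; exfalso; move: h.
  suff /[swap]/[apply] : exists2 z0, D z0 & exists2 r : R, 0 < r & forall y, normc (y - z0) < r -> f1 y = 0 by [].
  exists q => //; exists (r / 4); first by lra.
  move=> y yq; have Dy : D y by apply: rD; lra.
  apply: cdiff_unique (fd y Dy) _.
  have r40 : 0 < r / 4 by lra.
  apply: (cdiff_local r40) (cdiff_cst (f q) y) => v vy; rewrite cst //.
  by have := normc_tri y v q; lra.
have na : 0 < normc a by rewrite normc_gt0.
have [fq|fq] := eqVneq (f q) w; last first.
  have d0 : 0 < normc (f q - w) by rewrite normc_gt0 subr_eq0.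
  have [|dl dl0 h] := cdiff_ccont (fd q Dq) (_ : 0 < normc (f q - w) / 2); first by lra.
  exists dl => // z fz /h; rewrite fz normcC => h'; exfalso; lra.
exists (Num.min r' (normc a / (C + 1))); first by rewrite lt_min r'0 divr_gt0 //; lra.
move=> z fz; rewrite lt_min => /andP[zr]; rewrite ltr_pdivlMr; last by lra.
move=> zC; apply/eqP; rewrite -subr_eq0 -normc_eq0; apply/negPn/negP => nz.
have n0 : 0 < normc (z - q) by rewrite lt_def nz normc_ge0.
have [] := ord (z - q) zr; rewrite [q + _]addrC subrK fz fq subrr sub0r normcN normcM normcX => h _.
have p0 : 0 < normc (z - q) ^+ m.+1 by rewrite exprn_gt0.
move: h; rewrite [_ ^+ m.+2]exprS mulrA ler_pM2r //.
by lra.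
Qed.

End Discrete.

(** * Values of infinite valence *)

Section Primitive.
Context {R : realType}.
Implicit Types (f g h : R[i] -> R[i]) (p q z w u v : R[i]).
Variables (D : set R[i]) (gam : R -> R[i]) (bg : boundary_geometry D gam).
Variables (F : R[i] -> R[i]) (r : R) (b : R[i]) (lm : local_model F r b).
Variables (rho eps theta A kap kap' eta M L : R).
Variables (sd : scale_data bg b rho eps theta A kap kap') (f : R[i] -> R[i]).
Let k := sd_k sd.
Let K := bg_K bg.
Let c := bg_c bg.
Let r0 := bg_r0 bg.
Let om := lm_om lm.
Let m := lm_m lm.
Let kk := lm_k lm.
Let e := lm_e lm.
Hypotheses (eps0 : 0 < eps) (theta0 : 0 < theta) (theta1 : theta <= 1) (kap0 : 0 < kap) (kap1 : kap <= 2^-1)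
  (eta0 : 0 < eta) (M0 : 0 < M) (L0 : 0 < L).
Hypotheses (FM : forall w, normc w <= rho -> normc (F w) <= M)
  (FL : forall w w', normc w <= rho -> normc w' <= rho -> normc (F w' - F w) <= L * normc (w' - w))
  (fk : forall z, D z -> cdiff f z (F (k z))).
(** Conditions that can be met by choosing eta, eps, theta and kap in this order. They keep the
    errors of f' near a node, times the distances travelled, below a fraction of |m| kk, and the
    variation of f' along a kept arc below a fraction of |F b|. *)
Hypotheses (hA : 10 * normc om + 2 <= A) (hb : normc b * (1 + 2 * kap) <= rho)
  (hkap : kap * (10 * normc om) <= 1) (hkap1 : 50 * kap * normc om ^+ 2 <= lm_k1 lm) (hkapk : 8 * kap * normc om ^+ 2 <= kk)
  (hth : theta * kap <= kk / 2) (hthe : theta * kap <= eta) (hetaK : K * eta <= 8^-1) (hetar : eta * r0 <= 2^-1)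
  (hLm : L * eps <= normc m / 8) (hMe : 3 * M * K * eta <= normc m * kk / 10) (hLe : 3 * L * eps * normc om <= normc m * kk / 10)
  (hMt : 4 * (2 * M + e) * (theta * kap) <= normc m * kk / 10)
  (hFb : 3 * (L * (eps + normc b * (32 * (K * eta)))) <= normc (F b) / 2) (hMth : 16 * M * theta <= normc (F b) * c / 4).

Let s n := sd_s sd n.
Let N n := sd_N sd n.
Let nd n j := node bg N n j.
(** Height of the boundary layer in which stages after n still act. *)
Let y n : R := theta / (N n.+1)%:R.

Let fb := bd_ext D f.

Lemma sd_facts n : [/\ 0 < s n, 0 < (N n)%:R :> R, s n * (N n)%:R <= r0 / 2, s n <= kap * r0 / 2 &
   (2 * bg_C bg * s n <= kap /\ s n <= r0 / 4) /\ 0 < y n /\ y n <= theta * kap * s n].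
Proof.
have k0 := kap0; have k1 := kap1; have t0 := theta0; have rr := bg_r00 bg.
have sn := sd_s0 sd n; have Nn : 0 < (N n)%:R :> R by rewrite ltr0n; apply: leq_trans (sd_N0 sd n).
have Nn1 : 0 < (N n.+1)%:R :> R by rewrite ltr0n; apply: leq_trans (sd_N0 sd n.+1).
have h1 := sd_sN sd n; have h2 := sd_sC sd n; have h3 := sd_Nk sd n; have h4 := sd_step sd n.
rewrite -/(s n) -/(N n) -/(N n.+1) in sn h1 h2 h3 h4.
have a1 : s n <= kap * r0 / 2.
  by have := ler_wpM2l (ltW sn) h3; have := ler_wpM2l (ltW k0) h1; rewrite /r0; lra.
have a2 : 2 * bg_C bg * s n <= kap.
  have := ler_wpM2l (ltW k0) h2; have := ler_wpM2l (mulr_ge0 (bg_C0 bg) (ltW sn)) h3; lra.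
split => //; split.
  by split => //; have := ler_wpM2r (ltW rr) k1; rewrite /r0 in a1 *; lra.
split; first by rewrite /y divr_gt0.
by rewrite /y ler_pdivrMr //; have := ler_wpM2l (ltW t0) h4; lra.
Qed.

Lemma k_bound z : D z -> normc (k z) <= rho. Proof. exact: sd_bound. Qed.

Lemma f1_bound z : D z -> normc (F (k z)) <= M. Proof. by move=> /k_bound; exact: FM. Qed.

Lemma gam_closure t : closure D (gam t).
Proof.
apply/closurecP => x x0; have r00 := bg_r00 bg.
have [phi [h1 _ h2]] := bg_chart bg t.
have p0 : phi 0 = 0.
  apply/eqP; rewrite -normr_eq0 eq_le normr_ge0 andbT.
  by have := h1 0; rewrite normr0 expr0n /= mulr0; apply.
pose d := Num.min (x / 2) (r0 / 2).
have d0 : 0 < d by rewrite lt_min !divr_gt0.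
have dx : d <= x / 2 by rewrite ge_min lexx.
have dr : d <= r0 / 2 by rewrite ge_min lexx orbT.
clearbody d; rewrite /r0 in dr.
exists (gam t + bg_nu bg t * (0 +i* d)).
  apply/h2; rewrite /= ?p0 ?normr0 //.
  by rewrite gtr0_norm //; lra.
rewrite addrC addKr normcM bg_nu1 mul1r /= expr0n /= add0r sqrtr_sqr gtr0_norm //; lra.
Qed.

(** [local_path] with a layer of height 0: near the boundary, inner distances are at most three
    times the distances in the plane. *)
Lemma f_lip_near t z w : D z -> D w -> normc (z - gam t) < r0 / 16 -> normc (w - gam t) < r0 / 16 ->
  normc (f w - f z) <= 3 * M * normc (w - z) + 0.
Proof.
move=> Dz Dw zt wt; have rr := bg_r00 bg; have M0' := M0.
have [u zE nu] := chart_coord (gam t) (bg_nu1 bg t) z.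
have [v wE nv] := chart_coord (gam t) (bg_nu1 bg t) w.
rewrite -(mulr0 (4 * M)) {1}zE {1}wE zE wE (chart_dist _ (bg_nu1 bg t)).
apply: (@local_path _ D (gam t) (bg_nu bg t) r0 (bg_C bg) (bg_nu1 bg t) (bg_r00 bg) (bg_chart bg t) f (fun z => F (k z)) (r0 / 2) 0 M M) => //; rewrite -?zE -?wE //; rewrite /r0 in zt wt *; try lra.
by move=> x Dx _; split => [||_]; [exact: fk|exact: f1_bound|exact: f1_bound].
Qed.

Lemma fb_lim p : closure D p -> bd_lim D f p (fb p).
Proof.
move=> cp; have rr := bg_r00 bg; apply: bd_extP; have [Dp|nDp] := pselect (D p).
  by exists (f p); apply: ccont_bd_lim; exact: cdiff_ccont (fk Dp).
have [n [t [_ pE]]] : exists n t, bg_o bg n <= t < bg_o bg n + (bg_L bg n)%:R /\ p = gam t.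
  by apply: (bg_surj bg); split => // /interior_subset.
apply: (@bd_lim_ex _ D f p (r0 / 16) (3 * M)) => //.
- by rewrite divr_gt0.
- by rewrite mulr_ge0 // ltW.
- by move=> z w Dz Dw zp wp; have := f_lip_near (t := t) Dz Dw; rewrite -pE addr0; apply.
Qed.

Lemma fb_in z : D z -> fb z = f z.
Proof. by move=> Dz; apply: bd_ext_in => //; exact: cdiff_ccont (fk Dz). Qed.

Lemma fb_lip t p q : closure D p -> closure D q -> normc (p - gam t) < r0 / 16 -> normc (q - gam t) < r0 / 16 ->
  normc (fb q - fb p) <= 3 * M * normc (q - p).
Proof.
move=> cp cq pt qt; rewrite -[leRHS]addr0; have M0' := M0.
pose x := Num.min (r0 / 16 - normc (p - gam t)) (r0 / 16 - normc (q - gam t)).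
apply: (bd_lim_le (r := x)) (fb_lim cp) (fb_lim cq) _ => //; first by rewrite lt_min !subr_gt0 pt.
  by lra.
move=> z w Dz Dw; rewrite !lt_min => /andP[z1 _] /andP[_ w1].
apply: (f_lip_near (t := t)) => //.
  by have := normc_tri p z (gam t); lra.
by have := normc_tri q w (gam t); lra.
Qed.

Lemma fb_gam_lip t t' : K * `|t - t'| < r0 / 16 -> normc (fb (gam t) - fb (gam t')) <= 3 * M * K * `|t - t'|.
Proof.
move=> tt; have M0' := M0; have rr := bg_r00 bg; have h := bg_lip bg t t'.
have h1 : normc (gam t - gam t') < r0 / 16 by apply: le_lt_trans h _.
have h2 : normc (gam t' - gam t') < r0 / 16 by rewrite subrr normc0 divr_gt0.
have := fb_lip (@gam_closure t') (@gam_closure t) h2 h1; move=> h3; apply: le_trans h3 _.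
rewrite -[leRHS]mulrA ler_wpM2l //; lra.
Qed.

Section AtNode.
Variables (n j : nat).
Hypothesis jM : (j < bg_L bg n * N n)%N.
Let t0 := nd n j.
Let zt := gam t0.
Let nu := bg_nu bg t0.
Let nu1 : normc nu = 1. Proof. exact: bg_nu1. Qed.
Let sg := s n.
Let bp z := pole_bump zt nu sg z.
Let om_of z := (z - zt) / (nu * sg%:C).

Let nus0 : nu * sg%:C != 0.
Proof.
have [sn _ _ _ _] := sd_facts n.
by apply: mulf_neq0; [rewrite -normc_gt0 nu1|rewrite rc_eq0 gt_eqF].
Qed.

Lemma normc_om z : normc (z - zt) = sg * normc (om_of z).
Proof.
have [sn _ _ _ _] := sd_facts n.
by rewrite /om_of normcf normcM nu1 mul1r normc_real gtr0_norm // mulrC divfK // gt_eqF.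
Qed.

(** The last part says that D looks like the half-plane to the model: the chart gives Im om >= - C s
    |om|^2, and s is small enough for |om| <= 10 |om0|. *)
Lemma bump_facts z : D z -> [/\ normc (b * bp z) <= rho, normc (1 - bp z) * sg <= 2 * normc (z - zt) &
  normc (om_of z) <= 10 * normc om -> - lm_k1 lm <= complex.Im (om_of z)].
Proof.
move=> Dz; have [sn _ _ s1 [[s2 s3] _]] := sd_facts n.
have sr : s n <= kap * bg_r0 bg by have := mulr_gt0 kap0 (bg_r00 bg); rewrite /r0 in s1; lra.
have [b1 _ _ b4] := bump_bounds nu1 (bg_r00 bg) (bg_C0 bg) (bg_chart bg t0) kap0 kap1 sn s2 sr Dz.
split.
- by rewrite normcM; apply: le_trans hb; rewrite ler_wpM2l ?normc_ge0.
- apply: le_trans b4 _; rewrite ler_wpM2r ?normc_ge0 //; have := kap1; lra.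
- move=> ho; have [phi [h1 _ h2]] := bg_chart bg t0.
  have no := normc_ge0 (om_of z); have nz := normc_om z.
  have zE : z = zt + nu * (sg%:C * om_of z).
    by rewrite /om_of [nu * _]mulrA [nu * _ * _]mulrC divfK //; ring.
  have n1 : normc (sg%:C * om_of z) = sg * normc (om_of z) by rewrite normcM normc_real gtr0_norm.
  have n2 : sg * normc (om_of z) < bg_r0 bg.
    have hk := hkap; have k0 := kap0; have rr := bg_r00 bg.
    have := ler_wpM2l (ltW sn) ho; have := normc_ge0 om => om0.
    have := ler_wpM2r (mulr_ge0 (ltW rr) om0) (lexx 10); have := ler_wpM2l (ltW rr) hk.
    have := ler_wpM2r om0 s1; rewrite /sg /r0; lra.
  have rR : `|complex.Re (sg%:C * om_of z)| < bg_r0 bg by apply: le_lt_trans (normc_Re _) _; rewrite n1.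
  have rI : `|complex.Im (sg%:C * om_of z)| < bg_r0 bg by apply: le_lt_trans (normc_Im _) _; rewrite n1.
  have := h1 _ rR; rewrite ler_norml => /andP[p1 _].
  move: Dz; rewrite {1}zE => /(h2 _ rR rI); rewrite cImZ => p2.
  have b3 : complex.Re (sg%:C * om_of z) ^+ 2 <= (sg * normc (om_of z)) ^+ 2.
    by rewrite -[leLHS]real_normK ?num_real //; apply: lerXn2r; rewrite ?nnegrE ?normr_ge0 ?mulr_ge0 ?(ltW sn) // -n1 normc_Re.
  have o2 : normc (om_of z) ^+ 2 <= (10 * normc om) ^+ 2.
    by apply: lerXn2r; rewrite ?nnegrE ?mulr_ge0 ?normc_ge0.
  have b5 := ler_wpM2l (bg_C0 bg) b3.
  rewrite -(ler_pM2l sn); have hk1 := hkap1.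
  have q1 := ler_wpM2l (mulr_ge0 (bg_C0 bg) (sqr_ge0 sg)) o2.
  have q2 := ler_wpM2r (mulr_ge0 (ltW sn) (sqr_ge0 (normc om))) s2.
  have q3 := ler_wpM2l (ltW sn) hk1.
  rewrite /sg in b3 b5 p1 p2 q1 *; rewrite !exprMn !expr2 in b3 b5 p1 p2 q1 q2 q3 *; lra.
Qed.

Lemma node_region o : normc o <= 2 * normc om -> kk / 2 <= complex.Im o -> D (zt + nu * (sg%:C * o)).
Proof.
move=> ho oI; have [sn _ _ s1 [[s2 s3] _]] := sd_facts n.
have [phi [h1 _ h2]] := bg_chart bg t0; have no := normc_ge0 o.
have n1 : normc (sg%:C * o) = sg * normc o by rewrite normcM normc_real gtr0_norm.
have om0 := normc_ge0 om; have rr := bg_r00 bg; have kk0 : 0 < kk := lm_k0 lm.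
have n2 : sg * normc o < bg_r0 bg.
  have hk := hkap; have := ler_wpM2l (ltW sn) ho; have := ler_wpM2l (ltW rr) hk.
  have := ler_wpM2r om0 s1; rewrite /sg /r0; lra.
have rR : `|complex.Re (sg%:C * o)| < bg_r0 bg by apply: le_lt_trans (normc_Re _) _; rewrite n1.
have rI : `|complex.Im (sg%:C * o)| < bg_r0 bg by apply: le_lt_trans (normc_Im _) _; rewrite n1.
apply/h2 => //; have := h1 _ rR; rewrite ler_norml => /andP[_ p1].
apply: le_lt_trans p1 _; rewrite cImZ.
have b3 : complex.Re (sg%:C * o) ^+ 2 <= (sg * normc o) ^+ 2.
  by rewrite -[leLHS]real_normK ?num_real //; apply: lerXn2r; rewrite ?nnegrE ?normr_ge0 ?mulr_ge0 ?(ltW sn) // -n1 normc_Re.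
have o2 : normc o ^+ 2 <= (2 * normc om) ^+ 2 by apply: lerXn2r; rewrite ?nnegrE ?mulr_ge0 ?normc_ge0.
have b4 := ler_wpM2l (bg_C0 bg) b3; have hk := hkapk.
have q1 := ler_wpM2l (mulr_ge0 (bg_C0 bg) (sqr_ge0 sg)) o2.
have q2 := ler_wpM2r (mulr_ge0 (ltW sn) (sqr_ge0 (normc om))) s2.
have q3 := ler_wpM2l (ltW sn) hk; have q4 := ler_wpM2l (ltW sn) oI; have q5 := mulr_gt0 sn kk0.
apply: le_lt_trans b4 _.
rewrite /sg in q1 *; rewrite !exprMn !expr2 in q1 q2 q3 *; lra.
Qed.

Lemma node_estimate z : D z -> normc (z - zt) <= A * sg -> (forall w, normc (w - z) < y n -> D w) ->
  normc (k z - b * bp z) <= eps.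
Proof. by move=> Dz zA zD; exact: (sd_node jM Dz zA zD). Qed.

Lemma om_ofE o : om_of (zt + nu * (sg%:C * o)) = o.
Proof. by rewrite /om_of addrC addKr [nu * _]mulrA mulrC mulKf. Qed.

Lemma bpE z : bp z = (1 - 'i * om_of z)^-1. Proof. by []. Qed.

(** The disc is deep inside D, so the stage estimate applies. The error |m|/2 is |m|/4 from
    [lm_near], |m|/8 from [lm_small] and |m|/8 from L eps; this is what [local_solve] tolerates. *)
Lemma node_deriv z : normc (z - (zt + nu * (sg%:C * om))) <= kk * sg -> D z /\ normc (F (k z) - m) <= normc m / 2.
Proof.
move=> zz; have [sn _ _ s1 [[s2 s3] [y0 ys]]] := sd_facts n.
have om0 := normc_ge0 om; have kk0 : 0 < kk := lm_k0 lm.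
have omI : 2 * kk <= complex.Im om := lm_Im lm.
have omk : 2 * kk <= normc om by have := normc_Im om; have := ler_norm (complex.Im om); lra.
have dist o : normc (zt + nu * (sg%:C * o) - (zt + nu * (sg%:C * om))) = sg * normc (o - om).
  rewrite (_ : _ - _ = nu * (sg%:C * (o - om))); last by ring.
  by rewrite !normcM nu1 mul1r normc_real gtr0_norm.
have coord w : w = zt + nu * (sg%:C * om_of w).
  by rewrite /om_of [nu * _]mulrA [nu * _ * _]mulrC divfK //; ring.
have ih o (x : R) : normc (o - om) <= x -> x <= 3 / 2 * kk -> normc o <= 2 * normc om /\ kk / 2 <= complex.Im o.
  move=> h hx; split; first by have := normcD (o - om) om; rewrite subrK; lra.
  have := normc_Im (o - om); rewrite ler_norml cImD cImN => /andP[h1 _]; lra.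
have oz : normc (om_of z - om) <= kk.
  by move: zz; rewrite {1}(coord z) dist mulrC ler_pM2r.
have Dz : D z.
  by rewrite (coord z); have [|a1 a2] := ih _ _ oz; [lra|exact: node_region].
have zD w : normc (w - z) < y n -> D w.
  move=> wz; rewrite (coord w); have [||a1 a2] := ih (om_of w) (3 / 2 * kk); last exact: node_region.
    have : sg * normc (om_of w - om_of z) = normc (w - z).
      have <- : nu * (sg%:C * (om_of w - om_of z)) = w - z by rewrite {2}(coord w) {2}(coord z); ring.
      by rewrite !normcM nu1 mul1r normc_real gtr0_norm.
    move=> hh; have h1 : sg * normc (om_of w - om_of z) <= sg * (theta * kap) by rewrite hh; rewrite /sg; lra.
    rewrite ler_pM2l // in h1; have := hth; have := normc_tri (om_of z) (om_of w) om; lra.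
  by [].
have [|i1 i2] := ih _ _ oz (_ : kk <= 3 / 2 * kk); first by lra.
split => //.
have [b1 _ b3] := bump_facts Dz.
have o10 : normc (om_of z) <= 10 * normc om by lra.
have [_ g1] := lm_diff o10 (b3 o10).
have g2 := lm_near oz.
have zA : normc (z - zt) <= A * sg.
  by rewrite normc_om mulrC ler_pM2r //; have := hA; lra.
have g3 := FL b1 (k_bound Dz); have g4 := node_estimate Dz zA zD.
have g5 := ler_wpM2l (ltW L0) g4; have := hLm; have := lm_small lm.
have := normc_tri (F (b * bp z)) (F (k z)) m; have := normc_tri (lm_G1 lm (om_of z)) (F (b * bp z)) m.
rewrite (normcC (F (b * bp z)) (lm_G1 lm _)) bpE -/m; rewrite bpE in g3; lra.
Qed.

(** The difference f - G changes little from the node to [z0], and G has the same value at both.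
    Hence f(z0) is close to the boundary values on the arc, and [local_solve] around [z0] attains
    them exactly. *)
Lemma node_hit t : `|t - t0| <= eta * sg -> exists2 z, D z & f z = fb (gam t) /\ normc (z - zt) <= 2 * normc om * sg.
Proof.
move=> tt; have [sn _ _ s1 [[s2 s3] [y0 ys]]] := sd_facts n.
have om0 := normc_ge0 om; have kk0 : 0 < kk := lm_k0 lm; have M0' := M0; have k1 := kap1; have k0 := kap0.
have omI : 2 * kk <= complex.Im om := lm_Im lm; have rr := bg_r00 bg; have e0 : 0 <= e := lm_e0 lm.
have omk : 2 * kk <= normc om by have := normc_Im om; have := ler_norm (complex.Im om); lra.
have K1 : 1 <= K := bg_K0 bg.
pose z0 := zt + nu * (sg%:C * om).
have nd0 : normc (z0 - zt) = sg * normc om by rewrite /z0 addrC addKr !normcM nu1 mul1r normc_real gtr0_norm.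
have [|Dz0 _] := @node_deriv z0; first by rewrite subrr normc0 mulr_ge0 // ltW.
have m0 : 0 < normc m by rewrite normc_gt0 lm_m0.
pose G z := nu * sg%:C * lm_G lm (om_of z).
have Gd z : normc (om_of z) <= 10 * normc om -> - lm_k1 lm <= complex.Im (om_of z) -> cdiff G z (lm_G1 lm (om_of z)).
  move=> h1 h2; have [h3 _] := lm_diff h1 h2.
  have a1 : cdiff om_of z (nu * sg%:C)^-1.
    have := cdiffZ (nu * sg%:C)^-1 (cdiffD (cdiff_id z) (cdiff_cst (- zt) z)).
    rewrite addr0 mulr1; apply: (cdiff_local (r := 1)) => // w _.
    by rewrite /om_of mulrC.
  have := cdiffZ (nu * sg%:C) (cdiff_comp a1 h3); apply: cdiff_eqd.
  by rewrite mulrC -mulrA mulVf // mulr1.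
have Gcont : G z0 = G zt.
  rewrite /G /z0 om_ofE; have -> : om_of zt = 0 by rewrite /om_of subrr mul0r.
  by rewrite -/om /om (lm_per lm).
have Gzt : ccont G zt.
  apply: cdiff_ccont (Gd zt _ _); rewrite /om_of subrr mul0r ?normc0 ?mulr_ge0 //=.
  by have := lm_k10 lm; lra.
have Gz0 : ccont G z0.
  by apply: cdiff_ccont (Gd z0 _ _); rewrite om_ofE; [lra|have := lm_k10 lm; lra].
(* Both ends of the path must lie within S/8 of the node; [z0] is at distance S/10, which leaves
   S/80 for the passage to the limit. *)
pose S := 10 * normc om * sg.
have omp : 0 < normc om by lra.
have S0 : 0 < S by rewrite !mulr_gt0.
have Sr : S <= r0 / 2.
  by have := ler_wpM2l (ltW rr) hkap; have := ler_wpM2l om0 s1; rewrite /S /sg /r0; lra.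
have yS : 8 * y n <= S.
  have := ler_wpM2r (ltW sn) hth; have := ler_wpM2r (ltW sn) omk; have := mulr_gt0 kk0 sn.
  by rewrite /S /sg; lra.
have hpath : normc ((fb z0 - G z0) - (fb zt - G zt)) <= 3 * (L * eps + e) * normc (z0 - zt) + 4 * (2 * M + e) * y n.
  have L1 : bd_lim D (fun z => f z - G z) zt (fb zt - G zt).
    by apply: bd_limB (fb_lim (@gam_closure t0)) (ccont_bd_lim D Gzt).
  have L2 : bd_lim D (fun z => f z - G z) z0 (fb z0 - G z0).
    by apply: bd_limB (fb_lim (subset_closure Dz0)) (ccont_bd_lim D Gz0).
  have Le : 0 <= L * eps + e by have := mulr_gt0 L0 eps0; lra.
  apply: (bd_lim_le (r := S / 80)) (@gam_closure t0) (subset_closure Dz0) L1 L2 _; first by lra.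
    by rewrite mulr_ge0.
  move=> z w Dz Dw zz wz.
  have [u zE nuu] := chart_coord zt nu1 z; have [v wE nvv] := chart_coord zt nu1 w.
  clear tt s1 s2 s3 ys kk0 k1 k0 omI omk K1 m0.
  subst z w; rewrite (chart_dist _ nu1).
  apply: (@local_path _ D zt nu r0 (bg_C bg) nu1 (bg_r00 bg) (bg_chart bg t0) (fun z => f z - G z) (fun z => F (k z) - lm_G1 lm (om_of z)) S (y n)) => //; try lra.
  - move=> x Dx; rewrite normc_om /S mulrC ltr_pM2r // => xo.
    have [b1 _ b3] := bump_facts Dx; have [d1 d2] := lm_diff (ltW xo) (b3 (ltW xo)).
    have b2 := FM b1.
    split; first by apply: cdiffB; [exact: fk|exact: Gd (ltW xo) (b3 (ltW xo))].
      have := normcB (F (k x)) (lm_G1 lm (om_of x)); have := f1_bound Dx.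
      by have := normc_ge_sub (lm_G1 lm (om_of x)) (F (b / (1 - 'i * om_of x))); rewrite -/e in d2; rewrite bpE in b2; lra.
    move=> xD; have xA : normc (x - zt) <= A * sg.
      by rewrite normc_om mulrC ler_pM2r //; have := hA; lra.
    have g3 := FL b1 (k_bound Dx); have g4 := node_estimate Dx xA xD.
    have g5 := ler_wpM2l (ltW L0) g4.
    have := normc_tri (F (b * bp x)) (F (k x)) (lm_G1 lm (om_of x)).
    rewrite (normcC (F (b * bp x)) (lm_G1 lm _)) bpE; rewrite -/e in d2; rewrite bpE in g3 g5; lra.
  - rewrite nvv; have q1 := normc_tri z0 (zt + nu * v) zt; rewrite nd0 in q1.
    have q2 : 0 < normc om * sg := mulr_gt0 omp sn; rewrite /S in wz *; lra.
rewrite Gcont in hpath; clear Sr yS S0 s1 s2 k0 k1 omI Gzt Gz0 Gcont.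
have hpath' : normc (fb z0 - fb zt) <= 3 * (L * eps + e) * (sg * normc om) + 4 * (2 * M + e) * y n.
  by move: hpath; rewrite nd0 (_ : fb z0 - G zt - (fb zt - G zt) = fb z0 - fb zt) //; ring.
have tz : normc (fb (gam t) - fb zt) <= 3 * M * K * (eta * sg).
  apply: le_trans (fb_gam_lip _) _.
    have : K * `|t - t0| <= K * (eta * sg) by rewrite ler_wpM2l //; lra.
    by have := ler_wpM2r (ltW sn) hetaK; rewrite /sg /r0 in s3 *; lra.
  by rewrite ler_wpM2l // !mulr_ge0 //; lra.
(* In units of |m| kk sg the move along the boundary, the layer and the stage error cost 1/10 each,
   the model error 3/100; [local_solve] allows 1/2. *)
have close : normc (fb (gam t) - f z0) <= normc m * (kk * sg) / 2.
  rewrite -(fb_in Dz0); have := normc_tri (fb zt) (fb (gam t)) (fb z0); rewrite (normcC (fb zt) (fb z0)).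
  have q1 := ler_wpM2r (ltW sn) hMe; have q2 := ler_wpM2r (ltW sn) hLe.
  have Me : 0 <= 4 * (2 * M + e) by lra.
  have q3 := ler_wpM2l Me ys; have q4 := ler_wpM2r (ltW sn) hMt.
  have q5 := ler_wpM2r (ltW sn) (lm_err lm); rewrite -/e -/om -/m -/kk in q5.
  have q6 := mulr_gt0 (mulr_gt0 m0 kk0) sn.
  by rewrite /sg in hpath' tz *; lra.
have mm : m != 0 := lm_m0 lm.
have [||z zz fz] := local_solve (f := f) (f1 := fun z => F (k z)) (z0 := z0) (r := kk * sg) (c := m) (w := fb (gam t)) _ mm _ close.
- by rewrite mulr_gt0.
- by move=> z /node_deriv[Dz h]; split => //; exact: fk.
have [Dz _] := node_deriv zz.
exists z => //; split => //.
have q1 := normc_tri z0 z zt; rewrite nd0 in q1.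
have q2 : 2 * kk * sg <= normc om * sg := ler_wpM2r (ltW sn) omk.
have q3 : normc (z - z0) <= kk * sg := zz.
have q4 : 0 < kk * sg := mulr_gt0 kk0 sn.
lra.
Qed.

Lemma node_window t : t0 <= t <= t0 + eta * sg -> bg_o bg n <= t < bg_o bg n + (bg_L bg n)%:R.
Proof.
move=> /andP[h1 h2]; have [sn Nn sN _ _] := sd_facts n; have e0 := eta0; have hr := hetar.
have jn : j.+1%:R <= (bg_L bg n)%:R * (N n)%:R :> R by rewrite -natrM ler_nat.
have h3 : bg_o bg n <= t0 by rewrite /t0 /nd /node lerDl divr_ge0 ?ler0n.
have h4 : t0 + eta * sg < bg_o bg n + (bg_L bg n)%:R.
  rewrite /t0 /nd /node -addrA ltrD2l -(ltr_pM2r Nn) mulrDl divfK ?gt_eqF //.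
  apply: lt_le_trans jn; rewrite -addn1 natrD ltrD2l.
  by have := ler_wpM2l (ltW e0) sN; rewrite /sg; lra.
by apply/andP; split; lra.
Qed.

(** On the arc the bump is close to 1, so f' is close to F(b) away from the layer and f is nearly
    affine with slope F(b), which is not zero. The layer costs 8 M y_n, which is harmless because
    the last hypothesis bounds y_n by 2 theta |t - t'|. *)
Lemma node_lower t t' : t0 <= t <= t0 + eta * sg -> t0 <= t' <= t0 + eta * sg ->
  1 <= 2 * (N n.+1)%:R * `|t - t'| -> normc (F b) * c / 4 * `|t - t'| <= normc (fb (gam t) - fb (gam t')).
Proof.
move=> ht ht' hd; have [sn Nn sN s1 [[s2 s3] [y0 ys]]] := sd_facts n.
have Nn1 : 0 < (N n.+1)%:R :> R by have [_ h _ _ _] := sd_facts n.+1.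
have [K1 c0 rr e0] := And4 (bg_K0 bg) (bg_c0 bg) (bg_r00 bg) eta0; rewrite -/K -/c in K1 c0.
have M0' := M0; have k1 := kap1; have th0 := theta0.
have Fb0 : 0 < normc (F b) by rewrite normc_gt0 (lm_Fb lm).
(* The arc is shorter than half a window, so the minimum in [bg_chord] is |t - t'|. *)
have es : eta * sg <= 4^-1.
  have N1 : 1 <= (N n)%:R :> R by rewrite ler1n -(ltr0n R).
  have := ler_wpM2l (ltW sn) N1; have := ler_wpM2l (ltW e0) sN; have := hetar; rewrite /sg => a1 a2 a3.
  by have := ler_wpM2l (ltW e0) a3; lra.
have dle : `|t - t'| <= eta * sg by move/andP: ht => [? ?]; move/andP: ht' => [? ?]; rewrite ler_norml; lra.
have Dl : c * `|t - t'| <= normc (gam t - gam t').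
  have := bg_chord (node_window ht) (node_window ht'); rewrite -/c.
  have L1 : 1 <= (bg_L bg n)%:R :> R by rewrite ler1n bg_L0.
  by rewrite min_l //; lra.
have yd : y n <= 2 * theta * `|t - t'|.
  by rewrite /y ler_pdivrMr //; have := ler_wpM2l (ltW th0) hd; lra.
pose S := 16 * K * eta * sg.
have kes : 0 < K * eta * sg by rewrite !mulr_gt0 //; lra.
have S0 : 0 < S by rewrite /S; lra.
have hk8 := ler_wpM2r (ltW sn) hetaK.
have Ssg : S <= 2 * sg by rewrite /S /sg; lra.
have Sr : S <= r0 / 2 by rewrite /sg in Ssg; lra.
have yS : 8 * y n <= S.
  have := ler_wpM2r (ltW sn) hthe; have := ler_wpM2r (mulr_ge0 (ltW e0) (ltW sn)) K1.
  by rewrite /S /sg; lra.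
have near x : t0 <= x <= t0 + eta * sg -> normc (gam x - zt) <= S / 16.
  move=> /andP[x1 x2]; have h := bg_lip bg x t0.
  have : `|x - t0| <= eta * sg by rewrite ler_norml; lra.
  by move=> /(ler_wpM2l (le_trans ler01 K1)); rewrite -/K in h; rewrite /zt /S; lra.
pose e1 := L * (eps + normc b * (32 * (K * eta))).
have nb := normc_ge0 b.
have e10 : 0 <= e1.
  by rewrite mulr_ge0 ?(ltW L0) // addr_ge0 ?(ltW eps0) // !mulr_ge0 //; lra.
pose Gl z := F b * z.
have Gc z : cdiff Gl z (F b) by have := cdiffZ (F b) (cdiff_id z); rewrite mulr1.
have lim x : bd_lim D (fun z => f z - Gl z) (gam x) (fb (gam x) - Gl (gam x)).
  by apply: bd_limB (fb_lim (@gam_closure x)) (ccont_bd_lim D (cdiff_ccont (Gc _))).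
have hb' : normc b <= rho by have := hb; have := mulr_ge0 nb (ltW kap0); lra.
have hpath : normc ((fb (gam t) - Gl (gam t)) - (fb (gam t') - Gl (gam t'))) <=
    3 * e1 * normc (gam t - gam t') + 4 * (2 * M) * y n.
  apply: (bd_lim_le (r := S / 16)) (@gam_closure t') (@gam_closure t) (lim t') (lim t) _; first by lra.
    by rewrite mulr_ge0.
  move=> z w Dz Dw zz wz.
  have [u zE nuu] := chart_coord zt nu1 z; have [v wE nvv] := chart_coord zt nu1 w.
  clear hd Nn sN s1 s2 s3 ys Nn1 c0 th0 Fb0 es dle Dl yd k1 hk8.
  subst z w; rewrite (chart_dist _ nu1).
  apply: (@local_path _ D zt nu r0 (bg_C bg) nu1 (bg_r00 bg) (bg_chart bg t0) (fun z => f z - Gl z) (fun z => F (k z) - F b) S (y n)) => //; try lra.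
  - move=> x Dx xS; split; first by apply: cdiffB; [exact: fk|exact: Gc].
      by have := normcB (F (k x)) (F b); have := f1_bound Dx; have := FM hb'; lra.
    move=> xD; have [b1 b2 _] := bump_facts Dx.
    have xA : normc (x - zt) <= A * sg.
      have om0 := normc_ge0 om; have A2 : 2 <= A by have := hA; lra.
      by have := ler_wpM2r (ltW sn) A2; rewrite /sg in Ssg *; lra.
    have g4 := node_estimate Dx xA xD.
    have g6 : normc (1 - bp x) <= 32 * (K * eta).
      by rewrite -(ler_pM2r sn); apply: le_trans b2 _; rewrite /S /sg in xS; lra.
    apply: le_trans (FL hb' (k_bound Dx)) _; rewrite ler_wpM2l ?(ltW L0) //.
    have := normc_tri (b * bp x) (k x) b.
    have -> : b * bp x - b = - (b * (1 - bp x)) by ring.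
    by rewrite normcN normcM; have := ler_wpM2l nb g6; lra.
  - by rewrite nuu; have := normc_tri (gam t') (zt + nu * u) zt; have := near t' ht'; lra.
  - by rewrite nvv; have := normc_tri (gam t) (zt + nu * v) zt; have := near t ht; lra.
have := normc_ge_sub (Gl (gam t) - Gl (gam t')) (- ((fb (gam t) - Gl (gam t)) - (fb (gam t') - Gl (gam t')))).
rewrite normcN (_ : _ - - _ = fb (gam t) - fb (gam t')); last by ring.
rewrite {1}/Gl -mulrBr normcM.
have h1 := ler_wpM2r (normc_ge0 (gam t - gam t')) hFb; rewrite -/e1 in h1.
clear Nn sN s1 s2 s3 y0 ys Nn1 K1 rr e0 k1 th0 es dle kes S0 hk8 Ssg Sr yS e10 hb' nb.
have h2 := ler_wpM2l (ltW Fb0) Dl; have M8 : 0 <= 8 * M by lra.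
have h3 := ler_wpM2l M8 yd; have h4 := ler_wpM2r (normr_ge0 (t - t')) hMth.
lra.
Qed.

End AtNode.

Hypotheses (hkape : 8 * kap <= eta) (hkp : kap' = 4 / eta).

Lemma nonzero_deriv : exists2 z, D z & F (k z) != 0.
Proof.
have jM : (0 < bg_L bg 0 * N 0)%N by rewrite muln_gt0 bg_L0; apply: leq_trans (sd_N0 sd 0).
have [s0 _ _ _ _] := sd_facts 0; have kk0 : 0 < kk := lm_k0 lm.
pose z := gam (nd 0 0) + bg_nu bg (nd 0 0) * ((s 0)%:C * om).
have [|Dz h] := @node_deriv 0 0 jM z; first by rewrite subrr normc0 mulr_ge0 // ltW.
exists z => //; apply/eqP => F0; move: h; rewrite F0 sub0r normcN.
have : 0 < normc m by rewrite normc_gt0 lm_m0.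
by lra.
Qed.

Let l n := eta * s n.
Let cN0 n : (0 < N n)%N. Proof. exact: leq_trans (sd_N0 sd n). Qed.
Let cl0 n : 0 < l n. Proof. by have [h _ _ _ _] := sd_facts n; rewrite mulr_gt0. Qed.
Let clN n : l n * (N n)%:R <= 4^-1.
Proof.
have [_ _ h _ _] := sd_facts n; have := ler_wpM2l (ltW eta0) h; have := hetar.
by rewrite /l; lra.
Qed.
Let clNS n : 8 <= l n * (N n.+1)%:R.
Proof.
have h := sd_step sd n; have [s0 _ _ _ _] := sd_facts n; have [_ N1 _ _ _] := sd_facts n.+1.
have := ler_wpM2r (mulr_ge0 (ltW s0) (ltW N1)) hkape; rewrite /l /s /N in h *; lra.
Qed.
Let cgrow n : (\prod_(i < n.+1) (4 / (l i * (N i)%:R))) ^+ n <= (N n)%:R.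
Proof.
apply: le_trans (sd_grow sd n); rewrite le_eqVlt; apply/orP; left; apply/eqP; congr (_ ^+ _).
apply: eq_bigr => i _; have [s0 N1 _ _ _] := sd_facts i.
have gen (x y' : R) : 0 < x -> 0 < y' -> 4 / (eta * x * y') = 4 / eta / (x * y').
  by move=> x0 y0; have e0 := eta0; field; rewrite !gt_eqF.
by rewrite /l gen // -hkp.
Qed.
Let cmono := bg_mono bg.

Section Valence.
Variables (n0 j0 : nat).
Hypotheses (n00 : (0 < n0)%N) (j0M : (j0 < bg_L bg n0 * N n0)%N).
Let cp := cantor_point (bg_o bg) N l n0 j0.

Lemma cantor_nodes x n : 0 <= x < 1 -> (n0 <= n)%N ->
  exists2 j, (j < bg_L bg n * N n)%N & nd n j <= cp x <= nd n j + l n.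
Proof.
move=> x01 nn; exists (address (bg_o bg) N l n0 j0 x (n - n0)).1.
  by have [h _] := address_bounds cN0 cl0 clN clNS cmono j0M (n - n0) x01; rewrite subnKC in h.
by have := cantor_point_in cN0 cl0 clN clNS cmono j0M (n - n0) x01; rewrite /= subnKC.
Qed.

Lemma cantor_base x : 0 <= x < 1 -> nd n0 j0 <= cp x <= nd n0 j0 + l n0.
Proof. by move=> x01; have := cantor_point_in cN0 cl0 clN clNS cmono j0M 0 x01; rewrite /= addn0. Qed.

Lemma scale_small (x : R) : 0 < x -> exists n1 : nat, forall n : nat, (n1 <= n)%N -> s n <= x /\ (N n)%:R^-1 <= x.
Proof.
move=> x0; have rr := bg_r00 bg.
have [|n1 h] := @natr_inv_small R (Num.min x (2 * x / r0)); first by rewrite lt_min x0 divr_gt0 // mulr_gt0.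
exists n1 => n /h; rewrite le_min => /andP[a1 a2].
have [s0 N1 sN _ _] := sd_facts n.
have Nn : (N n)%:R^-1 <= n.+1%:R^-1 :> R by rewrite lef_pV2 ?posrE ?ltr0n // ler_nat; exact: sd_N0.
split; last exact: le_trans Nn a1.
have : s n <= r0 / 2 * (N n)%:R^-1 by rewrite ler_pdivlMr.
have := ler_wpM2l (ltW rr) (le_trans Nn a2); rewrite -/r0 [r0 * (_ / _)]mulrC divfK ?gt_eqF //; lra.
Qed.

(** Each generation supplies a preimage within a multiple of s_n of the boundary point. This point
    is not in D, so preimages accumulating at it are infinitely many. *)
Lemma cantor_valence x : 0 <= x < 1 -> infinite_valence D fb (fb (gam (cp x))).
Proof.
move=> x01; have om0 := normc_ge0 om; have K1 : 1 <= K := bg_K0 bg; have e0 := eta0.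
have hit n : (n0 <= n)%N -> exists2 z, D z & fb z = fb (gam (cp x)) /\ normc (z - gam (cp x)) <= (2 * normc om + K * eta) * s n.
  move=> nn; have [j jM /andP[h1 h2]] := cantor_nodes x01 nn.
  have [s0 _ _ _ _] := sd_facts n.
  have dn : `|cp x - nd n j| <= eta * s n by move: h1 h2; rewrite /l => h1 h2; rewrite ler_norml; apply/andP; split; have := mulr_gt0 e0 s0; lra.
  have [z Dz [fz zz]] := node_hit jM dn; exists z => //; split; first by rewrite fb_in.
  have h3 := bg_lip bg (nd n j) (cp x); rewrite -/K distrC in h3.
  have h4 := ler_wpM2l (le_trans ler01 K1) dn.
  by have := normc_tri (gam (nd n j)) z (gam (cp x)); lra.
have C0 : 0 < 2 * normc om + K * eta by rewrite ltr_wpDl ?mulr_ge0 // mulr_gt0 //; lra.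
split.
  by have [z Dz [fz _]] := hit n0 (leqnn _); exists z.
apply: (@infinite_accumulation _ _ (gam (cp x))); first by case=> h _; exact: (@bg_notin _ _ _ bg _ h).
move=> e1 e10; have [|n1 hn1] := @scale_small (e1 / 2 / (2 * normc om + K * eta)).
  by rewrite !divr_gt0.
have [hs _] := hn1 (maxn n0 n1) (leq_maxr _ _).
have [z Dz [fz zz]] := hit (maxn n0 n1) (leq_maxl _ _).
exists z => //; apply: le_lt_trans zz _; rewrite ler_pdivlMr // in hs; lra.
Qed.

Lemma cantor_holder : exists2 C : R, 0 < C & forall x y, 0 <= x < 1 -> 0 <= y < 1 ->
  `|x - y| ^+ n0 <= C * normc (fb (gam (cp x)) - fb (gam (cp y))) ^+ n0.-1.
Proof.
have [C C0 hC] := cantor_separation cN0 cl0 clN clNS cmono cgrow n00 j0M.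
have Fb0 : 0 < normc (F b) by rewrite normc_gt0 (lm_Fb lm).
pose c2 := normc (F b) * c / 4; have c20 : 0 < c2 by rewrite divr_gt0 // mulr_gt0 // bg_c0.
exists (C * c2^-1 ^+ n0.-1); first by rewrite mulr_gt0 // exprn_gt0 // invr_gt0.
move=> x x' x01 x01'; have [->|xy] := eqVneq x x'.
  rewrite !subrr normr0 normc0 expr0n (gtn_eqF n00) !mulr_ge0 ?exprn_ge0 ?(ltW C0) //.
  by rewrite invr_ge0 ltW.
have [n [j [[nn jM] hx hy hd hh]]] := hC x x' x01 x01' xy.
apply: le_trans hh _; rewrite -mulrA; apply: ler_wpM2l; first exact: ltW.
rewrite -exprMn; apply: lerXn2r; rewrite ?nnegrE ?mulr_ge0 ?normc_ge0 ?invr_ge0 ?(ltW c20) //.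
rewrite mulrC ler_pdivlMr // mulrC.
by move: (node_lower jM hx hy hd).
Qed.

End Valence.

(** The Cantor set may start in any generation n0. A late start puts it close to the parameter of p,
    hence its image into the ball, and makes the exponent 1 - 1/n0 as close to 1 as desired. *)
Lemma valence_dim_ge1 (e1 : R) p : 0 < e1 -> boundary D p ->
  (1 <= hausdorff_dim (ball (fb p) e1%:C `&` infinite_valence D fb))%E.
Proof.
move=> e10 /(bg_surj bg)[n1 [t [/andP[t1 t2] pE]]]; have rr := bg_r00 bg; have K1 : 1 <= K := bg_K0 bg; have M0' := M0.
have win n : (n1 <= n)%N -> bg_o bg n <= t /\ t < bg_o bg n + (bg_L bg n)%:R.
  elim: n => [|n IH]; first by rewrite leqn0 => /eqP <-.
  rewrite leq_eqVlt => /orP[/eqP <- //|/IH[a1 a2]]; have [b1 b2] := bg_mono bg n; split; lra.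
apply: hausdorff_dim_ge1 => m0.
(* Parameters within 2 x0 of t are in the range of [fb_gam_lip] and have values within 6 M K x0 <
   e1. *)
pose x0 := Num.min (r0 / (64 * K)) (e1 / (16 * M * K)).
have x00 : 0 < x0 by rewrite lt_min !divr_gt0 // !mulr_gt0 //; lra.
have [n2 hn2] := scale_small x00.
pose n0 := (maxn (maxn m0 n1) n2).+1.
have n0m : (m0 <= n0)%N by rewrite leqW // !leq_max leqnn.
have n0n1 : (n1 <= n0)%N by rewrite leqW // !leq_max leqnn orbT.
have n0n2 : (n2 <= n0)%N by rewrite leqW // !leq_max leqnn !orbT.
have [_ Ninv] := hn2 n0 n0n2.
have n00 : (0 < n0)%N by [].
clearbody n0.
have [w1 w2] := win n0 n0n1; have [s0 N1 sN _ _] := sd_facts n0.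
pose X := (t - bg_o bg n0) * (N n0)%:R.
have X0 : 0 <= X by rewrite mulr_ge0 ?ler0n //; lra.
pose j0 := Num.trunc X; have /andP[j1 j2] := truncn_itv X0; rewrite -/j0 in j1 j2.
have j0M : (j0 < bg_L bg n0 * N n0)%N.
  rewrite -(ltr_nat R) natrM; apply: le_lt_trans j1 _; rewrite /X ltr_pM2r //; lra.
have nd1 : nd n0 j0 <= t.
  by rewrite /nd /node; have : j0%:R / (N n0)%:R <= t - bg_o bg n0 by [rewrite ler_pdivrMr]; lra.
have nd2 : t <= nd n0 j0 + (N n0)%:R^-1.
  rewrite /nd /node; have : t - bg_o bg n0 <= j0.+1%:R / (N n0)%:R by rewrite ler_pdivlMr // ltW.
  by rewrite -[j0.+1%:R]natr1 mulrDl mul1r; lra.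
have lN : l n0 <= (N n0)%:R^-1 by rewrite -(ler_pM2r N1) mulVf ?gt_eqF //; have := clN n0; lra.
have [C C0 hC] := cantor_holder n00 j0M.
pose h x := fb (gam (cantor_point (bg_o bg) N l n0 j0 x)).
exists n0, C, h; split => // x x01; split; last exact: cantor_valence.
have /andP[c1 c2] := cantor_base j0M x01.
have l0 := cl0 n0; clear t1 t2 w1 w2 j1 j2 X0 N1 sN s0.
have tt : `|t - cantor_point (bg_o bg) N l n0 j0 x| <= 2 * x0 by rewrite ler_norml; apply/andP; split; lra.
have x01' : x0 * (64 * K) <= r0 by rewrite -ler_pdivlMr ?ge_min ?lexx // mulr_gt0 //; lra.
have x02 : x0 * (16 * M * K) <= e1 by rewrite -ler_pdivlMr ?ge_min ?lexx ?orbT // !mulr_gt0 //; lra.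
have Ktt := ler_wpM2l (le_trans ler01 K1) tt.
apply/ballcE; rewrite pE; apply: le_lt_trans (fb_gam_lip _) _; first by rewrite /r0 in x01' *; lra.
have := ler_wpM2l (ltW M0') Ktt; have := mulr_gt0 (mulr_gt0 M0' x00) (lt_le_trans ltr01 K1); lra.
Qed.

(** The preimages of a value in the ball are bounded by tameness, so infinitely many of them
    accumulate. They cannot do so inside D, where level sets are discrete, so the value is one of
    the boundary values. *)
Lemma valence_dim_le1 (e1 : R) p : 0 < e1 ->
  (forall W : R, exists B, forall z, D z -> normc (f z) <= W -> normc z <= B) ->
  (forall B, exists B', forall q, boundary D q -> normc q <= B -> exists2 t, - B' <= t <= B' & q = gam t) ->
  (hausdorff_dim (ball (fb p) e1%:C `&` infinite_valence D fb) <= 1)%E.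
Proof.
move=> e10 tame param; have rr := bg_r00 bg; have K1 : 1 <= K := bg_K0 bg; have M0' := M0.
have [B hB] := tame (normc (fb p) + e1); have [B' hB'] := param (B + 1).
have oD : open D by exact: bg_open bg.
apply: (@hausdorff_dim_le1 _ _ (fun t => fb (gam t)) (`|B'| + 1) (3 * M * K) (r0 / (16 * K))).
- by rewrite ltr_wpDl.
- by rewrite !mulr_gt0 //; lra.
- by rewrite divr_gt0 // mulr_gt0 //; lra.
- move=> w [/ballcE pw [_ inf]].
  have wle : normc w <= normc (fb p) + e1 by have := normc_tri (fb p) w 0; rewrite !subr0 (normcC w (fb p)); lra.
  have inB z : (D `&` fb @^-1` [set w]) z -> normc z <= B.
    by move=> [Dz fz]; apply: hB => //; rewrite -(fb_in Dz) fz.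
  have [q hq] : exists q, ~ exists2 d : R, 0 < d & forall z, (D `&` fb @^-1` [set w]) z -> normc (z - q) < d -> z = q.
    apply/existsNP => disc; apply: inf; exact: bounded_discrete_finite inB disc.
  have acc (d : R) : 0 < d -> exists2 z, D z /\ fb z = w & normc (z - q) < d.
    move=> d0; apply: contrapT => nz; apply: hq; exists d => // z Az zq.
    by exfalso; apply: nz; exists z.
  have cq : closure D q by apply/closurecP => d /acc[z [Dz _] zq]; exists z.
  have nDq : ~ D q.
    move=> Dq; apply: hq.
    have [d d0 he] := @level_set_discrete _ D f (fun z => F (k z)) w q oD (bg_conn bg) fk nonzero_deriv Dq.
    by exists d => // z [Dz fz]; apply: he; rewrite -(fb_in Dz).
  have bq : boundary D q by split => // /interior_subset.
  have wq : w = fb q.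
    apply/eqP; rewrite -subr_eq0; apply/eqP/normc_le0/ler_addgt0Pr => d d0; rewrite add0r.
    have [dl dl0 h] := fb_lim cq d0; have [z [Dz fz] zq] := acc dl dl0.
    by have := h z Dz zq; rewrite -(fb_in Dz) fz.
  have qB : normc q <= B + 1.
    have [z [Dz fz] zq] := acc 1 ltr01; have := inB z (conj Dz fz).
    by have := normc_tri z q 0; rewrite !subr0 (normcC q z); lra.
  have [t /andP[tB1 tB2] qE] := hB' q bq qB; exists t; last by rewrite wq qE.
  by have hn := ler_norm B'; apply/andP; split; lra.
- move=> t t' _ _; rewrite ltr_pdivlMr; last by rewrite mulr_gt0 //; lra.
  by move=> tt; apply: fb_gam_lip; lra.
Qed.

End Primitive.

(** * The function for a domain with a given boundary geometry *)

Section GeometryMain.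
Context {R : realType}.
Implicit Types (f g h : R[i] -> R[i]) (q z w u v : R[i]) (D : set R[i]).

(** Solves a finite list of smallness conditions x a <= c at once. *)
Lemma small_number (s : seq (R * R)) : all (fun p => 0 < p.2) s ->
  exists2 x, 0 < x & all (fun p => x * p.1 <= p.2) s.
Proof.
move=> s0; have [x x0 hx] : exists2 x, 0 < x & all (fun p => x * (`|p.1| + 1) <= p.2) s.
  elim: s s0 => [_|[a c] s IH /= /andP[c0 /IH[x x0 hx]]]; first by exists 1.
  have a1 : 0 < `|a| + 1 by rewrite ltr_wpDl.
  exists (Num.min x (c / (`|a| + 1))); first by rewrite lt_min x0 divr_gt0.
  apply/andP; split; first by rewrite -ler_pdivlMr // ge_min lexx orbT.
  apply/allP => p h; apply: le_trans (allP hx _ h).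
  by rewrite ler_wpM2r ?ge_min ?lexx // addr_ge0.
exists x => //; apply/allP => p /(allP hx); apply: le_trans; rewrite ler_wpM2l ?(ltW x0) //.
by have := ler_norm p.1; lra.
Qed.

(* Automatic for bounded D; for the half-plane it prevents the preimages of a
   value from accumulating only at infinity. *)
Definition tame D := forall f f1 (c : R[i]) (M : R), c != 0 ->
  (forall z, D z -> cdiff f z (f1 z) /\ normc (f1 z) <= M) ->
  (forall z, (forall w, normc (w - z) < 1 -> D w) -> normc (f1 z - c) <= normc c / 2) ->
  forall W : R, exists B, forall z, D z -> normc (f z) <= W -> normc z <= B.

(** The bound on k keeps P + k in the half-plane, so each value of the derivative F(k) is a value of
    g'. The function is a primitive of F(k), replaced by its limits on the boundary. *)
Lemma geometry_main D (gam : R -> R[i]) g g1 P (r : R) b : boundary_geometry D gam -> D !=set0 ->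
  (forall z, uhp z -> cdiff g z (g1 z)) -> (forall w, normc w < r -> uhp (P + w)) ->
  local_model (fun w => g1 (P + w)) r b -> tame D ->
  (forall B, exists B', forall q, boundary D q -> normc q <= B -> exists2 t, - B' <= t <= B' & q = gam t) ->
  exists f, [/\ forall z, D z -> exists2 w, uhp w & cdiff f z (g1 w), {within closure D, continuous f} &
    forall (s : R) p, 0 < s -> boundary D p ->
      hausdorff_dim (ball (f p) s%:C `&` infinite_valence D f) = 1%E].
Proof.
move=> bg [z0 Dz0] gd Pr lm tm param; pose F w := g1 (P + w).
pose rho := (normc b + r) / 2; have br := lm_br lm; have nb := normc_ge0 b.
have brho : normc b < rho by rewrite /rho; lra.
have rr : rho < r by rewrite /rho; lra.
have rho0 : 0 <= rho by lra.
have gdP z : normc (z - P) < r -> cdiff g z (g1 z) by move=> zP; rewrite -(subrK P z) addrC; apply/gd/Pr.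
have [L L0 hL] := deriv_lipschitz rho0 rr gdP.
have FL w w' : normc w <= rho -> normc w' <= rho -> normc (F w' - F w) <= L * normc (w' - w).
  move=> hw hw'; have := hL (P + w) (P + w'); rewrite ![P + _ - P]addrC !addKr => /(_ hw hw').
  by rewrite (_ : P + w' - (P + w) = w' - w) //; ring.
pose M := normc (F 0) + L * rho + 1; have M0 : 0 < M by rewrite ltr_wpDl // addr_ge0 ?normc_ge0 // mulr_ge0 // ltW.
have FM w : normc w <= rho -> normc (F w) <= M.
  move=> hw; have := FL 0 w; rewrite normc0 subr0 => /(_ rho0 hw).
  by have := normc_ge_sub (F w) (F 0); have := ler_wpM2l (ltW L0) hw; rewrite /M; clear; lra.
clearbody M.
pose om := lm_om lm; pose m := lm_m lm; pose kk := lm_k lm; pose e := lm_e lm.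
pose K := bg_K bg; pose c := bg_c bg; pose r0 := bg_r0 bg.
have om0 : 0 <= normc om := normc_ge0 om.
have m0 : 0 < normc m by rewrite normc_gt0 (lm_m0 lm).
have kk0 : 0 < kk := lm_k0 lm. have k10 : 0 < lm_k1 lm := lm_k10 lm. have e0 : 0 <= e := lm_e0 lm.
have Fb0 : 0 < normc (F b) by rewrite normc_gt0 (lm_Fb lm).
have c0 : 0 < c := bg_c0 bg.
have K1 : 1 <= K := bg_K0 bg.
have r00 : 0 < r0 := bg_r00 bg.
have mk : 0 < normc m * kk / 10 by rewrite divr_gt0 ?mulr_gt0.
(* The order matters: eps shares the budget |F b| with eta, and kap depends on theta and eta. *)
have [|eta eta0] := @small_number [:: (K, 8^-1); (r0, 2^-1); (3 * M * K, normc m * kk / 10); (96 * L * normc b * K, normc (F b) / 4)].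
  by rewrite /= mk !divr_gt0 // !invr_gt0 !ltr0n.
rewrite /= => /and5P[eta1 eta2 eta3 eta4 _].
have [|eps eps0] := @small_number [:: (8 * L, normc m); (3 * L * normc om, normc m * kk / 10); (3 * L, normc (F b) / 4); (1, rho - normc b)].
  by rewrite /= m0 mk !divr_gt0 // subr_gt0 brho.
rewrite /= => /and5P[eps1 eps2 eps3 eps4 _].
have [|theta theta0] := @small_number [:: (1, 1); (16 * M, normc (F b) * c / 4)].
  by rewrite /= ltr01 !divr_gt0 // mulr_gt0.
rewrite /= => /and3P[th1 th2 _].
have [|kap kap0] := @small_number [:: (1, 2^-1); (2 * normc b, rho - normc b); (10 * normc om, 1);
    (50 * normc om ^+ 2, lm_k1 lm); (8 * normc om ^+ 2, kk); (theta, kk / 2); (theta, eta); (4 * (2 * M + e) * theta, normc m * kk / 10); (8, eta)].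
  by rewrite /= invr_gt0 ltr0n subr_gt0 brho ltr01 k10 kk0 divr_gt0 // eta0 mk.
rewrite /= => /andP[ka1 /andP[ka2 /andP[ka3 /andP[ka4 /and5P[ka5 ka6 ka7 ka8 /andP[ka9 _]]]]]].
have brho' : normc b + eps <= rho by clear -eps4; lra.
have A0 : 0 < 10 * normc om + 2 by clear -om0; lra.
have ke0 : 0 < 4 / eta by rewrite divr_gt0.
have th1' : theta <= 1 by clear -th1; lra.
have [sd] := scale_data_ex bg eps0 theta0 th1' A0 kap0 ke0 brho'.
pose k := sd_k sd.
(* Truncated Taylor series of g' at P are uniform for |k| <= rho, as rho is smaller than the radius
   s of the expansion. *)
have Fka : locally_approx D (fun z => F (k z)).
  move=> B y y0; pose s := (rho + r) / 2.
  have rhos : rho < s by rewrite /s; clear -rr; lra.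
  have sr : s < r by rewrite /s; clear -rr; lra.
  have [||c' [M' tay]] := @taylor _ g1 P r s _ _ sr.
  - move=> z zP; have d0 : 0 < r - normc (z - P) by clear -zP; lra.
    apply: (@cdiff_cdiff _ g g1 z _ d0) => w wz; apply: gdP.
    by have := normc_tri z w P; clear -wz; lra.
  - by clear -nb brho rhos; lra.
  have rho1 : 0 < rho by clear -nb brho; lra.
  apply: (poly_approx_taylor (@core_bounded _ D B y) tay rho1 rhos).
    by move=> z [_ zD]; apply: (sd_bound sd); apply: zD; rewrite subrr normc0.
  exact: (sd_approx sd).
have [f0 hf0] := locally_approx_primitive (bg_open bg) (bg_conn bg) Dz0 Fka.
have fbin z : D z -> bd_ext D f0 z = f0 z by move=> Dz; apply: (fb_in (sd := sd) hf0).
exists (bd_ext D f0); split.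
- move=> z Dz; exists (P + k z); first by apply: Pr; apply: le_lt_trans (sd_bound sd Dz) rr.
  have /opencP/(_ z Dz)[s s0 sD] := bg_open bg.
  by apply: cdiff_local s0 _ (hf0 z Dz) => w ws; rewrite fbin //; exact: sD.
- apply: bd_lim_continuous => p cp d d0.
  have [dl dl0 h] := fb_lim (sd := sd) M0 FM hf0 cp d0.
  by exists dl => // z Dz zp; rewrite fbin //; exact: h.
move=> s p s0 bp; apply/eqP; rewrite eq_le; apply/andP; split.
- apply: (valence_dim_le1 (sd := sd) (lm := lm) (M := M) (L := L)) => //; rewrite -/om -/m -/kk -/e -/K -/c -/r0 -/F; try (clear -ka1 ka2 ka4 ka5 ka6 eps1; lra).
  apply: (tm f0 (fun z => F (k z)) (F b) M); first exact: (lm_Fb lm).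
    by move=> z Dz; split; [exact: hf0|exact: FM (sd_bound sd Dz)].
  move=> z zD; have Dz : D z by apply: zD; rewrite subrr normc0.
  apply: le_trans (FL _ _ (ltW brho) (sd_bound sd Dz)) _.
  by have := ler_wpM2l (ltW L0) (sd_far sd zD); have := mulr_gt0 L0 eps0; clear -eps3; lra.
- by apply: (valence_dim_ge1 (sd := sd) (lm := lm) (M := M) (L := L) (eta := eta)) => //; rewrite -/om -/m -/kk -/e -/K -/c -/r0 -/F; clear -ka1 ka2 ka4 ka5 ka6 ka7 eta1 eps1 eta3 eps2 ka8 eta4 eps3 th2 ka9; lra.
Qed.

End GeometryMain.

(** * The half-plane and smooth Jordan domains *)

Section HalfPlane.
Context {R : realType}.
Implicit Types (f g h : R[i] -> R[i]) (p q z w u v : R[i]) (D : set R[i]).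

Section PolePaths.
Variables (D : set R[i]) (B y : R).
Hypothesis y0 : 0 < y.
Let S := core D B y.
Let approx p := poly_approx S (fun z => (z - p)^-1).

(** The pole stays at distance at least y from the core, so it may advance by y/2 at a time, and
    finitely many such steps cover the path. *)
Lemma pole_path (path : R -> R[i]) (K : R) t0 t1 : 0 <= K -> (forall t, ~ D (path t)) ->
  (forall t t', normc (path t - path t') <= K * `|t - t'|) -> approx (path t0) -> approx (path t1).
Proof.
move=> K0 nD lip; have y0' := y0; have [n hn] := natr_large (K * `|t1 - t0| / (y / 2)).
have {hn} : K * `|t1 - t0| <= n%:R * (y / 2) by rewrite -ler_pdivrMr; [exact: hn|lra].
elim: n t0 => [|n IH] t0.
  rewrite mul0r => h; apply: (poly_approx_push (@core_bounded _ D B y) y0).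
    by move=> z; exact: core_away.
  by apply: le_trans (lip _ _) _; lra.
move=> h ap; pose t' := t0 + (t1 - t0) / n.+1%:R.
have n1 : 0 < n.+1%:R :> R by rewrite ltr0n.
have h1 : K * `|t' - t0| <= y / 2.
  rewrite /t' addrC addKr normrM (gtr0_norm (_ : 0 < n.+1%:R^-1)) ?invr_gt0 // mulrA ler_pdivrMr // mulrC.
  by rewrite [y / 2 * _]mulrC mulrC.
apply: (IH t').
  have -> : t1 - t' = (t1 - t0) * (n%:R / n.+1%:R).
    by rewrite /t' -[n.+1%:R]natr1; field; rewrite natr1 gt_eqF.
  have q0 : 0 <= n%:R / n.+1%:R :> R by rewrite divr_ge0 ?ler0n.
  rewrite normrM (ger0_norm q0) [K * (_ * _)]mulrA; have := ler_wpM2r q0 h; move/le_trans; apply.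
  by rewrite le_eqVlt; apply/orP; left; apply/eqP; field; rewrite gt_eqF.
apply: (poly_approx_push (@core_bounded _ D B y) y0) ap => [z|]; first exact: core_away.
exact: le_trans (lip _ _) h1.
Qed.

(** A pole far out on the ray is harmless by [poly_approx_far], and it is brought back along the
    ray. *)
Lemma pole_ray p d : normc d = 1 -> (forall t : R, 0 <= t -> ~ D (p + t%:C * d)) -> approx p.
Proof.
move=> d1 nD; pose path (t : R) := p + (`|t|)%:C * d.
have -> : p = path 0 by rewrite /path normr0 mul0r addr0.
pose B1 := `|B| + 1; have B10 : 0 < B1 by rewrite ltr_wpDl.
have lip t t' : normc (path t - path t') <= 1 * `|t - t'|.
  rewrite (_ : path t - path t' = (`|t| - `|t'|)%:C * d); last by rewrite /path rcB; ring.
  by rewrite normcM d1 normc_real mulr1 mul1r; exact: ler_dist_dist.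
apply: (@pole_path path 1 (2 * B1 + normc p)) => //; first by move=> t; exact: nD.
apply: (@poly_approx_far _ _ B1) => // [z [zB _]|].
  by apply: le_trans zB _; rewrite /B1; have := ler_norm B; lra.
have T0 : 0 <= 2 * B1 + normc p by have := normc_ge0 p; lra.
rewrite /path (ger0_norm T0) addrC; have := normc_ge_add ((2 * B1 + normc p)%:C * d) p.
by rewrite normcM d1 mulr1 normc_real (ger0_norm T0); lra.
Qed.

End PolePaths.

Lemma uhp_deep z : 1 <= complex.Im z -> forall w, normc (w - z) < 1 -> uhp w.
Proof.
move=> zI w wz; rewrite /uhp /upper_half_plane /=; have := normc_Im (w - z).
by rewrite ler_norml cImD cImN; lra.
Qed.

(** Above height 1 the function f(z) - c z has derivative at most |c|/2, so |f(z + i) - f(i)| >= |c|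
    |z| / 2; passing from z to z + i changes f by at most M. *)
Lemma uhp_tame : tame (@uhp R).
Proof.
move=> f f1 c M c0 hf hdeep W; have nc : 0 < normc c by rewrite normc_gt0.
exists (2 * (W + normc (f 'i) + M) / normc c) => z Dz fz.
have M0 : 0 <= M by have [_ h] := hf z Dz; exact: le_trans (normc_ge0 _) h.
have zI : 0 < complex.Im z := Dz.
have h1 : normc (f (z + 'i) - f z) <= M * normc (z + 'i - z).
  apply: (@mean_value_bound _ f f1) => // t /andP[t0 t1]; apply: hf.
  by rewrite /uhp /upper_half_plane /= [z + 'i]addrC addrK cImD cImZ /=; lra.
have h2 : normc ((f (z + 'i) - c * (z + 'i)) - (f 'i - c * 'i)) <= normc c / 2 * normc (z + 'i - 'i).
  apply: (@mean_value_bound _ (fun w => f w - c * w) (fun w => f1 w - c)); first by rewrite divr_ge0 // ltW.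
  move=> t /andP[t0 t1].
  have tI : 1 <= complex.Im ('i + t%:C * (z + 'i - 'i)).
    by rewrite addrK cImD cImZ /=; have := mulr_ge0 t0 (ltW zI); lra.
  have dp := uhp_deep tI; have Dt : uhp ('i + t%:C * (z + 'i - 'i)) by apply: dp; rewrite subrr normc0.
  split; last exact: hdeep.
  apply: cdiffB; first by have [] := hf _ Dt.
  by have := cdiffZ c (cdiff_id ('i + t%:C * (z + 'i - 'i))); rewrite mulr1.
rewrite [z + 'i - z]addrC addKr normc_i mulr1 in h1; rewrite addrK in h2.
have h3 : normc c * normc z <= normc (f (z + 'i) - f 'i) + normc c / 2 * normc z.
  rewrite -normcM (_ : c * z = (f (z + 'i) - f 'i) - ((f (z + 'i) - c * (z + 'i)) - (f 'i - c * 'i))); last by ring.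
  by apply: le_trans (normcB _ _) _; rewrite lerD2l.
rewrite ler_pdivlMr //; have := normcB (f (z + 'i)) (f 'i); have := normc_tri (f z) (f (z + 'i)) 0.
rewrite !subr0; lra.
Qed.

Lemma uhp_boundary p : boundary (@uhp R) p -> complex.Im p = 0.
Proof.
move=> /(boundarycP uhp_open)[nD acc]; apply/eqP; rewrite eq_le; apply/andP; split.
  by rewrite leNgt; apply/negP.
apply/ler_addgt0Pr => e e0; have [w Dw wp] := acc e e0.
have : 0 < complex.Im w := Dw; have := normc_Im (w - p); rewrite ler_norml cImD cImN; lra.
Qed.

Lemma uhp_geometry : boundary_geometry (@uhp R) (fun t => t%:C).
Proof.
(* The windows are [-(n+1), n+1); they grow to the whole line, and the ends of one window need not
   be treated as close. *)
apply: (@BoundaryGeometry R uhp (fun t => t%:C) (fun=> 1) 1 1 1 0 (fun n => - n.+1%:R) (fun n => n.+1.*2)) => //.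
- exact: uhp_open.
- exact: convex_clopen_conn uhp_convex.
- by move=> t t'; rewrite -rcB normc_real mul1r.
- by move=> t; exact: normc1.
- move=> t; exists (fun=> 0); split.
  + by move=> x _; rewrite normr0 mul0r.
  + by move=> x y _ _; rewrite subrr normr0 divr_ge0.
  + by move=> u _ _; rewrite /uhp /upper_half_plane /= mul1r cImD /= add0r.
- move=> t s s0 _ B y y0; apply: (@pole_ray _ B y y0 _ (- 'i)).
    by rewrite normcN normc_i.
  move=> x x0; have pI : complex.Im (t%:C - 'i * 1 * s%:C + x%:C * - 'i) = - (s + x).
    by rewrite !(cImD, cImN, cImM, cReM) /=; ring.
  have : ~ (0 < complex.Im (t%:C - 'i * 1 * s%:C + x%:C * - 'i)) by rewrite pI; apply/negP; rewrite -leNgt; lra.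
  by [].
- move=> n t t' _ _; rewrite mul1r -rcB normc_real ge_min lexx //.
- move=> n; rewrite -!mul2n !natrM -[n.+2%:R]natr1; lra.
- move=> p bp; have pI := uhp_boundary bp.
  have [n hn] := natr_large `|complex.Re p|; exists n, (complex.Re p); split.
    have := hn n (leqnn _); rewrite -mul2n natrM -[n.+1%:R]natr1 ler_norml => /andP[h1 h2].
    by apply/andP; split; lra.
  by rewrite [LHS]complexE pI mulr0 addr0.
Qed.

End HalfPlane.

(** * Simple closed curves: uniform bounds and the chord-arc property *)

Section PeriodicCurve.
Context {R : realType}.
Implicit Types (phi psi : R -> R[i]) (t s : R).

Lemma periodic_reduce (P : R -> Prop) : (forall t, P (t + 1) <-> P t) -> (forall t, 0 <= t < 1 -> P t) -> forall t, P t.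
Proof.
move=> per h.
have pn n t : P (t + n%:R) <-> P t.
  elim: n => [|n IH]; first by rewrite addr0.
  by rewrite -natr1 addrA; apply: iff_trans (per _) IH.
move=> t; have [n hn] := natr_large (`|t|); have {}hn := hn n (leqnn _).
have t0 : 0 <= t + n%:R by move: hn; rewrite ler_norml; lra.
have /andP[h1 h2] := truncn_itv t0; rewrite -[_.+1%:R]natr1 in h2.
set m := Num.trunc _ in h1 h2.
apply/(pn n); have := pn m (t + n%:R - m%:R); rewrite subrK => ->.
by apply: h; apply/andP; split; lra.
Qed.

Lemma periodic_bounded psi : (forall t, psi (t + 1) = psi t) -> (forall t, rcont psi t) ->
  exists2 M : R, 0 < M & forall t, normc (psi t) <= M.
Proof.
move=> per c; have [M M0 h] := rcont_bounded (fun t _ => c t).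
exists (M + 1); first by lra.
apply: periodic_reduce => [t|t /andP[t0 t1]]; first by rewrite per.
by have := h t; rewrite t0 (ltW t1) => /(_ isT); lra.
Qed.

Variables (gam d d2 : R -> R[i]).
Hypotheses (gd : forall t, rdiff gam t (d t)) (dd : forall t, rdiff d t (d2 t)) (d2c : forall t, rcont d2 t)
  (gp : forall t, gam (t + 1) = gam t) (dp : forall t, d (t + 1) = d t) (d2p : forall t, d2 (t + 1) = d2 t)
  (d0 : forall t, d t != 0)
  (ginj : forall t s, 0 <= t < 1 -> 0 <= s < 1 -> gam t = gam s -> t = s).

Lemma rdiff_lipschitz phi psi (M : R) : 0 <= M -> (forall t, rdiff phi t (psi t)) -> forall t s,
  (forall x, 0 <= x <= 1 -> normc (psi (s + (t - s) * x)) <= M) -> normc (phi t - phi s) <= M * `|t - s|.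
Proof.
move=> M0 h t s hM; have := @rdiff_bound _ (fun x => phi (s + (t - s) * x)) (M * `|t - s|).
rewrite mulr0 addr0 (_ : s + (t - s) * 1 = t); last by ring.
apply; first by rewrite mulr_ge0.
move=> x x01; exists (psi (s + (t - s) * x) * (t - s)%:C); first exact: rdiff_affine.
by rewrite normcM normc_real ler_wpM2r // hM.
Qed.

(** Periodicity makes d2, d and 1/d bounded. The quadratic estimate is the mean value inequality for
    the curve minus its tangent at s. *)
Lemma curve_bounds : exists C2 K c0 : R, [/\ 0 < C2, 1 <= K, 0 < c0,
  forall t, c0 <= normc (d t) & [/\ forall t s, normc (gam t - gam s) <= K * `|t - s|,
   forall t s, normc (d t - d s) <= C2 * `|t - s| &
   forall t s, normc (gam t - gam s - d s * (t - s)%:C) <= C2 * `|t - s| ^+ 2]].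
Proof.
have [C2 C20 hC2] := periodic_bounded d2p d2c.
have [K K0 hK] := periodic_bounded dp (fun t => rdiff_rcont (@dd t)).
have [||M M0 hM] := @periodic_bounded (fun t => (d t)^-1).
- by move=> t; rewrite dp.
- by move=> t; apply: (@ccont_rcont _ GRing.inv); [exact: cdiff_ccont (cdiff_inv (d0 t))|exact: rdiff_rcont (@dd t)].
exists C2, (K + 1), M^-1; split => //; first by lra.
- by rewrite invr_gt0.
- move=> t; have := hM t; rewrite normcV => h; have n0 : 0 < normc (d t) by rewrite normc_gt0.
  by rewrite invf_ple ?posrE.
have L2 t s : normc (d t - d s) <= C2 * `|t - s|.
  by apply: (rdiff_lipschitz (psi := d2)) => //; exact: ltW.
split => // t s.
- apply: le_trans (_ : K * `|t - s| <= _); last by rewrite ler_wpM2r //; lra.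
  by apply: (rdiff_lipschitz (psi := d)) => //; exact: ltW.
pose phi x := gam x - d s * x%:C.
have phid x : rdiff phi x (d x - d s).
  have idd : rdiff (fun x : R => x%:C : R[i]) x 1.
    by move=> e e0; exists 1 => // v _; rewrite mul1r -rcB subrr normc0 mulr_ge0 // ltW.
  have := rdiffD (@gd x) (rdiffZ (- d s) idd); rewrite mulr1; congr (rdiff _ _ _).
  by apply/funext => v; rewrite mulNr.
have Ct : 0 <= C2 * `|t - s| by rewrite mulr_ge0 // ltW.
have := rdiff_lipschitz Ct phid (t := t) (s := s).
rewrite /phi expr2 mulrA (_ : _ - _ - (_ - _) = gam t - gam s - d s * (t - s)%:C); last by rewrite rcB; ring.
apply=> x /andP[x0 x1]; apply: le_trans (L2 _ _) _; rewrite ler_wpM2l ?(ltW C20) //.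
by rewrite addrC addKr normrM (ger0_norm x0) ler_piMr.
Qed.

Lemma gam_reduce t0 t1 : exists2 t, `|t - t0| <= 2^-1 & gam t = gam t1.
Proof.
move: t0; apply: periodic_reduce => [t0|t0 t01].
  split=> -[t h1 h2]; first by exists (t - 1); [move: h1; congr (`|_| <= _); ring|rewrite -h2 -(gp (t - 1)) subrK].
  by exists (t + 1); [move: h1; congr (`|_| <= _); ring|rewrite gp].
have [t2 t201 <-] : exists2 t, 0 <= t < 1 & gam t = gam t1.
  move: t1; apply: periodic_reduce => [t|t t1]; first by rewrite gp.
  by exists t.
move/andP: t01 => [a1 a2]; move/andP: t201 => [b1 b2].
have [h|h] := leP (2^-1) (t2 - t0).
  by exists (t2 - 1); [rewrite ler_norml; lra|rewrite -(gp (t2 - 1)) subrK].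
have [h'|h'] := leP (t2 - t0) (- 2^-1); last by exists t2 => //; rewrite ler_norml; lra.
by exists (t2 + 1); [rewrite ler_norml; lra|rewrite gp].
Qed.

Lemma gam_separated t s : 0 < s < 1 -> gam (t + s) != gam t.
Proof.
move: t; apply: periodic_reduce => [t|t /andP[t0 t1] /andP[s0 s1]].
  by rewrite addrAC !gp.
apply/eqP => h; have [h1|h1] := ltP (t + s) 1.
  have := ginj (t := t + s) (s := t) _ _ h => H.
  have : t + s = t by apply: H; apply/andP; split; lra.
  lra.
have : t + s - 1 = t.
  apply: ginj; [apply/andP; split; lra|apply/andP; split; lra|].
  by rewrite -h -(gp (t + s - 1)) subrK.
lra.
Qed.

(** Compactness in two variables by [cousin]: for a fixed lag s over one period of t, and then over
    the lags. *)
Lemma gam_lag_bound (K : R) (dl : R) : 1 <= K -> (forall t s, normc (gam t - gam s) <= K * `|t - s|) -> 0 < dl -> dl <= 4^-1 ->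
  exists2 c : R, 0 < c & forall t s, dl <= s <= 1 - dl -> c <= normc (gam (t + s) - gam t).
Proof.
move=> K1 lip dl0 dl1.
have near t s t' s' (v : R) : v = normc (gam (t + s) - gam t) -> `|t' - t| <= v / (8 * K) -> `|s' - s| <= v / (8 * K) ->
    v / 2 <= normc (gam (t' + s') - gam t').
  move=> vE; rewrite !ler_pdivlMr ?mulr_gt0 //; try lra.
  move=> h1 h2; have l1 := lip (t' + s') (t + s); have l2 := lip t' t.
  have : `|t' + s' - (t + s)| <= `|t' - t| + `|s' - s|.
    by rewrite opprD addrACA ler_normD.
  move=> /(ler_wpM2l (le_trans ler01 K1)) h3.
  have e1 : gam (t + s) - gam t = (gam (t' + s') - gam t') - ((gam (t' + s') - gam (t + s)) - (gam t' - gam t)) by ring.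
  have := normcB (gam (t' + s') - gam t') ((gam (t' + s') - gam (t + s)) - (gam t' - gam t)).
  have := normcB (gam (t' + s') - gam (t + s)) (gam t' - gam t).
  have v0 : 0 <= v by rewrite vE normc_ge0.
  rewrite -e1 -vE; clear -h1 h2 l1 l2 h3 v0; lra.
have row s : 0 < s < 1 -> exists2 e : R, 0 < e & exists2 c : R, 0 < c & forall t s', 0 <= t <= 1 -> `|s' - s| <= e ->
    c <= normc (gam (t + s') - gam t).
  move=> s01.
  have [||e e0 [c c0 h]] := @cousin R (fun a b => exists2 e : R, 0 < e & exists2 c : R, 0 < c & forall t s', a <= t <= b -> `|s' - s| <= e ->
    c <= normc (gam (t + s') - gam t)); last by exists e => //; exists c.
    move=> a b x ab bx [e1 e10 [c1 c10 h1]] [e2 e20 [c2 c20 h2]].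
    exists (Num.min e1 e2); first by rewrite lt_min e10.
    exists (Num.min c1 c2); first by rewrite lt_min c10.
    move=> t s' /andP[ta tx]; rewrite le_min => /andP[se1 se2]; rewrite ge_min.
    have [tb|tb] := leP t b; first by rewrite h1 // ta.
    by rewrite (h2 t s') ?orbT // (ltW tb).
  move=> t _; pose v := normc (gam (t + s) - gam t).
  have v0 : 0 < v by rewrite normc_gt0 subr_eq0 gam_separated.
  have vK : 0 < v / (8 * K) by rewrite divr_gt0 // mulr_gt0 //; lra.
  exists (v / (8 * K)) => // a b _ at_ tb _ ha hb; exists (v / (8 * K)) => //; exists (v / 2); first by rewrite divr_gt0.
  move=> t' s' /andP[at' t'b] ss; apply: (near t s) => //; rewrite ler_norml; apply/andP; split; rewrite -/v; clear -ha at' hb t'b; lra.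
pose X s := dl + (1 - 2 * dl) * s.
have [||c c0 h] := @cousin R (fun a b => exists2 c : R, 0 < c & forall t s', 0 <= t <= 1 -> X a <= s' <= X b ->
    c <= normc (gam (t + s') - gam t)).
- move=> a b x ab bx [c1 c10 h1] [c2 c20 h2]; exists (Num.min c1 c2); first by rewrite lt_min c10.
  move=> t s' t01 /andP[sa sx]; rewrite ge_min; have [sb|sb] := leP s' (X b); first by rewrite h1 // sa.
  by rewrite (h2 t s') ?orbT // (ltW sb).
- move=> s /andP[s0 s1].
  have Xs : 0 < X s < 1 by rewrite /X; apply/andP; split; nra.
  have [e e0 [c c0 h]] := row _ Xs; exists e => // a b _ as_ sb _ ha hb; exists c => // t s' t01 /andP[as' s'b].
  apply: h => //; move: as' s'b; rewrite /X ler_norml => as' s'b.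
  have k1 : (1 - 2 * dl) * (s - a) <= s - a by rewrite ler_piMl; clear -K1 as_ dl0 gam d d2; lra.
  have k2 : (1 - 2 * dl) * (b - s) <= b - s by rewrite ler_piMl; clear -K1 sb dl0 gam d d2; lra.
  by apply/andP; split; clear -ha as' k1 hb s'b k2; lra.
exists c => // t s hs; have hs' : X 0 <= s <= X 1 by rewrite /X mulr0 mulr1; move: hs => /andP[? ?]; apply/andP; split; lra.
move: t; apply: periodic_reduce => [t|t /andP[t0 t1]]; first by rewrite addrAC !gp.
by apply: h => //; rewrite t0 ltW.
Qed.

(** Short lags follow from the tangent, lags near 1 are short lags backwards by periodicity, and
    injectivity with compactness settles those in between. *)
Lemma chord_arc : exists2 c : R, 0 < c & forall t s, 0 <= s <= 1 -> c * Num.min s (1 - s) <= normc (gam (t + s) - gam t).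
Proof.
have [C2 [K [c0 [C20 K1 c00 dlow [lip _ tay]]]]] := curve_bounds.
pose dl := Num.min 4^-1 (c0 / (2 * C2)).
have dl0 : 0 < dl by rewrite lt_min divr_gt0 ?mulr_gt0 // andbT; lra.
have dl1 : dl <= 4^-1 by rewrite ge_min lexx.
have dl2 : dl * (2 * C2) <= c0 by rewrite -ler_pdivlMr ?mulr_gt0 // ge_min lexx orbT.
clearbody dl; have [c c1 hc] := gam_lag_bound K1 lip dl0 dl1.
have short t t' : `|t' - t| <= dl -> c0 / 2 * `|t' - t| <= normc (gam t' - gam t).
  move=> h; have := tay t' t; have := normc_ge_sub (d t * (t' - t)%:C) (- (gam t' - gam t - d t * (t' - t)%:C)).
  rewrite normcN normcM normc_real (_ : _ - - _ = gam t' - gam t); last by ring.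
  have n0 := normr_ge0 (t' - t); have := ler_wpM2r n0 (dlow t).
  have := ler_wpM2r (mulr_ge0 (ltW C20) n0) h; have := ler_wpM2r n0 dl2; rewrite expr2; lra.
exists (Num.min c (c0 / 2)); first by rewrite lt_min c1; lra.
have m1 : Num.min c (c0 / 2) <= c by rewrite ge_min lexx.
have m2 : Num.min c (c0 / 2) <= c0 / 2 by rewrite ge_min lexx orbT.
have m0 : 0 < Num.min c (c0 / 2) by rewrite lt_min c1; lra.
set m := Num.min c _ in m1 m2 m0 *; clearbody m.
move=> t s /andP[s0 s1].
have ms : Num.min s (1 - s) <= s by rewrite ge_min lexx.
have ms' : Num.min s (1 - s) <= 1 - s by rewrite ge_min lexx orbT.
set x := Num.min s _ in ms ms' *; clearbody x.
have [h|h] := leP s dl.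
  have := short t (t + s); rewrite [t + s - t]addrC addKr (ger0_norm s0) => /(_ h).
  have := ler_wpM2l (ltW m0) ms; have := ler_wpM2r s0 m2; lra.
have [h'|h'] := leP (1 - dl) s.
  have e1 : t + s - (t + 1) = - (1 - s) by ring.
  have s1' : 0 <= 1 - s by lra.
  have := short (t + 1) (t + s); rewrite e1 normrN (ger0_norm s1') gp => H.
  have : c0 / 2 * (1 - s) <= normc (gam (t + s) - gam t) by apply: H; lra.
  have := ler_wpM2l (ltW m0) ms'; have := ler_wpM2r s1' m2; lra.
have := hc t s; rewrite (ltW h) (ltW h') => /(_ isT).
have := ler_wpM2l (ltW m0) ms; have := ler_wpM2l (ltW m0) s1; lra.
Qed.

End PeriodicCurve.

(** * The two sides of the boundary curve in a chart *)

Section JordanDomain.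
Context {R : realType}.
Implicit Types (p q z w u v nu : R[i]) (t s x : R).

Section Sides.
Variable (D : set R[i]).
Hypothesis oD : open D.

Lemma off_boundary q : ~ boundary D q -> exists2 e : R, 0 < e &
  (forall w, normc (w - q) < e -> D w) \/ (forall w, normc (w - q) < e -> ~ D w).
Proof.
move=> nb; have [Dq|nDq] := pselect (D q).
  by have /opencP/(_ q Dq)[e e0 h] := oD; exists e => //; left.
apply: contrapT => H; apply: nb; apply/(boundarycP oD); split => // e e0.
apply: contrapT => h; apply: H; exists e => //; right => w we Dw; apply: h.
by exists w.
Qed.

Lemma off_boundary_segment z w : (forall t, 0 <= t <= 1 -> ~ boundary D (z + t%:C * (w - z))) -> D z <-> D w.
Proof.
move=> h; split => [|Dw]; first by apply: clopen_segment => t /h; exact: off_boundary.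
apply: contrapT => nz; have := @clopen_segment _ (~` D) z w; apply => //= t /h/off_boundary[e e0 [H|H]]; exists e => //.
  by right => v /H Dv; apply.
by left.
Qed.

Variables (p nu : R[i]) (r0 C : R) (phi : R -> R).
Hypotheses (r00 : 0 < r0) (nu1 : normc nu = 1)
  (quad : forall x, `|x| < r0 -> `|phi x| <= C * x ^+ 2)
  (lip : forall x x', `|x| < r0 -> `|x'| < r0 -> `|phi x - phi x'| <= `|x - x'| / 3)
  (graph : forall u, `|complex.Re u| < r0 -> `|complex.Im u| < r0 ->
     (boundary D (p + nu * u) <-> complex.Im u = phi (complex.Re u))).

Let phi0 : phi 0 = 0.
Proof.
apply/eqP; rewrite -normr_eq0 eq_le normr_ge0 andbT.
by have := quad (x := 0); rewrite normr0 expr0n /= mulr0; apply.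
Qed.

Lemma phi_small x : `|x| < r0 -> `|phi x| <= `|x| / 3.
Proof. by move=> xr; have := lip xr (_ : `|0| < r0); rewrite phi0 !subr0 normr0; apply. Qed.

Lemma box_closure u : `|complex.Re u| < r0 -> `|complex.Im u| < r0 -> complex.Im u <> phi (complex.Re u) ->
  closure D (p + nu * u) -> D (p + nu * u).
Proof.
move=> uR uI un cu; apply: contrapT => nD; apply: un; apply/(graph uR uI); split => //.
by move=> /interior_subset.
Qed.

(** From u a vertical and then a horizontal segment lead to the reference point without meeting the
    graph: its slope is at most 1/3, so it stays below height r0/3, while the crossing is at
    r0/2. *)
Lemma side_transfer (e : R) u : e = 1 \/ e = -1 -> `|complex.Re u| < r0 -> `|complex.Im u| < r0 ->
  0 < e * (complex.Im u - phi (complex.Re u)) -> D (p + nu * u) <-> D (p + nu * (0 +i* (e * (r0 / 2)))).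
Proof.
move=> e1; case: u => a s; rewrite [complex.Re _]/= [complex.Im _]/= => ar sr pos; have r00' := r00.
have := phi_small ar; rewrite ler_norml => /andP[f1 f2].
have seg v v' : (forall t, 0 <= t <= 1 -> let w := v + t%:C * (v' - v) in [/\ `|complex.Re w| < r0, `|complex.Im w| < r0 & 0 < e * (complex.Im w - phi (complex.Re w))]) ->
    D (p + nu * v) <-> D (p + nu * v').
  move=> h; apply: off_boundary_segment => t /h /= [h1 h2 h3].
  have -> : p + nu * v + t%:C * (p + nu * v' - (p + nu * v)) = p + nu * (v + t%:C * (v' - v)) by ring.
  by move/(graph h1 h2) => h4; rewrite h4 subrr mulr0 ltxx in h3.
have arI : - r0 < a < r0 by rewrite -ltr_norml.
have srI : - r0 < s < r0 by rewrite -ltr_norml.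
have es : `|e * (r0 / 2)| < r0 by rewrite ltr_norml; case: e1 => ->; apply/andP; split; lra.
apply: (@iff_trans _ (D (p + nu * (a +i* (e * (r0 / 2)))))); apply: seg => t /andP[t0 t1] w.
- have -> : w = a +i* ((1 - t) * s + t * (e * (r0 / 2))).
    by rewrite /w; apply/eqP; rewrite eq_complex /=; apply/andP; split; apply/eqP; ring.
  rewrite [complex.Re _]/= [complex.Im _]/=; split => //.
    rewrite ltr_norml; move: srI arI es; rewrite ltr_norml => /andP[s1 s2] _ /andP[s3 s4].
    have [t'|t'] := ltP t 1; last by have -> : t = 1 by [lra]; apply/andP; split; lra.
    have k1 : 0 < 1 - t by lra.
    have q1 : (1 - t) * s < (1 - t) * r0 by rewrite ltr_pM2l.
    have q2 : (1 - t) * - r0 < (1 - t) * s by rewrite ltr_pM2l.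
    have q3 := ler_wpM2l t0 (ltW s3); have q4 := ler_wpM2l t0 (ltW s4).
    by apply/andP; split; lra.
  have h2 : 0 < e * (e * (r0 / 2) - phi a).
    by move: f1 f2 arI; case: e1 => -> => f1 f2 /andP[? ?]; have : `|a| < r0 by []; lra.
  have -> : e * ((1 - t) * s + t * (e * (r0 / 2)) - phi a) = (1 - t) * (e * (s - phi a)) + t * (e * (e * (r0 / 2) - phi a)) by ring.
  have [t'|t'] := ltP t 1; last by have -> : t = 1 by [lra]; lra.
  have k1 : 0 < 1 - t by lra.
  by have := mulr_gt0 k1 pos; have := mulr_ge0 t0 (ltW h2); lra.
have -> : w = ((1 - t) * a) +i* (e * (r0 / 2)).
  by rewrite /w; apply/eqP; rewrite eq_complex /=; apply/andP; split; apply/eqP; ring.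
rewrite [complex.Re _]/= [complex.Im _]/=.
have at_ : `|(1 - t) * a| <= `|a| by rewrite normrM ger0_norm ?ler_piMl //; lra.
have atr : `|(1 - t) * a| < r0 by apply: le_lt_trans ar.
split => //; have := phi_small atr; rewrite ler_norml => /andP[g1 g2].
by case: e1 => ->; lra.
Qed.

Let ref (e : R) := p + nu * (0 +i* (e * (r0 / 2))).

Lemma some_side : closure D p -> D (ref 1) \/ D (ref (-1)).
Proof.
move=> /closurecP cp; have [z Dz zp] := cp r0 r00.
have [u zE nu_] := chart_coord p nu1 z; rewrite -nu_ in zp.
have uR : `|complex.Re u| < r0 by apply: le_lt_trans (normc_Re u) zp.
have uI : `|complex.Im u| < r0 by apply: le_lt_trans (normc_Im u) zp.
rewrite zE in Dz; have [h|h|h] := ltgtP (complex.Im u) (phi (complex.Re u)).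
- right; apply/(@side_transfer (-1) u) => //; first by right.
  by rewrite mulN1r opprB subr_gt0.
- left; apply/(@side_transfer 1 u) => //; first by left.
  by rewrite mul1r subr_gt0.
- by have := (graph uR uI).2 h => /(boundarycP oD)[nD _].
Qed.

(** For a boundary point on the curve this expresses that D lies on both sides of it. *)
Definition in_interior_closure q := exists2 s, 0 < s & forall w, normc (w - q) < s -> closure D w.

Lemma both_sides : D (ref 1) -> D (ref (-1)) -> in_interior_closure p.
Proof.
move=> D1 D2; exists r0 => // w wp; have [u wE nu_] := chart_coord p nu1 w; rewrite -nu_ in wp; rewrite wE.
have uR : `|complex.Re u| < r0 by apply: le_lt_trans (normc_Re u) wp.
have uI : `|complex.Im u| < r0 by apply: le_lt_trans (normc_Im u) wp.
have [h|h|h] := ltgtP (complex.Im u) (phi (complex.Re u)).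
- apply: subset_closure; apply/(@side_transfer (-1) u) => //; first by right.
  by rewrite mulN1r opprB subr_gt0.
- apply: subset_closure; apply/(@side_transfer 1 u) => //; first by left.
  by rewrite mul1r subr_gt0.
- by have [] := (graph uR uI).2 h.
Qed.

(** A point slightly off the curve on the side that misses D lies outside the closure by
    [box_closure]. *)
Lemma one_side (e : R) q : e = 1 \/ e = -1 -> ~ D (ref e) -> boundary D q -> normc (q - p) < r0 -> ~ in_interior_closure q.
Proof.
move=> e1 nD bq qp [s s0 hs]; have [u qE nu_] := chart_coord p nu1 q; rewrite -nu_ in qp.
have uR : `|complex.Re u| < r0 by apply: le_lt_trans (normc_Re u) qp.
have uI : `|complex.Im u| < r0 by apply: le_lt_trans (normc_Im u) qp.
rewrite qE in bq; have h := (graph uR uI).1 bq.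
pose x := Num.min (s / 2) ((r0 - `|complex.Im u|) / 2).
have x0 : 0 < x by rewrite lt_min !divr_gt0 // subr_gt0.
have x1 : x <= s / 2 by rewrite ge_min lexx.
have x2 : x <= (r0 - `|complex.Im u|) / 2 by rewrite ge_min lexx orbT.
clearbody x; pose v : R[i] := complex.Re u +i* (complex.Im u + e * x).
have ex : `|e * x| = x by case: e1 => ->; rewrite ?mul1r ?mulN1r ?normrN gtr0_norm.
have vI : `|complex.Im v| < r0.
  by rewrite /=; apply: le_lt_trans (ler_normD _ _) _; rewrite ex; lra.
have vpos : 0 < e * (complex.Im v - phi (complex.Re v)).
  by rewrite /= -h addrC addKr; case: e1 => ->; lra.
have vR : `|complex.Re v| < r0 by exact: uR.
have nDv : ~ D (p + nu * v) by move=> /(side_transfer e1 vR vI vpos).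
apply: nDv; apply: box_closure => //.
  by move=> h'; move: vpos; rewrite h' subrr mulr0 ltxx.
apply: hs; rewrite qE (chart_dist p nu1).
rewrite (_ : v - u = 'i * (e * x)%:C); first by rewrite normcM normc_i mul1r normc_real ex; lra.
by rewrite /v; case: (u) => a b; apply/eqP; rewrite eq_complex /=; apply/andP; split; apply/eqP; ring.
Qed.

(** Exactly one reference point belongs to D. If it is the lower one, the chart is turned by 180
    degrees: nu becomes -nu and the graph is reflected in the origin. *)
Lemma side_chart : closure D p -> ~ in_interior_closure p -> exists nu', normc nu' = 1 /\ graph_chart D p nu' r0 C.
Proof.
move=> cp nI; have nboth : ~ (D (ref 1) /\ D (ref (-1))) by move=> [h1 h2]; apply: nI; exact: both_sides.
have [D1|D2] := some_side cp.
  have nD2 : ~ D (ref (-1)) by move=> h; apply: nboth.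
  exists nu; split => //; exists phi; split => //.
    by move=> x x' xr xr'; apply: le_trans (lip xr xr') _; rewrite ler_wpM2l // lef_pV2 ?posrE ?ler_nat.
  move=> u uR uI; split => [Du|h]; last first.
    by apply/(@side_transfer 1 u) => //; [left|rewrite mul1r subr_gt0].
  have [h|h|h] := ltgtP (complex.Im u) (phi (complex.Re u)) => //.
    exfalso; apply: nD2; apply/(@side_transfer (-1) u) => //; [by right|by rewrite mulN1r opprB subr_gt0].
  by have := (graph uR uI).2 h => /(boundarycP oD)[nD _].
have nD1 : ~ D (ref 1) by move=> h; apply: nboth.
exists (- nu); split; first by rewrite normcN.
have uN u : p + - nu * u = p + nu * (- u) by ring.
exists (fun x => - phi (- x)); split.
- by move=> x xr; have := quad (x := - x); rewrite !normrN sqrrN; apply.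
- move=> x x' xr xr'; have := lip (x := - x') (x' := - x); rewrite !normrN => /(_ xr' xr).
  rewrite (_ : - x' - - x = x - x'); last by ring.
  rewrite (_ : - phi (- x) - - phi (- x') = phi (- x') - phi (- x)); last by ring.
  by have := normr_ge0 (x - x'); lra.
- move=> u uR uI; rewrite uN; have uR' : `|complex.Re (- u)| < r0 by rewrite cReN normrN.
  have uI' : `|complex.Im (- u)| < r0 by rewrite cImN normrN.
  rewrite -cReN ltrNl -cImN; split => [Du|h]; last first.
    by apply/(@side_transfer (-1) (- u)) => //; [right|rewrite mulN1r opprB subr_gt0].
  have [h|h|h] := ltgtP (complex.Im (- u)) (phi (complex.Re (- u))) => //.
    exfalso; apply: nD1; apply/(@side_transfer 1 (- u)) => //; [by left|by rewrite mul1r subr_gt0].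
  by have := (graph uR' uI').2 h => /(boundarycP oD)[nD _].
Qed.

End Sides.
End JordanDomain.

(** * Boundary geometry of a domain bounded by a simple closed curve *)

Section JordanGeometry.
Context {R : realType}.
Implicit Types (p q z w u v nu : R[i]) (t s x : R).

Lemma lipschitz_continuous (f : R -> R) (K : R) : (forall t s, `|f t - f s| <= K * `|t - s|) -> continuous f.
Proof.
move=> lip t; apply/cvgrPdist_le => e e0; have K1 : 0 < `|K| + 1 by rewrite ltr_wpDl.
apply/nbhs_ballP; exists (e / (`|K| + 1)); first by rewrite /= divr_gt0.
move=> s; rewrite /ball /= ltr_pdivlMr // => h; apply: le_trans (lip t s) _.
by have := ler_wpM2r (normr_ge0 (t - s)) (ler_norm K); have := normr_ge0 (t - s); lra.
Qed.

Variables (D : set R[i]) (gam d d2 : R -> R[i]).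
Hypotheses (oD : open D) (cD : clopen_conn D) (bD : exists B : R, forall z, D z -> normc z <= B)
  (bJ : forall p, boundary D p <-> exists t, p = gam t).
Hypotheses (gd : forall t, rdiff gam t (d t)) (dd : forall t, rdiff d t (d2 t)) (d2c : forall t, rcont d2 t)
  (gp : forall t, gam (t + 1) = gam t) (dp : forall t, d (t + 1) = d t) (d2p : forall t, d2 (t + 1) = d2 t)
  (d0 : forall t, d t != 0)
  (ginj : forall t s, 0 <= t < 1 -> 0 <= s < 1 -> gam t = gam s -> t = s).

(** In the frame of the tangent at t0 the abscissa [a] of the curve is bi-Lipschitz in the
    parameter, with inverse obtained from the intermediate value theorem, and the ordinate [h] is a
    function of it. Parts of the curve with remote parameters are kept out of the box by the
    chord-arc property. *)
Lemma local_graph : exists r0 C : R, [/\ 0 < r0, 0 <= C & forall t0, exists nu (phi : R -> R), [/\ normc nu = 1,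
  forall x, `|x| < r0 -> `|phi x| <= C * x ^+ 2,
  forall x x', `|x| < r0 -> `|x'| < r0 -> `|phi x - phi x'| <= `|x - x'| / 3 &
  forall u, `|complex.Re u| < r0 -> `|complex.Im u| < r0 ->
     (boundary D (gam t0 + nu * u) <-> complex.Im u = phi (complex.Re u))]].
Proof.
have [C2 [K [c0 [C20 K1 c00 dlow [lip dlip tay]]]]] := curve_bounds gd dd d2c dp d2p d0.
have [c c1 hc] := chord_arc gd dd d2c gp dp d2p d0 ginj.
(* For parameters within dl of t0 the deviation from the tangent is at most 3 C2 dl |t - s| <=
   (c0/4) |t - s|, which leaves slope 3/4 for [a] and 1/3 for the graph. *)
pose dl := Num.min 2^-1 (c0 / (12 * C2)).
have dl0 : 0 < dl by rewrite lt_min divr_gt0 ?mulr_gt0 // andbT; lra.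
have dl1 : dl <= 2^-1 by rewrite ge_min lexx.
have dl2 : dl * (12 * C2) <= c0 by rewrite -ler_pdivlMr ?mulr_gt0 // ge_min lexx orbT.
clearbody dl.
pose rh := 3 / 4 * c0 * dl; have rh0 : 0 < rh by rewrite !mulr_gt0 //; lra.
(* The first bound makes [a] attain every abscissa of the box; by the second a point of the curve in
   the box, at distance less than 2 r0, has its parameter within dl. *)
pose r0 := Num.min rh (c * dl / 2).
have r00 : 0 < r0 by rewrite lt_min rh0 divr_gt0 // mulr_gt0.
have r01 : r0 <= rh by rewrite ge_min lexx.
have r02 : r0 <= c * dl / 2 by rewrite ge_min lexx orbT.
clearbody r0.
exists r0, (C2 * (4 / (3 * c0)) ^+ 2); split => //; first by rewrite mulr_ge0 ?(ltW C20) // exprn_ge0 // divr_ge0 // mulr_ge0 // ltW.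
move=> t0; pose n0 := normc (d t0); have n00 : c0 <= n0 := dlow t0.
pose nu := d t0 / n0%:C.
have n0pos : 0 < n0 := lt_le_trans c00 n00.
have n0C : n0%:C != 0 :> R[i] by rewrite rc_eq0 gt_eqF.
have nu1 : normc nu = 1 by rewrite normcf normc_real ger0_norm ?normc_ge0 // divff // gt_eqF.
have nu0 : nu != 0 by rewrite -normc_gt0 nu1.
pose U t := (gam t - gam t0) / nu.
pose a t := complex.Re (U t); pose h t := complex.Im (U t).
have Unorm t s : normc (U t - U s) = normc (gam t - gam s).
  by rewrite /U -mulrBl normcf nu1 divr1; congr (normc _); ring.
have Utay t s : normc (gam t - gam s - d t0 * (t - s)%:C) = normc (U t - U s - (n0 * (t - s))%:C).
  rewrite -[LHS]divr1 -nu1 -normcf; congr (normc _); rewrite /U rcM mulrBl.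
  have -> : d t0 * (t - s)%:C / nu = n0%:C * (t - s)%:C by rewrite /nu; field; rewrite n0C d0.
  by rewrite -!mulrBl; congr (_ - _); congr (_ / _); ring.
have U0 : U t0 = 0 by rewrite /U subrr mul0r.
have key t s : `|t - t0| <= dl -> `|s - t0| <= dl ->
    `|a t - a s - n0 * (t - s)| <= c0 / 4 * `|t - s| /\ `|h t - h s| <= c0 / 4 * `|t - s|.
  move=> td sd; have E : normc (U t - U s - (n0 * (t - s))%:C) <= c0 / 4 * `|t - s|.
    rewrite -Utay; have e1 : gam t - gam s - d t0 * (t - s)%:C = (gam t - gam s - d s * (t - s)%:C) + (d s - d t0) * (t - s)%:C by ring.
    rewrite e1; apply: le_trans (normcD _ _) _; rewrite normcM normc_real.
    have nn := normr_ge0 (t - s).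
    have h1 : normc (d s - d t0) * `|t - s| <= C2 * dl * `|t - s|.
      by rewrite ler_wpM2r //; apply: le_trans (dlip _ _) _; rewrite ler_wpM2l ?(ltW C20).
    have ts : `|t - s| <= 2 * dl by move: td sd; rewrite !ler_norml; lra.
    have := tay t s; rewrite expr2; have := ler_wpM2l (mulr_ge0 (ltW C20) nn) ts; have := ler_wpM2r nn dl2; lra.
  split; apply: le_trans E.
    have := normc_Re (U t - U s - (n0 * (t - s))%:C); rewrite !(cReD, cReN) /=.
    by [].
  have := normc_Im (U t - U s - (n0 * (t - s))%:C); rewrite !(cImD, cImN) /= oppr0 addr0.
  by [].
have a_low t s : `|t - t0| <= dl -> `|s - t0| <= dl -> 3 / 4 * c0 * `|t - s| <= `|a t - a s|.
  move=> td sd; have [h1 _] := key t s td sd; have nn := normr_ge0 (t - s).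
  have := lerB_dist (n0 * (t - s)) (a t - a s); rewrite normrM (gtr0_norm n0pos) distrC.
  have := ler_wpM2r nn n00; lra.
have h_up t s : `|t - t0| <= dl -> `|s - t0| <= dl -> `|h t - h s| <= `|a t - a s| / 3.
  by move=> td sd; have [_ h1] := key t s td sd; have := a_low t s td sd; lra.
have a0 : a t0 = 0 by rewrite /a U0.
have h0 : h t0 = 0 by rewrite /h U0.
have t0d : `|t0 - t0| <= dl by rewrite subrr normr0 ltW.
have h_quad t : `|t - t0| <= dl -> `|h t| <= C2 * (4 / (3 * c0)) ^+ 2 * a t ^+ 2.
  move=> td; have h1 := a_low t t0 td t0d; rewrite a0 subr0 in h1.
  have h2 : `|h t| <= C2 * `|t - t0| ^+ 2.
    apply: le_trans (tay t t0); rewrite Utay U0 subr0.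
    by have := normc_Im (U t - (n0 * (t - t0))%:C); rewrite cImD cImN /= oppr0 addr0.
  apply: le_trans h2 _; rewrite -mulrA ler_wpM2l ?(ltW C20) // -exprMn -[leRHS]real_normK ?num_real //.
  apply: lerXn2r; rewrite ?nnegrE // normrM.
  have q0 : 0 < 4 / (3 * c0) by rewrite divr_gt0 // mulr_gt0.
  rewrite (gtr0_norm q0); have := ler_wpM2l (ltW q0) h1.
  by rewrite (_ : 4 / (3 * c0) * (3 / 4 * c0 * `|t - t0|) = `|t - t0|) //; field; rewrite gt_eqF.
have a_cont : continuous a.
  apply: (@lipschitz_continuous a K) => t s; apply: le_trans (lip t s); rewrite -Unorm.
  by have := normc_Re (U t - U s); rewrite cReD cReN.
have ivt x : `|x| < r0 -> exists2 t, `|t - t0| <= dl & a t = x.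
  move=> xr; have le1 : t0 - dl <= t0 + dl by lra.
  have d1 : `|t0 + dl - t0| <= dl by rewrite addrC addKr gtr0_norm.
  have d2' : `|t0 - dl - t0| <= dl by rewrite addrC addKr normrN gtr0_norm.
  have [k1 _] := key _ _ d1 t0d; have [k2 _] := key _ _ d2' t0d.
  rewrite a0 subr0 [t0 + dl - t0]addrC addKr (gtr0_norm dl0) ler_norml in k1.
  rewrite a0 subr0 [t0 - dl - t0]addrC addKr normrN (gtr0_norm dl0) ler_norml in k2.
  move/andP: k1 => [k1 _]; move/andP: k2 => [_ k2].
  have := ler_wpM2r (ltW dl0) n00 => k3.
  move: xr; rewrite ltr_norml => /andP[x1 x2].
  have a1 : x <= a (t0 + dl) by rewrite /rh in r01; lra.
  have a2 : a (t0 - dl) <= x by rewrite /rh in r01; lra.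
  have [||t tin at_] := @IVT R a (t0 - dl) (t0 + dl) x le1.
  - exact: continuous_subspaceT.
  - by rewrite ge_min le_max a1 a2 orbT.
  by exists t => //; move: tin; rewrite in_itv /= ler_norml => /andP[? ?]; apply/andP; split; lra.
have /choice[T hT] x : exists t, `|x| < r0 -> `|t - t0| <= dl /\ a t = x.
  have [xr|xr] := ltP `|x| r0; last by exists t0.
  by have [t h1 h2] := ivt x xr; exists t.
exists nu, (fun x => h (T x)); split => //.
- by move=> x /hT[h1 h2]; have := h_quad _ h1; rewrite h2.
- by move=> x x' /hT[h1 h2] /hT[h1' h2']; have := h_up _ _ h1 h1'; rewrite h2 h2'.
move=> u uR uI.
have UE t : gam t = gam t0 + nu * U t by rewrite /U mulrC divfK //; ring.
split => [/bJ[t1 uE]|uE].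
  have [t td te] := gam_reduce gp t0 t1; rewrite -te (UE t) in uE.
  have UEu : U t = u by move: uE => /addrI /(mulfI nu0) ->.
  have tdl : `|t - t0| <= dl.
    have nU : normc (gam t - gam t0) < 2 * r0.
      rewrite (UE t) chart_dist0 // UEu; apply: le_lt_trans (normc_ReIm _) _; lra.
    have s01 : 0 <= `|t - t0| <= 1 by rewrite normr_ge0 /=; lra.
    have mE : Num.min `|t - t0| (1 - `|t - t0|) = `|t - t0| by apply/min_idPl; lra.
    have : c * `|t - t0| <= normc (gam t - gam t0).
      have [tt|tt] := leP t0 t.
        have := hc t0 `|t - t0| s01; rewrite mE; rewrite (_ : t0 + `|t - t0| = t) //.
        by rewrite ger0_norm; lra.
      have := hc t `|t - t0| s01; rewrite mE (_ : t + `|t - t0| = t0) 1?normcC //.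
      by rewrite ltr0_norm; lra.
    by move=> h1; rewrite -(ler_pM2l c1); lra.
  have [T1 T2] := hT _ uR.
  have := h_up _ _ tdl T1; rewrite T2 -UEu -/(a t) subrr normr0 mul0r normr_le0 subr_eq0 => /eqP.
  by [].
have [T1 T2] := hT _ uR; apply/bJ; exists (T (complex.Re u)); rewrite (UE (T _)); congr (_ + nu * _).
by apply/eqP; rewrite eq_complex; apply/andP; split; apply/eqP; [rewrite -/(a _) T2|rewrite uE].
Qed.

(** From a point of D above the whole curve the vertical ray would never meet the boundary and would
    leave the bounded set D. *)
Lemma top_point : exists ts, forall z, D z -> complex.Im z <= complex.Im (gam ts).
Proof.
have [C2 [K [c0 [_ K1 _ _ [lip _ _]]]]] := curve_bounds gd dd d2c dp d2p d0.
have cont : continuous (fun t => complex.Im (gam t)).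
  apply: (@lipschitz_continuous _ K) => t s; apply: le_trans (lip t s).
  by have := normc_Im (gam t - gam s); rewrite cImD cImN.
have [ts _ hts] := EVT_max (@ler01 R) (continuous_subspaceT cont).
have top t : complex.Im (gam t) <= complex.Im (gam ts).
  move: t; apply: periodic_reduce => [t|t /andP[a1 a2]]; first by rewrite gp.
  by apply: hts; rewrite in_itv /= a1 ltW.
exists ts => z Dz; rewrite leNgt; apply/negP => zI; have [B hB] := bD.
have B0 : 0 <= B := le_trans (normc_ge0 _) (hB z Dz).
pose S := 2 * B + 1.
have : D (z + 'i * S%:C).
  have S0 : 0 <= S by rewrite /S; lra.
  apply: (proj1 (@off_boundary_segment R D oD z _ _) Dz) => t /andP[t0 t1] /bJ[t' tE].
  have := top t'; rewrite -tE [z + _ - z]addrC addKr !(cImD, cImM, cReM) /=.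
  by have := mulr_ge0 t0 S0; lra.
move=> /hB; have := normc_ge_add ('i * S%:C) z; rewrite [_ + z]addrC normcM normc_i mul1r normc_real ger0_norm; last by rewrite /S; lra.
by have := hB z Dz; rewrite /S; lra.
Qed.

Lemma gam_boundary t : boundary D (gam t). Proof. by apply/bJ; exists t. Qed.

Lemma gam_closure_jordan t : closure D (gam t). Proof. by have [] := gam_boundary t. Qed.

(* Being in the interior of the closure is locally constant along the curve, and
   false at the topmost point; so D lies on exactly one side of the curve. *)
Lemma not_in_interior_closure t : ~ in_interior_closure D (gam t).
Proof.
have [C2 [K [c0 [_ K1 _ _ [lip _ _]]]]] := curve_bounds gd dd d2c dp d2p d0.
have [r0 [C [r00 C0 hg]]] := local_graph.
have [ts hts] := top_point.
pose I x := in_interior_closure D (gam x).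
have nIs : ~ I ts.
  move=> [s s0 h]; have hc : closure D (gam ts + 'i * (s / 2)%:C).
    by apply: h; rewrite addrC addKr normcM normc_i mul1r normc_real gtr0_norm; lra.
  have s4 : 0 < s / 4 by lra.
  have [w Dw ws] := proj1 (closurecP _ _) hc _ s4.
  have := hts w Dw; have := normc_Im (w - (gam ts + 'i * (s / 2)%:C)).
  rewrite ler_norml !(cImD, cImN, cImM) /= => /andP[h1 h2]; lra.
have loc x : exists2 e : R, 0 < e & forall x', `|x' - x| < e -> I x' <-> I x.
  have [[s s0 h]|nI] := pselect (I x).
    exists (s / (2 * K)); first by rewrite divr_gt0 // mulr_gt0 //; lra.
    move=> x'; rewrite ltr_pdivlMr; last by rewrite mulr_gt0 //; lra.
    move=> xx; split => _; [by exists s|exists (s / 2); first by lra].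
    move=> w ws; apply: h; have := normc_tri (gam x') w (gam x); have := lip x' x; lra.
  have [nu [phi [nu1 quad plip graph]]] := hg x.
  have nb : ~ (D (gam x + nu * (0 +i* (1 * (r0 / 2)))) /\ D (gam x + nu * (0 +i* (-1 * (r0 / 2))))).
    by move=> [h1 h2]; apply: nI; exact: (both_sides oD r00 nu1 quad plip graph).
  have [e e1 nD] : exists2 e : R, e = 1 \/ e = -1 & ~ D (gam x + nu * (0 +i* (e * (r0 / 2)))).
    have [h1|h1] := pselect (D (gam x + nu * (0 +i* (1 * (r0 / 2))))); last by exists 1; [left|].
    by exists (-1); [right|move=> h2; exact: nb].
  exists (r0 / K); first by rewrite divr_gt0 //; lra.
  move=> x'; rewrite ltr_pdivlMr; last by lra.
  move=> xx; split => // /(one_side oD r00 nu1 quad plip graph e1 nD (gam_boundary x')) [].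
  by apply: le_lt_trans (lip x' x) _; rewrite mulrC.
pose Y x := ts + (t - ts) * x.
have : I (Y 0) <-> I (Y 1).
  apply: (@cousin R (fun a b => I (Y a) <-> I (Y b))); first by move=> a b c _ _; exact: iff_trans.
  move=> x _; have [e e0 he] := loc (Y x); have n1 : 0 < `|t - ts| + 1 by rewrite ltr_wpDl.
  exists (e / (`|t - ts| + 1)); first by rewrite divr_gt0.
  move=> a b _ ax xb _ ha hb.
  have near (v : R) : `|v - x| < e / (`|t - ts| + 1) -> I (Y v) <-> I (Y x).
    rewrite ltr_pdivlMr // => h; apply: he.
    rewrite (_ : Y v - Y x = (v - x) * (t - ts)); last by rewrite /Y; ring.
    by rewrite normrM; have := normr_ge0 (v - x); lra.
  apply: (@iff_trans _ (I (Y x))); [|apply: iff_sym]; apply: near; rewrite ltr_norml; apply/andP; split; lra.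
rewrite /Y mulr0 addr0 mulr1 addrC subrK => h /h.
by [].
Qed.

(** The poles are reached from infinity outside D: down the vertical ray to the topmost point, along
    the curve to gam t, and then along the outer normal. A single window, one period, suffices. *)
Lemma jordan_geometry : inhabited (boundary_geometry D gam).
Proof.
have [C2 [K [c0 [_ K1 _ _ [lip _ _]]]]] := curve_bounds gd dd d2c dp d2p d0.
have [c c1 hc] := chord_arc gd dd d2c gp dp d2p d0 ginj.
have [r0 [C [r00 C0 hg]]] := local_graph.
have [ts hts] := top_point.
have nDg t : ~ D (gam t) by have /(boundarycP oD)[] := gam_boundary t.
have side (t : R) : exists nu : R[i], normc nu = 1 /\ graph_chart D (gam t) nu r0 C.
  have [nu [phi [nu1 quad plip graph]]] := hg t.
  have gc : closure D (gam t) by apply: gam_closure_jordan.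
  have ni : ~ in_interior_closure D (gam t) by apply: not_in_interior_closure.
  by have := side_chart oD r00 nu1 quad plip graph gc ni.
have [nu hnu] := choice side.
constructor; apply: (@BoundaryGeometry R D gam nu c K r0 C (fun=> 0) (fun=> 1%N)) => //.
- by move=> t; have [] := hnu t.
- by move=> t; have [] := hnu t.
- move=> t s s0 sr B y y0; have [nu1 [phi [quad _ ch]]] := hnu t.
  have phi0 : phi 0 = 0.
    apply/eqP; rewrite -normr_eq0 eq_le normr_ge0 andbT.
    by have := quad 0; rewrite normr0 expr0n /= mulr0; apply.
  have top : poly_approx (core D B y) (fun z => (z - gam ts)^-1).
    apply: (pole_ray B y0 normc_i) => x x0 Dx; have [x1|x1] := leP x 0.
      have x00 : x = 0 by lra.
      by move: Dx; rewrite x00 mul0r addr0; exact: nDg.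
    by have := hts _ Dx; rewrite cImD cImM /=; lra.
  have K0 : 0 <= K by lra.
  have gt := pole_path y0 t K0 nDg lip top.
  (* Folding and truncating the parameter makes the path stay on the outer normal segment for all
     real x. *)
  pose path (x : R) := gam t - 'i * nu t * (Num.min `|x| s)%:C.
  have p0 : path 0 = gam t by rewrite /path normr0 min_l ?(ltW s0) // mulr0 subr0.
  have ps : path s = gam t - 'i * nu t * s%:C by rewrite /path gtr0_norm // minxx.
  rewrite -ps; rewrite -p0 in gt; apply: (@pole_path _ D B y y0 path 1 0) => //.
    move=> x; have m0 : 0 <= Num.min `|x| s by rewrite le_min normr_ge0 ltW.
    have ms : Num.min `|x| s <= s by rewrite ge_min lexx orbT.
    have := ch (0 +i* (- Num.min `|x| s)).
    have -> : gam t + nu t * (0 +i* - Num.min `|x| s) = path x.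
      rewrite /path; congr (_ + _).
      by case: (nu t) => a b; apply/eqP; rewrite eq_complex /=; apply/andP; split; apply/eqP; ring.
    rewrite [complex.Re _]/= [complex.Im _]/= phi0 normr0 normrN (ger0_norm m0) => /(_ r00) h.
    by move=> /h h'; have : 0 < - Num.min `|x| s by [apply: h'; lra]; lra.
  move=> x x'; rewrite (_ : path x - path x' = 'i * nu t * (Num.min `|x'| s - Num.min `|x| s)%:C); last by rewrite /path rcB; ring.
  rewrite !normcM normc_i nu1 !mul1r normc_real.
  apply: le_trans (ler_dist_dist x x'); rewrite distrC.
  have [h1|h1] := leP `|x| s; have [h2|h2] := leP `|x'| s => //.
  + by rewrite distrC ler_norml; have := ler_norm (`|x'| - `|x|); rewrite distrC; lra.
  + by rewrite ler_norml; have := ler_norm (`|x| - `|x'|); lra.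
  + by rewrite subrr normr0.
- move=> n t t'; rewrite add0r.
  wlog tt : t t' / t' <= t.
    move=> H h1 h2; have [h|h] := leP t' t; first exact: H.
    by rewrite distrC normcC; apply: H => //; exact: ltW.
  move=> /andP[a1 a2] /andP[b1 b2]; have s0 : 0 <= t - t' by lra.
  have := hc t' (t - t'); rewrite [t' + _]addrC subrK (ger0_norm s0); apply.
  by apply/andP; split; lra.
- move=> p /bJ[t ->]; exists 0%N.
  move: t; apply: periodic_reduce => [t|t /andP[t0 t1]].
    by rewrite gp.
  by exists t; rewrite t0 add0r.
Qed.

Lemma jordan_param (B : R) : exists B' : R, forall q, boundary D q -> normc q <= B -> exists2 t, - B' <= t <= B' & q = gam t.
Proof.
exists 1 => q /bJ[t ->] _; move: t; apply: periodic_reduce => [t|t /andP[t0 t1]]; first by rewrite gp.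
by exists t => //; apply/andP; split; lra.
Qed.

Lemma bounded_tame : tame D.
Proof. by move=> f f1 c M _ _ _ W; have [B hB] := bD; exists B => z Dz _; exact: hB. Qed.

End JordanGeometry.

(** * Curve data of a smooth Jordan domain *)

Section SmoothJordan.
Context {R : realType}.
Implicit Types (x y : R -> R).

Lemma rdiff_pair x y (t a b : R) :
  is_derive t (1 : R) x a -> is_derive t (1 : R) y b -> rdiff (fun s => x s +i* y s) t (a +i* b).
Proof.
move=> xa yb e e0; have e2 : 0 < e / 2 by rewrite divr_gt0.
have [d1 d10 h1] := real_deriv xa e2; have [d2 d20 h2] := real_deriv yb e2.
exists (Num.min d1 d2); first by rewrite lt_min d10.
move=> s; rewrite lt_min => /andP[/h1 k1 /h2 k2].
apply: le_trans (normc_ReIm _) _; rewrite /= !(mulr0, mul0r, addr0, add0r, subr0) in k1 k2 *.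
by apply: le_trans (lerD k1 k2) _; rewrite -mulrDl -splitr.
Qed.

Lemma derive1n_periodic x n : (forall t, x (t + 1) = x t) -> forall t, x^`(n) (t + 1) = x^`(n) t.
Proof.
move=> xp; elim: n => [|n IH] t; first by rewrite derive1n0 xp.
rewrite derive1nS /derive1; set u := (X in fmap X _); set v := (X in _ = lim (fmap X _)).
suff -> : u = v by [].
by apply/funext => h; rewrite /u /v addrA !IH.
Qed.

Lemma smooth_is_derive x n t : smooth x -> is_derive t (1 : R) (x^`(n)) (x^`(n.+1) t).
Proof. by move=> sx; rewrite derive1nS derive1E; apply: derivableP; exact: sx. Qed.

Lemma bounded_normc (D : set R[i]) : bounded_set D -> exists B : R, forall z, D z -> normc z <= B.
Proof.
move=> [M [Mreal hM]]; have lt1 : M < M + 1 by rewrite ltrDl.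
exists (complex.Re (M + 1)) => z Dz; have := hM _ lt1 z Dz.
by rewrite /= lecE /= => /andP[_].
Qed.

Lemma smooth_jordan_data (D : set R[i]) : smooth_jordan_domain D ->
  [/\ D !=set0, tame D & exists gam : R -> R[i], inhabited (boundary_geometry D gam) /\
    forall B : R, exists B' : R, forall q, boundary D q -> normc q <= B -> exists2 t, - B' <= t <= B' & q = gam t].
Proof.
move=> [[oD cD D0] /bounded_normc bD [x [y [[sx sy] per reg inj bE]]]].
split => //; first exact: bounded_tame.
pose c n t := x^`(n) t +i* y^`(n) t.
have cd n t : rdiff (c n) t (c n.+1 t) by apply: rdiff_pair; exact: smooth_is_derive.
have cp n t : c n (t + 1) = c n t.
  by congr (_ +i* _); apply: derive1n_periodic => s; have [] := per s.
have c0 t : c 1%N t != 0.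
  by apply/eqP => -[x0 y0]; apply: (reg t); rewrite -!derive1n1.
have cinj t s : 0 <= t < 1 -> 0 <= s < 1 -> c 0%N t = c 0%N s -> t = s.
  by move=> t01 s01 e; apply: inj => //; rewrite inE /= in_itv.
have bJ p : boundary D p <-> exists t, p = c 0%N t.
  rewrite bE; split => [[t _ <-]|[t ->]]; first by exists t.
  move: t; apply: periodic_reduce => [t|t t01]; first by rewrite cp.
  by exists t => //=; rewrite in_itv.
exists (c 0%N); split; last by apply: jordan_param => // t; exact: cp.
apply: (@jordan_geometry _ _ _ (c 1%N) (c 2%N)) => //; first exact: connected_clopen_conn.
by move=> t; apply: rdiff_rcont.
Qed.

End SmoothJordan.

(** * Both kinds of domains brought together *)

Unset Implicit Arguments.

Theorem mainTheorem2 (R : realType) (g : R[i] -> R[i])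
    (g_analytic : analytic_on (@upper_half_plane R) g)
    (g_nonconstant : ~ constant_on (@upper_half_plane R) g)
    (g_nonunivalent : ~ set_inj (@upper_half_plane R) g)
    (D : set R[i]) (D_class : domain_class D) :
  exists f : R[i] -> R[i],
    [/\ analytic_on D f,
        {within closure D, continuous f},
        f^`() @` D `<=` g^`() @` (@upper_half_plane R) &
        forall (r : R) (z0 : R[i]), 0 < r -> (f @` boundary D) z0 ->
          hausdorff_dim (ball z0 r%:C `&` infinite_valence D f) = 1%:E].
Proof.
have gd z : uhp z -> cdiff g z (g^`() z) by move=> /g_analytic/derivable_cdiff.
have [P [r [b [inU [mod]]]]] := model_ex gd (noncritical_pair gd g_nonconstant g_nonunivalent).
have [D0 tD [gam [[geo] param]]] : [/\ D !=set0, tame D & exists gam : R -> R[i],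
    inhabited (boundary_geometry D gam) /\ forall B : R, exists B' : R, forall q, boundary D q ->
      (normc q <= B -> exists2 t, - B' <= t <= B' & q = gam t)].
  case: D_class => [->|/smooth_jordan_data//]; split; [by exists 'i; rewrite /= /upper_half_plane /= ltr01|exact: uhp_tame|].
  exists (real_complex R); split; first by constructor; exact: uhp_geometry.
  move=> B; exists B => q bq qB; exists (complex.Re q).
    by rewrite -ler_norml; apply: le_trans (normc_Re q) qB.
  by have := uhp_boundary bq; case: (q) => u v /= ->.
have [f [fd fc fdim]] := geometry_main geo D0 gd inU mod tD param.
exists f; split; [|exact: fc| |].
- by move=> z /fd[w _ /cdiff_derivable[]].
- move=> _ [z /fd[w Uw fw] <-]; exists w; first exact: Uw.
  (* Uniqueness of derivatives turns the relation between f at z and g' at w into the required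
     equality. *)
  have [df _] := cdiff_derivable fw; exact: cdiff_unique fw (derivable_cdiff df).
- by move=> s _ s0 [p bp <-]; exact: fdim.
Qed.
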